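(* Let $K$ be an algebraically closed field of characteristic $p=0$. Let $X\subset\mathbb{P}^{n+1}$ be a hypersurface of dimension $n\ge 1$ and degree $d\ge 4$ with $s=s(X)\le n-2$, and let $m=m(n,s):=[(n+s+1)/2]$. Assume that $\Delta(X)$ is a finite set. Then the following hold. (I-0) If $d=4$ and $s=-1$, then $\sharp\Delta(X)\le 4(m+1)$. Equality holds if and only if $X$ is projectively equivalent to the hypersurface defined by $$\sum_{i=0}^{m}X_{m+1+i}X_i^3+\sum_{i=m+1}^{n+1}X_i^4=0.$$ (I-1) If $d=4$, $s\ge 0$ and $n+s$ is odd, then $\sharp\Delta(X)\le 4(m-s-1)+(s+2)$. Equality holds if and only if $X$ is projectively equivalent to the hypersurface defined by $$\sum_{i=0}^{m-s-2}X_{m+1+i}X_i^3+X_{2m-s}\left(X_{m-s-1}^3+\dots+X_m^3\right)+\sum_{i=m+1}^{2m-s-1}X_i^4+aX_{2m-s}^4=0,$$ where $a=0$ or $1$. (I-2) If $d=4$, $s=0$ and $n$ is even, then $\sharp\Delta(X)\le 4m+1$. Equality holds if and only if $X$ is projectively equivalent to the hypersurface defined by $$\sum_{i=0}^{m}X_{m+1+i}X_i^3+\sum_{i=m+1}^{2m}X_i^4=0.$$ (I-3) If $d=4$, $s=1$ and $n+s$ is even, then $\sharp\Delta(X)\le 4(m-1)$. Equality holds if and only if $X$ is projectively equivalent to the hypersurface defined by $$\sum_{i=0}^{m-2}X_{m-1+i}X_i^3+\sum_{i=m-1}^{2m-3}X_i^4+G=0,$$ where $G\in K[X_{2m-2},X_{2m-1},X_{n+1}]$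 has a multiple component. (I-4) If $d=4$, $s\ge 2$ and $n+s$ is even, then $\sharp\Delta(X)\le 4(m-s-1)+(s+2)$. Equality holds if and only if $X$ is projectively equivalent to a hypersurface defined by one of the following: (i) $\displaystyle \sum_{i=0}^{m-s-1}X_{m-s+i}X_i^3+\sum_{i=m-s}^{2m-2s-1}X_i^4+G_1=0$, where $s=2$ and $G_1\in K[X_{2m-2s},\ldots,X_{n+1}]$ has a multiple component; or (ii) $\displaystyle \sum_{i=0}^{m-s-2}X_{m+1+i}X_i^3+X_{2m-s}X_{m-s-1}^3+\sum_{i=m-s}^{m}A_iX_i^3+\sum_{i=m+1}^{2m-s-1}X_i^4+G_2=0$, where $s\ge 2$ and $A_{m-s},\ldots,A_m,G_2\in K[X_{2m-s},X_{n+1}]$. (II) If $d\ge 5$, then $\sharp\Delta(X)\le m+1$. Equality holds if and only if $X$ is projectively equivalent to the hypersurface defined by $$\sum_{i=0}^{m-s-1}X_{m+1+i}X_i^{d-1}+\sum_{i=m-s}^{m}A_iX_i^{d-1}+G=0,$$ where $A_{m-s},\ldots,A_m,G\in K[X_{m+1},\ldots,X_{n+1}]$ are homogeneous polynomials with $\deg A_{m-s}=\dots=\deg A_m=1$ and $\deg G=d$. (The sum $\sum_{i=m-s}^{m}A_iX_i^{d-1}$ does not appear if $s=-1$.)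
   Context: A hypersurface $X\subset\mathbb{P}^{n+1}$ is irreducible and reduced; $X_0,\ldots,X_{n+1}$ are homogeneous coordinates of $\mathbb{P}^{n+1}$. $s(X):=\dim\mathrm{Sing}(X)$, with $\dim\emptyset=-1$. $X_{\rm sm}$ is the smooth locus of $X$. A point $P\in X_{\rm sm}\cup(\mathbb{P}^{n+1}\setminus X)$ is a Galois point for $X$ if the function field extension $K(X)/K(\mathbb{P}^n)$ induced by the projection $\pi_P:X\dashrightarrow\mathbb{P}^n$ from $P$ is Galois. $\Delta(X)$ is the set of all Galois points contained in $X_{\rm sm}$. $[\,\cdot\,]$ is the integer part. Two hypersurfaces are projectively equivalent if some projective transformation of $\mathbb{P}^{n+1}$ maps one onto the other. All defining polynomials are homogeneous of degree $d$; so in (I-3) and (I-4), $G,G_1,G_2$ are homogeneous of degree $4$ and the $A_i$ are homogeneous of degree $1$. A homogeneous polynomial has a multiple component if it is divisible by the square of a nonconstant polynomial. Empty sums are zero. *)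

(* Defs.v *)
From HB Require Import structures.
From mathcomp Require Import all_boot all_order all_algebra all_field.
From mathcomp Require Import finmap mpoly.
From mathcomp Require Import mathcomp_extra boolp classical_sets functions cardinality.

Set Implicit Arguments.
Unset Strict Implicit.
Unset Printing Implicit Defensive.

Import Order.TTheory GRing.Theory Num.Theory.
Local Open Scope classical_set_scope.
Local Open Scope ring_scope.

Section ProjectiveSpace.
Variables (K : fieldType) (N : nat).
Local Notation V := 'rV[K]_N.+1.

(* P^N over K, as the set of lines of K^(N+1). *)
Definition ppoint := {P : {vspace V} | \dim P == 1%N}.

Definition vanishes_at (F : {mpoly K[N.+1]}) (P : ppoint) : Prop :=
  forall v : V, v \in val P -> F.@[v 0] = 0.

Definition hypersurface (F : {mpoly K[N.+1]}) : set ppoint :=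
  [set P | vanishes_at F P].

(* Jacobian criterion; this is Sing(X) when F generates the ideal of X,
   in particular when F is irreducible. *)
Definition Sing (F : {mpoly K[N.+1]}) : set ppoint :=
  [set P | vanishes_at F P /\ forall i : 'I_N.+1, vanishes_at F^`M(i) P].

Definition smooth_locus (F : {mpoly K[N.+1]}) : set ppoint :=
  hypersurface F `\` Sing F.

Definition zclosed (Z : set ppoint) : Prop :=
  exists S : set {mpoly K[N.+1]},
    (forall F, S F -> exists e : nat, F \is e.-homog) /\
    Z = [set P | forall F, S F -> vanishes_at F P].

Definition zirreducible (Z : set ppoint) : Prop :=
  [/\ zclosed Z, Z !=set0 &
      forall Z1 Z2 : set ppoint, zclosed Z1 -> zclosed Z2 ->
        Z `<=` Z1 `|` Z2 -> Z `<=` Z1 \/ Z `<=` Z2].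

(* Krull dimension of a closed set Z: the strict chains of irreducible closed
   subsets of Z have at most s + 1 members, and each such number of members is
   attained.  The empty set, which only has the chain without members, gets
   dimension -1. *)
Definition has_dim (Z : set ppoint) (s : int) : Prop :=
  forall k : nat,
    (exists C : nat -> set ppoint,
        (forall i, (i < k)%N -> zirreducible (C i) /\ C i `<=` Z) /\
        (forall i, (i.+1 < k)%N -> C i `<` C i.+1))
    <-> k%:Z <= s + 1.

Lemma ptransf_subproof (T : 'End(V)) (hT : lker T == 0%VS) (P : ppoint) :
  \dim (T @: val P)%VS == 1%N.
Proof.
by rewrite limg_dim_eq ?(eqP (valP P)) //; apply/eqP; rewrite (eqP hT) capv0.
Qed.

Definition ptransf (T : 'End(V)) (hT : lker T == 0%VS) (P : ppoint) : ppoint :=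
  exist _ (T @: val P)%VS (ptransf_subproof hT P).

Definition proj_equiv (X Y : set ppoint) : Prop :=
  exists (T : 'End(V)) (hT : lker T == 0%VS), ptransf hT @` X = Y.

End ProjectiveSpace.

Definition irreducible_elt (R : unitRingType) (F : R) : Prop :=
  [/\ F != 0, F \isn't a GRing.unit &
      forall G H : R, F = G * H -> G \is a GRing.unit \/ H \is a GRing.unit].

(* The subfields k and L of E form a (finite) Galois extension L / k: some
   Galois extension M / k0 is identified with it by an embedding of M in E. *)
Definition galois_subfields (E : fieldType) (k L : set E) : Prop :=
  exists (k0 : fieldType) (M : splittingFieldType k0) (psi : {rmorphism M -> E}),
    [/\ psi @` setT = L,
        psi @` [set x : M | x \in 1%VS] = k &
        galois 1%VS {:M}%VS].

Section FunctionField.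
Variables (K : fieldType) (N : nat) (F : {mpoly K[N.+1]}).

(* iota presents E as the fraction field of the homogeneous coordinate ring
   K[X_0, ..., X_N] / (F); it is unique up to isomorphism. *)
Definition coord_fraction_field (E : fieldType)
    (iota : {rmorphism {mpoly K[N.+1]} -> E}) : Prop :=
  (forall G, iota G = 0 <-> exists Q, G = Q * F) /\
  (forall z : E, exists G H, iota H != 0 /\ z = iota G / iota H).

Variables (E : fieldType) (iota : {rmorphism {mpoly K[N.+1]} -> E}).

(* K(X): the elements of degree 0 of E. *)
Definition function_field : set E :=
  [set z | exists (e : nat) (G H : {mpoly K[N.+1]}),
     [/\ G \is e.-homog, H \is e.-homog, iota H != 0 & z = iota G / iota H]].

(* B is the matrix of a projection with centre P,
   pi_P : v |-> v *m B from P^N to P^(N-1). *)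
Definition projection_from (P : ppoint K N) (B : 'M[K]_(N.+1, N)) : Prop :=
  \rank B = N /\ forall v : 'rV[K]_N.+1, v \in val P -> v *m B = 0.

Definition linear_forms (B : 'M[K]_(N.+1, N)) : N.-tuple {mpoly K[N.+1]} :=
  [tuple \sum_(i < N.+1) B i j *: 'X_i | j < N].

(* The image of K(P^(N-1)) in K(X) under the pull-back by pi_P. *)
Definition pullback_field (B : 'M[K]_(N.+1, N)) : set E :=
  let L := linear_forms B in
  [set z | exists (e : nat) (G H : {mpoly K[N]}),
     [/\ G \is e.-homog, H \is e.-homog, iota (H \mPo L) != 0 &
         z = iota (G \mPo L) / iota (H \mPo L)]].

End FunctionField.

Section GaloisPoints.
Variables (K : fieldType) (N : nat) (F : {mpoly K[N.+1]}).

Definition galois_point (P : ppoint K N) : Prop :=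
  (smooth_locus F `|` ~` hypersurface F) P /\
  exists (E : fieldType) (iota : {rmorphism {mpoly K[N.+1]} -> E})
         (B : 'M[K]_(N.+1, N)),
    [/\ coord_fraction_field F iota, projection_from P B &
        galois_subfields (pullback_field iota B) (function_field iota)].

Definition Delta : set (ppoint K N) :=
  [set P | smooth_locus F P /\ galois_point P].

End GaloisPoints.

(* Only meaningful for finite (Delta F): fset_set sends infinite sets to the
   empty set. *)
Definition card_Delta (K : fieldType) (N : nat) (F : {mpoly K[N.+1]}) : int :=
  #|` fset_set (Delta F)|%:Z.

Section Equations.
Variables (K : fieldType) (N : nat).

(* The variable X_j for 0 <= j <= N; integer indices keep expressions such as
   2m - s free of truncated subtraction. *)
Definition xvar (j : int) : {mpoly K[N.+1]} := 'X_(inord `|j|%N).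

(* G belongs to K[X_j | J j]. *)
Definition in_vars (J : pred int) (G : {mpoly K[N.+1]}) : Prop :=
  forall (mon : 'X_{1..N.+1}) (j : 'I_N.+1),
    mon \in msupp G -> ~~ J j%:Z -> mon j = 0%N.

Definition has_multiple_component (G : {mpoly K[N.+1]}) : Prop :=
  exists Q R : {mpoly K[N.+1]}, (1 < msize Q)%N /\ G = Q ^+ 2 * R.

End Equations.

(* Main.v *)
Require Import Defs.
From HB Require Import structures.
From mathcomp Require Import all_boot all_order all_algebra all_field.
From mathcomp Require Import finmap mpoly.
From mathcomp Require Import mathcomp_extra boolp classical_sets functions cardinality.
From mathcomp Require Import perm ring zify.

Set Implicit Arguments.
Unset Strict Implicit.
Unset Printing Implicit Defensive.

Import Order.TTheory GRing.Theory Num.Theory.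
Local Open Scope classical_set_scope.
Local Open Scope ring_scope.

(* A point <v> of X is a Galois point if and only if F = l L^(d-1) + G for
   linear forms l, L and a form G with L(v) = 1 and l, G invariant under
   translation by v.  The form gives a Kummer extension.  Conversely X is normal,
   because dim Sing X <= n - 2; hence l times any conjugate of the coordinate
   projected away is the class of a quadratic form, the Galois group acts by
   affine substitutions of that coordinate, and F has no other terms.

   The form of F says D_v F = (d-1) l L^(d-2).  Comparing D_w D_v F with
   D_v D_w F for two Galois vectors v, w shows that they are either orthogonal
   (each is killed by the forms of the other), or d = 4 and they lie in a plane
   carrying four Galois points and splitting off a block Y X^3 + Y^4.  Otherwise
   X would be a cone, and Delta(X) infinite.  Splitting off a maximal orthogonal
   family one finds coordinates X_i, Y_i (i < q), Z_j (j < k) and t further ones,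
   T, with
     F = sum_i (Y_i X_i^3 + Y_i^4) + sum_j lam_j(T) Z_j^(d-1) + g(T),
   where #Delta(X) = 4 q + k, and q = 0 if d >= 5.

   The locus X = Y = T = 0, sum_j lam_j Z_j^(d-1) = 0 is singular, whence
   k <= s + 1 + rank(lam).  For d = 4, singular points have X = Y = 0; when
   R = sum_j lam_j Z_j^3 + g is squarefree, the singular locus misses a line in
   P(Z, T), given by a point off R = 0 and a second one where the discriminant
   is not zero, so that s <= k + t - 3.  The bounds and the normal forms follow
   from these inequalities, n + 2 = 2 q + k + t and the analysis of the cases in
   which R is not squarefree. *)

(** * Evaluation, linear substitutions and homogeneity *)

(** The dimension of the singular locus enters through linear forms: a closed set of dimension s
    admits s + 1 linear forms without common zero on it, while r forms of one degree without common
    zero on it force s + 1 <= r. The former, with s + 1 <= n - 1, leaves a line in the target P^n of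
    the projection from a point off X that avoids the image of Sing X; every hypersurface of P^n
    meets this line, which excludes all prime factors of the denominator of an integral fraction.
    The latter turns every linear space free of singular points into an inequality for s.

    The degree matters twice. The centre of the affine symmetries is seen to be a linear form by
    comparing the coefficients of index d - 2 and d - 3 of the equation, which needs d - 3 > 0. And
    comparing two Galois vectors leaves the power L^(d-3): it forbids a second point next to v
    except when it is a simple factor, that is d = 4, whence the blocks.

    Finiteness of Delta(X) also excludes vertices: translating a Galois vector along a vertex gives
    infinitely many Galois points. *)

Lemma mpoly_morph_ext (n : nat) (R : comNzRingType) (S : comNzRingType)
  (f g : {rmorphism {mpoly R[n]} -> S}) :
  (forall c, f c%:MP = g c%:MP) -> (forall i, f 'X_i = g 'X_i) -> f =1 g.
Proof.
move=> hC hX p; rewrite (mpolyE p) !rmorph_sum; apply: eq_bigr => m _.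
rewrite -mul_mpolyC !rmorphM hC mpolyXE_id !rmorph_prod; congr (_ * _).
by apply: eq_bigr => i _; rewrite !rmorphXn hX.
Qed.

Section Muni.
Variables (n : nat) (R : comNzRingType).
Local Notation widen := (widen_ord (leqnSn n)).

Lemma muniX_widen (i : 'I_n) : muni ('X_(widen i) : {mpoly R[n.+1]}) = ('X_i)%:P.
Proof.
rewrite muniE msuppX big_seq1 mcoeffX eqxx scale1r mnm1E.
rewrite (_ : (widen i == ord_max) = false) ?expr0; last first.
  by apply/negbTE/eqP => /(congr1 val) /=; case: i => i /= hi ei; rewrite ei ltnn in hi.
rewrite alg_polyC; congr (_ %:P); congr 'X_[_]; apply/mnmP => j.
by rewrite mnmE !mnm1E; congr (nat_of_bool _); apply/eqP/eqP => [/(congr1 val)/= /val_inj|->].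
Qed.

Lemma muniX_max : muni ('X_ord_max : {mpoly R[n.+1]}) = 'X.
Proof.
rewrite muniE msuppX big_seq1 mcoeffX eqxx scale1r mnm1E eqxx expr1.
rewrite (_ : [multinom _ | i < n] = 0%MM) ?mpolyX0 ?scale1r //.
apply/mnmP => j; rewrite mnmE mnm1E mnm0E; apply/eqP; rewrite eqb0.
by apply/eqP => /(congr1 val) /=; case: j => j /= hj ej; rewrite -ej ltnn in hj.
Qed.

(** Inverse of [muni]. Through this pair a statement on n + 1 variables becomes one on polynomials
    in the last variable; that variable is later the direction of a projection. *)
Definition munif (q : {poly {mpoly R[n]}}) : {mpoly R[n.+1]} :=
  (map_poly (@mwiden n R) q).['X_ord_max].

Fact munif_is_zmod : zmod_morphism munif.
Proof. by move=> p q; rewrite /munif rmorphB hornerD hornerN. Qed.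
Fact munif_is_monoid : monoid_morphism munif.
Proof.
by split=> [|p q]; rewrite /munif ?rmorph1 ?hornerC // rmorphM hornerM.
Qed.
HB.instance Definition _ := GRing.isZmodMorphism.Build _ _ munif munif_is_zmod.
HB.instance Definition _ := GRing.isMonoidMorphism.Build _ _ munif munif_is_monoid.

Lemma munifC p : munif p%:P = mwiden p.
Proof. by rewrite /munif map_polyC hornerC. Qed.

Lemma munifX : munif 'X = 'X_ord_max.
Proof. by rewrite /munif map_polyX hornerX. Qed.

Lemma mwidenXU (i : 'I_n) : mwiden ('X_i : {mpoly R[n]}) = 'X_(widen i).
Proof. by rewrite mwidenX mnmwiden1. Qed.

Lemma muni_widen (p : {mpoly R[n]}) : muni (mwiden p) = p%:P.
Proof.
pose f : {rmorphism {mpoly R[n]} -> {poly {mpoly R[n]}}} := @muni n R \o @mwiden n R.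
pose g : {rmorphism {mpoly R[n]} -> {poly {mpoly R[n]}}} := polyC.
apply: (mpoly_morph_ext (f := f) (g := g)) => [c|i].
  by rewrite /= mwidenC muniC.
by rewrite /= mwidenXU muniX_widen.
Qed.

Lemma munifK : cancel munif (@muni n R).
Proof.
move=> q; rewrite -[in RHS](coefK q) poly_def -[in LHS](coefK q) poly_def.
rewrite !rmorph_sum; apply: eq_bigr => i _.
by rewrite -mul_polyC !rmorphM /= munifC muni_widen !rmorphXn /= munifX muniX_max.
Qed.

Lemma muniK : cancel (@muni n R) munif.
Proof.
pose f : {rmorphism {mpoly R[n.+1]} -> {mpoly R[n.+1]}} := munif \o @muni n R.
apply: (mpoly_morph_ext (f := f) (g := idfun)) => [c|i] /=.
  by rewrite muniC munifC mwidenC.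
have [j /= ej|j /= ej] := splitP (cast_ord (esym (addn1 n)) i).
  rewrite (_ : i = widen j); first by rewrite muniX_widen munifC mwidenXU.
  exact: val_inj.
rewrite (_ : i = ord_max); first by rewrite muniX_max munifX.
by apply: val_inj; rewrite /= ej ord1 addn0.
Qed.

Lemma muni_inj : injective (@muni n R).
Proof. exact: can_inj muniK. Qed.
End Muni.

Section EvalMuni.
Variables (n : nat) (R : comNzRingType).
Local Notation widen := (widen_ord (leqnSn n)).

Lemma meval_muni (v : 'I_n.+1 -> R) (p : {mpoly R[n.+1]}) :
  p.@[v] = (map_poly (meval (v \o widen)) (muni p)).[v ord_max].
Proof.
pose f : {rmorphism {mpoly R[n.+1]} -> R} :=
  horner_eval (v ord_max) \o map_poly (meval (v \o widen)) \o @muni n R.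
apply: (mpoly_morph_ext (f := meval v) (g := f)) => [c|i] /=.
  by rewrite muniC map_polyC /= !mevalC /horner_eval hornerC.
rewrite mevalXU; have [j /= ej|j /= ej] := splitP (cast_ord (esym (addn1 n)) i).
  rewrite (_ : i = widen j); last exact: val_inj.
  by rewrite muniX_widen map_polyC /= mevalXU /horner_eval hornerC.
rewrite (_ : i = ord_max); first by rewrite muniX_max map_polyX /horner_eval hornerX.
by apply: val_inj; rewrite /= ej ord1 addn0.
Qed.

Lemma meval_muni_row (y : 'rV[R]_n) (t : R) (p : {mpoly R[n.+1]}) (v : 'I_n.+1 -> R) :
  (forall i, v (widen i) = y 0 i) -> v ord_max = t ->
  p.@[v] = (map_poly (meval (y 0)) (muni p)).[t].
Proof.
move=> hy <-; rewrite meval_muni; congr (_.[_]).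
by apply: eq_map_poly => q; apply: meval_eq => i; rewrite /= hy.
Qed.
End EvalMuni.

Section EvalExt.
Variable K : closedFieldType.

Lemma poly_nonroots (s : seq {poly K}) :
  (forall p, p \in s -> p != 0) -> exists t, forall p, p \in s -> p.[t] != 0.
Proof.
move=> hs; have: \prod_(p <- s) p != 0.
  by rewrite prodf_seq_neq0; apply/allP => p /hs ->; rewrite implybT.
move=> /closed_nonrootP [t]; rewrite /root horner_prod prodf_seq_neq0 => /allP ht.
by exists t => p /ht.
Qed.

Lemma mpoly_nonroot n (p : {mpoly K[n]}) : p != 0 -> exists x : 'rV[K]_n, p.@[x 0] != 0.
Proof.
elim: n p => [|n IH] p p0.
  exists 0; rewrite [p]nvar0_mpolyC mevalC; apply: contra_neq p0 => p0.
  by rewrite [p]nvar0_mpolyC p0 mpolyC0.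
have q0 : muni p != 0.
  by apply: contra_neq p0 => e; apply: (@muni_inj _ K); rewrite e raddf0.
have {q0}lq : lead_coef (muni p) != 0 by rewrite lead_coef_eq0.
have [y hy] := IH _ lq.
have qy : map_poly (meval (y 0)) (muni p) != 0.
  rewrite -lead_coef_eq0 lead_coef_map_eq //.
have [t ht] := closed_nonrootP _ qy.
exists (\row_i if unlift ord_max i is Some j then y 0 j else t).
rewrite (meval_muni_row (y := y) (t := t)) // ?mxE ?unlift_none // => i.
rewrite mxE (_ : widen_ord _ i = lift ord_max i) ?liftK //.
by apply: val_inj; rewrite /= /bump leqNgt ltn_ord.
Qed.

Lemma mpoly_eval0 n (p : {mpoly K[n]}) : (forall x : 'rV[K]_n, p.@[x 0] = 0) -> p = 0.
Proof.
by move=> h; apply/eqP; apply: contraT => /mpoly_nonroot [x]; rewrite h eqxx.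
Qed.

Lemma mpoly_ext n (p q : {mpoly K[n]}) :
  (forall x : 'rV[K]_n, p.@[x 0] = q.@[x 0]) -> p = q.
Proof.
by move=> h; apply/eqP; rewrite -subr_eq0; apply/eqP/mpoly_eval0 => x; rewrite mevalB h subrr.
Qed.

Lemma mpoly_nonroots n (s : seq {mpoly K[n]}) :
  (forall p, p \in s -> p != 0) -> exists x : 'rV_n, forall p, p \in s -> p.@[x 0] != 0.
Proof.
move=> hs; have: \prod_(p <- s) p != 0.
  by rewrite prodf_seq_neq0; apply/allP => p /hs ->; rewrite implybT.
move=> /mpoly_nonroot [t]; rewrite rmorph_prod prodf_seq_neq0 => /allP ht.
by exists t => p /ht.
Qed.
End EvalExt.

Section LinearForms.
Variable K : closedFieldType.

Definition lin n (c : 'cV[K]_n) : {mpoly K[n]} := \sum_i c i 0 *: 'X_i.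

Lemma lin_eval n (c : 'cV[K]_n) (x : 'rV_n) : (lin c).@[x 0] = (x *m c) 0 0.
Proof.
rewrite /lin raddf_sum mxE; apply: eq_bigr => i _ /=.
by rewrite mevalZ mevalXU mulrC.
Qed.

Lemma lin_homog n (c : 'cV[K]_n) : lin c \is 1.-homog.
Proof.
by apply: rpred_sum => i _; apply: rpredZ; rewrite dhomogX /= mdeg1.
Qed.

Definition subst n m (D : 'M[K]_(n, m)) (p : {mpoly K[m]}) : {mpoly K[n]} :=
  p \mPo [tuple lin (col j D) | j < m].

HB.instance Definition _ n m (D : 'M[K]_(n, m)) :=
  GRing.RMorphism.copy (subst D) (comp_mpoly [tuple lin (col j D) | j < m]).

Lemma subst_eval n m (D : 'M[K]_(n, m)) (p : {mpoly K[m]}) (x : 'rV_n) :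
  (subst D p).@[x 0] = p.@[(x *m D) 0].
Proof.
rewrite /subst comp_mpoly_meval; apply: meval_eq => j.
rewrite tnth_mktuple lin_eval !mxE; apply: eq_bigr => i _; by rewrite mxE.
Qed.

Lemma substC n m (D : 'M[K]_(n, m)) (c : K) : subst D c%:MP = c%:MP.
Proof. exact: comp_mpolyC. Qed.

Lemma subst_comp n m k (D : 'M[K]_(n, m)) (E : 'M[K]_(m, k)) (p : {mpoly K[k]}) :
  subst D (subst E p) = subst (D *m E) p.
Proof. by apply: mpoly_ext => x; rewrite !subst_eval mulmxA. Qed.

Lemma subst1 n (p : {mpoly K[n]}) : subst 1%:M p = p.
Proof. by apply: mpoly_ext => x; rewrite subst_eval mulmx1. Qed.

Lemma dhomog_comp n m d (p : {mpoly K[n]}) (lq : n.-tuple {mpoly K[m]}) e :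
  p \is d.-homog -> (forall i, tnth lq i \is e.-homog) -> p \mPo lq \is (e * d).-homog.
Proof.
move=> hp hq; rewrite comp_mpolyEX big_seq; apply: rpred_sum => mm hm.
apply: rpredZ; have <- : mdeg mm = d := dhomog_mf hp hm.
rewrite comp_mpolyX mdegE big_distrr /=.
elim/big_ind2: _ => //; first exact: dhomog1.
- by move=> p1 d1 p2 d2 h1 h2; apply: dhomogM.
- by move=> i _; apply: dhomogMn.
Qed.

Lemma dhomog_subst n m (D : 'M[K]_(n, m)) d (p : {mpoly K[m]}) :
  p \is d.-homog -> subst D p \is d.-homog.
Proof.
move=> hp; rewrite -[d]mul1n; apply: dhomog_comp => // i.
by rewrite tnth_mktuple lin_homog.
Qed.

Lemma dhomog_eval_scale n d (p : {mpoly K[n]}) (x : 'rV_n) (t : K) :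
  p \is d.-homog -> p.@[(t *: x) 0] = t ^+ d * p.@[x 0].
Proof.
move=> hp; rewrite !mevalE big_distrr /= !big_seq; apply: eq_bigr => m hm.
rewrite mulrCA; congr (_ * _); have <- : mdeg m = d := dhomog_mf hp hm.
rewrite mdegE -prodrXr.
by rewrite -big_split; apply: eq_bigr => i _; rewrite mxE exprMn.
Qed.

Lemma dhomog_eval0 n d (p : {mpoly K[n]}) : p \is d.-homog -> (0 < d)%N ->
  p.@[(0 : 'rV_n) 0] = 0.
Proof.
by move=> hp d0; rewrite -(scale0r 0) (dhomog_eval_scale _ _ hp) expr0n eqn0Ngt d0 mul0r.
Qed.

(** The restriction of [p] to the line through 0 and [x], with the values of the homogeneous
    components as coefficients. Statements on graded pieces thereby become identities between
    polynomials in one variable. *)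
Definition ray n (p : {mpoly K[n]}) (x : 'rV[K]_n) : {poly K} :=
  \poly_(e < msize p) (pihomog mdeg e p).@[x 0].

Lemma pihomog_big n (p : {mpoly K[n]}) e : (msize p <= e)%N -> pihomog mdeg e p = 0.
Proof.
move=> he; rewrite pihomogE big_seq_cond big1 // => m /andP[hm /eqP hd].
by have := leq_trans (msize_mdeg_lt hm) he; rewrite hd ltnn.
Qed.

Lemma coef_ray n (p : {mpoly K[n]}) x e : (ray p x)`_e = (pihomog mdeg e p).@[x 0].
Proof.
rewrite coef_poly; case: ltnP => // he.
by rewrite pihomog_big // meval0.
Qed.

Lemma ray_eval n (p : {mpoly K[n]}) x t : (ray p x).[t] = p.@[(t *: x) 0].
Proof.
rewrite horner_poly [in RHS](pihomog_partitionE (mf := mdeg) (leqnn (msize p))) raddf_sum.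
by apply: eq_bigr => i _ /=; rewrite (dhomog_eval_scale _ _ (pihomogP _ _ _)) mulrC.
Qed.

Lemma poly_ext (p q : {poly K}) : (forall t, p.[t] = q.[t]) -> p = q.
Proof.
move=> h; apply/eqP; rewrite -subr_eq0; apply: contraT => /closed_nonrootP [t].
by rewrite /root hornerD hornerN h subrr eqxx.
Qed.

Lemma rayM n (p q : {mpoly K[n]}) x : ray (p * q) x = ray p x * ray q x.
Proof. by apply: poly_ext => t; rewrite hornerM !ray_eval mevalM. Qed.

Lemma ray_homog n d (p : {mpoly K[n]}) x : p \is d.-homog -> ray p x = p.@[x 0] *: 'X^d.
Proof.
move=> hp; apply: poly_ext => t.
by rewrite ray_eval (dhomog_eval_scale _ _ hp) hornerZ hornerXn mulrC.
Qed.

Lemma dhomog_ext n d (p : {mpoly K[n]}) :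
  (forall (x : 'rV_n) t, p.@[(t *: x) 0] = t ^+ d * p.@[x 0]) -> p \is d.-homog.
Proof.
move=> h; rewrite homog_piE; apply/eqP/mpoly_ext => x.
rewrite -coef_ray; have -> : ray p x = p.@[x 0] *: 'X^d.
  by apply: poly_ext => t; rewrite ray_eval h hornerZ hornerXn mulrC.
by rewrite coefZ coefXn eqxx mulr1.
Qed.

Lemma pihomogMl n d e (p q : {mpoly K[n]}) : p \is d.-homog ->
  pihomog mdeg (d + e) (p * q) = p * pihomog mdeg e q.
Proof.
move=> hp; apply: mpoly_ext => x; rewrite mevalM -!coef_ray rayM (ray_homog _ hp).
by rewrite -scalerAl coefZ coefXnM ltnNge leq_addr /= addKn.
Qed.

(** On a ray where it does not vanish, a product of degree d restricts to a multiple of t^d, so a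
    factor restricts to a monomial. The exponent is the same on all rays because finitely many
    nonzero polynomials have a common nonzero. *)
Lemma dhomog_factor n d (p q : {mpoly K[n]}) : p * q != 0 -> p * q \is d.-homog ->
  exists2 e, p \is e.-homog & (e <= d)%N.
Proof.
move=> pq0 hpq; have [x hx] := mpoly_nonroot pq0.
have key (y : 'rV_n) : (p * q).@[y 0] != 0 -> exists2 e, ray p y = p.@[y 0] *: 'X^e & (e <= d)%N.
  move=> hy; have hd : ray p y %| 'X^d.
    have := rayM p q y; rewrite (ray_homog _ hpq) => ed.
    by rewrite -(dvdpZr _ _ hy) ed dvdp_mulIl.
  have := hd; rewrite -{1}['X]subr0 => /dvdp_exp_XsubCP [e he]; rewrite subr0.
  move=> /eqpP[[a b] /= /andP[a0 b0] hab]; exists e => //.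
  have r1 : ray p y = (b / a) *: 'X^e.
    by apply: (scalerI a0); rewrite hab scalerA mulrCA divff // mulr1.
  suff <- : b / a = p.@[y 0] by [].
  by rewrite -[y in RHS]scale1r -ray_eval r1 hornerZ hornerXn expr1n mulr1.
have [e he led] := key x hx; exists e => //.
rewrite homog_piE -subr_eq0; apply/negP => /negP r0.
(* If [p] had a component of another degree, some [z] would see it together with the component of
   degree [e], although the ray at [z] is a monomial. *)
have [z hz] : exists z : 'rV_n, ((p - pihomog mdeg e p) * (pihomog mdeg e p * (p * q))).@[z 0] != 0.
  apply: mpoly_nonroot; apply: mulf_neq0; last apply: mulf_neq0 => //.
    by move: r0; rewrite -opprB oppr_eq0.
  apply: contraNneq hx => e0; move: (congr1 (fun r : {poly K} => r`_e) he).
  by rewrite coef_ray e0 meval0 coefZ coefXn eqxx mulr1 mevalM => <-; rewrite mul0r.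
move: hz; rewrite !mevalM !mulf_eq0 !negb_or => /and3P[h1 h2 h3].
have [e' he' _] : exists2 e, ray p z = p.@[z 0] *: 'X^e & (e <= d)%N.
  by apply: key; rewrite mevalM mulf_neq0 //; case/andP: h3.
have ee : e' = e.
  apply/eqP; apply: contraNT h2 => ne; rewrite -coef_ray he' coefZ coefXn.
  by rewrite [e == e']eq_sym (negbTE ne) mulr0.
move: h1; rewrite mevalB -coef_ray he' ee coefZ coefXn eqxx mulr1 subrr eqxx.
by [].
Qed.
End LinearForms.

(** * Unique factorization and principal ideals *)

Section Divisibility.
Variable R : idomainType.

Definition divides (a b : R) : Prop := exists c, b = c * a.

Definition prime_elt (p : R) : Prop :=
  [/\ p != 0, p \isn't a GRing.unit &
      forall a b, divides p (a * b) -> divides p a \/ divides p b].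

(** The factors are required to be prime rather than irreducible: uniqueness then comes for free,
    and the passage to polynomials only has to produce primes. *)
Definition ufd : Prop := forall a, a != 0 ->
  exists2 s : seq R, (forall p, p \in s -> prime_elt p) &
    exists2 u, u \is a GRing.unit & a = u * \prod_(p <- s) p.

Lemma divides_refl a : divides a a. Proof. by exists 1; rewrite mul1r. Qed.
Lemma divides0 a : divides a 0. Proof. by exists 0; rewrite mul0r. Qed.
Lemma divides_mull a b c : divides a b -> divides a (c * b).
Proof. by case=> x ->; exists (c * x); rewrite mulrA. Qed.
Lemma divides_mulr a b c : divides a b -> divides a (b * c).
Proof. by rewrite mulrC; apply: divides_mull. Qed.
Lemma dividesD a b c : divides a b -> divides a c -> divides a (b + c).
Proof. by case=> x -> [y ->]; exists (x + y); rewrite mulrDl. Qed.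
Lemma dividesB a b c : divides a b -> divides a c -> divides a (b - c).
Proof. by case=> x -> [y ->]; exists (x - y); rewrite mulrBl. Qed.
Lemma divides_trans b a c : divides a b -> divides b c -> divides a c.
Proof. by case=> x -> [y ->]; exists (y * x); rewrite mulrA. Qed.
Lemma prime_unit p u : prime_elt p -> u \is a GRing.unit -> ~ divides p u.
Proof.
case=> p0 pu _ uu [c e]; move: pu uu; rewrite e unitrM => /negbTE -> /andP[].
by [].
Qed.

Lemma prime_exp p a k : prime_elt p -> divides p (a ^+ k) -> divides p a.
Proof.
move=> hp; elim: k => [|k IH]; first by rewrite expr0 => /prime_unit; rewrite unitr1 => /(_ hp isT).
by rewrite exprS => /(proj2 (proj2 (and3_rec (fun a b c => conj a (conj b c)) hp))) [].
Qed.

Lemma prime_prod p (s : seq R) : prime_elt p -> divides p (\prod_(q <- s) q) ->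
  exists2 q, q \in s & divides p q.
Proof.
move=> hp; elim: s => [|q s IH].
  by rewrite big_nil => /(prime_unit hp); rewrite unitr1 => /(_ isT).
have [_ _ h] := hp.
rewrite big_cons => /h [hq|/IH [r hr hd]]; first by exists q; rewrite ?mem_head.
by exists r; rewrite ?inE ?hr ?orbT.
Qed.

Lemma prime_assoc p q : prime_elt p -> prime_elt q -> divides p q ->
  exists2 v, v \is a GRing.unit & q = v * p.
Proof.
move=> [p0 pu hp] [q0 qu hq] [v e]; exists v => //.
have /hq [[w ew]|[w ew]] : divides q (v * p) by rewrite -e; apply: divides_refl.
  move: e pu; rewrite ew => /eqP; rewrite -mulrA mulrCA -{1}[q]mulr1 (inj_eq (mulfI q0)).
  by move=> /eqP e1; rewrite (_ : p \is a GRing.unit) //; apply/unitrPr; exists w; rewrite mulrC.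
apply/unitrPr; exists w; apply: (mulIf p0); rewrite mul1r {2}ew e.
by rewrite mulrCA mulrA.
Qed.

(** In a factorization of an irreducible element into primes the cofactor of the first prime is a
    unit. *)
Lemma irr_prime a : ufd -> irreducible_elt a -> prime_elt a.
Proof.
move=> hu [a0 au hirr]; have [s hs [u uu ea]] := hu a a0.
case: s hs ea => [|p s] hs ea; first by move: au; rewrite ea big_nil mulr1 uu.
have [p0 pu hp] := hs p (mem_head _ _).
rewrite big_cons mulrCA in ea.
have [|hr] := hirr _ _ ea; first by rewrite (negbTE pu).
split=> // b c [x ebc].
have /hp [[y ->]|[y ->]] : divides p (b * c).
    by exists (x * (u * \prod_(q <- s) q)); rewrite ebc ea -mulrA [_ * p]mulrC.
  by left; exists (y / (u * \prod_(q <- s) q)); rewrite ea [p * _]mulrC mulrA divrK.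
by right; exists (y / (u * \prod_(q <- s) q)); rewrite ea [p * _]mulrC mulrA divrK.
Qed.
End Divisibility.

Lemma ufd_iso (R S : idomainType) (f : {rmorphism R -> S}) (g : {rmorphism S -> R}) :
  cancel f g -> cancel g f -> ufd S -> ufd R.
Proof.
move=> fK gK hS a a0; have fa0 : f a != 0.
  by apply: contra_neq a0 => e; rewrite -[a]fK e rmorph0.
have gu x : (g x \is a GRing.unit) = (x \is a GRing.unit).
  apply/idP/idP; last exact: rmorph_unit.
  by move=> /(rmorph_unit f); rewrite gK.
have [s hs [u uu ea]] := hS _ fa0; exists [seq g p | p <- s].
  move=> _ /mapP [p /hs [p0 pu hp] ->]; split.
  - by apply: contra_neq p0 => e; rewrite -[p]gK e rmorph0.
  - by rewrite gu.
  - move=> x y [c e]; have /hp [[d e']|[d e']] : divides p (f x * f y).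
        by exists (f c); rewrite -rmorphM e rmorphM gK.
      by left; exists (g d); rewrite -rmorphM -e' fK.
    by right; exists (g d); rewrite -rmorphM -e' fK.
exists (g u); rewrite ?gu //.
by rewrite big_map -rmorph_prod -rmorphM -ea fK.
Qed.

Section PolyUfd.
Variable R : idomainType.
Hypothesis hR : ufd R.
Implicit Types f g h : {poly R}.

Lemma divides_polyC (p : R) f : divides p%:P f <-> forall i, divides p f`_i.
Proof.
split=> [[c ->] i|h]; first by exists c`_i; rewrite coefMC.
exists (\poly_(i < size f) sval (cid (h i))); apply/polyP => i.
rewrite coefMC coef_poly; case: ltnP => hi; first by rewrite -(svalP (cid (h i))).
by rewrite mul0r nth_default.
Qed.

(** Gauss's argument: [p] divides the product of the leading coefficients, hence one of them, and
    the leading term it belongs to is removed. The induction is on the sum of the sizes. *)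
Lemma prime_polyC (p : R) : prime_elt p -> prime_elt p%:P.
Proof.
move=> [p0 pu hp]; split; rewrite ?polyC_eq0 //.
  by rewrite poly_unitE coefC eqxx (negbTE pu) andbF.
move=> f g; move: {2}(size f + size g)%N (leqnn (size f + size g)) => n.
elim: n f g => [|n IH] f g.
  by rewrite leqn0 addn_eq0 size_poly_eq0 => /andP[/eqP -> _] _; left; apply: divides0.
have [->|f0] := eqVneq f 0; first by left; apply: divides0.
have [->|g0] := eqVneq g 0; first by right; apply: divides0.
have split_lead h : h != 0 -> exists2 h', h = h' + (lead_coef h)%:P * 'X^((size h).-1) &
    (size h' < size h)%N.
  move=> h0; exists (h - (lead_coef h)%:P * 'X^((size h).-1)); first by rewrite subrK.
  have sh : (0 < size h)%N by rewrite size_poly_gt0.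
  rewrite -[X in (_ < X)%N](prednK sh) ltnS; apply/leq_sizeP => j hj.
  rewrite coefB coefCM coefXn; case: eqP => [->|/eqP ne].
    by rewrite mulr1 lead_coefE subrr.
  by rewrite mulr0 subr0 nth_default // -(prednK sh) ltn_neqAle eq_sym ne.
move=> hs hd; have : divides p (lead_coef f * lead_coef g).
  by rewrite -lead_coefM lead_coefE; have /divides_polyC := hd; apply.
have dC c k : divides p c -> divides p%:P (c%:P * 'X^k).
  by case=> y ->; rewrite polyCM -mulrA mulrCA; exists (y%:P * 'X^k); rewrite mulrC.
move=> /hp [hl|hl].
  have [f' ef sf] := split_lead f f0.
  have hf := dC _ (size f).-1 hl.
  have [||h|h] := IH f' g; [|rewrite {1}(_ : f' = f - (lead_coef f)%:P * 'X^((size f).-1))|left|by right].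
  - by rewrite -ltnS; apply: leq_trans hs; rewrite -addSn leq_add2r.
  - by rewrite mulrBl; apply: dividesB => //; apply: divides_mulr.
  - by rewrite {1}ef addrK.
  - by rewrite ef; apply: dividesD.
have [f' ef sf] := split_lead g g0.
have hf := dC _ (size g).-1 hl.
have [||h|h] := IH f f'; [|rewrite {1}(_ : f' = g - (lead_coef g)%:P * 'X^((size g).-1))|by left|right].
- by rewrite -ltnS; apply: leq_trans hs; rewrite -addnS leq_add2l.
- by rewrite mulrBr; apply: dividesB => //; apply: divides_mull.
- by rewrite {1}ef addrK.
- by rewrite ef; apply: dividesD.
Qed.

(** The primes of [c] remain prime in the polynomial ring, so each of them can be cancelled from [g]
    or from [h]; [c1] and [c2] collect what is taken out of either factor. *)
Lemma cancel_const (c : R) f g h : c != 0 -> c%:P * f = g * h ->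
  exists g' h' c1 c2,
    [/\ f = g' * h', g = c1%:P * g', h = c2%:P * h', c1 != 0 & c2 != 0].
Proof.
move=> /hR [s + [u uu ->]]; elim: s f g h => [|p s IH] f g h hs.
  rewrite big_nil mulr1 => e; have u0 : u != 0 by apply: contraTneq uu => ->; rewrite unitr0.
  exists (u^-1%:P * g), h, u, 1; split; rewrite ?oner_eq0 ?mul1r //.
    by rewrite -mulrA -e mulrA -polyCM mulVr // mul1r.
  by rewrite mulrA -polyCM divrr // mul1r.
have hp := hs p (mem_head _ _); have [p0 _ _] := hp.
have pP0 : p%:P != 0 :> {poly R} by rewrite polyC_eq0.
have [_ _ hpp] := prime_polyC hp.
have {}hs q : q \in s -> prime_elt q by move=> hq; apply: hs; rewrite inE hq orbT.
rewrite big_cons mulrCA polyCM -mulrA => e.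
have /hpp [[g1 e1]|[g1 e1]] : divides p%:P (g * h) by rewrite -e mulrC; apply: divides_mull; apply: divides_refl.
  have {e} : (u * \prod_(q <- s) q)%:P * f = g1 * h.
    by apply: (mulfI pP0); rewrite e e1; ring.
  move=> /(IH _ _ _ hs) [g' [h' [c1 [c2 [e2 e3 e4 c10 c20]]]]].
  exists g', h', (p * c1), c2; split => //; last by rewrite mulf_neq0.
  by rewrite e1 e3 polyCM; ring.
have {e} : (u * \prod_(q <- s) q)%:P * f = g * g1.
  by apply: (mulfI pP0); rewrite e e1; ring.
move=> /(IH _ _ _ hs) [g' [h' [c1 [c2 [e2 e3 e4 c10 c20]]]]].
exists g', h', c1, (p * c2); split => //; last by rewrite mulf_neq0.
by rewrite e1 e4 polyCM; ring.
Qed.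

Definition primitive f := forall p : R, prime_elt p -> ~ divides p%:P f.

(** A constant prime dividing [f] divides its leading coefficient, so dividing such primes out stops
    after at most as many rounds as that coefficient has prime factors. *)
Lemma content_exists f : f != 0 ->
  exists c f1, [/\ c != 0, f = c%:P * f1 & primitive f1].
Proof.
move=> f0; have lf0 : lead_coef f != 0 by rewrite lead_coef_eq0.
have [s + [u uu]] := hR lf0.
move: {2}(size s) (leqnn (size s)) => n.
elim: n s u uu f f0 {lf0} => [|n IH] s u uu f f0 hn hs el.
  exists 1, f; split; rewrite ?oner_eq0 ?mul1r // => p hp [c e].
  move: hn el; rewrite leqn0 size_eq0 => /eqP ->; rewrite big_nil mulr1 e.
  rewrite lead_coefM lead_coefC => eu; move: uu; rewrite -eu.
  by move=> /(prime_unit hp); apply; apply: divides_mull; apply: divides_refl.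
have [hprim|] := pselect (primitive f).
  by exists 1, f; split; rewrite ?oner_eq0 ?mul1r.
move=> /existsNP [p /not_implyP [hp /contrapT [g e]]].
have [p0 pu hpp] := hp.
have g0 : g != 0 by apply: contra_neq f0 => g0; rewrite e g0 mul0r.
have el' : lead_coef g * p = u * \prod_(q <- s) q.
  by rewrite -el e lead_coefM lead_coefC.
have [q hq hd] : exists2 q, q \in s & divides p q.
  apply: (prime_prod hp); have /hpp [hd|//] : divides p (u * \prod_(q <- s) q).
    by rewrite -el'; apply: divides_mull; apply: divides_refl.
  by case: (prime_unit hp uu).
have [v vu ev] := prime_assoc hp (hs q hq) hd.
have [c [f1 [c0 e1 hf1]]] : exists c f1, [/\ c != 0, g = c%:P * f1 & primitive f1].
  apply: (IH (rem q s) (u * v)) => //.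
  - by rewrite unitrM uu.
  - by rewrite size_rem // -ltnS (leq_trans _ hn) // prednK // lt0n size_eq0; case: (s) hq.
  - by move=> r /mem_rem; apply: hs.
  - apply: (mulIf p0); rewrite el' (big_rem q hq) /= ev; ring.
exists (c * p), f1; split; rewrite ?mulf_neq0 //.
by rewrite e e1 polyCM; ring.
Qed.

Lemma primitive_dvd f g : primitive f -> divides g f -> primitive g.
Proof. by move=> hf hgf p hp hpg; apply: (hf p hp); apply: divides_trans hgf. Qed.

Lemma primitive_unit f : f != 0 -> primitive f -> (size f <= 1)%N -> f \is a GRing.unit.
Proof.
move=> f0 hf /size1_polyC ef; have c0 : f`_0 != 0 by rewrite -polyC_eq0 -ef.
have [s hs [u uu e]] := hR c0; case: s hs e => [|p s] hs e.
  by rewrite ef e big_nil mulr1 rmorph_unit.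
case: (hf p (hs p (mem_head _ _))); rewrite ef e big_cons.
exists (u * \prod_(q <- s) q)%:P; rewrite -polyCM; congr _%:P; ring.
Qed.

Lemma primitive_cancel f g (c : R) : primitive g -> c != 0 -> divides g (c%:P * f) -> divides g f.
Proof.
move=> hg c0 [w /cancel_const]; case/(_ c0) => w' [g' [c1 [c2 [ef _ eg _ c20]]]].
have uc : c2 \is a GRing.unit.
  have [s hs [u uu e]] := hR c20; case: s hs e => [|p s] hs e; first by rewrite e big_nil mulr1.
  case: (hg p (hs p (mem_head _ _))); rewrite eg e big_cons.
  by exists ((u * \prod_(q <- s) q)%:P * g'); rewrite !polyCM; ring.
exists (w' * c2^-1%:P); rewrite ef eg mulrA -[w' * _ * _]mulrA -polyCM mulVr //.
by rewrite mulr1.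
Qed.

(** [r] is a nonzero element of least size in the ideal of [f] and [g]; pseudo-division leaves a
    remainder in the ideal, hence zero. This is the gcd over the fraction field, found without
    leaving R[X]. *)
Lemma bezout_min f g : f != 0 -> exists u v r,
  [/\ r != 0, r = u * f + v * g,
      exists2 c, c != 0 & divides r (c%:P * f) & exists2 c, c != 0 & divides r (c%:P * g)].
Proof.
move=> f0; pose I r := exists u v, r = u * f + v * g.
have hex : exists n, `[< exists r, [/\ r != 0, I r & size r = n] >].
  exists (size f); apply/asboolP; exists f; split => //.
  by exists 1, 0; rewrite mul1r mul0r addr0.
case: (ex_minnP hex) => n /asboolP [r [r0 [u [v er]] sr]] hmin.
have key h : I h -> exists2 c, c != 0 & divides r (c%:P * h).
  move=> [u' [v' eh]]; exists (lead_coef r ^+ Pdiv.Idomain.scalp h r).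
    by rewrite expf_neq0 // lead_coef_eq0.
  have e := Pdiv.Idomain.divp_eq h r; rewrite mul_polyC e.
  exists (h %/ r); have [->|m0] := eqVneq (h %% r) 0; first by rewrite addr0.
  have := Pdiv.Idomain.ltn_modp h r; rewrite r0 sr ltnNge hmin //.
  apply/asboolP; exists (h %% r); split => //.
  set c := lead_coef r ^+ _ in e.
  exists (c%:P * u' - (h %/ r) * u), (c%:P * v' - (h %/ r) * v).
  have -> : h %% r = c%:P * h - (h %/ r) * r by rewrite mul_polyC e addrC addKr.
  by rewrite eh er; ring.
exists u, v, r; split => //.
  by apply: key; exists 1, 0; rewrite mul1r mul0r addr0.
by apply: key; exists 0, 1; rewrite mul1r mul0r add0r.
Qed.

(** Let [r] be the least combination of [g] and [a]. As [g] has no two factors of positive degree,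
    either [r] is constant, and [g] divides [r * b], or [r] is [g] up to constants, and [g] divides
    [a]; primitivity removes the constants. *)
Lemma primitive_irr_prime g : (1 < size g)%N -> primitive g ->
  (forall h k, g = h * k -> (size h <= 1)%N \/ (size k <= 1)%N) -> prime_elt g.
Proof.
move=> sg hg hirr; have g0 : g != 0 by rewrite -size_poly_gt0 ltnW.
split => //; first by rewrite poly_unitE; move: sg; case: (size g) => [|[]].
move=> a b [x exb]; have [u [v [r [r0 er [c c0 [w ew]] [c' c0' [w' ew']]]]]] := bezout_min a g0.
have [w1 [r1 [c1 [c2 [eg ew1 er1 c10 c20]]]]] := cancel_const c0 ew.
have [sr|sw] := hirr _ _ eg; last first.
  have rC : r = (c2 * r1`_0)%:P by rewrite er1 {1}[r1]size1_polyC // polyCM.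
  right; apply: (@primitive_cancel _ _ (c2 * r1`_0)) => //.
    by rewrite -polyC_eq0 -rC.
  rewrite -rC er mulrDl; apply: dividesD; first by rewrite mulrAC; apply: divides_mull; apply: divides_refl.
  by rewrite -mulrA exb mulrA; apply: divides_mull; apply: divides_refl.
left; apply: (@primitive_cancel _ _ (w1`_0 * c')) => //.
  rewrite mulf_neq0 // -polyC_eq0 -size1_polyC //.
  by apply: contra_neq g0 => w10; rewrite eg w10 mul0r.
rewrite polyCM -mulrA ew' er1 -size1_polyC // eg; exists (w' * c2%:P); ring.
Qed.

(** A divisor of positive degree and least size cannot be split further, so it is prime; the
    cofactor is smaller and again primitive. *)
Lemma primitive_factor f : f != 0 -> primitive f ->
  exists2 s : seq {poly R}, (forall p, p \in s -> prime_elt p) &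
    exists2 u, u \is a GRing.unit & f = u * \prod_(p <- s) p.
Proof.
move: {2}(size f) (leqnn (size f)) => n; elim: n f => [|n IH] f hn f0 hf.
  by move: hn; rewrite leqn0 size_poly_eq0 (negbTE f0).
have [sf|sf] := leqP (size f) 1.
  exists [::] => //; exists f; rewrite ?big_nil ?mulr1 //; exact: primitive_unit.
have hex : exists k, `[< exists g, [/\ divides g f, (1 < size g)%N & size g = k] >].
  by exists (size f); apply/asboolP; exists f; split => //; apply: divides_refl.
case: (ex_minnP hex) => k /asboolP [g [hgf sg ek]] hmin; have [h efg] := hgf.
have hg := primitive_dvd hf hgf.
have g0 : g != 0 by rewrite -size_poly_gt0 ltnW.
have h0 : h != 0 by apply: contra_neq f0 => h0; rewrite efg h0 mul0r.
have pg : prime_elt g.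
  apply: primitive_irr_prime => // a b eab.
  have [a0 b0] : a != 0 /\ b != 0 by apply/andP; rewrite -negb_or -mulf_eq0 -eab.
  have [|sa] := leqP (size a) 1; [by left|right].
  have : (k <= size a)%N.
    apply: hmin; apply/asboolP; exists a; split => //.
    by apply: divides_trans hgf; exists b; rewrite mulrC.
  rewrite -ek eab size_mul //; have : (0 < size b)%N by rewrite size_poly_gt0.
  by move: sa; case: (size a) (size b) => // i [|j] //; rewrite /= addnS /=; lia.
have hh : primitive h by apply: primitive_dvd hf _; exists g; rewrite mulrC.
have sh : (size h <= n)%N.
  rewrite -ltnS (leq_trans _ hn) // efg size_mul //.
  by move: sg; case: (size g) (size h) => [|[|i]] // j _; rewrite !addnS /=; lia.
have [s hs [u uu eh]] := IH h sh h0 hh.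
exists (g :: s); first by move=> p; rewrite inE => /orP[/eqP ->|/hs].
by exists u => //; rewrite efg eh big_cons; ring.
Qed.

Lemma ufd_poly : ufd {poly R}.
Proof.
move=> f f0; have [c [f1 [c0 ef hf1]]] := content_exists f0.
have [s hs [u uu ec]] := hR c0.
have f10 : f1 != 0 by apply: contra_neq f0 => f10; rewrite ef f10 mulr0.
have [s1 hs1 [u1 uu1 ef1]] := primitive_factor f10 hf1.
exists ([seq p%:P | p <- s] ++ s1).
  move=> p; rewrite mem_cat => /orP[/mapP[q /hs hq ->]|/hs1 //].
  exact: prime_polyC.
exists (u%:P * u1); first by rewrite unitrM uu1 andbT rmorph_unit.
rewrite ef ec ef1 big_cat big_map /= polyCM rmorph_prod /=; ring.
Qed.

(** A least combination of positive degree would have a prime factor of positive degree dividing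
    both. For polynomials over K[X_1, ..., X_n] the constant [r] is an eliminant: nonzero, and zero
    below every common zero. *)
Lemma bezout_coprime f g : f != 0 ->
  (forall p : {poly R}, prime_elt p -> (1 < size p)%N -> divides p f -> ~ divides p g) ->
  exists u v (r : R), r != 0 /\ r%:P = u * f + v * g.
Proof.
move=> f0 hfg; have [u [v [r [r0 er [c c0 hrf] [c' c0' hrg]]]]] := bezout_min g f0.
have [sr|sr] := leqP (size r) 1.
  by exists u, v, r`_0; rewrite -polyC_eq0 -size1_polyC.
have [s hs [w uw e]] := ufd_poly r0.
have [p hp sp] : exists2 p, p \in s & (1 < size p)%N.
  apply/not_exists2P => hall; move: sr; rewrite ltnNge => /negP; apply.
  rewrite e; have sw : (size w <= 1)%N by move: uw; rewrite poly_unitE => /andP[/eqP ->].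
  have sM (a b : {poly R}) : (size a <= 1)%N -> (size b <= 1)%N -> (size (a * b)%R <= 1)%N.
    move=> ha hb; apply: leq_trans (size_polyMleq _ _) _.
    by move: ha hb; case: (size a) (size b) => [|[|?]] // [|[|?]].
  apply: (sM) => //; rewrite big_seq.
  apply: (big_ind (fun x : {poly R} => (size x <= 1)%N)); [by rewrite size_poly1|exact: sM|].
  by move=> p hp; rewrite leqNgt; apply/negP; case: (hall p) => [/(_ hp)|].
have hpr : divides p r.
  by rewrite e (big_rem p hp) /= mulrCA; exists (w * \prod_(q <- rem p s) q); rewrite mulrC.
have pp := hs p hp; have [_ _ hpp] := pp.
have hC d h : d != 0 -> divides r (d%:P * h) -> divides p h.
  move=> d0 /(divides_trans hpr) /hpp [[x ex]|//].
  have : size d%:P = size (x * p) by rewrite ex.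
  have x0 : x != 0 by apply: contra_neq d0 => x0; apply/eqP; rewrite -polyC_eq0 ex x0 mul0r.
  rewrite size_polyC d0 size_mul // -?size_poly_gt0 ?(ltnW sp) //.
  have : (0 < size x)%N by rewrite size_poly_gt0.
  by move: sp; case: (size p) (size x) => [|[|i]] // [|j] // _ _; rewrite !addnS /=; lia.
case: (hfg p pp sp (hC _ _ c0 hrf) (hC _ _ c0' hrg)).
Qed.
End PolyUfd.

Lemma ufd_mpoly (F : fieldType) n : ufd {mpoly F[n]}.
Proof.
elim: n => [|n IH].
  move=> a a0; exists [::] => //; exists a; rewrite ?big_nil ?mulr1 //.
  rewrite [a]nvar0_mpolyC rmorph_unit // unitfE; apply: contra_neq a0 => a0.
  by rewrite [a]nvar0_mpolyC a0 mpolyC0.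
exact: (ufd_iso (@muniK n F) (@munifK n F) (ufd_poly IH)).
Qed.

Lemma mpoly_unitP (F : fieldType) n (p : {mpoly F[n]}) :
  p \is a GRing.unit <-> exists2 c, c != 0 & p = c%:MP.
Proof.
split=> [|[c c0 ->]]; last by rewrite rmorph_unit // unitfE.
move=> /andP[/eqP e h]; exists p@_0 => //; by rewrite -unitfE.
Qed.

Lemma munifM n (R : comNzRingType) : {morph @munif n R : p q / p * q}.
Proof. exact: rmorphM. Qed.

Section ZeroLocus.
Variable K : closedFieldType.

Definition rowpt n (y : 'rV[K]_n) (t : K) : 'rV[K]_n.+1 :=
  \row_i if unlift ord_max i is Some j then y 0 j else t.

Lemma meval_rowpt n (p : {mpoly K[n.+1]}) (y : 'rV[K]_n) t :
  p.@[(rowpt y t) 0] = (map_poly (meval (y 0)) (muni p)).[t].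
Proof.
apply: meval_muni_row => [i|]; rewrite mxE ?unlift_none //.
rewrite (_ : widen_ord _ i = lift ord_max i) ?liftK //.
by apply: val_inj; rewrite /= /bump leqNgt ltn_ord.
Qed.

Lemma prime_muni n (p : {mpoly K[n.+1]}) : prime_elt p <-> prime_elt (muni p).
Proof.
have gu x : (muni x \is a GRing.unit) = (x \is a GRing.unit).
  apply/idP/idP; last exact: rmorph_unit.
  have : muni x \is a GRing.unit -> munif (muni x) \is a GRing.unit by exact: rmorph_unit.
  by rewrite muniK.
split=> -[p0 pu hp]; split.
- by apply: contra_neq p0 => e; apply: (@muni_inj _ K); rewrite e raddf0.
- by rewrite gu.
- move=> a b [c e]; have /hp [[d e']|[d e']] : divides p (munif a * munif b).
      by exists (munif c); rewrite -[p in RHS]muniK -!munifM e.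
    by left; exists (muni d); rewrite -muniM -e' munifK.
  by right; exists (muni d); rewrite -muniM -e' munifK.
- by apply: contra_neq p0 => e; rewrite e raddf0.
- by rewrite -gu.
- move=> a b [c e]; have /hp [[d e']|[d e']] : divides (muni p) (muni a * muni b).
      by exists (muni c); have := congr1 (@muni n K) e; rewrite !muniM.
    by left; exists (munif d); apply: (@muni_inj _ K); rewrite muniM munifK.
  by right; exists (munif d); apply: (@muni_inj _ K); rewrite muniM munifK.
Qed.

Lemma divides_muni n (p q : {mpoly K[n.+1]}) : divides p q <-> divides (muni p) (muni q).
Proof.
split=> -[c e]; first by exists (muni c); rewrite e muniM.
by exists (munif c); apply: (@muni_inj _ K); rewrite muniM munifK.
Qed.

(** If [p] involves the last variable and does not divide [c], there is a nonzero eliminant r = u p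
    + v c. Over a point where neither [r] nor the leading coefficient of [p] vanishes, [p] still has
    a root; [c] vanishes there, and so would [r]. If [p] does not involve that variable, the
    coefficients of [c] are treated by induction. *)
Lemma prime_nullstellensatz n (p c : {mpoly K[n]}) : prime_elt p ->
  (forall x : 'rV[K]_n, p.@[x 0] = 0 -> c.@[x 0] = 0) -> divides p c.
Proof.
elim: n p c => [|n IH] p c hp hc.
  have [p0 pu _] := hp; case/negP: pu; rewrite [p]nvar0_mpolyC rmorph_unit // unitfE.
  by apply: contra_neq p0 => p0; rewrite [p]nvar0_mpolyC p0 mpolyC0.
apply/divides_muni; have hmp := (prime_muni p).1 hp; have [p0 pu hpp] := hmp.
have [sp|sp] := leqP (size (muni p)) 1.
  have := size1_polyC sp; move: ((muni p)`_0) => q0 ep; rewrite ep in p0 pu hpp *.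
  apply/divides_polyC => i; have hp' : prime_elt q0.
    split; first by rewrite -polyC_eq0.
      by move: pu; apply: contra => h; rewrite rmorph_unit.
    move=> a b [x e]; case: (hpp a%:P b%:P) => [|h|h].
    - by exists x%:P; rewrite -!polyCM e.
    - by left; move: ((divides_polyC _ _).1 h 0%N); rewrite coefC.
    - by right; move: ((divides_polyC _ _).1 h 0%N); rewrite coefC.
  apply: IH => // y hy; have : map_poly (meval (y 0)) (muni c) = 0.
    apply: poly_ext => t; rewrite horner0 -meval_rowpt; apply: hc.
    by rewrite meval_rowpt ep map_polyC /= hy hornerC.
  by move=> /(congr1 (fun q : {poly K} => q`_i)); rewrite coef_map coef0.
apply: contrapT => hn.
have [u [v [r [r0 er]]]] : exists u v (r : {mpoly K[n]}), r != 0 /\ r%:P = u * muni p + v * muni c.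
  apply: (@bezout_coprime _ (@ufd_mpoly K n) (muni p) (muni c) p0).
  move=> q hq sq hqp hqc; apply: hn.
  have [w wu ew] := prime_assoc hq hmp hqp.
  case: hqc => z ez; exists (z / w); rewrite ez ew mulrA divrK //.
have [|y hy] := @mpoly_nonroots K n [:: r; lead_coef (muni p)].
  by move=> q; rewrite !inE => /orP[/eqP ->|/eqP ->]; rewrite ?lead_coef_eq0.
have sy : size (map_poly (meval (y 0)) (muni p)) = size (muni p).
  by apply: size_map_poly_id0; apply: hy; rewrite !inE eqxx orbT.
have /closed_rootP [t ht] : size (map_poly (meval (y 0)) (muni p)) != 1.
  by rewrite sy; move: sp; case: (size _) => [|[]].
have pt : p.@[(rowpt y t : 'rV_n.+1) 0] = 0 by rewrite meval_rowpt; apply/eqP.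
have ct := hc _ pt; have /negP := hy r (mem_head _ _); apply.
have er' : mwiden r = munif u * p + munif v * c.
  by apply: (@muni_inj _ K); rewrite muni_widen er muniD !muniM !munifK.
have := congr1 (meval ((rowpt y t : 'rV_n.+1) 0)) er'.
by rewrite meval_rowpt muni_widen map_polyC hornerC mevalD !mevalM pt ct !mulr0 addr0 /= => ->.
Qed.

Lemma irreducible_dvd n (p c : {mpoly K[n]}) : irreducible_elt p ->
  (forall x : 'rV[K]_n, p.@[x 0] = 0 -> c.@[x 0] = 0) -> divides p c.
Proof.
move=> /(irr_prime (@ufd_mpoly _ _)); exact: prime_nullstellensatz.
Qed.
End ZeroLocus.

(** * Zeros of ideals *)

Lemma dhomog_cast (R : comNzRingType) n d e (p : {mpoly R[n]}) :
  d = e -> p \is d.-homog -> p \is e.-homog.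
Proof. by move=> ->. Qed.

Lemma mevalXn (R : comNzRingType) n (v : 'I_n -> R) (p : {mpoly R[n]}) k :
  (p ^+ k).@[v] = p.@[v] ^+ k.
Proof. by elim: k => [|k IH]; rewrite ?expr0 ?meval1 // !exprS mevalM IH. Qed.

Lemma mpolyX_neq0 (R : comNzRingType) n (i : 'I_n) : 'X_i != 0 :> {mpoly R[n]}.
Proof.
by apply/eqP => /(congr1 (meval (fun=> 1))) /eqP; rewrite mevalXU meval0 oner_eq0.
Qed.

Section MuniHomog.
Variable K : closedFieldType.

Lemma coef_muni_homog n d (p : {mpoly K[n.+1]}) k : p \is d.-homog -> (k <= d)%N ->
  (muni p)`_k \is (d - k).-homog.
Proof.
move=> hp hk; rewrite muniE coef_sum big_seq; apply: rpred_sum => m hm.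
rewrite coefZ coefXn; case: eqP => [ek|_]; last by rewrite mulr0 dhomog0.
rewrite mulr1; apply: rpredZ; rewrite dhomogX /=; apply/eqP.
have <- : mdeg m = d := dhomog_mf hp hm.
rewrite !mdegE big_ord_recr /= -ek addnK; apply: eq_bigr => i _; by rewrite mnmE.
Qed.

Lemma coef_muni_big n d (p : {mpoly K[n.+1]}) k : p \is d.-homog -> (d < k)%N ->
  (muni p)`_k = 0.
Proof.
move=> hp hk; rewrite muniE coef_sum big_seq big1 // => m hm.
rewrite coefZ coefXn; case: eqP => [ek|_]; last by rewrite mulr0.
have e : mdeg m = d := dhomog_mf hp hm.
by move: hk; rewrite -e ek mdegE big_ord_recr /= ltnNge leq_addl.
Qed.

Definition elast n : 'rV[K]_n.+1 := delta_mx 0 ord_max.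

Lemma homog0C n (p : {mpoly K[n]}) : p \is 0.-homog -> p = (p@_0)%:MP.
Proof.
move=> hp; apply/mpolyP => m; rewrite mcoeffC; case: eqP => [<-|/eqP ne]; rewrite ?mulr1 // mulr0.
by apply: (dhomog_nemf_coeff hp); rewrite /= mdeg_eq0.
Qed.

Lemma coef_muni_top n d (p : {mpoly K[n.+1]}) : p \is d.-homog ->
  (muni p)`_d = (p.@[elast n 0])%:MP.
Proof.
move=> hp; have hd : (muni p)`_d \is 0.-homog.
  by have := coef_muni_homog hp (leqnn d); rewrite subnn.
rewrite (homog0C hd).
congr _%:MP; rewrite (meval_muni_row (y := 0) (t := 1)); last 2 first.
- by move=> i; rewrite !mxE eqxx /=; case: eqP => // /(congr1 val) /= e; have := ltn_ord i; rewrite e ltnn.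
- by rewrite mxE !eqxx.
have sz : (size (map_poly (meval ((0 : 'rV[K]_n)%R 0%R)) (muni p)) <= d.+1)%N.
  by apply/leq_sizeP => j hj; rewrite coef_map (coef_muni_big hp) ?raddf0.
rewrite (horner_coef_wide _ sz) big_ord_recr /= big1 ?add0r => [|i _].
  by rewrite expr1n mulr1 coef_map /= [in RHS](homog0C hd) mevalC.
rewrite coef_map /= (dhomog_eval0 (coef_muni_homog hp _)) ?mul0r ?subn_gt0 //.
exact: ltnW.
Qed.

Lemma size_muni_top n d (p : {mpoly K[n.+1]}) : p \is d.-homog -> p.@[elast n 0] != 0 ->
  size (muni p) = d.+1 /\ lead_coef (muni p) = (p.@[elast n 0])%:MP.
Proof.
move=> hp h0; have sz : size (muni p) = d.+1.
  apply/eqP; rewrite eqn_leq; apply/andP; split.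
    by apply/leq_sizeP => j hj; rewrite (coef_muni_big hp).
  by rewrite ltnNge; apply: contra h0 => /leq_sizeP /(_ d (leqnn d)); rewrite (coef_muni_top hp) => /eqP; rewrite mpolyC_eq0.
by rewrite lead_coefE sz /= coef_muni_top.
Qed.

Lemma exists_row_unitmx n (w : 'rV[K]_n.+1) : w != 0 ->
  exists2 D : 'M_n.+1, D \in unitmx & elast n *m D = w.
Proof.
move=> w0; have [i hi] : exists i, w 0 i != 0.
  by apply/existsP; apply: contraR w0 => /existsPn h; apply/eqP/rowP => i; rewrite mxE; apply/eqP; have := h i; rewrite negbK.
(* The identity with row [i] replaced by [w]; a transposition then moves this row to the last
   place. *)
pose D : 'M[K]_n.+1 := \matrix_(a, b) (if a == i then w 0 b else (a == b)%:R).
have hD : D \in unitmx.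
  rewrite -row_free_unit; apply/inj_row_free => v hv.
  have hvb b : v 0 b = if b == i then v 0 i else - v 0 i * w 0 b.
    have := congr1 (fun M : 'rV_n.+1 => M 0 b) hv; rewrite !mxE (bigD1 i) //= mxE eqxx.
    case: (eqVneq b i) => [->//|ne]; rewrite (bigD1 b) //= mxE (negbTE ne) eqxx mulr1 big1 ?addr0.
      by move/eqP; rewrite addrC addr_eq0 mulNr => /eqP.
    by move=> c /andP[hc1 hc2]; rewrite mxE (negbTE hc1) (negbTE hc2) mulr0.
  have vi : v 0 i = 0.
    have := congr1 (fun M : 'rV_n.+1 => M 0 i) hv; rewrite !mxE (bigD1 i) //= mxE eqxx big1 ?addr0.
      by move/eqP; rewrite mulf_eq0 (negbTE hi) orbF => /eqP.
    by move=> c hc; rewrite mxE (negbTE hc) mulr0.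
  by apply/rowP => b; move: (hvb b); rewrite vi oppr0 mul0r if_same mxE.
exists (tperm_mx i ord_max *m D); first by rewrite unitmx_mul hD unitmx_perm.
rewrite -(mul1mx D) mul1mx mulmxA -xcolE; apply/rowP => b; rewrite mxE (bigD1 i) //=.
rewrite !mxE tpermL !eqxx mul1r big1 ?addr0 // => c hc; rewrite !mxE /=.
case: tpermP => [e|e|]; rewrite ?eqxx.
- by rewrite e eqxx in hc.
- by rewrite -e eq_sym (negbTE hc) mul0r.
- by move=> _ /eqP /negbTE ->; rewrite mul0r.
Qed.
End MuniHomog.

Section Nullstellensatz.
Variable K : closedFieldType.

Definition is_ideal (A : comNzRingType) (I : A -> Prop) :=
  [/\ I 0, forall a b, I a -> I b -> I (a + b) & forall a b, I b -> I (a * b)].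

Lemma map_resultant_rmorph (aR rR : comNzRingType) (f : {rmorphism aR -> rR}) (p q : {poly aR}) :
  f (lead_coef p) != 0 -> f (lead_coef q) != 0 ->
  f (resultant p q) = resultant (map_poly f p) (map_poly f q).
Proof.
move=> nz_fp nz_fq; rewrite /resultant /Sylvester_mx !size_map_poly_id0 //.
rewrite -det_map_mx /= map_col_mx; congr (\det (col_mx _ _));
  by apply: map_lin1_mx => v; rewrite map_poly_rV rmorphM /= map_rVpoly.
Qed.

Lemma ideal_sub (A : comNzRingType) (I : A -> Prop) a b : is_ideal I -> I a -> I b -> I (a - b).
Proof. by case=> _ hD hM ha hb; apply: hD => //; rewrite -mulN1r; apply: hM. Qed.

Lemma ideal_sum (A : comNzRingType) (I : A -> Prop) (T : eqType) (s : seq T) (P : pred T)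
  (F : T -> A) : is_ideal I -> (forall i, i \in s -> P i -> I (F i)) -> I (\sum_(i <- s | P i) F i).
Proof.
by case=> h0 hD hM h; rewrite big_seq_cond; elim/big_ind: _ => // i /andP[]; apply: h.
Qed.

(** Adding X^N G to [h] keeps the ideal generated with [G] but makes the leading coefficient
    constant, so that the resultant commutes with evaluation at [a]. It is nonzero there because the
    specialized polynomials have no common root. *)
Lemma resultant_specialize n (G h : {poly {mpoly K[n]}}) (a : 'rV[K]_n) (c : K) :
  c != 0 -> lead_coef G = c%:MP -> (1 < size G)%N ->
  (forall t, (map_poly (meval (a 0)) G).[t] = 0 -> (map_poly (meval (a 0)) h).[t] != 0) ->
  exists u v r, [/\ r%:P = u * G + v * h & r.@[a 0] != 0].
Proof.
move=> c0 lG sG hr; pose N := size h; pose h1 := h + 'X^N * G.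
have G0 : G != 0 by rewrite -size_poly_gt0 ltnW.
have sX : (size h < size ('X^N * G)%R)%N.
  by rewrite mulrC size_mulXn // -[X in (X < _)%N]addn0 ltn_add2l size_poly_gt0.
have l1 : lead_coef h1 = c%:MP.
  by rewrite /h1 lead_coefDr // lead_coefM lead_coefXn mul1r lG.
have s1 : (1 < size h1)%N.
  rewrite /h1 addrC size_polyDl // mulrC size_mulXn //.
  by apply: leq_trans sG _; rewrite leq_addl.
have [[u v] /= [_ _ e]] := resultant_in_ideal sG s1.
exists (u + v * 'X^N), v, (resultant G h1); split; first by rewrite e /h1; ring.
have ec : (c%:MP).@[a 0] != 0 by rewrite mevalC.
rewrite (map_resultant_rmorph (f := meval (a 0))) ?lG ?l1 //.
rewrite resultant_eq0 -leqNgt.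
set G' := map_poly _ G; set h' := map_poly _ h1.
have h1t t : h'.[t] = (map_poly (meval (a 0)) h).[t] + t ^+ N * G'.[t].
  by rewrite /h' /h1 rmorphD rmorphM /= map_polyXn hornerD hornerM hornerXn.
rewrite leqNgt; apply/negP => sg.
have /closed_rootP [t] : size (gcdp G' h') != 1%N by rewrite neq_ltn sg orbT.
rewrite root_gcd => /andP[/eqP tG /eqP th].
by have := hr t tG; have := h1t t; rewrite tG th mulr0 addr0 => <-; rewrite eqxx.
Qed.

(** Let [a] be a zero of the elimination ideal [I']. Evaluating the first n variables at [a] turns
    [I] into an ideal of K[t], generated by an element of least size. Were this a constant, a
    resultant with [g] would lie in [I'] without vanishing at [a]; so it has a root t, and (a, t) is
    a zero of [I]. *)
Lemma weak_nullstellensatz_monic n :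
  (forall I : {mpoly K[n]} -> Prop, is_ideal I -> ~ I 1 ->
     exists x : 'rV[K]_n, forall f, I f -> f.@[x 0] = 0) ->
  forall (I : {mpoly K[n.+1]} -> Prop) g c, is_ideal I -> ~ I 1 -> I g -> c != 0 ->
     lead_coef (muni g) = c%:MP -> exists x : 'rV[K]_n.+1, forall f, I f -> f.@[x 0] = 0.
Proof.
move=> IH I g c [I0 ID IM] I1 Ig c0 lg.
pose J q := I (munif q); pose I' r := J r%:P.
have JD p q : J p -> J q -> J (p + q) by rewrite /J raddfD; apply: ID.
have JM p q : J q -> J (p * q) by rewrite /J munifM; apply: IM.
have [|I'1|a ha] := IH I'.
- split; first by rewrite /I' /J !raddf0.
    by move=> p q hp hq; rewrite /I' polyCD; exact: (JD _ _ hp hq).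
  by move=> p q hq; rewrite /I' polyCM; exact: (JM _ _ hq).
- by apply: I1; move: I'1; rewrite /I' /J munifC mwiden1.
pose G := muni g; have JG : J G by rewrite /J muniK.
have cM : c%:MP != 0 :> {mpoly K[n]} by rewrite mpolyC_eq0.
have sG : (1 < size G)%N.
  rewrite ltnNge; apply/negP => sG; apply: I1; rewrite -(_ : (c^-1)%:MP * g = 1); first exact: IM.
  have gC : G = (c%:MP)%:P.
    have [q eq] : exists q, G = q%:P by exists G`_0; apply: size1_polyC.
    by rewrite eq; move: lg; rewrite -/G eq lead_coefC => ->.
  by apply: (@muni_inj _ K); rewrite muniM muniC -/G gC muni1 -polyCM -mpolyCM mulVf.
pose ev := map_poly (meval (a 0)) : {poly {mpoly K[n]}} -> {poly K}.
have evG : ev G != 0.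
  have lG : lead_coef G = c%:MP := lg.
  have h : meval (a 0) (lead_coef G) != 0 by rewrite lG mevalC.
  by rewrite -lead_coef_eq0 /ev (lead_coef_map_eq h).
have hex : exists k, `[< exists q, [/\ J q, ev q != 0 & size (ev q) = k] >].
  by exists (size (ev G)); apply/asboolP; exists G.
case: (ex_minnP hex) => k /asboolP [q0 [Jq0 q00 ek]] hmin.
have [sq|sq] := eqVneq (size (ev q0)) 1%N.
  have [|u [v [r [er]]]] := @resultant_specialize n G q0 a c c0 lg sG.
    move=> t _; rewrite -/(ev _); have e1 := size1_polyC (eq_leq sq).
    by rewrite e1 hornerC -polyC_eq0 -e1.
  rewrite ha ?eqxx //; rewrite /I' er; exact: (JD _ _ (JM _ _ JG) (JM _ _ Jq0)).
have /closed_rootP [t ht] := sq.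
exists (rowpt a t) => f If.
rewrite meval_rowpt -/(ev _); set q := muni f; have Jq : J q by rewrite /J /q muniK.
have q0r : (ev q %% ev q0) = 0.
  apply/eqP; apply: contraT => m0; have := ltn_modp (ev q) (ev q0); rewrite q00 ek ltnNge hmin //.
  apply/asboolP; pose w := map_poly (@mpolyC n K) (ev q %/ ev q0).
  exists (q - w * q0); have -> : ev (q - w * q0) = ev q %% ev q0.
    rewrite /ev rmorphB rmorphM /= -/(ev q) -/(ev q0) /w -map_poly_comp map_poly_id; last first.
      by move=> x _; rewrite /= mevalC.
    by rewrite {1}(divp_eq (ev q) (ev q0)) addrC addKr.
  split=> //; rewrite -mulN1r; exact: (JD _ _ Jq (JM _ _ (JM _ _ Jq0))).
by rewrite (divp_eq (ev q) (ev q0)) q0r addr0 hornerM (eqP ht) mulr0.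
Qed.

Lemma pihomog_subst n m (D : 'M[K]_(n, m)) e (p : {mpoly K[m]}) :
  pihomog mdeg e (subst D p) = subst D (pihomog mdeg e p).
Proof.
apply: mpoly_ext => x; rewrite subst_eval -!coef_ray.
suff -> : ray (subst D p) x = ray p (x *m D) by [].
by apply: poly_ext => t; rewrite !ray_eval subst_eval scalemxAl.
Qed.

Lemma top_degree n (g : {mpoly K[n]}) : g != 0 ->
  exists2 e, pihomog mdeg e g != 0 & forall k, (e < k)%N -> pihomog mdeg k g = 0.
Proof.
move=> g0; have hex : exists e, pihomog mdeg e g != 0.
  apply: contrapT => hn; move/eqP: g0; apply.
  rewrite (pihomog_partitionE (mf := mdeg) (leqnn (msize g))) big1 // => i _.
  by apply/eqP; apply: contraT => hi; case: hn; exists i.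
have hb k : pihomog mdeg k g != 0 -> (k <= msize g)%N.
  by apply: contraR; rewrite -ltnNge => hk; apply/eqP/pihomog_big/ltnW.
case: (ex_maxnP hex hb) => e he hm; exists e => // k hk.
by apply/eqP; apply: contraLR hk => /hm; rewrite leqNgt.
Qed.

Lemma lead_coef_muni_top n (g : {mpoly K[n.+1]}) e :
  (forall k, (e < k)%N -> pihomog mdeg k g = 0) ->
  (pihomog mdeg e g).@[elast K n 0] != 0 ->
  lead_coef (muni g) = ((pihomog mdeg e g).@[elast K n 0])%:MP.
Proof.
move=> hb h0; have gE : g = \sum_(i < e.+1) pihomog mdeg i g.
  rewrite {1}(pihomog_partitionE (mf := mdeg) (leq_maxl (msize g) e.+1)).
  rewrite -(big_mkord xpredT (fun i => pihomog mdeg i g)) (big_cat_nat (n := e.+1)) ?leq_maxr //=.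
  rewrite [X in _ + X]big_nat_cond [X in _ + X]big1 ?addr0 ?big_mkord // => i /andP[/andP[hi _] _].
  exact: hb.
have mE k : (muni g)`_k = \sum_(i < e.+1) (muni (pihomog mdeg i g))`_k.
  by rewrite {1}gE raddf_sum coef_sum.
have hP k : pihomog mdeg k g \is k.-homog := pihomogP mdeg k g.
have ce : (muni g)`_e = ((pihomog mdeg e g).@[elast K n 0])%:MP.
  rewrite mE big_ord_recr /= big1 ?add0r; first exact: coef_muni_top (hP e).
  move=> i _.
  by rewrite (coef_muni_big (hP i)).
have sz : size (muni g) = e.+1.
  apply/eqP; rewrite eqn_leq; apply/andP; split.
    apply/leq_sizeP => k hk; rewrite mE; apply: big1 => i _.
    by rewrite (coef_muni_big (hP i)) // (leq_trans (ltn_ord i)).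
  rewrite ltnNge; apply: contra h0 => /leq_sizeP /(_ e (leqnn e)); rewrite ce => /eqP.
  by rewrite mpolyC_eq0.
by rewrite lead_coefE sz.
Qed.

(** A nonzero element of [I] gets a constant leading coefficient in the last variable once the last
    basis vector is moved to a point where its top form does not vanish. *)
Lemma weak_nullstellensatz n (I : {mpoly K[n]} -> Prop) : is_ideal I -> ~ I 1 ->
  exists x : 'rV[K]_n, forall f, I f -> f.@[x 0] = 0.
Proof.
elim: n I => [|n IH] I hI I1; have [I0 ID IM] := hI.
  exists 0 => f If; rewrite [f]nvar0_mpolyC mevalC; apply/eqP; apply: contraT => f0.
  case: I1; rewrite -(_ : (f@_0)^-1%:MP * f = 1); first exact: IM.
  by rewrite {2}[f]nvar0_mpolyC -mpolyCM mulVf.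
have [[g Ig g0]|hn] := pselect (exists2 g, I g & g != 0); last first.
  exists 0 => f If; have [->|f0] := eqVneq f 0; first by rewrite meval0.
  by case: hn; exists f.
have [e ge0 hb] := top_degree g0.
(* ['X_ord_max] is listed to make [w] nonzero, which the top form does not ensure when it has degree
   0. *)
have [|w hw] := @mpoly_nonroots K n.+1 [:: pihomog mdeg e g; 'X_ord_max].
  move=> p; rewrite !inE => /orP[/eqP -> //|/eqP ->].
  by apply/eqP => /(congr1 (meval ((\row__ 1 : 'rV[K]_n.+1) 0))); rewrite mevalXU meval0 mxE => /eqP; rewrite oner_eq0.
have w0 : w != 0.
  apply/eqP => w0; have := hw 'X_ord_max; rewrite !inE eqxx orbT => /(_ isT).
  by rewrite mevalXU w0 mxE eqxx.
have [D uD eD] := exists_row_unitmx w0.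
have DK p : subst D (subst (invmx D) p) = p by rewrite subst_comp mulmxV // subst1.
have DK' p : subst (invmx D) (subst D p) = p by rewrite subst_comp mulVmx // subst1.
pose I' p := I (subst (invmx D) p).
have top : (pihomog mdeg e (subst D g)).@[elast K n 0] != 0.
  by rewrite pihomog_subst subst_eval eD; apply: hw; rewrite mem_head.
have [||||x hx] := @weak_nullstellensatz_monic n IH I' (subst D g) _ _ _ _ top.
- split; first by rewrite /I' raddf0.
    by move=> a b ha hb'; rewrite /I' raddfD; exact: (ID _ _ ha hb').
  by move=> a b hb'; rewrite /I' rmorphM; exact: (IM _ _ hb').
- by rewrite /I' rmorph1.
- by rewrite /I' DK'.
- apply: lead_coef_muni_top top => k hk.
  by rewrite pihomog_subst hb // raddf0.
exists (x *m D) => f If.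
by rewrite -subst_eval; apply: hx; rewrite /I' DK'.
Qed.

(** A zero of I + (X_i - 1) would be a nonzero zero of [I]. Hence 1 = f + q (X_i - 1) with f in [I],
    and homogenizing f by means of X_i puts a power of X_i into [I]. A monomial of large degree
    contains one of these powers. *)
Lemma projective_nullstellensatz n (I : {mpoly K[n]} -> Prop) : is_ideal I ->
  (forall f e, I f -> I (pihomog mdeg e f)) ->
  (forall x : 'rV[K]_n, (forall f, I f -> f.@[x 0] = 0) -> x = 0) ->
  exists k, forall m : 'X_{1..n}, (k <= mdeg m)%N -> I 'X_[m].
Proof.
move=> hI hg hz; have [I0 ID IM] := hI.
have key i : exists M, I ('X_i ^+ M).
  pose J h := exists f q, I f /\ h = f + q * ('X_i - 1).
  have hJ : is_ideal J.
    split; first by exists 0, 0; rewrite mul0r addr0.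
      move=> _ _ [f [q [hf ->]]] [f' [q' [hf' ->]]]; exists (f + f'), (q + q').
      by split; [exact: ID|rewrite mulrDl addrACA].
    move=> a _ [f [q [hf ->]]]; exists (a * f), (a * q).
    by split; [exact: IM|rewrite mulrDr mulrA].
  have [[f [q [If e1]]]|J1] := pselect (J 1); last first.
    have [x hx] := weak_nullstellensatz hJ J1.
    have x0 : x = 0.
      by apply: hz => f If; apply: hx; exists f, 0; rewrite mul0r addr0.
    have : ('X_i - 1 : {mpoly K[n]}).@[x 0] = 0.
      by apply: hx; exists 0, 1; rewrite mul1r add0r.
    rewrite mevalB mevalXU meval1 x0 mxE => /eqP.
    by rewrite sub0r oppr_eq0 oner_eq0.
  pose M := msize f; exists M.
  pose s := \sum_(e < M) 'X_i ^+ (M - e) * pihomog mdeg e f.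
  have Is : I s by apply: ideal_sum => // e _ _; apply: IM; apply: hg.
  suff -> : 'X_i ^+ M = s by [].
  have hs : s \is M.-homog.
    apply: rpred_sum => e _; apply: (@dhomog_cast _ _ (1 * (M - e) + e)).
      by rewrite mul1n subnK // ltnW.
    apply: dhomogM; last exact: pihomogP.
    by apply: dhomogMn; rewrite dhomogX /= mdeg1.
  have hX : ('X_i ^+ M : {mpoly K[n]}) \is M.-homog.
    by apply: (@dhomog_cast _ _ (1 * M)); [by rewrite mul1n|apply: dhomogMn; rewrite dhomogX /= mdeg1].
  (* Both forms agree where X_i = 1, so by scaling wherever X_i is not zero; the factor X_i covers
     the remaining points. *)
  have hXs : 'X_i * ('X_i ^+ M - s) = 0 :> {mpoly K[n]}.
    apply: mpoly_eval0 => x; rewrite mevalM mevalXU.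
    have [->|xi] := eqVneq (x 0 i) 0; first by rewrite mul0r.
    have [t [y [-> yi]]] : exists t (y : 'rV[K]_n), x = t *: y /\ y 0 i = 1.
      by exists (x 0 i), ((x 0 i)^-1 *: x); rewrite scalerA divff // scale1r mxE mulVf.
    rewrite (dhomog_eval_scale (d := M)) ?rpredB //.
    suff -> : ('X_i ^+ M - s).@[y 0] = 0 by rewrite !mulr0.
    have := congr1 (meval (y 0)) e1; rewrite meval1 mevalD mevalM mevalB mevalXU yi meval1 subrr mulr0 addr0 => fy.
    rewrite mevalB mevalXn mevalXU yi expr1n; suff -> : s.@[y 0] = f.@[y 0] by rewrite -fy subrr.
    rewrite [in RHS](pihomog_partitionE (mf := mdeg) (leqnn M)) !raddf_sum /=.
    by apply: eq_bigr => e _; rewrite mevalM mevalXn mevalXU yi expr1n mul1r.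
  by move/eqP: hXs; rewrite mulf_eq0 (negbTE (mpolyX_neq0 _ _)) subr_eq0 => /eqP.
have [M hM] := choice key.
exists (\sum_i M i).+1 => m hm.
have [i hi] : exists i, (M i <= m i)%N.
  apply: contrapT => hn; move: hm; rewrite ltnNge => /negP; apply; rewrite mdegE.
  apply: leq_sum => i _; rewrite leqNgt; apply/negP => h; apply: hn.
  by exists i; apply: ltnW.
rewrite (_ : m = (U_(i) *+ M i + (m - U_(i) *+ M i))%MM).
  by rewrite mpolyXD mulrC -mpolyXn; apply: IM.
rewrite addmC submK //; apply/mnm_lepP => j; rewrite mulmnE mnm1E.
by case: eqP => [<-|]; rewrite ?mul1n ?mul0n.
Qed.
End Nullstellensatz.

(** * Chains of irreducible cones *)

Section VanishingIdeal.
Variables (K : closedFieldType) (n : nat).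
Implicit Types (C : 'rV[K]_n -> Prop) (f g p q : {mpoly K[n]}).

Definition vI C f := forall v : 'rV[K]_n, C v -> f.@[v 0] = 0.
Definition is_cone C := forall t (v : 'rV[K]_n), C v -> C (t *: v).
Definition is_closed C := forall v : 'rV[K]_n, (forall f, vI C f -> f.@[v 0] = 0) -> C v.
(** Tested on forms only, which is what irreducibility of a projective set provides. *)
Definition is_prime C := forall d e f g, f \is d.-homog -> g \is e.-homog ->
  vI C (f * g) -> vI C f \/ vI C g.

Lemma vI_ideal C : is_ideal (vI C).
Proof.
split=> [v _|f g hf hg v hv|f g hg v hv]; first by rewrite meval0.
  by rewrite mevalD hf // hg // addr0.
by rewrite mevalM hg // mulr0.
Qed.

Lemma vI_graded C f e : is_cone C -> vI C f -> vI C (pihomog mdeg e f).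
Proof.
move=> hC hf v hv; rewrite -coef_ray (_ : ray f v = 0) ?coef0 //.
by apply: poly_ext => t; rewrite ray_eval horner0; apply: hf; apply: hC.
Qed.

(** The projective Nullstellensatz for the ideal J + (h_j), kept graded: taking components in the
    relation bounds the degree of the coefficients of the h_j, on which the later inductions run. *)
Lemma ideal_plus_forms (r : nat) (h : 'I_r -> {mpoly K[n]}) D (J : {mpoly K[n]} -> Prop) :
  is_ideal J -> (forall f e, J f -> J (pihomog mdeg e f)) ->
  (forall j, h j \is D.-homog) ->
  (forall v : 'rV[K]_n, (forall f, J f -> f.@[v 0] = 0) -> (forall j, (h j).@[v 0] = 0) -> v = 0) ->
  exists k, forall p d, p \is d.-homog -> (k <= d)%N -> (D <= d)%N ->
    exists f (q : 'I_r -> {mpoly K[n]}),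
      [/\ J f, forall j, q j \is (d - D).-homog & p = f + \sum_j h j * q j].
Proof.
move=> hJ gJ hh hz; have [J0 JD JM] := hJ.
pose J' p := exists f (q : 'I_r -> {mpoly K[n]}), J f /\ p = f + \sum_j h j * q j.
have hJ' : is_ideal J'.
  split; first by exists 0, (fun=> 0); split => //; rewrite big1 ?addr0 // => j _; rewrite mulr0.
    move=> _ _ [f [q [hf ->]]] [f' [q' [hf' ->]]]; exists (f + f'), (fun j => q j + q' j).
    split; first exact: JD.
    by rewrite addrACA -big_split /=; congr (_ + _); apply: eq_bigr => j _; rewrite mulrDr.
  move=> a _ [f [q [hf ->]]]; exists (a * f), (fun j => a * q j); split; first exact: JM.
  by rewrite mulrDr mulr_sumr; congr (_ + _); apply: eq_bigr => j _; rewrite mulrCA.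
have ph (p : {mpoly K[n]}) d q j : (D <= d)%N ->
    pihomog mdeg d (h j * q) = h j * pihomog mdeg (d - D) q.
  by move=> hd; rewrite -{1}(subnKC hd) (pihomogMl _ _ (hh j)).
have gJ' f e : J' f -> J' (pihomog mdeg e f).
  move=> [f1 [q [hf ->]]]; exists (pihomog mdeg e f1).
  exists (fun j => if (D <= e)%N then pihomog mdeg (e - D) (q j) else 0); split; first exact: gJ.
  rewrite raddfD raddf_sum /=; congr (_ + _); apply: eq_bigr => j _.
  case: leqP => he; first by rewrite ph.
  rewrite mulr0; apply: mpoly_eval0 => x; rewrite -coef_ray rayM (ray_homog _ (hh j)).
  by rewrite -scalerAl coefZ coefXnM he mulr0.
have [x hx|k hk] := projective_nullstellensatz hJ' gJ'.
  apply: hz => [f hf|j]; apply: hx.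
    by exists f, (fun=> 0); split => //; rewrite big1 ?addr0 // => j _; rewrite mulr0.
  exists 0, (fun i => (i == j)%:R); split => //.
  rewrite (bigD1 j) //= eqxx mulr1 big1 ?addr0 ?add0r // => i hi.
  by rewrite (negbTE hi) mulr0.
exists k => p d hp kd Dd.
have [f [q [hf ep]]] : J' p.
  have [J0' JD' JM'] := hJ'; rewrite (mpolyE p); apply: ideal_sum => // m hm _.
  rewrite -mul_mpolyC; apply: JM'; apply: hk.
  by have -> : mdeg m = d := dhomog_mf hp hm.
exists (pihomog mdeg d f), (fun j => pihomog mdeg (d - D) (q j)); split.
- exact: gJ.
- by move=> j; apply: pihomogP.
- rewrite -(pihomog_dE (mf := mdeg) (d := d) hp) {1}ep raddfD raddf_sum /=; congr (_ + _).
  by apply: eq_bigr => j _; rewrite ph.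
Qed.
End VanishingIdeal.

Section FiniteProjection.
Variables (K : closedFieldType) (n r D : nat) (h : 'I_r -> {mpoly K[n]}).
Hypotheses (hD : (0 < D)%N) (hh : forall j, h j \is D.-homog).
Variable C : 'rV[K]_n -> Prop.
Hypotheses (cC : is_cone C) (clC : is_closed C).
Hypothesis avoid : forall v, C v -> (forall j, (h j).@[v 0] = 0) -> v = 0.

(** [pull] and [projf] are the two sides of the morphism with components h_j: substitution into
    functions and the map on points. Degrees are multiplied by [D]. *)
Definition pull (a : {mpoly K[r]}) : {mpoly K[n]} := a \mPo [tuple h j | j < r].
HB.instance Definition _ := GRing.RMorphism.copy pull (comp_mpoly [tuple h j | j < r]).
Definition projf (v : 'rV[K]_n) : 'rV[K]_r := \row_j (h j).@[v 0].

Lemma pull_eval a (v : 'rV[K]_n) : (pull a).@[v 0] = a.@[(projf v) 0].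
Proof.
by rewrite /pull comp_mpoly_meval; apply: meval_eq => j; rewrite tnth_mktuple mxE.
Qed.

Lemma pullX j : pull 'X_j = h j.
Proof.
by apply: mpoly_ext => v; rewrite pull_eval mevalXU mxE.
Qed.

Lemma pullM : {morph pull : a b / a * b}. Proof. exact: rmorphM. Qed.

Lemma dhomog_pull d a : a \is d.-homog -> pull a \is (D * d).-homog.
Proof. by move=> ha; apply: dhomog_comp => // j; rewrite tnth_mktuple. Qed.

Lemma proj_scale t (v : 'rV[K]_n) : projf (t *: v) = t ^+ D *: projf v.
Proof. by apply/rowP => j; rewrite !mxE (dhomog_eval_scale _ _ (hh j)). Qed.

Lemma pihomog_pull e a : pihomog mdeg (D * e) (pull a) = pull (pihomog mdeg e a).
Proof.
apply: mpoly_ext => x; rewrite pull_eval -!coef_ray.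
have -> : ray (pull a) x = ray a (projf x) \Po 'X^D.
  by apply: poly_ext => t; rewrite horner_comp hornerXn !ray_eval pull_eval proj_scale.
by rewrite coef_comp_poly_Xn // dvdn_mulr // mulKn.
Qed.

(** Graded Nakayama: modulo the ideal of [C] a monomial of large degree is a combination of the h_j
    with coefficients of smaller degree, so the monomials of bounded degree generate the coordinate
    ring over the subring of the h_j. *)
Lemma finite_generation : exists k, forall p,
  exists a : 'X_{1..n < k.+1} -> {mpoly K[r]},
    vI C (p - \sum_m pull (a m) * 'X_[m]).
Proof.
have hI := vI_ideal C; have [I0 ID IM] := hI.
have [|k0 hk] := @ideal_plus_forms K n r h D (vI C) hI (fun f e => @vI_graded _ _ _ _ _ cC) hh.
  by move=> v hv1 hv2; apply: avoid => //; apply: clC.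
exists (k0 + D)%N; pose M p := exists a : 'X_{1..n < (k0 + D).+1} -> {mpoly K[r]},
    vI C (p - \sum_m pull (a m) * 'X_[m]).
have M0 : M 0.
  by exists (fun=> 0); rewrite sub0r big1 ?oppr0 // => m _; rewrite raddf0 mul0r.
have MD p q : M p -> M q -> M (p + q).
  move=> [a ha] [b hb]; exists (fun m => a m + b m).
  rewrite (_ : _ - _ = (p - \sum_m pull (a m) * 'X_[m]) + (q - \sum_m pull (b m) * 'X_[m])).
    exact: ID.
  rewrite addrACA -opprD -big_split /=; congr (_ - _); apply: eq_bigr => m _.
  by rewrite raddfD mulrDl.
have MM b p : M p -> M (pull b * p).
  move=> [a ha]; exists (fun m => b * a m).
  rewrite (_ : _ - _ = pull b * (p - \sum_m pull (a m) * 'X_[m])); first exact: IM.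
  by rewrite mulrBr mulr_sumr; congr (_ - _); apply: eq_bigr => m _; rewrite pullM mulrA.
have MI p : vI C p -> M p.
  by move=> hp; exists (fun=> 0); rewrite big1 ?subr0 // => m _; rewrite raddf0 mul0r.
have Msum (T : eqType) (s : seq T) (F : T -> {mpoly K[n]}) :
    (forall i, i \in s -> M (F i)) -> M (\sum_(i <- s) F i).
  by move=> hF; rewrite big_seq; apply: (big_ind M).
suff hX m : M 'X_[m].
  move=> p; rewrite (mpolyE p); apply: (Msum) => m _; rewrite -mul_mpolyC.
  by rewrite -(_ : pull (p@_m)%:MP = (p@_m)%:MP); [apply: (MM)|apply: comp_mpolyC].
move: {2}(mdeg m) (leqnn (mdeg m)) => d; elim: d m => [|d IH] m hm.
all: have [hlt|hge] := ltnP (mdeg m) (k0 + D).+1.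
- exists (fun m' => (m' == BMultinom hlt)%:R); rewrite (bigD1 (BMultinom hlt)) //= eqxx.
  rewrite rmorph1 mul1r big1 ?addr0 ?subrr // => m' /negbTE ->; by rewrite raddf0 mul0r.
- by move: (leq_ltn_trans hm (leq_ltn_trans (leq0n _) hge)); rewrite ltnn.
- exists (fun m' => (m' == BMultinom hlt)%:R); rewrite (bigD1 (BMultinom hlt)) //= eqxx.
  rewrite rmorph1 mul1r big1 ?addr0 ?subrr // => m' /negbTE ->; by rewrite raddf0 mul0r.
have [|||f [q [hf hq ->]]] := hk 'X_[m] (mdeg m).
- by rewrite dhomogX.
- by apply: leq_trans (ltnW hge); rewrite leq_addr.
- by apply: leq_trans (ltnW hge); rewrite leq_addl.
apply: (MD); first exact: MI.
apply: (Msum) => j _; rewrite -pullX; apply: (MM).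
rewrite (mpolyE (q j)); apply: (Msum) => m' hm'; rewrite -mul_mpolyC.
rewrite -(_ : pull ((q j)@_m')%:MP = ((q j)@_m')%:MP); [apply: (MM)|exact: comp_mpolyC].
apply: IH; have -> : mdeg m' = (mdeg m - D)%N := dhomog_mf (hq j) hm'.
have : (D <= mdeg m)%N by apply: leq_trans (ltnW hge); rewrite leq_addl.
by move: hm hD; lia.
Qed.

(** Cramer's rule modulo the ideal of [C]: multiply the system by the adjugate. *)
Lemma det_vI q (A : 'M[{mpoly K[n]}]_q) (u : 'I_q -> {mpoly K[n]}) :
  (forall i, vI C (\sum_j A i j * u j)) -> forall l, vI C (\det A * u l).
Proof.
move=> hA l; have [I0 ID IM] := vI_ideal C.
have -> : \det A * u l = \sum_i (\adj A) l i * \sum_j A i j * u j.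
  have /matrixP e := mul_adj_mx A.
  have e' j : \sum_i (\adj A) l i * (A i j * u j) = (\det A)%:M l j * u j.
    rewrite -e mxE mulr_suml; apply: eq_bigr => i _; exact: mulrA.
  under eq_bigr => i _ do rewrite mulr_sumr.
  rewrite exchange_big /= (eq_bigr _ (fun j _ => e' j)) (bigD1 l) //= big1 => [|j hj].
    by rewrite mxE eqxx mulr1n addr0.
  by rewrite mxE eq_sym (negbTE hj) mulr0n mul0r.
by apply: ideal_sum (vI_ideal C) _ => i _ _; apply: IM.
Qed.

(** Multiplication by [f] acts on the generating monomials through a matrix [A]; as 1 is one of
    these monomials, the characteristic polynomial of [A] annihilates [f] modulo the ideal. *)
Lemma integral_equation (f : {mpoly K[n]}) :
  exists2 P : {poly {mpoly K[r]}}, P \is monic & vI C (map_poly pull P).[f].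
Proof.
have [I0 ID IM] := vI_ideal C.
have [k hk] := finite_generation; pose T : finType := 'X_{1..n < k.+1}.
have /choice [a ha] : forall i : 'I_#|{: T}|, exists a : T -> {mpoly K[r]},
    vI C (f * 'X_[enum_val i] - \sum_m pull (a m) * 'X_[m]) by move=> i; apply: hk.
pose A : 'M[{mpoly K[r]}]_#|{: T}| := \matrix_(i, j) a i (enum_val j).
exists (char_poly A); first exact: char_poly_monic.
pose u (i : 'I_#|{: T}|) : {mpoly K[n]} := 'X_[enum_val i].
pose B := f%:M - map_mx pull A.
have hdet : (map_poly pull (char_poly A)).[f] = \det B.
  rewrite /char_poly -[LHS]/(horner_eval f (map_poly pull (\det (char_poly_mx A)))).
  rewrite -det_map_mx -det_map_mx; congr (\det _); apply/matrixP => i j.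
  rewrite !mxE rmorphB /= map_polyC /= /horner_eval hornerD hornerN hornerC.
  by rewrite rmorphMn /= map_polyX hornerMn hornerX.
rewrite hdet.
have l0 : (mdeg (0%MM : 'X_{1..n}) < k.+1)%N by rewrite mdeg0.
have -> : \det B = \det B * u (enum_rank (BMultinom l0)).
  by rewrite /u enum_rankK /= mpolyX0 mulr1.
apply: det_vI => i; have := ha i; congr (vI C _).
under [in RHS]eq_bigr => j _ do rewrite !mxE mulrBl.
rewrite sumrB; congr (_ - _).
  rewrite (bigD1 i) //= eqxx mulr1n big1 ?addr0 // => j hj.
  by rewrite eq_sym (negbTE hj) mulr0n mul0r.
by rewrite (reindex (@enum_val _ (mem {: T}))) //; apply: onW_bij; apply: enum_val_bij.
Qed.

(** Properness of the projection. If nothing of [C] lies over [y], the forms [g j] that cut out the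
    line of [y] pull back to forms without nonzero common zero on [C]. So for a power [w] of a
    coordinate not vanishing at [y], the products of [w] with the generating monomials are
    combinations of these monomials with coefficients in the ideal of the [g j]. The determinant of
    this system kills the coordinate ring, and at [y] it is a power of that coordinate. *)
Lemma elimination (y : 'rV[K]_r) : y != 0 -> (forall v, C v -> projf v <> y) ->
  exists2 a : {mpoly K[r]}, a.@[y 0] != 0 & vI C (pull a).
Proof.
move=> y0 hy; have [I0 ID IM] := vI_ideal C.
have [j0 hj0] : exists i, y 0 i != 0.
  by apply/existsP; apply: contraR y0 => /existsPn h0; apply/eqP/rowP => i; rewrite mxE; apply/eqP; have := h0 i; rewrite negbK.
pose g (j : 'I_r) : {mpoly K[r]} := (y 0 j0) *: 'X_j - (y 0 j) *: 'X_j0.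
have gy j : (g j).@[y 0] = 0 by rewrite mevalB !mevalZ !mevalXU mulrC subrr.
have hg j : pull (g j) \is D.-homog.
  rewrite -[D]muln1; apply: dhomog_pull.
  by apply: rpredB; apply: rpredZ; rewrite dhomogX /= mdeg1.
have [|k' hk'] := @ideal_plus_forms K n r (fun j => pull (g j)) D (vI C) (vI_ideal C) (fun f e => @vI_graded _ _ _ _ _ cC) hg.
  move=> v hv1 hv2; have Cv := clC hv1.
  have pv : projf v = (projf v 0 j0 / y 0 j0) *: y.
    apply/rowP => j; have := hv2 j; rewrite pull_eval mevalB !mevalZ !mevalXU => /eqP.
    rewrite subr_eq0 => /eqP e; rewrite [RHS]mxE.
    have -> : projf v 0 j = y 0 j * projf v 0 j0 / y 0 j0 by rewrite -e mulrC mulKf.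
    by rewrite mulrAC [y 0 j / _ * _]mulrC mulrA mulrAC.
  set c := _ / _ in pv; have [c0|c0] := eqVneq c 0.
    by apply: avoid => // j; have /rowP /(_ j) := pv; rewrite c0 scale0r !mxE.
  have [t /eqP ht] : exists t, root ('X^D - c^-1%:P) t.
    by apply/closed_rootP; rewrite size_XnsubC //; case: (D) hD.
  move: ht; rewrite hornerD hornerN hornerXn hornerC => /eqP; rewrite subr_eq0 => /eqP ht.
  by case: (hy (t *: v)); [exact: cC|rewrite proj_scale ht pv scalerA mulVf // scale1r].
have [k hk] := finite_generation; pose T : finType := 'X_{1..n < k.+1}.
pose k1 := (k' + 1)%N; pose w : {mpoly K[r]} := 'X_j0 ^+ k1.
have hw : w \is k1.-homog.
  by apply: (@dhomog_cast _ _ (1 * k1)); [rewrite mul1n|apply: dhomogMn; rewrite dhomogX /= mdeg1].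
have key (i : 'I_#|{: T}|) : exists a : 'I_r -> T -> {mpoly K[r]},
    vI C (pull w * 'X_[enum_val i] - \sum_j pull (g j) * \sum_m pull (a j m) * 'X_[m]).
  have [|||f [q [hf hq eq]]] := hk' (pull w * 'X_[enum_val i]) (D * k1 + mdeg (enum_val i))%N.
  - by apply: dhomogM; [apply: dhomog_pull|rewrite dhomogX].
  - by move: hD; rewrite /k1; case: (D) => // D' _; lia.
  - by move: hD; rewrite /k1; case: (D) => // D' _; lia.
  have [a ha] := choice (fun j => hk (q j)); exists a.
  rewrite eq (_ : _ - _ = f + \sum_j pull (g j) * (q j - \sum_m pull (a j m) * 'X_[m])).
    by apply: (ID) => //; apply: ideal_sum (vI_ideal C) _ => j _ _; apply: (IM); apply: ha.
  by rewrite -addrA -sumrB; congr (_ + _); apply: eq_bigr => j _; rewrite mulrBr.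
have [a ha] := choice key.
pose A : 'M[{mpoly K[r]}]_#|{: T}| :=
  w%:M - \matrix_(i, l) \sum_j g j * a i j (enum_val l).
exists (\det A).
  rewrite -det_map_mx (_ : map_mx _ A = ((y 0 j0) ^+ k1)%:M); last first.
    apply/matrixP => i l; rewrite /A !mxE /= mevalB mevalMn mevalXn mevalXU.
    have -> : (\sum_j g j * a i j (enum_val l)).@[y 0] = 0; last by rewrite subr0.
    by rewrite raddf_sum big1 // => j _; rewrite /= mevalM gy mul0r.
  by rewrite det_scalar !expf_neq0.
have l0 : (mdeg (0%MM : 'X_{1..n}) < k.+1)%N by rewrite mdeg0.
pose u (i : 'I_#|{: T}|) : {mpoly K[n]} := 'X_[enum_val i].
have -> : pull (\det A) = \det (map_mx pull A) * u (enum_rank (BMultinom l0)).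
  by rewrite /u enum_rankK /= mpolyX0 mulr1 det_map_mx.
apply: det_vI => i; have := ha i; congr (vI C _).
under [in RHS]eq_bigr => l _ do rewrite !mxE rmorphB mulrBl.
rewrite sumrB; congr (_ - _).
  rewrite (bigD1 i) //= eqxx mulr1n big1 ?addr0 // => j hj.
  by rewrite eq_sym (negbTE hj) mulr0n raddf0 mul0r.
under [in RHS]eq_bigr => l _ do rewrite raddf_sum mulr_suml.
rewrite exchange_big /=; apply: eq_bigr => j _.
rewrite mulr_sumr (reindex (@enum_val _ (mem {: T}))) /=; last by apply: onW_bij; apply: enum_val_bij.
by apply: eq_bigr => l _; rewrite pullM mulrA.
Qed.
End FiniteProjection.

Section Pencil.
Variable K : closedFieldType.

(** The columns are the linear forms y_j0 X_j - y_j X_j0; if y_j0 is not zero, their common zeros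
    are the multiples of [y]. *)
Definition pencil r (y : 'rV[K]_r.+1) (j0 : 'I_r.+1) : 'M[K]_(r.+1, r) :=
  \matrix_(i, j) (y 0 j0 *+ (i == lift j0 j) - y 0 (lift j0 j) *+ (i == j0)).

Lemma mulmx_pencil r (y z : 'rV[K]_r.+1) j0 j :
  (z *m pencil y j0) 0 j = z 0 (lift j0 j) * y 0 j0 - z 0 j0 * y 0 (lift j0 j).
Proof.
rewrite mxE; under eq_bigr => i _ do rewrite mxE mulrBr.
rewrite sumrB; congr (_ - _).
  rewrite (bigD1 (lift j0 j)) //= eqxx mulr1n big1 ?addr0 // => i /negbTE ->.
  by rewrite mulr0n mulr0.
rewrite (bigD1 j0) //= eqxx mulr1n big1 ?addr0 // => i /negbTE ->.
by rewrite mulr0n mulr0.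
Qed.

Lemma pencil_proportional r (y z : 'rV[K]_r.+1) j0 : y 0 j0 != 0 ->
  (forall j, z 0 (lift j0 j) * y 0 j0 = z 0 j0 * y 0 (lift j0 j)) ->
  z = (z 0 j0 / y 0 j0) *: y.
Proof.
move=> hj h; apply/rowP => i; rewrite mxE.
have [->|ne] := eqVneq i j0; first by rewrite divfK.
have [j ->] : exists j, i = lift j0 j.
  by have [j ->|e] := unliftP j0 i; [exists j|rewrite e eqxx in ne].
by rewrite mulrAC -h mulfK.
Qed.

Lemma pencil_kernel r (y z : 'rV[K]_r.+1) j0 : y 0 j0 != 0 ->
  z *m pencil y j0 = 0 -> z = (z 0 j0 / y 0 j0) *: y.
Proof.
move=> hj hz; apply: pencil_proportional => // j.
have := congr1 (fun M : 'rV_r => M 0 j) hz; rewrite mulmx_pencil mxE => /eqP.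
by rewrite subr_eq0 => /eqP.
Qed.

Lemma mul_pencil r (y : 'rV[K]_r.+1) j0 : y *m pencil y j0 = 0.
Proof. by apply/rowP => j; rewrite mulmx_pencil mxE mulrC subrr. Qed.

Lemma row_neq0 n (y : 'rV[K]_n) : y != 0 -> exists i, y 0 i != 0.
Proof.
move=> y0; apply/existsP; apply: contraR y0 => /existsPn h0; apply/eqP/rowP => i.
by rewrite mxE; apply/eqP; have := h0 i; rewrite negbK.
Qed.

Lemma prime_pow n (C : 'rV[K]_n -> Prop) d (f : {mpoly K[n]}) k :
  is_prime C -> (exists2 v, C v & v != 0) -> f \is d.-homog -> vI C (f ^+ k) -> vI C f.
Proof.
move=> hC [v0 Cv0 _] hf; elim: k => [|k IH].
  by rewrite expr0 => /(_ v0 Cv0) /eqP; rewrite meval1 oner_eq0.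
by rewrite exprS => /(hC _ _ _ _ hf (dhomogMn k hf)) [].
Qed.

(** The drop of the dimension by one, in terms of parameters. In an equation of least degree for a
    power of [f] over the subring of the h_j, the constant term b_0 vanishes on [C], but not on [C']
    by primality. Take y with b_0(y) != 0 and replace the h_j by the forms that cut out the line of
    y, one form fewer. Where these vanish on [C], h is a multiple c y, and b_0 = 0 forces c = 0. *)
Lemma cut_parameter n r D (h : 'I_r.+1 -> {mpoly K[n]}) (C C' : 'rV[K]_n -> Prop) e f :
  (0 < D)%N -> (forall j, h j \is D.-homog) ->
  is_cone C' -> is_closed C' -> is_prime C' ->
  (forall v, C v -> C' v) -> (exists2 v, C v & v != 0) ->
  f \is e.-homog -> vI C f -> ~ vI C' f ->
  (forall v, C' v -> (forall j, (h j).@[v 0] = 0) -> v = 0) ->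
  exists2 h' : 'I_r -> {mpoly K[n]}, forall j, h' j \is D.-homog &
    forall v, C v -> (forall j, (h' j).@[v 0] = 0) -> v = 0.
Proof.
move=> D0 hh cC' clC' pC' sub [v0 Cv0 v00] hf fC fC' avoid.
have [I0 ID IM] := vI_ideal C'.
have ne' : exists2 v, C' v & v != 0 by exists v0 => //; apply: sub.
have e0 : (0 < e)%N.
  rewrite lt0n; apply/eqP => e0; move: hf fC fC'; rewrite e0 => /homog0C ->.
  by move=> /(_ v0 Cv0); rewrite mevalC => -> /(_ I0).
(* The power makes the degree of [F] a multiple of [D], as are the degrees of the pulled back forms,
   so that the equation can be chosen homogeneous. *)
pose F := f ^+ D; have hF : F \is (D * e).-homog by rewrite mulnC; apply: dhomogMn.
have FC : vI C F by move=> v hv; rewrite mevalXn fC // expr0n gtn_eqF.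
pose rel k := exists b : nat -> {mpoly K[r.+1]},
  [/\ forall i, (i <= k)%N -> b i \is (e * (k - i)).-homog, b k = 1 &
      vI C' (\sum_(i < k.+1) pull h (b i) * F ^+ i)].
have hex : exists k, `[< rel k >].
  have [P mP hP] := integral_equation D0 hh cC' clC' avoid F.
  pose k := (size P).-1; have sP : size P = k.+1.
    by rewrite /k prednK // size_poly_gt0 monic_neq0.
  exists k; apply/asboolP; exists (fun i => pihomog mdeg (e * (k - i)) P`_i); split.
  - by move=> i _; apply: pihomogP.
  - rewrite subnn muln0 (_ : P`_k = 1); last by move/monicP: mP; rewrite lead_coefE.
    by apply: pihomog_dE; apply: dhomog1.
  - have := @vI_graded _ _ _ _ (D * (e * k))%N cC' hP; congr (vI C' _).
    rewrite horner_coef size_map_poly_id0 ?sP; last first.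
      by rewrite (monicP mP) rmorph1 oner_eq0.
    rewrite raddf_sum /=; apply: eq_bigr => i _; rewrite coef_map /=.
    have hFi : F ^+ i \is (D * e * i).-homog by apply: dhomogMn.
    rewrite mulrC [in RHS]mulrC -(pihomog_pull D0 hh).
    rewrite -(pihomogMl _ _ hFi); congr (pihomog _ _ _).
    by rewrite -mulnA -mulnDr -mulnDr subnKC // -ltnS.
case: (ex_minnP hex) => k /asboolP [b [hb bk hrel]] hmin.
have k0 : (0 < k)%N.
  rewrite lt0n; apply/eqP => k0; move: (hrel v0 (sub _ Cv0)); rewrite k0 big_ord1.
  have b0 : b (ord0 : 'I_1) = 1 by move: bk; rewrite k0.
  by rewrite b0 rmorph1 expr0 mulr1 meval1 => /eqP; rewrite oner_eq0.
(* A constant term vanishing on [C'] would allow division by [F] there and leave an equation of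
   degree k - 1. *)
have hb0 : ~ vI C' (pull h (b 0%N)).
  move=> hb0; have hF' : vI C' (F * \sum_(i < k) pull h (b i.+1) * F ^+ i).
    have := ideal_sub (vI_ideal C') hrel hb0; congr (vI C' _).
    rewrite big_ord_recl expr0 mulr1 addrC addKr mulr_sumr; apply: eq_bigr => i _.
    by rewrite lift0 exprS mulrCA.
  have hs : \sum_(i < k) pull h (b i.+1) * F ^+ i \is (D * (e * k.-1)).-homog.
    apply: rpred_sum => i _; apply: (@dhomog_cast _ _ (D * (e * (k - i.+1)) + D * e * i)).
      rewrite -mulnA -mulnDr -mulnDr; congr (_ * (_ * _))%N.
      by have := ltn_ord i; move: k0; lia.
    apply: dhomogM; last exact: dhomogMn.
    by apply: dhomog_pull => //; apply: hb; apply: ltn_ord.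
  have [h1|h1] := pC' _ _ _ _ hF hs hF'.
    exact: fC' (prime_pow pC' ne' hf h1).
  have : (k <= k.-1)%N.
    apply: hmin; apply/asboolP; exists (fun i => b i.+1); split.
    - move=> i hi; apply: (@dhomog_cast _ _ (e * (k - i.+1))).
        by congr (_ * _)%N; lia.
      by apply: hb; rewrite -(prednK k0) ltnS.
    - by rewrite prednK.
    - by rewrite prednK.
  by rewrite leqNgt prednK // leqnn.
have hb0C : vI C (pull h (b 0%N)).
  move=> v hv; have := hrel v (sub v hv); rewrite big_ord_recl mevalD expr0 mulr1.
  rewrite [X in _ + X](_ : _ = 0) ?addr0 // raddf_sum big1 // => i _ /=.
  by rewrite mevalM mevalXn FC // expr0n /= mulr0.
have [y hy] : exists y : 'rV[K]_r.+1, (b 0%N).@[y 0] != 0.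
  apply: mpoly_nonroot; apply: contra_notN hb0 => /eqP ->; by rewrite raddf0.
have hb00 : b 0%N \is (e * k).-homog by have := hb 0%N (leq0n k); rewrite subn0.
have [j0 hj0] : exists i, y 0 i != 0.
  apply: row_neq0; apply: contraNneq hy => ->.
  by rewrite (dhomog_eval0 hb00) // muln_gt0 e0.
exists (fun j => y 0 j0 *: h (lift j0 j) - y 0 (lift j0 j) *: h j0).
  by move=> j; apply: rpredB; apply: rpredZ.
move=> v hv hv2.
have pv : projf h v = (projf h v 0 j0 / y 0 j0) *: y.
  apply: pencil_proportional => // j; have := hv2 j.
  rewrite mevalB !mevalZ => /eqP; rewrite subr_eq0 ![projf _ _ _ _]mxE => /eqP e1.
  by rewrite mulrC e1 mulrC.
have := hb0C v hv; rewrite pull_eval pv (dhomog_eval_scale _ _ hb00) => /eqP.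
rewrite mulf_eq0 (negbTE hy) orbF expf_eq0 muln_gt0 e0 k0 /= => /eqP c0.
apply: avoid; first exact: sub.
by move=> j; have /rowP /(_ j) := pv; rewrite c0 scale0r !mxE.
Qed.

(** From the top of the chain downwards each proper inclusion uses up one of the [r] forms, and the
    smallest member, having a nonzero vector, still needs one. *)
Lemma chain_bound n D k r (h : 'I_r -> {mpoly K[n]}) (C : nat -> 'rV[K]_n -> Prop) :
  (0 < D)%N -> (forall j, h j \is D.-homog) ->
  (forall i, (i < k)%N -> [/\ is_cone (C i), is_closed (C i), is_prime (C i) &
                           exists2 v, C i v & v != 0]) ->
  (forall i, (i.+1 < k)%N -> (forall v, C i v -> C i.+1 v) /\
     exists e f, [/\ f \is e.-homog, vI (C i) f & ~ vI (C i.+1) f]) ->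
  (forall v, (0 < k)%N -> C k.-1 v -> (forall j, (h j).@[v 0] = 0) -> v = 0) ->
  (k <= r)%N.
Proof.
move=> D0; elim: k r h => // k IH r h hh hC hS avoid.
have [cC clC pC [v Cv v0]] := hC k (ltnSn k).
case: r h hh avoid => [|r] h hh avoid.
  by move: v0; rewrite (avoid v isT Cv) ?eqxx // => -[].
case: k IH hC hS avoid cC clC pC Cv => // k IH hC hS avoid cC clC pC Cv.
have [sub [e [f [hf f1 f2]]]] := hS k (ltnSn _).
have [cC' clC' pC' neC'] := hC k (leqW (ltnSn _)).
have [h' hh' av'] := cut_parameter D0 hh cC clC pC sub neC' hf f1 f2 (fun v => avoid v isT).
rewrite ltnS; apply: (IH r h') => //.
- by move=> i hi; apply: hC; apply: ltnW.
- by move=> i hi; apply: hS; apply: ltnW.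
- by move=> w _; apply: av'.
Qed.

Lemma exists_pencil r (y : 'rV[K]_r) : y != 0 -> exists r' (B : 'M[K]_(r, r')),
  y *m B = 0 /\ forall z : 'rV_r, z *m B = 0 -> exists c, z = c *: y.
Proof.
case: r y => [|r] y y0; first by case/negP: y0; apply/eqP/rowP => -[].
have [j0 hj0] := row_neq0 y0; exists r, (pencil y j0); rewrite mul_pencil; split=> // z hz.
by exists (z 0 j0 / y 0 j0); apply: pencil_kernel.
Qed.
End Pencil.

(** * Dimension and linear projections *)

Section ProjectiveDimension.
Variables (K : closedFieldType) (N : nat).
Local Notation V := 'rV[K]_N.+1.
Local Notation point := (ppoint K N).
Implicit Types (P Q : point) (Z W : set point) (v : V).

Lemma point_neq0 P : exists2 v, v \in val P & v != 0.
Proof.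
exists (vpick (val P)); first exact: memv_pick.
by rewrite vpick0 -dimv_eq0 (eqP (valP P)).
Qed.

Lemma point_vline P v : v \in val P -> v != 0 -> val P = <[v]>%VS.
Proof.
move=> vP v0; apply/esym/eqP; rewrite eqEdim (eqP (valP P)) dim_vline v0 andbT.
by rewrite -memvE.
Qed.

Lemma point_eq P Q v : v \in val P -> v \in val Q -> v != 0 -> P = Q.
Proof.
by move=> vP vQ v0; apply: val_inj; rewrite (point_vline vP v0) (point_vline vQ v0).
Qed.

Lemma point_exists v : v != 0 -> exists P, v \in val P.
Proof.
move=> v0; have h : \dim <[v]>%VS == 1%N by rewrite dim_vline v0.
by exists (exist (fun U : {vspace V} => \dim U == 1%N) _ h); apply: memv_line.
Qed.

Lemma vanishes_atP e (F : {mpoly K[N.+1]}) P v : F \is e.-homog -> v \in val P ->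
  v != 0 -> (vanishes_at F P <-> F.@[v 0] = 0).
Proof.
move=> hF vP v0; split=> [h|h w]; first exact: h.
rewrite (point_vline vP v0) => /vlineP [t ->].
by rewrite (dhomog_eval_scale _ _ hF) h mulr0.
Qed.

Definition cone_of Z v := exists2 P, Z P & v \in val P.

Lemma cone_of_cone Z : is_cone (cone_of Z).
Proof. by move=> t v [P ZP vP]; exists P => //; apply: memvZ. Qed.

Lemma vI_cone_of Z e (F : {mpoly K[N.+1]}) : F \is e.-homog ->
  (vI (cone_of Z) F <-> Z `<=` hypersurface F).
Proof.
move=> hF; split=> [h P ZP v vP|h v [P ZP vP]]; first by apply: h; exists P.
exact: (h P ZP v vP).
Qed.

Lemma cone_of_point Z P v : v \in val P -> v != 0 -> cone_of Z v -> Z P.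
Proof. by move=> vP v0 [Q ZQ vQ]; rewrite (point_eq vP vQ v0). Qed.

Lemma cone_of_closed Z : zclosed Z -> is_closed (cone_of Z).
Proof.
move=> [S [hS eZ]] v hv; have [v0|v0] := eqVneq v 0.
  have [[P ZP]|hn] := pselect (Z !=set0); first by exists P => //; rewrite v0 mem0v.
  have := hv 1; rewrite meval1 => h; case/eqP: (oner_neq0 K); apply: h.
  by move=> w [P ZP _]; case: hn; exists P.
have [P vP] := point_exists v0; exists P => //; rewrite eZ => F SF.
have [e hF] := hS F SF; apply/(vanishes_atP hF vP v0); apply: hv => w [Q ZQ wQ].
by move: ZQ; rewrite eZ => /(_ F SF) /(_ w wQ).
Qed.

Lemma zclosed_hypersurface e (F : {mpoly K[N.+1]}) : F \is e.-homog ->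
  zclosed (hypersurface F).
Proof.
move=> hF; exists [set F]; split; first by move=> _ ->; exists e.
by apply/seteqP; split=> P h; [move=> _ ->|apply: h].
Qed.

Lemma zclosedI Z W : zclosed Z -> zclosed W -> zclosed (Z `&` W).
Proof.
move=> [S [hS ->]] [T [hT ->]]; exists (S `|` T); split.
  by move=> F [/hS|/hT].
apply/seteqP; split=> [P [h1 h2] F [/h1|/h2] //|P h].
by split=> F hF; apply: h; [left|right].
Qed.

Lemma zclosed_bigcap (I : Type) (D : set I) (Z : I -> set point) :
  (forall i, D i -> zclosed (Z i)) -> zclosed (\bigcap_(i in D) Z i).
Proof.
move=> hZ; exists [set F | exists2 i, D i & (exists e, F \is e.-homog) /\ Z i `<=` hypersurface F].
split; first by move=> F [i _ []].
apply/seteqP; split=> [P h F [i Di [_ sub]]|P h i Di]; first exact: sub (h i Di).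
have [S [hS eZ]] := hZ i Di; rewrite eZ => F SF; apply: h; exists i => //.
by split; [exact: hS|move=> Q; rewrite eZ => /(_ F SF)].
Qed.

Lemma zirreducible_prime Z : zirreducible Z -> is_prime (cone_of Z).
Proof.
move=> [_ _ hirr] d e f g hf hg /(vI_cone_of _ (dhomogM hf hg)) h.
have [h1|h1] : Z `<=` hypersurface f \/ Z `<=` hypersurface g.
- apply: hirr; [exact: zclosed_hypersurface hf|exact: zclosed_hypersurface hg|].
  move=> P /h hP; have [v vP v0] := point_neq0 P.
  have /eqP := hP v vP; rewrite mevalM mulf_eq0 => /orP[/eqP h1|/eqP h1].
    by left; apply/(vanishes_atP hf vP v0).
  by right; apply/(vanishes_atP hg vP v0).
- by left; apply/(vI_cone_of _ hf).
- by right; apply/(vI_cone_of _ hg).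
Qed.

Lemma dim_upper Z (s : int) r D (h : 'I_r -> {mpoly K[N.+1]}) : has_dim Z s ->
  (0 < D)%N -> (forall j, h j \is D.-homog) ->
  (forall v, cone_of Z v -> (forall j, (h j).@[v 0] = 0) -> v = 0) -> s + 1 <= r%:Z.
Proof.
move=> hs D0 hh avoid.
have s1 : 0 <= s + 1 by apply/(hs 0%N); exists (fun=> set0); split.
have [k ek] : exists k : nat, s + 1 = k%:Z by exists (absz (s + 1)); rewrite gez0_abs.
have /hs [C [hC hsub]] : k%:Z <= s + 1 by rewrite ek.
rewrite ek lez_nat; apply: (@chain_bound K _ D k r h (fun i => cone_of (C i)) D0 hh).
- move=> i hi; have [hirr _] := hC i hi; have [cl [P CP] _] := hirr; split.
  + exact: cone_of_cone.
  + exact: cone_of_closed.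
  + exact: zirreducible_prime.
  + by have [v vP v0] := point_neq0 P; exists v => //; exists P.
- move=> i hi; have [sub nsub] := hsub i hi; split.
    by move=> v [P CP vP]; exists P => //; apply: sub.
  apply: contrapT => hn; apply: nsub => P C1P.
  have [[[S [hS eC]] _ _] _] := hC i (ltnW hi); rewrite eC => F SF.
  have [e hF] := hS F SF; apply: contrapT => hnF; apply: hn; exists e, F; split => //.
    by apply/(vI_cone_of _ hF); rewrite eC => Q /(_ F SF).
  by move=> /(vI_cone_of _ hF) /(_ P C1P).
- move=> v k0 [P CP vP]; apply: avoid; exists P => //.
  have kk : (k.-1 < k)%N by rewrite prednK.
  by have [_ sub] := hC _ kk; apply: sub.
Qed.

Lemma row_lin_eval r (H : 'M[K]_(N.+1, r)) v j : (lin (col j H)).@[v 0] = (v *m H) 0 j.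
Proof. by rewrite lin_eval !mxE; apply: eq_bigr => i _; rewrite mxE. Qed.

Definition avoids Z r (H : 'M[K]_(N.+1, r)) :=
  forall v, cone_of Z v -> v *m H = 0 -> v = 0.

Lemma dim_upper_mx Z (s : int) r (H : 'M[K]_(N.+1, r)) : has_dim Z s -> avoids Z H ->
  s + 1 <= r%:Z.
Proof.
move=> hs hZ; apply: (@dim_upper Z s r 1%N (fun j => lin (col j H))) => //.
  by move=> j; apply: lin_homog.
move=> v Zv hv; apply: hZ => //; apply/rowP => j; rewrite -row_lin_eval mxE.
exact: hv.
Qed.

Section Lower.
Variables (Z : set point) (r : nat) (H : 'M[K]_(N.+1, r)).
Hypotheses (clZ : zclosed Z) (av : avoids Z H).

Definition over W (y : 'rV[K]_r) := exists2 v, cone_of W v & v *m H = y.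
(** The projection by [H] covers the coordinate subspace of codimension [i]. Covering the members of
    a full flag one after the other is what produces a chain of [r] irreducible sets. *)
Definition onto W i :=
  forall y : 'rV[K]_r, y != 0 -> (forall j : 'I_r, (j < i)%N -> y 0 j = 0) -> over W y.

Lemma over_elimination W (y : 'rV[K]_r) : zclosed W -> W `<=` Z -> y != 0 -> ~ over W y ->
  exists2 a : {mpoly K[r]}, a.@[y 0] != 0 &
    forall v, cone_of W v -> a.@[(v *m H) 0] = 0.
Proof.
move=> clW sub y0 hn.
pose h j := lin (col j H).
have pE v : projf h v = v *m H by apply/rowP => j; rewrite mxE row_lin_eval.
have [|||||a ha1 ha2] := @elimination K N.+1 r 1%N h isT _ (cone_of W) _ _ _ y y0.
- by move=> j; apply: lin_homog.
- exact: cone_of_cone.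
- exact: cone_of_closed.
- move=> v [P WP vP] hv; apply: av; first by exists P => //; apply: sub.
  by rewrite -pE; apply/rowP => j; rewrite !mxE; apply: hv.
- by move=> v Wv; rewrite pE => e; apply: hn; exists v.
by exists a => // v Wv; rewrite -pE -pull_eval; apply: ha2.
Qed.

(** A compactness argument. If nothing in the intersection lay over [y], the union of the ideals of
    the members together with the forms cutting out the line of [y] would contain a power of every
    coordinate. Finitely many members account for these powers, by totality a single one does, and
    nothing of that member lies over [y]. *)
Lemma over_chain (F : set (set point)) (y : 'rV[K]_r) :
  F !=set0 -> (forall W, F W -> zclosed W /\ W `<=` Z) -> total_on F subset ->
  y != 0 -> (forall W, F W -> over W y) -> over (\bigcap_(W in F) W) y.
Proof.
move=> [W0 FW0] hF tot y0 hov; apply: contrapT => hn.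
have [r' [B [yB hB]]] := exists_pencil y0.
pose J f := exists2 W, F W & vI (cone_of W) f.
have hJ : is_ideal J.
  split; first by exists W0 => //; case: (vI_ideal (cone_of W0)).
    move=> a b [W FW ha] [W' FW' hb]; have [s|s] := tot W W' FW FW'.
      exists W => // v [P WP vP]; rewrite mevalD ha ?hb ?addr0 //; exists P => //; exact: s.
    exists W' => // v [P WP vP]; rewrite mevalD ha ?hb ?addr0 //; exists P => //; exact: s.
  by move=> a b [W FW hb]; exists W => //; case: (vI_ideal (cone_of W)) => _ _; apply.
pose g j := lin (col j (H *m B)).
have [|||k hk] := @ideal_plus_forms K _ _ g 1%N J hJ.
- by move=> f e [W FW hf]; exists W => //; apply: vI_graded => //; apply: cone_of_cone.
- by move=> j; apply: lin_homog.
- move=> v hv1 hv2; apply/eqP; apply: contraT => v0.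
  have Wv W : F W -> cone_of W v.
    by move=> FW; apply: cone_of_closed; [case: (hF W FW)|move=> f hf; apply: hv1; exists W].
  have [P vP] := point_exists v0.
  have CP : (\bigcap_(W in F) W) P by move=> W FW; apply: cone_of_point vP v0 (Wv W FW).
  have e : v *m H *m B = 0.
    apply/rowP => j; rewrite -mulmxA -row_lin_eval mxE; exact: hv2.
  have [c ec] := hB _ e.
  have [c0|c0] := eqVneq c 0.
    case/eqP: v0; apply: av; last by rewrite ec c0 scale0r.
    by have [Q WQ vQ] := Wv W0 FW0; exists Q => //; case: (hF W0 FW0) => _; apply.
  case: hn; exists (c^-1 *: v); first by exists P => //; apply: memvZ.
  by rewrite -scalemxAl ec scalerA mulVf // scale1r.
have hX (i : 'I_N.+1) : exists W, F W /\ forall v, cone_of W v -> v *m H *m B = 0 -> v 0 i = 0.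
  have [|||f [q [[W FW hf] hq e]]] := hk ('X_i ^+ k.+1) k.+1.
  - by apply: (@dhomog_cast _ _ (1 * k.+1)); [rewrite mul1n|apply: dhomogMn; rewrite dhomogX /= mdeg1].
  - exact: leqnSn.
  - by [].
  exists W; split=> // v Wv hv; have := congr1 (meval (v 0)) e.
  rewrite mevalXn mevalXU mevalD (hf v Wv) add0r raddf_sum big1 => [/eqP|j _ /=].
    by rewrite expf_eq0 /= => /eqP.
  by rewrite mevalM row_lin_eval mulmxA hv mxE mul0r.
have [G hG] := choice hX.
have [W [FW hW]] : exists W, F W /\ forall i, W `<=` G i.
  suff [W [FW hW]] : exists W, F W /\ forall i, i \in enum 'I_N.+1 -> W `<=` G i.
    by exists W; split=> // i; apply: hW; rewrite mem_enum.
  elim: (enum _) => [|i s [W [FW hW]]]; first by exists W0.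
  have [FG _] := hG i; have [s1|s1] := tot W (G i) FW FG.
    by exists W; split=> // j; rewrite inE => /orP[/eqP ->|/hW].
  exists (G i); split=> // j; rewrite inE => /orP[/eqP -> //|/hW h].
  exact: subset_trans h.
have [v [P WP vP] hv] := hov W FW.
case/negP: y0; rewrite -hv; apply/eqP.
suff -> : v = 0 by rewrite mul0mx.
apply/rowP => i; rewrite mxE; have [_] := hG i; apply; last by rewrite hv yB.
by exists P => //; apply: hW.
Qed.

Definition linep n (p : {mpoly K[n]}) (x u : 'rV[K]_n) : {poly K} :=
  mmap polyC (fun i => (x 0 i)%:P + u 0 i *: 'X) p.

Lemma linep_eval n (p : {mpoly K[n]}) (x u : 'rV[K]_n) t :
  (linep p x u).[t] = p.@[(x + t *: u) 0].
Proof.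
rewrite /linep /mmap mevalE horner_sum; apply: eq_bigr => m _.
rewrite hornerM hornerC /mmap1 horner_prod; congr (_ * _); apply: eq_bigr => i _.
by rewrite horner_exp hornerD hornerC hornerZ hornerX !mxE mulrC.
Qed.

(** A minimal closed subset of [W] with the property, written [W] minus [A] because Zorn's lemma
    provides maximal sets. Of two closed sets covering it, neither of which contains it, each would
    miss a nonempty open part of the target; a general point of the line joining two missed points
    lies in both parts. *)
Lemma irreducible_onto W i : (i < r)%N -> zclosed W -> W `<=` Z -> onto W i ->
  exists W', [/\ W' `<=` W, zirreducible W' & onto W' i].
Proof.
move=> ir clW sub oW.
pose T (A : set point) := zclosed (W `\` A) /\ onto (W `\` A) i.
have hT A : T A -> zclosed (W `\` A) /\ W `\` A `<=` Z.
  by case=> h _; split => // P [/sub].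
have [F FT tot|A [[clA oA] maxA]] := @Zorn_bigcup _ T.
  have [->|/set0P F0] := eqVneq F set0.
    by rewrite bigcup_set0 /T setD0.
  have e : W `\` \bigcup_(X in F) X = \bigcap_(B in [set W `\` X | X in F]) B.
    apply/seteqP; split=> [P [WP nP] _ [X FX <-]|P hP].
      by split=> // XP; apply: nP; exists X.
    have [X0 FX0] := F0; split; first by case: (hP (W `\` X0)) => //; exists X0.
    move=> [X FX XP]; case: (hP (W `\` X)) => //; by exists X.
  rewrite /T e; split.
    by apply: zclosed_bigcap => _ [X FX <-]; case: (FT X FX).
  move=> y y0 hy; apply: over_chain => //.
  - by have [X FX] := F0; exists (W `\` X); exists X.
  - by move=> _ [X FX <-]; apply: hT; apply: FT.
  - move=> _ _ [X FX <-] [X' FX' <-]; have [s|s] := tot X X' FX FX'.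
      by right=> P [WP nP]; split=> // XP; apply: nP; apply: s.
    by left=> P [WP nP]; split=> // XP; apply: nP; apply: s.
  - by move=> _ [X FX <-]; case: (FT X FX) => _; apply.
have subA : W `\` A `<=` Z by move=> P [/sub].
exists (W `\` A); split; [by move=> P []| |exact: oA].
split => //.
  pose e : 'rV[K]_r := delta_mx 0 (Ordinal ir).
  have [||v [P WP _] _] := oA e; last by exists P.
    by apply/eqP => /rowP /(_ (Ordinal ir)); rewrite !mxE !eqxx => /eqP; rewrite oner_eq0.
  by move=> j hj; rewrite mxE eqxx /=; case: eqP => // ej; rewrite ej /= ltnn in hj.
move=> Z1 Z2 cl1 cl2 cover.
have key Z' : zclosed Z' -> ~ W `\` A `<=` Z' -> exists (y : 'rV[K]_r) (a : {mpoly K[r]}),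
    [/\ y != 0, forall j : 'I_r, (j < i)%N -> y 0 j = 0, a.@[y 0] != 0 &
     forall v, cone_of ((W `\` A) `&` Z') v -> a.@[(v *m H) 0] = 0].
  move=> cl' nsub; have : ~ onto ((W `\` A) `&` Z') i.
    move=> o'; apply: (maxA (A `|` ~` Z')).
      split; first by move=> P; left.
      by move=> h; apply: nsub => P [WP nA]; apply: contrapT => nZ; apply: nA; apply: h; right.
    have e : W `\` (A `|` ~` Z') = (W `\` A) `&` Z'.
      apply/seteqP; split=> [P [WP nP]|P [[WP nA] ZP]].
        split; first by split=> // AP; apply: nP; left.
        by apply: contrapT => nZ; apply: nP; right.
      by split=> // -[//|]; apply.
    by rewrite /T e; split=> //; apply: zclosedI.
  move=> /existsNP [y] /not_implyP [y0] /not_implyP [hy hov].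
  have [||a ha1 ha2] := over_elimination _ _ y0 hov.
  - exact: zclosedI.
  - by move=> P [/subA].
  by exists y, a.
have [|n1] := pselect (W `\` A `<=` Z1); first by left.
have [|n2] := pselect (W `\` A `<=` Z2); first by right.
have [y1 [a1 [y10 hy1 ha1 hv1]]] := key Z1 cl1 n1.
have [y2 [a2 [y20 hy2 ha2 hv2]]] := key Z2 cl2 n2.
have [j hj] := row_neq0 y10.
have [|t ht] := @poly_nonroots K [:: linep a1 y1 (y2 - y1); linep a2 y1 (y2 - y1); linep 'X_j y1 (y2 - y1)].
  move=> p; rewrite !inE => /or3P[] /eqP ->; apply/eqP => e.
  - by case/negP: ha1; rewrite -[y1]addr0 -(scale0r (y2 - y1)) -linep_eval e horner0.
  - by case/negP: ha2; rewrite -[y2](addrNK y1) addrC -[_ - _]scale1r -linep_eval e horner0.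
  - by case/negP: hj; rewrite -(mevalXU (y1 0)) -[y1]addr0 -(scale0r (y2 - y1)) -linep_eval e horner0.
pose y := y1 + t *: (y2 - y1).
have y0 : y != 0.
  apply: contra_neq (ht (linep 'X_j y1 (y2 - y1)) _); last by rewrite !inE eqxx !orbT.
  by move=> y0; rewrite linep_eval -/y y0 mevalXU mxE.
have [l hl|v [P WP vP] hv] := oA y y0.
  by rewrite !mxE hy1 // hy2 // subr0 mulr0 addr0.
have [Z1P|Z2P] := cover P WP.
  case/negP: (ht (linep a1 y1 (y2 - y1)) (mem_head _ _)); rewrite linep_eval -/y -hv hv1 //.
  by exists P.
have := ht (linep a2 y1 (y2 - y1)); rewrite !inE eqxx orbT => /(_ isT).
by rewrite linep_eval -/y -hv hv2 ?eqxx //; exists P.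
Qed.

(** An irreducible set covering the subspace of codimension l is cut with the next coordinate
    hyperplane, and an irreducible subset of the section covers the subspace of codimension l + 1.
    The chain so built descends, hence the reversed index at the end. *)
Lemma onto_chain : onto Z 0 -> exists C : nat -> set point,
  (forall i, (i < r)%N -> zirreducible (C i) /\ C i `<=` Z) /\
  (forall i, (i.+1 < r)%N -> C i `<` C i.+1).
Proof.
move=> oZ.
have key l : (l <= r)%N -> exists C : nat -> set point,
    (forall i, (i < l)%N -> [/\ zirreducible (C i), C i `<=` Z & onto (C i) i]) /\
    (forall i, (i.+1 < l)%N -> C i.+1 `<` C i).
  elim: l => [_|l IH lr]; first by exists (fun=> set0).
  have [C [h1 h2]] := IH (ltnW lr).
  have next W : zclosed W -> W `<=` Z -> onto W l -> (forall i, i.+1 = l -> W `<` C i) ->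
      exists C : nat -> set point,
    (forall i, (i < l.+1)%N -> [/\ zirreducible (C i), C i `<=` Z & onto (C i) i]) /\
    (forall i, (i.+1 < l.+1)%N -> C i.+1 `<` C i).
    move=> clW sW oW hW; have [W' [sW' irrW' oW']] := irreducible_onto lr clW sW oW.
    exists (fun i => if (i < l)%N then C i else W'); split=> i hi.
      have [/h1 //|li] := ltnP i l; have -> : i = l by apply/eqP; rewrite eqn_leq li andbT -ltnS.
      by split=> //; apply: subset_trans sW.
    have il : (i < l)%N by rewrite ltnS in hi.
    rewrite il; have [/h2 //|li] := ltnP i.+1 l.
    have e : i.+1 = l by apply/eqP; rewrite eqn_leq li andbT.
    have [s1 s2] := hW i e; split; first exact: subset_trans s1.
    by move=> h; apply: s2; apply: subset_trans sW'.
  case: l IH lr h1 h2 next => [|l] IH lr h1 h2 next; first by apply: (next Z).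
  have [[clC _ _] sC oC] := h1 l (ltnSn l).
  pose o := Ordinal (ltnW lr).
  pose g := lin (col o H); have hg : g \is 1.-homog by apply: lin_homog.
  apply: (next (C l `&` hypersurface g)).
  - by apply: zclosedI => //; apply: zclosed_hypersurface hg.
  - by move=> P [/sC].
  - move=> y y0 hy; have [|v [P CP vP] hv] := oC y y0.
      by move=> j hj; apply: hy; apply: leqW.
    have v0 : v != 0 by apply: contra_neq y0 => v0; rewrite -hv v0 mul0mx.
    exists v => //; exists P => //; split=> //; apply/(vanishes_atP hg vP v0).
    by rewrite row_lin_eval hv; apply: hy.
  - move=> i [->]; split; first by move=> P [].
    move=> sub; pose y : 'rV[K]_r := delta_mx 0 o.
    have [||v [P CP vP] hv] := oC y.
    + by apply/eqP => /rowP /(_ o); rewrite !mxE !eqxx => /eqP; rewrite oner_eq0.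
    + by move=> j hj; rewrite mxE eqxx /=; case: eqP => // ej; rewrite ej /= ltnn in hj.
    + have [_ /(_ v vP)] := sub P CP; rewrite row_lin_eval hv mxE !eqxx => /eqP.
      by rewrite oner_eq0.
have [C [h1 h2]] := key r (leqnn r).
exists (fun i => C (r - i.+1)%N); split=> i hi.
  by have [] := h1 (r - i.+1)%N; first by lia.
have -> : (r - i.+1 = (r - i.+2).+1)%N by lia.
by apply: h2; lia.
Qed.
End Lower.

(** With more than s + 1 forms the projection cannot be onto, for it would yield too long a chain.
    So some line of the target is missed, and composing with the projection from it keeps the forms
    without common zero on [Z]. *)
Lemma dim_lower Z (s : int) r (H : 'M[K]_(N.+1, r)) : zclosed Z -> has_dim Z s ->
  avoids Z H -> exists r' (B : 'M[K]_(r, r')), r'%:Z = s + 1 /\ avoids Z (H *m B).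
Proof.
move=> clZ hs; elim: r H => [|r IH] H av.
  exists 0%N, 1%:M; rewrite mulmx1; split=> //; apply/eqP.
  rewrite eq_le (dim_upper_mx hs av) andbT.
  by apply/(hs 0%N); exists (fun=> set0); split.
have [hle|hgt] := leP r.+1%:Z (s + 1).
  exists r.+1, 1%:M; rewrite mulmx1; split=> //; apply/eqP; rewrite eq_le hle.
  exact: dim_upper_mx av.
have [B hB] : exists B : 'M[K]_(r.+1, r), avoids Z (H *m B).
  apply: contrapT => hn; suff oZ : onto H Z 0.
    by have /hs := onto_chain clZ av oZ; rewrite leNgt hgt.
  move=> y y0 _; have [j0 hj0] := row_neq0 y0.
  have := hn; move/forallNP/(_ (pencil y j0))/existsNP => [v] /not_implyP [Zv] /not_implyP [hv v0].
  move: hv; rewrite mulmxA => /(pencil_kernel hj0); set c := _ / _ => hv.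
  have c0 : c != 0 by apply/eqP => c0; apply: v0; apply: av => //; rewrite hv c0 scale0r.
  exists (c^-1 *: v); first exact: cone_of_cone.
  by rewrite -scalemxAl hv scalerA mulVf // scale1r.
have [r' [B' [er hB']]] := IH _ hB.
by exists r', (B *m B'); split=> //; rewrite mulmxA.
Qed.
End ProjectiveDimension.

(** * Directional derivatives and singular points *)

Section DirectionalDerivative.
Variable K : closedFieldType.

Lemma mpoly_alg_ind n (R : comNzRingType) (P : {mpoly R[n]} -> Prop) :
  (forall c, P c%:MP) -> (forall i, P 'X_i) ->
  (forall p q, P p -> P q -> P (p + q)) -> (forall p q, P p -> P q -> P (p * q)) ->
  forall p, P p.
Proof.
move=> hC hX hD hM p; rewrite (mpolyE p).
have h0 : P 0 by rewrite -mpolyC0.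
apply: (big_ind P) => // m _; rewrite -mul_mpolyC; apply: (hM) => //.
have h1 : P 1 by rewrite -mpolyC1.
rewrite mpolyXE_id; apply: (big_ind P) => // i _.
by elim: (m i) => [|k IH]; [rewrite expr0|rewrite exprS; apply: hM].
Qed.

Definition linepr n (x u : 'rV[K]_n) (p : {mpoly K[n]}) := linep p x u.
HB.instance Definition _ n (x u : 'rV[K]_n) :=
  GRing.RMorphism.copy (linepr x u) (mmap polyC (fun i => (x 0 i)%:P + u 0 i *: 'X)).

Lemma linepM n (x u : 'rV[K]_n) p q : linep (p * q) x u = linep p x u * linep q x u.
Proof. exact: (rmorphM (linepr x u)). Qed.
Lemma linepD n (x u : 'rV[K]_n) p q : linep (p + q) x u = linep p x u + linep q x u.
Proof. exact: (rmorphD (linepr x u)). Qed.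
Lemma linepC n (x u : 'rV[K]_n) c : linep c%:MP x u = c%:P.
Proof. by rewrite /linep mmapC. Qed.
Lemma linepX n (x u : 'rV[K]_n) i : linep 'X_i x u = (x 0 i)%:P + u 0 i *: 'X.
Proof. by rewrite /linep mmapX mmap1U. Qed.

Definition dird n (u : 'rV[K]_n) (p : {mpoly K[n]}) : {mpoly K[n]} :=
  \sum_i u 0 i *: p^`M(i).

Lemma dirdM n (u : 'rV[K]_n) p q : dird u (p * q) = dird u p * q + p * dird u q.
Proof.
rewrite /dird mulr_suml mulr_sumr -big_split; apply: eq_bigr => i _ /=.
by rewrite mderivM scalerDr scalerAl scalerAr.
Qed.

Lemma dirdD n (u : 'rV[K]_n) p q : dird u (p + q) = dird u p + dird u q.
Proof.
by rewrite /dird -big_split; apply: eq_bigr => i _ /=; rewrite mderivD scalerDr.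
Qed.

Lemma deriv_linep n (p : {mpoly K[n]}) x u : (linep p x u)^`() = linep (dird u p) x u.
Proof.
move: p; apply: mpoly_alg_ind => [c|i|p q hp hq|p q hp hq].
- rewrite linepC derivC /dird big1 => [|i _]; last by rewrite mderivC scaler0.
  by rewrite -mpolyC0 linepC.
- rewrite linepX derivD derivC add0r derivZ derivX alg_polyC /dird (bigD1 i) //= big1 ?addr0.
    rewrite mderivX mnm1E eqxx scale1r.
    by rewrite (_ : (U_(i) - U_(i))%MM = 0%MM) ?mpolyX0 -?mul_mpolyC ?mulr1 ?linepC //; apply/mnmP => j; rewrite mnmBE subnn mnm0E.
  by move=> j hj; rewrite mderivX mnm1E eq_sym (negbTE hj) scale0r scaler0.
- by rewrite linepD derivD hp hq dirdD linepD.
- by rewrite linepM derivM hp hq dirdM linepD !linepM.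
Qed.

Lemma dird_eval n (p : {mpoly K[n]}) (x u : 'rV_n) :
  (dird u p).@[x 0] = \sum_i u 0 i * p^`M(i).@[x 0].
Proof. by rewrite /dird raddf_sum; apply: eq_bigr => i _ /=; rewrite mevalZ. Qed.

Lemma dird_deriv0 n (p : {mpoly K[n]}) (x u : 'rV_n) : (dird u p).@[x 0] = (linep p x u)^`().[0].
Proof. by rewrite deriv_linep linep_eval scale0r addr0. Qed.

Definition singular n (F : {mpoly K[n]}) (v : 'rV[K]_n) :=
  F.@[v 0] = 0 /\ forall i, F^`M(i).@[v 0] = 0.

Lemma singular_dird n (F : {mpoly K[n]}) (v : 'rV_n) : F.@[v 0] = 0 ->
  (forall u : 'rV_n, (dird u F).@[v 0] = 0) -> singular F v.
Proof.
move=> F0 h; split=> // i; have := h (delta_mx 0 i); rewrite dird_eval (bigD1 i) //=.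
rewrite mxE !eqxx mul1r big1 ?addr0 // => j hj.
by rewrite mxE eqxx (negbTE hj) mul0r.
Qed.

Lemma dhomog_deriv n d (F : {mpoly K[n]}) i : F \is d.-homog -> F^`M(i) \is d.-1.-homog.
Proof.
move=> hF; rewrite (mpolyE F) raddf_sum big_seq /=; apply: rpred_sum => m hm.
rewrite linearZ /=; apply: rpredZ; rewrite mderivX.
have [->|mi] := eqVneq (m i) 0%N; first by rewrite scale0r dhomog0.
apply: rpredZ; rewrite dhomogX /=.
have em : (m = U_(i) + (m - U_(i)))%MM.
  by rewrite addmC submK //; apply/mnm_lepP => j; rewrite mnm1E; case: eqP => // <-; rewrite lt0n.
have <- : mdeg m = d := dhomog_mf hF hm.
by rewrite {2}em mdegD mdeg1.
Qed.

Lemma singular_scale n d (F : {mpoly K[n]}) v t : F \is d.-homog ->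
  singular F v -> singular F (t *: v).
Proof.
move=> hF [h1 h2]; split; first by rewrite (dhomog_eval_scale _ _ hF) h1 mulr0.
by move=> i; rewrite (dhomog_eval_scale _ _ (dhomog_deriv i hF)) h2 mulr0.
Qed.
End DirectionalDerivative.

(** * Integral fractions above a smooth point *)

Section Normality.
Variable K : closedFieldType.

(** Common roots are divided out one by one; since [f] does not divide [A], a root of [f] is met at
    which [A] is exhausted first. *)
Lemma multiplicity_gap (f A : {poly K}) : f != 0 -> ~~ (f %| A) ->
  exists c e a g h, [/\ f = ('X - c%:P) ^+ e * g, A = ('X - c%:P) ^+ a * h,
    (a < e)%N & h.[c] != 0].
Proof.
move: {2}(size f) (leqnn (size f)) => m; elim: m f A => [|m IH] f A hm f0 hd.
  by move: hm f0; rewrite leqn0 size_poly_eq0 => ->.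
have A0 : A != 0 by apply: contraNneq hd => ->; rewrite dvdp0.
have sf : size f != 1%N by apply: contraNneq hd => /eqP sf; rewrite size_poly_eq1 in sf; rewrite (eqp_dvdl _ sf) dvd1p.
have /closed_rootP [c hc] := sf.
have [Ac|Ac] := boolP (root A c); last first.
  have /factor_theorem [f' ef] := hc.
  exists c, 1%N, 0%N, f', A; split => //; first by rewrite ef mulrC.
  by rewrite mul1r.
have /factor_theorem [f' ef] := hc; have /factor_theorem [A' eA] := Ac.
have f'0 : f' != 0 by apply: contra_neq f0 => f'0; rewrite ef f'0 mul0r.
have [|||c' [e [a [g [h [e1 e2 hae hh]]]]]] := IH f' A' => //.
- by move: hm; rewrite ef size_mul ?polyXsubC_eq0 // size_XsubC addn2.
- by move: hd; rewrite ef eA dvdp_mul2r ?polyXsubC_eq0.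
have [ecc|ne] := eqVneq c c'.
  exists c', e.+1, a.+1, g, h; split => //; rewrite ?ef ?eA ?e1 ?e2 ecc exprS; ring.
exists c', e, a, (g * ('X - c%:P)), (h * ('X - c%:P)); split => //.
- by rewrite ef e1; ring.
- by rewrite eA e2; ring.
- by rewrite hornerM mulf_neq0 // hornerXsubC subr_eq0 eq_sym.
Qed.

Lemma cancel_XsubC (R : idomainType) (c : R) m (p F Q : {poly R}) : F.[c] != 0 ->
  ('X - c%:P) ^+ m * p = F * Q -> exists Q', p = F * Q'.
Proof.
move=> Fc; elim: m Q => [|m IH] Q; first by rewrite mul1r => ->; exists Q.
move=> e; have : root (F * Q) c by rewrite -e exprS -mulrA rootM root_XsubC eqxx.
rewrite rootM /root (negbTE Fc) /= => /factor_theorem [Q1 eQ].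
apply: (IH Q1); have X0 : 'X - c%:P != 0 :> {poly R} by rewrite polyXsubC_eq0.
apply: (mulfI X0); rewrite mulrA -exprS e eQ; ring.
Qed.

Section Psi.
Variables (A : comNzRingType) (k : nat) (p : nat -> A).
(** The homogenization y^k P(x / y) of P = sum p_i X^i: divisibility of its value by F expresses,
    without division, that x / y is a root of P. *)
Definition psi (x y : A) := \sum_(i < k.+1) p i * y ^+ (k - i) * x ^+ i.

Lemma psi_scale w x y : psi (w * x) (w * y) = w ^+ k * psi x y.
Proof.
rewrite /psi mulr_sumr; apply: eq_bigr => i _; rewrite !exprMn.
have -> : w ^+ k = w ^+ (k - i) * w ^+ i by rewrite -exprD subnK // -ltnS.
ring.
Qed.

Lemma exp_congr (F x x' : A) i : (exists q, x = x' + F * q) -> exists q, x ^+ i = x' ^+ i + F * q.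
Proof.
move=> [q e]; elim: i => [|i [q' IH]]; first by exists 0; rewrite mulr0 addr0.
exists (x * q' + q * x' ^+ i); rewrite !exprS IH mulrDr {1}e; ring.
Qed.

Lemma psi_congr (F x x' y y' : A) : (exists q, x = x' + F * q) -> (exists q, y = y' + F * q) ->
  exists q, psi x y = psi x' y' + F * q.
Proof.
move=> hx hy; rewrite /psi; apply: (big_ind2 (fun a b => exists q, a = b + F * q)).
- by exists 0; rewrite mulr0 addr0.
- by move=> a b a' b' [q ->] [q' ->]; exists (q + q'); ring.
move=> i _; have [q eq] := exp_congr i hx; have [q' eq'] := exp_congr (k - i) hy.
exists (p i * y ^+ (k - i) * q + p i * q' * x' ^+ i); rewrite eq {1}eq' {1}eq'; ring.
Qed.
End Psi.

(* If the plane curve [F = 0] is smooth at the point [(c, 0)] and meets the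
   line [u = 0] there with multiplicity [e], a fraction [A / (u eps)] whose
   numerator meets it with multiplicity [a < e] is not integral. *)
Lemma smooth_not_integral (c : K) e a (g h : {poly K}) (W b eps : {poly {poly K}}) k
    (p : nat -> {poly {poly K}}) (Q F A : {poly {poly K}}) :
  (a < e)%N -> h.[c] != 0 -> p k = 1 ->
  F = ('X - c%:P%:P) ^+ e * map_poly polyC g + 'X%:P * W ->
  A = ('X - c%:P%:P) ^+ a * map_poly polyC h + 'X%:P * b ->
  psi k p A ('X%:P * eps) = F * Q -> W.[c%:P].[0] = 0.
Proof.
move=> hae hc pk eF eA ePsi; apply/eqP; apply: contraT => W0.
set tau := 'X - _ in eF eA; set g' := map_poly polyC g in eF; set h' := map_poly polyC h in eA.
(* Modulo [F], u W equals - tau^e g'. After multiplication by W the pair (A, u eps) is therefore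
   tau^a times (M, - tau^(e-a) g' eps), whose second entry vanishes at the point, while M has there
   the value of W h', which is not zero. *)
pose M := W * h' - tau ^+ (e - a) * g' * b.
have [q eq] : exists q, psi k p (W * A) (W * ('X%:P * eps)) =
    psi k p (tau ^+ a * M) (tau ^+ a * (- tau ^+ (e - a) * g' * eps)) + F * q.
  have ee : tau ^+ e = tau ^+ a * tau ^+ (e - a) by rewrite -exprD subnKC // ltnW.
  apply: psi_congr; first by exists b; rewrite eA eF /M ee; ring.
  by exists eps; rewrite eF ee; ring.
rewrite psi_scale ePsi psi_scale -exprM in eq.
have Fc : F.[c%:P] = 'X * W.[c%:P].
  rewrite eF hornerD !hornerM horner_exp hornerXsubC subrr expr0n.
  by rewrite (gtn_eqF (leq_ltn_trans _ hae)) // mul0r add0r hornerC.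
have Fc0 : F.[c%:P] != 0.
  rewrite Fc mulf_neq0 ?polyX_eq0 //; apply: contra_neq W0 => ->; by rewrite horner0.
have [Q' eQ'] : exists Q', psi k p M (- tau ^+ (e - a) * g' * eps) = F * Q'.
  apply: (@cancel_XsubC _ c%:P (a * k) _ F (W ^+ k * Q - q)) => //.
  apply/eqP; rewrite mulrBr; rewrite -subr_eq0 -(addrK (F * q) (_ ^+ _ * _)) -eq; apply/eqP; ring.
have := congr1 (fun x : {poly {poly K}} => x.[c%:P].[0]) eQ'.
rewrite hornerM [RHS]hornerM Fc hornerM hornerX !mul0r /psi horner_sum horner_sum big_ord_recr /=.
rewrite subnn expr0 mulr1 pk mul1r big1 ?add0r => [|i _].
  rewrite !horner_exp /M hornerD hornerN !hornerM horner_exp hornerXsubC subrr expr0n subn_eq0 leqNgt hae /=.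
  rewrite !mul0r subr0 hornerM => /eqP; rewrite expf_eq0 mulf_eq0 (negbTE W0) /= => /andP[_].
  by rewrite /h' horner_map hornerC (negbTE hc).
have ki : (0 < k - i)%N by rewrite subn_gt0.
rewrite !hornerM !horner_exp !hornerM hornerN horner_exp hornerXsubC subrr.
have -> : (0 : {poly K}) ^+ (e - a) = 0 by rewrite expr0n subn_eq0 leqNgt hae.
by rewrite oppr0 horner0 !mul0r expr0n (gtn_eqF ki) mulr0 mul0r.
Qed.

Lemma split_u (p : {poly {poly K}}) : exists W,
  p = map_poly polyC (map_poly (horner_eval 0) p) + 'X%:P * W.
Proof.
have hq (q : {poly K}) : exists q1, q = (q.[0])%:P + 'X * q1.
  have : root (q - (q.[0])%:P) 0 by rewrite /root hornerD hornerN hornerC subrr.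
  move=> /factor_theorem [q1]; rewrite subr0 => e; exists q1.
  by rewrite mulrC -e addrC subrK.
have [w hw] := choice hq.
exists (\poly_(i < size p) w p`_i); apply/polyP => i.
rewrite coefD coefCM coef_map /= coef_map /= /horner_eval coef_poly.
case: ltnP => hi; first exact: hw.
by rewrite nth_default // horner0 mulr0 addr0.
Qed.

Lemma mwiden_eval n (p : {mpoly K[n]}) (y : 'rV[K]_n) t : (mwiden p).@[(rowpt y t) 0] = p.@[y 0].
Proof. by rewrite meval_rowpt muni_widen map_polyC hornerC. Qed.

Lemma rowptE n (v : 'rV[K]_n.+1) : exists y t, v = rowpt y t.
Proof.
exists (\row_i v 0 (lift ord_max i)), (v 0 ord_max); apply/rowP => i; rewrite mxE.
by case: unliftP => [j ->|->] //; rewrite mxE.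
Qed.

Lemma rowpt_line n (y w : 'rV[K]_n) t u : rowpt y t + u *: rowpt w 0 = rowpt (y + u *: w) t.
Proof.
apply/rowP => i; rewrite !mxE; case: unliftP => [j _|_]; first by rewrite !mxE.
by rewrite mulr0 addr0.
Qed.

Lemma rowpt_scale n (y : 'rV[K]_n) t u : u *: rowpt y t = rowpt (u *: y) (u * t).
Proof. by apply/rowP => i; rewrite !mxE; case: unliftP => [j _|_] //; rewrite !mxE. Qed.

Lemma rowpt_eq0 n (y : 'rV[K]_n) t : rowpt y t = 0 -> y = 0 /\ t = 0.
Proof.
move=> /rowP h; split; last by have := h ord_max; rewrite !mxE unlift_none.
by apply/rowP => i; have := h (lift ord_max i); rewrite !mxE liftK.
Qed.

Lemma rowpt_delta n : rowpt (0 : 'rV[K]_n) 1 = elast K n.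
Proof.
apply/rowP => i; rewrite !mxE eqxx /=; case: unliftP => [j ->|->]; last by rewrite eqxx.
by rewrite mxE eq_sym (negbTE (neq_lift _ _)).
Qed.

Lemma pihomog_widen n e (p : {mpoly K[n]}) :
  pihomog mdeg e (mwiden p) = mwiden (pihomog mdeg e p).
Proof.
apply: mpoly_ext => v; have [y [t ->]] := rowptE v.
rewrite mwiden_eval -!coef_ray (_ : ray (mwiden p) (rowpt y t) = ray p y) //.
by apply: poly_ext => u; rewrite !ray_eval rowpt_scale mwiden_eval.
Qed.

Lemma dhomog_widen n e (p : {mpoly K[n]}) : p \is e.-homog -> mwiden p \is e.-homog.
Proof. by move=> hp; rewrite homog_piE pihomog_widen pihomog_dE. Qed.

Lemma pihomogMr_lt n d e (p q : {mpoly K[n]}) : p \is d.-homog -> (e < d)%N ->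
  pihomog mdeg e (p * q) = 0.
Proof.
move=> hp he; apply: mpoly_eval0 => x; rewrite -coef_ray rayM (ray_homog _ hp).
by rewrite -scalerAl coefZ coefXnM he mulr0.
Qed.

Section AtPoint.
Variables (n d : nat) (F : {mpoly K[n.+1]}).
Hypotheses (hF : F \is d.-homog) (Fl : F.@[elast K n 0] != 0).
Let f := muni F.
Variables (A D : {poly {mpoly K[n]}}) (k : nat) (p : nat -> {poly {mpoly K[n]}})
  (Q : {poly {mpoly K[n]}}) (D0 : {mpoly K[n]}).
Hypotheses (pk : p k = 1) (hint : psi k p A D0%:P = f * Q) (d0 : (0 < d)%N)
  (sA : (size A <= d)%N).
Local Notation at_ T := (map_poly (meval ((T : 'rV[K]_n) 0))).

(** As deg A < deg f, there is a root c of [f] over [T] at which [A] vanishes to a lower order a <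
    e. If the derivative of [F] at (T, c) in a direction (w, 0) were nonzero, [smooth_not_integral]
    in the plane of that direction would contradict the integral equation. The derivative along the
    last variable vanishes because e >= 2. *)
Lemma singular_over (T : 'rV[K]_n) : D0.@[T 0] = 0 -> at_ T A != 0 ->
  exists t, singular F (rowpt T t).
Proof.
move=> DT AT0; have [sf lf] := size_muni_top hF Fl.
have lfT : meval (T 0) (lead_coef f) != 0 by rewrite lf mevalC.
have sfT : size (at_ T f) = d.+1 by rewrite size_map_poly_id0.
have fT0 : at_ T f != 0 by rewrite -size_poly_gt0 sfT.
have nd : ~~ (at_ T f %| at_ T A).
  apply/negP => /(dvdp_leq AT0); rewrite sfT leqNgt ltnS => /negP; apply.
  by apply: leq_trans sA; apply: size_poly.
have [c [e [a [g [h [ef eA hae hc]]]]]] := multiplicity_gap fT0 nd.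
have fc : (at_ T f).[c] = 0.
  by rewrite ef hornerM horner_exp hornerXsubC subrr expr0n gtn_eqF ?mul0r // (leq_ltn_trans _ hae).
have eAk : at_ T A ^+ k = at_ T f * at_ T Q.
  have := congr1 (at_ T) hint; rewrite rmorphM => <-.
  rewrite /psi rmorph_sum big_ord_recr /= subnn expr0 mulr1 pk mul1r rmorphXn big1 ?add0r // => i _.
  rewrite !rmorphM rmorphXn /= map_polyC /= DT rmorphXn expr0n subn_eq0 leqNgt ltn_ord /=.
  by rewrite mulr0 mul0r.
(* Over [T] the equation reads A^k = f Q, so [A] vanishes at [c] too, and [e] is at least 2. *)
have a0 : (0 < a)%N.
  rewrite lt0n; apply/eqP => a0; have := congr1 (fun q : {poly K} => q.[c]) eAk.
  rewrite hornerM fc mul0r horner_exp eA a0 mul1r => /eqP.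
  by rewrite expf_eq0 (negbTE hc) andbF.
have key w : (dird (rowpt w 0) F).@[(rowpt T c) 0] = 0.
  pose L := map_poly (linepr T w) : {poly {mpoly K[n]}} -> {poly {poly K}}.
  have at0 q : map_poly (horner_eval 0) (L q) = at_ T q.
    rewrite /L -map_poly_comp; apply: eq_map_poly => r /=.
    by rewrite /horner_eval linep_eval scale0r addr0.
  have [W eW] := split_u (L f); have [b eb] := split_u (L A).
  have [eps eeps] := split_u (L D0%:P).
  rewrite at0 ef rmorphM rmorphXn /= rmorphB /= map_polyX map_polyC /= in eW.
  rewrite at0 eA rmorphM rmorphXn /= rmorphB /= map_polyX map_polyC /= in eb.
  rewrite at0 map_polyC /= DT !raddf0 add0r in eeps.
  have hW : W.[c%:P].[0] = 0.
    apply: (@smooth_not_integral c e a g h W b eps k (fun i => L (p i)) (L Q) (L f) (L A)) => //.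
      by rewrite pk /L rmorph1.
    have := congr1 L hint; rewrite /L rmorphM => <-.
    rewrite -eeps /L /psi rmorph_sum; apply: eq_bigr => i _.
    by rewrite !rmorphM !rmorphXn.
  have el : linep F (rowpt T c) (rowpt w 0) = (L f).[c%:P].
    apply: poly_ext => u; rewrite linep_eval rowpt_line meval_rowpt -/f.
    have -> : (L f).[c%:P].[u] = (map_poly (horner_eval u) (L f)).[c].
      have -> : c = horner_eval u c%:P by rewrite /horner_eval hornerC.
      by rewrite horner_map /horner_eval hornerC.
    rewrite /L -map_poly_comp; congr (_.[_]); apply: eq_map_poly => r /=.
    by rewrite /horner_eval linep_eval.
  rewrite dird_deriv0 el eW hornerD !hornerM horner_exp hornerXsubC subrr expr0n.
  rewrite gtn_eqF ?(leq_ltn_trans _ hae) // mul0r add0r hornerC derivM derivX mul1r.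
  by rewrite hornerD hW hornerM hornerX mul0r addr0.
exists c; apply: singular_dird; first by rewrite meval_rowpt.
have kl : (dird (elast K n) F).@[(rowpt T c) 0] = 0.
  rewrite dird_deriv0.
  have -> : linep F (rowpt T c) (elast K n) = at_ T f \Po ('X + c%:P).
    apply: poly_ext => u; rewrite linep_eval horner_comp !hornerE -rowpt_delta.
    have -> : rowpt T c + u *: rowpt 0 1 = rowpt T (u + c).
      apply/rowP => i; rewrite !mxE; case: unliftP => [j _|_]; first by rewrite mxE mulr0 addr0.
      by rewrite mulr1 addrC.
    by rewrite meval_rowpt.
  rewrite deriv_comp hornerM horner_comp !hornerE ef.
  have e2 : (1 < e)%N by apply: leq_trans hae.
  have [e' ->] : exists e', e = e'.+2 by case: (e) e2 => [|[|e']] // _; exists e'.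
  rewrite !exprS -!mulrA derivM derivXsubC mul1r hornerD !hornerM hornerXsubC subrr.
  by rewrite !mul0r addr0 mul0r.
move=> u; have [w [t ->]] := rowptE u.
have -> : rowpt w t = rowpt w 0 + t *: elast K n.
  rewrite -rowpt_delta; apply/rowP => i; rewrite !mxE; case: unliftP => [j _|_].
    by rewrite mxE mulr0 addr0.
  by rewrite mulr1 add0r.
have -> : dird (rowpt w 0 + t *: elast K n) F = dird (rowpt w 0) F + t *: dird (elast K n) F.
  rewrite /dird scaler_sumr -big_split; apply: eq_bigr => i _ /=.
  by rewrite !mxE scalerDl scalerA.
by rewrite mevalD mevalZ key kl mulr0 addr0.
Qed.
End AtPoint.
End Normality.

(** * Normality *)

Lemma munifXn (R : comNzRingType) n (q : {poly {mpoly R[n]}}) k :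
  munif (q ^+ k) = munif q ^+ k.
Proof. by elim: k => [|k IH]; [rewrite !expr0 rmorph1|rewrite !exprS munifM IH]. Qed.

Section IntegrallyClosed.
Variables (K : closedFieldType) (n d r : nat) (F : {mpoly K[n.+1]}).
Hypotheses (hF : F \is d.-homog) (Fl : F.@[elast K n 0] != 0)
  (irrF : irreducible_elt F) (d0 : (0 < d)%N).
Let f := muni F.
Variables (B : 'M[K]_(n, r)) (rn : (r + 2 <= n)%N).
Hypothesis smooth : forall (y : 'rV[K]_n) t, singular F (rowpt y t) -> y *m B = 0 -> y = 0.
Variables (E : fieldType) (iota : {rmorphism {mpoly K[n.+1]} -> E}).
Hypothesis iotaF : coord_fraction_field F iota.

Let size_f : size f = d.+1. Proof. by have [] := size_muni_top hF Fl. Qed.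
Let prime_f : prime_elt f.
Proof. by apply/prime_muni; apply: irr_prime irrF; apply: ufd_mpoly. Qed.

Lemma iota_eq0 q : iota (munif q) = 0 <-> divides f q.
Proof.
split=> [/(iotaF.1 _).1 [Q e]|[Q ->]].
  by exists (muni Q); rewrite -[q]munifK e muniM.
by apply/(iotaF.1 _).2; exists (munif Q); rewrite munifM muniK.
Qed.

Lemma iota_widen_neq0 D : D != 0 -> iota (mwiden D) != 0.
Proof.
move=> D0; apply/eqP; rewrite -munifC => /iota_eq0 [q e].
have q0 : q != 0 by apply: contra_neq D0 => q0; apply/eqP; rewrite -polyC_eq0 e q0 mul0r.
have := congr1 (fun q : {poly {mpoly K[n]}} => size q) e; rewrite size_polyC D0 size_mul //; last first.
  by rewrite -size_poly_gt0 size_f.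
rewrite size_f; have : (0 < size q)%N by rewrite size_poly_gt0.
by move: d0; case: (size q) => // a; case: (d) => // b _ _; rewrite addnS /=; lia.
Qed.

(** [H] is prime to [F], so the two have an eliminant, a nonzero polynomial in the variables of the
    projection. Its top component serves as well, [F] and [H] being homogeneous. *)
Lemma homogeneous_denominator h (H : {mpoly K[n.+1]}) : H \is h.-homog -> iota H != 0 ->
  exists D e V, [/\ D != 0, D \is e.-homog & iota V * iota H = iota (mwiden D)].
Proof.
move=> hH H0; have f0 : f != 0 by rewrite -size_poly_gt0 size_f.
have [|u [v [D [D0 eD]]]] := @bezout_coprime _ (@ufd_mpoly K n) f (muni H) f0.
  move=> p pp sp pf pH; have [w wu ew] := prime_assoc pp prime_f pf.
  case/eqP: H0; rewrite -[H]muniK; apply/iota_eq0.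
  by case: pH => z ez; exists (z / w); rewrite ez ew mulrA divrK.
have eD' : mwiden D = munif u * F + munif v * H.
  by apply: (@muni_inj _ K); rewrite muni_widen eD muniD !muniM !munifK.
have [e De _] := top_degree D0.
exists (pihomog mdeg e D), e, (if (h <= e)%N then pihomog mdeg (e - h) (munif v) else 0).
split=> //; first exact: pihomogP.
rewrite -rmorphM -pihomog_widen eD' raddfD /= rmorphD /=.
have cmp k (P Q : {mpoly K[n.+1]}) : P \is k.-homog ->
    pihomog mdeg e (Q * P) = (if (k <= e)%N then pihomog mdeg (e - k) Q else 0) * P.
  move=> hP; rewrite mulrC; case: leqP => hk; last by rewrite (pihomogMr_lt _ hP hk) mul0r.
  by rewrite -{1}(subnKC hk) (pihomogMl _ _ hP) mulrC.
rewrite (cmp _ _ _ hF) (cmp _ _ _ hH) !rmorphM /=.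
have -> : iota F = 0 by apply/(iotaF.1 _).2; exists 1; rewrite mul1r.
have z x (y : E) : x * 0 + y = y by rewrite mulr0 add0r.
exact/esym/z.
Qed.

Lemma reduce_numerator (A0 : {poly {mpoly K[n]}}) :
  exists2 A : {poly {mpoly K[n]}}, (size A <= d)%N & iota (munif A) = iota (munif A0).
Proof.
have lf : lead_coef f \is a GRing.unit.
  have [_ ->] := size_muni_top hF Fl.
  by apply/mpoly_unitP; exists F.@[elast K n 0].
exists (A0 %% f).
  by rewrite -ltnS -size_f Pdiv.Idomain.ltn_modp -size_poly_gt0 size_f.
rewrite [in RHS](Pdiv.IdomainUnit.divp_eq lf A0) raddfD /= rmorphD /= munifM muniK rmorphM /=.
have -> : iota F = 0 by apply/(iotaF.1 _).2; exists 1; rewrite mul1r.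
by rewrite mulr0 add0r.
Qed.

(** The kernel of [B] has dimension at least 2, and a form of positive degree has a zero on every
    projective line. *)
Lemma zero_in_kernel (p : {mpoly K[n]}) e : p \is e.-homog -> (0 < e)%N ->
  exists2 y : 'rV[K]_n, y != 0 & y *m B = 0 /\ p.@[y 0] = 0.
Proof.
move=> hp e0; have rk : (2 <= \rank (kermx B))%N.
  by rewrite mxrank_ker; have := rank_leq_col B; move: rn; lia.
pose R := row_base (kermx B).
have RB : R *m B = 0.
  by apply/sub_kermxP; rewrite eq_row_base.
have [i0 [i1 ne]] : exists i0 i1 : 'I_(\rank (kermx B)), i0 != i1.
  by exists (Ordinal (ltnW rk)), (Ordinal rk).
pose v0 := row i0 R; pose v1 := row i1 R.
have vB i : row i R *m B = 0 by rewrite -row_mul RB row0.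
have free := row_base_free (kermx B).
have ind a b : a *: v0 + b *: v1 = 0 -> a = 0 /\ b = 0.
  move=> h; have : (a *: (delta_mx 0 i0 : 'rV_(\rank (kermx B))) + b *: delta_mx 0 i1) *m R = (0 : 'rV_(\rank (kermx B))) *m R.
    by rewrite mul0mx mulmxDl -!scalemxAl -!rowE.
  move=> /(row_free_inj free) /rowP h'; have := h' i0; have := h' i1; rewrite !mxE !eqxx /=.
  by rewrite [i1 == i0]eq_sym (negbTE ne) !mulr1 !mulr0 addr0 add0r.
have v0n : v0 != 0.
  by apply/eqP => h; have [] := ind 1 0; rewrite ?h ?scaler0 ?scale0r ?addr0 // => /eqP; rewrite oner_eq0.
have [p0|p0] := eqVneq p.@[v0 0] 0; first by exists v0 => //; split=> //; apply: vB.
have [q0|/closed_rootP [t ht]] := eqVneq (size (linep p v1 v0)) 1%N; last first.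
  exists (v1 + t *: v0).
    by apply/eqP; rewrite addrC -[v1]scale1r => /ind [_ /eqP]; rewrite oner_eq0.
  split; first by rewrite mulmxDl -scalemxAl !vB scaler0 addr0.
  by rewrite -linep_eval; apply/eqP.
case/eqP: p0; have ec := size1_polyC (eq_leq q0); set c := _`_0 in ec.
(* Without a zero on v1 + t v0 the form is a constant c there, so p(v0 + s v1) = c s^e, and this
   vanishes at v0. *)
have : 'X * (linep p v0 v1 - c *: 'X^e) = 0.
  apply: poly_ext => s; rewrite !hornerE linep_eval.
  have [->|s0] := eqVneq s 0; first by rewrite mul0r.
  have -> : v0 + s *: v1 = s *: (v1 + s^-1 *: v0) by rewrite scalerDr scalerA divff // scale1r addrC.
  by rewrite (dhomog_eval_scale _ _ hp) -linep_eval ec hornerC [c * _]mulrC subrr mulr0.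
move/eqP; rewrite mulf_eq0 polyX_eq0 subr_eq0 => /eqP e1.
rewrite -[v0]addr0 -(scale0r v1) -linep_eval e1 hornerZ hornerXn expr0n.
by rewrite (gtn_eqF e0) mulr0.
Qed.

(* No form [D] with a prime factor [p] not dividing [A] is the denominator of
   an integral fraction [A / D]: over every point of [p = 0] at which [A] does
   not vanish there would be a singular point of [F = 0]; since the projection
   of the singular locus is closed, there would be one over all of [p = 0]. *)
Lemma no_denominator k (p : nat -> {poly {mpoly K[n]}}) (A Q : {poly {mpoly K[n]}}) (D : {mpoly K[n]}) e (pi : {mpoly K[n]}) :
  p k = 1 -> psi k p A D%:P = f * Q -> (size A <= d)%N ->
  prime_elt pi -> pi \is e.-homog -> (0 < e)%N -> divides pi D -> divides pi%:P A.
Proof.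
move=> pk hint sA ppi hpi e0 hD; apply: contrapT => hn.
have [j hj] : exists j, ~ divides pi A`_j.
  by apply/existsNP => h; apply: hn; apply/divides_polyC.
have sing (T : 'rV[K]_n) : pi.@[T 0] = 0 -> (A`_j).@[T 0] != 0 -> exists t, singular F (rowpt T t).
  move=> piT AT; apply: (singular_over hF Fl pk hint sA).
    by case: hD => D' ->; rewrite mevalM piT mulr0.
  apply: contra_neq AT => AT; have := congr1 (fun q : {poly K} => q`_j) AT.
  by rewrite coef_map coef0.
have [T1 T10 [T1B piT1]] := zero_in_kernel hpi e0.
have ns t : ~ singular F (rowpt T1 t).
  by move=> /smooth /(_ T1B) T1e; rewrite T1e eqxx in T10.
have lf : lead_coef f = (F.@[elast K n 0])%:MP by have [] := size_muni_top hF Fl.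
pose fT := map_poly (meval (T1 0)) f.
have fT0 : fT != 0.
  by rewrite -size_poly_gt0 size_map_poly_id0 ?size_f // lf mevalC.
have [s es] := closed_field_poly_normal fT.
have rs t : fT.[t] = 0 -> t \in s.
  move=> /eqP; rewrite es hornerZ mulf_eq0 lead_coef_eq0 (negbTE fT0) /=.
  by rewrite -/(root _ t) root_prod_XsubC.
(* The differential of [F] at the point over [T1] with last coordinate t. The direction [u] is
   chosen so that none of these finitely many differentials vanishes on it. The eliminant [R] of [f]
   and of the derivative along [u] is then nonzero at [T1], while it vanishes below every singular
   point. *)
pose l t : {mpoly K[n.+1]} := \sum_i (F^`M(i).@[(rowpt T1 t) 0]) *: 'X_i.
have [|u hu] := @mpoly_nonroots K n.+1 [seq l t | t <- s & fT.[t] == 0].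
  move=> _ /mapP [t tm ->]; move: tm; rewrite mem_filter => /andP[/eqP ft _]; apply/eqP => lt.
  apply: (ns t); split; first by rewrite meval_rowpt.
  move=> i; have := congr1 (mcoeff U_(i)) lt; rewrite mcoeff0 raddf_sum (bigD1 i) //=.
  rewrite mcoeffZ mcoeffXU eqxx mulr1 big1 ?addr0 // => i' /negbTE hi.
  by rewrite mcoeffZ mcoeffXU hi mulr0.
pose h := dird u F.
have [||a [b [R [eR R0]]]] := @resultant_specialize K n f (muni h) T1 _ Fl lf.
- by rewrite size_f ltnS.
- move=> t ft; rewrite -meval_rowpt /h dird_eval.
  have -> : \sum_i u 0 i * (F^`M(i)).@[rowpt T1 t 0] = (l t).@[u 0].
    rewrite /l raddf_sum; apply: eq_bigr => i _.
    by rewrite /= mevalZ mevalXU mulrC.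
  apply: hu.
  by apply/mapP; exists t => //; rewrite mem_filter rs ?ft ?eqxx.
have [_ _ hpp] := ppi.
have /hpp [hR|//] : divides pi (R * A`_j).
  apply: prime_nullstellensatz => // T piT; rewrite mevalM.
  have [->|AT] := eqVneq (A`_j).@[T 0] 0; first by rewrite mulr0.
  have [t [Ft dFt]] := sing T piT AT.
  have eR' : mwiden R = munif a * F + munif b * h.
    by apply: (@muni_inj _ K); rewrite muni_widen eR muniD !muniM !munifK.
  have := congr1 (meval ((rowpt T t) 0)) eR'.
  rewrite mwiden_eval mevalD !mevalM Ft mulr0 add0r /h dird_eval big1 => [->|i _].
    by rewrite mulr0 mul0r.
  by rewrite dFt mulr0.
by case/eqP: R0; case: hR => R' ->; rewrite mevalM piT1 mulr0.
Qed.

(** Among the expressions A / D of the fraction with D a form in the variables of the projection,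
    one has D of least degree. A prime factor of D would divide A as well and could be cancelled, so
    D is a constant. *)
Lemma integrally_closed G g H h (P : {poly {mpoly K[n.+1]}}) :
  G \is g.-homog -> H \is h.-homog -> iota H != 0 -> P \is monic ->
  root (map_poly iota P) (iota G / iota H) -> exists Y, iota G / iota H = iota Y.
Proof.
move=> hG hH H0 mP; set z := _ / _ => rP.
pose ok e := exists (D : {mpoly K[n]}) (A : {poly {mpoly K[n]}}), [/\ D != 0, D \is e.-homog, (size A <= d)%N &
  z * iota (mwiden D) = iota (munif A)].
have hex : exists e, `[< ok e >].
  have [D [e [V [D0 hD eD]]]] := homogeneous_denominator hH H0; exists e; apply/asboolP.
  have [A sA eA] := reduce_numerator (muni (G * V)); exists D, A; split => //.
  by rewrite eA muniK rmorphM -eD /z; field.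
case: (ex_minnP hex) => e /asboolP [D [A [D0 hD sA eA]]] hmin.
have [uD|uD] := boolP (D \is a GRing.unit).
  have [c c0 ec] := (mpoly_unitP D).1 uD; exists (munif A * (c^-1)%:MP).
  rewrite rmorphM -eA -mulrA -rmorphM ec mwidenC -mpolyCM mulfV //.
  by rewrite rmorph1 mulr1.
have [s hs [u uu es]] := ufd_mpoly D0.
case: s hs es => [|pi s] hs es; first by move: uD; rewrite es big_nil mulr1 uu.
have ppi := hs pi (mem_head _ _); have [pi0 pu _] := ppi.
rewrite big_cons mulrCA in es; set D' := u * _ in es.
have D'0 : D' != 0 by apply: contra_neq D0 => D'0; rewrite es D'0 mulr0.
have [e1 he1 _] : exists2 e1, pi \is e1.-homog & (e1 <= e)%N.
  by apply: (@dhomog_factor _ _ _ pi D'); rewrite -es.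
have [e2 he2 _] : exists2 e2, D' \is e2.-homog & (e2 <= e)%N.
  by apply: (@dhomog_factor _ _ _ D' pi); rewrite mulrC -es.
have ee : e = (e1 + e2)%N by apply: (dhomog_uniq D0 hD); rewrite es; apply: dhomogM.
have e10 : (0 < e1)%N.
  rewrite lt0n; apply: contraNneq pu => e10; rewrite e10 in he1.
  apply/mpoly_unitP; exists pi@_0; last exact: homog0C.
  by apply: contra_neq pi0 => h0; rewrite (homog0C he1) h0 mpolyC0.
pose k := (size P).-1; pose p i := muni P`_i.
have sP : size P = k.+1 by rewrite /k prednK // size_poly_gt0 monic_neq0.
have pk : p k = 1 by rewrite /p /k -lead_coefE (monicP mP) muni1.
have [Q eQ] : divides f (psi k p A D%:P).
  apply/iota_eq0; have -> : iota (munif (psi k p A D%:P)) = \sum_(i < k.+1)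
      iota P`_i * iota (mwiden D) ^+ (k - i) * (z * iota (mwiden D)) ^+ i.
    have iS m (q : 'I_m -> {mpoly K[n.+1]}) : iota (\sum_(i < m) q i) = \sum_(i < m) iota (q i).
      exact: raddf_sum.
    have mS m (q : 'I_m -> {poly {mpoly K[n]}}) : munif (\sum_(i < m) q i) = \sum_(i < m) munif (q i).
      exact: raddf_sum.
    rewrite /psi mS iS; apply: eq_bigr => i _.
    have iE (a b c : {mpoly K[n.+1]}) x y : iota (a * b ^+ x * c ^+ y) = iota a * iota b ^+ x * iota c ^+ y.
      by rewrite !rmorphM !rmorphXn.
    by rewrite !munifM !munifXn munifC muniK iE eA.
  have -> : \sum_(i < k.+1) iota P`_i * iota (mwiden D) ^+ (k - i) * (z * iota (mwiden D)) ^+ i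
      = iota (mwiden D) ^+ k * (map_poly iota P).[z].
    rewrite horner_coef size_map_poly_id0 ?sP ?(monicP mP) ?rmorph1 ?oner_eq0 // mulr_sumr.
    apply: eq_bigr => i _; rewrite coef_map /= exprMn.
    have -> : iota (mwiden D) ^+ k = iota (mwiden D) ^+ (k - i) * iota (mwiden D) ^+ i.
      by rewrite -exprD subnK // -ltnS.
    by ring.
  by rewrite (eqP rP) mulr0.
have /divides_polyC hA : divides pi%:P A.
  apply: (@no_denominator k p A Q D e1 pi) => //; first by rewrite eQ mulrC.
  by exists D'; rewrite es mulrC.
have [A' eA'] : divides pi%:P A by apply/divides_polyC.
have : (e <= e2)%N; last by rewrite ee -{2}[e2]add0n leq_add2r leqNgt e10.
apply: hmin; apply/asboolP; exists D', A'; split => //.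
  by move: sA; rewrite eA' mulrC mul_polyC size_scale.
have pin : iota (mwiden pi) != 0 by apply: iota_widen_neq0.
apply: (mulIf pin); rewrite -mulrA -rmorphM -rmorphM [D' * _]mulrC -es eA eA' munifM munifC rmorphM.
by [].
Qed.
End IntegrallyClosed.

Lemma substM (K : closedFieldType) n m (D : 'M[K]_(n, m)) : {morph subst D : p q / p * q}.
Proof. exact: rmorphM. Qed.

Section CoordinateChange.
Variables (K : closedFieldType) (n : nat) (T : 'M[K]_n.+1).
Hypothesis uT : T \in unitmx.

Lemma substKV p : subst T (subst (invmx T) p) = p.
Proof. by rewrite subst_comp mulmxV // subst1. Qed.

Lemma substVK p : subst (invmx T) (subst T p) = p.
Proof. by rewrite subst_comp mulVmx // subst1. Qed.

Lemma dird_subst (u x : 'rV[K]_n.+1) p :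
  (dird u (subst T p)).@[x 0] = (dird (u *m T) p).@[(x *m T) 0].
Proof.
rewrite !dird_deriv0; congr (_^`().[_]); apply: poly_ext => t.
by rewrite !linep_eval subst_eval mulmxDl scalemxAl.
Qed.

Lemma singular_subst F (y : 'rV[K]_n.+1) : singular (subst T F) y <-> singular F (y *m T).
Proof.
split=> -[F0 hF]; apply: singular_dird; rewrite ?subst_eval // in F0 * => u.
  by rewrite -[u](mulmxKV uT) -dird_subst dird_eval big1 // => i _; rewrite hF mulr0.
by rewrite dird_subst dird_eval big1 // => i _; rewrite hF mulr0.
Qed.

Lemma subst_unit p : (subst T p \is a GRing.unit) = (p \is a GRing.unit).
Proof.
apply/idP/idP => h; last exact: rmorph_unit.
by rewrite -[p]substVK; apply: rmorph_unit.
Qed.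

Lemma irreducible_subst F : irreducible_elt F -> irreducible_elt (subst T F).
Proof.
move=> [F0 uF hF]; split; rewrite ?subst_unit //.
  by apply: contra_neq F0 => h; rewrite -[F]substVK h rmorph0.
move=> G H e; have /hF : F = subst (invmx T) G * subst (invmx T) H.
  by rewrite -substM -e substVK.
by rewrite -(subst_unit (subst _ G)) -(subst_unit (subst _ H)) !substKV.
Qed.

Lemma coord_fraction_subst F (E : fieldType) (iota : {rmorphism {mpoly K[n.+1]} -> E}) :
  coord_fraction_field F iota ->
  coord_fraction_field (subst T F) (iota \o subst (invmx T) : {rmorphism _ -> _}).
Proof.
move=> [h1 h2]; split=> [G /=|z].
  split=> [/h1 [Q e]|[Q ->]].
    by exists (subst T Q); rewrite -substM -e substKV.
  by apply/h1; exists (subst (invmx T) Q); rewrite substM substVK.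
have [G [H [H0 ->]]] := h2 z; exists (subst T G), (subst T H).
by rewrite /= !substVK.
Qed.
End CoordinateChange.

Section SingularLocus.
Variables (K : closedFieldType) (N d : nat) (F : {mpoly K[N.+1]}).
Hypothesis hF : F \is d.-homog.

Lemma cone_of_Sing (v : 'rV[K]_N.+1) : v != 0 -> (cone_of (Sing F) v <-> singular F v).
Proof.
move=> v0; split=> [[P [FP hP] vP]|[Fv hv]].
  by split=> [|i]; [apply: FP|apply: hP].
have [P vP] := point_exists v0; exists P => //; split=> [|i].
  exact/(vanishes_atP hF vP v0).
exact/(vanishes_atP (dhomog_deriv i hF) vP v0).
Qed.

Lemma zclosed_Sing : zclosed (Sing F).
Proof.
exists [set G | G = F \/ exists i, G = F^`M(i)]; split.
  by move=> G [->|[i ->]]; [exists d|exists d.-1; apply: dhomog_deriv].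
apply/seteqP; split=> P /=.
  by move=> [h1 h2] G [->|[i ->]].
by move=> h; split=> [|i]; apply: h; [left|right; exists i].
Qed.

Lemma irreducible_degree : irreducible_elt F -> (0 < d)%N.
Proof.
move=> [F0 uF _]; rewrite lt0n; apply: contraNneq uF => d0.
apply/mpoly_unitP; exists F@_0; last by apply/homog0C/(dhomog_cast d0 hF).
by apply: contra_neq F0 => h; rewrite (homog0C (dhomog_cast d0 hF)) h mpolyC0.
Qed.
End SingularLocus.

Definition prmx (K : fieldType) n : 'M[K]_(n.+1, n) := \matrix_(i, j) (lift ord_max j == i)%:R.

Lemma rowpt_prmx (K : closedFieldType) n (y : 'rV[K]_n) t : rowpt y t *m prmx K n = y.
Proof.
apply/rowP => j; rewrite mxE (bigD1 (lift ord_max j)) //= !mxE liftK eqxx mulr1.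
by rewrite big1 ?addr0 // => i hi; rewrite !mxE eq_sym (negbTE hi) mulr0.
Qed.

(** The projection is from a point [o] off X, moved to the last basis vector. Its n + 1 coordinates
    have no common zero on Sing X, so s + 1 combinations of them have none, and s + 1 <= n - 1
    leaves them a kernel of dimension at least 2. *)
Lemma normality (K : closedFieldType) (n d : nat) (F : {mpoly K[n.+2]}) (s : int)
    (E : fieldType) (iota : {rmorphism {mpoly K[n.+2]} -> E}) G g H h (P : {poly {mpoly K[n.+2]}}) :
  F \is d.-homog -> irreducible_elt F -> has_dim (Sing F) s -> s <= n%:Z - 2 ->
  coord_fraction_field F iota ->
  G \is g.-homog -> H \is h.-homog -> iota H != 0 -> P \is monic ->
  root (map_poly iota P) (iota G / iota H) -> exists Y, iota G / iota H = iota Y.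
Proof.
move=> hF irrF hs hsn iF hG hH H0 mP rP.
have d0 := irreducible_degree hF irrF; have [F0 _ _] := irrF.
have [o oF] := mpoly_nonroot F0.
have o0 : o != 0.
  by apply: contra_neq oF => ->; apply: dhomog_eval0 hF d0.
have [T uT eT] := exists_row_unitmx o0.
have av : avoids (Sing F) (invmx T *m prmx K n.+1).
  move=> v cv; have [->//|v0] := eqVneq v 0.
  move/(cone_of_Sing hF v0): cv => [Fv _].
  have [y [t e]] := rowptE (v *m invmx T); rewrite mulmxA e rowpt_prmx => y0.
  have ev : v = t *: o.
    by rewrite -[v](mulmxKV uT) e y0 -eT scalemxAl -rowpt_delta rowpt_scale scaler0 mulr1.
  move/eqP: Fv; rewrite ev (dhomog_eval_scale _ _ hF) mulf_eq0 (negbTE oF) orbF expf_eq0.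
  by case/andP=> _ /eqP ->; rewrite scale0r.
have [r' [B [er avB]]] := dim_lower (zclosed_Sing hF) hs av.
have hF' : subst T F \is d.-homog by apply: dhomog_subst.
have Fl : (subst T F).@[elast K n.+1 0] != 0 by rewrite subst_eval eT.
have rn : (r' + 2 <= n.+1)%N by move: er hsn; clear; lia.
have sm (y : 'rV[K]_n.+1) t : singular (subst T F) (rowpt y t) -> y *m B = 0 -> y = 0.
  move=> /(singular_subst uT) hs' yB.
  have [|v0] := eqVneq (rowpt y t *m T) 0.
    move=> h0; have : rowpt y t = 0 by rewrite -[rowpt y t](mulmxK uT) h0 mul0mx.
    by case/rowpt_eq0.
  move/(cone_of_Sing hF v0)/avB: hs'; rewrite !mulmxA mulmxK // rowpt_prmx => /(_ yB) h0.
  by rewrite h0 eqxx in v0.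
pose iota' : {rmorphism {mpoly K[n.+2]} -> E} := (iota \o subst (invmx T) : {rmorphism _ -> _}).
have iF' : coord_fraction_field (subst T F) iota' := coord_fraction_subst uT iF.
have ei p : iota p = iota' (subst T p) by rewrite /iota' /= substVK.
pose P' := map_poly (subst T) P.
have [|||||Y eY] := @integrally_closed K n.+1 d r' (subst T F) hF' Fl (irreducible_subst uT irrF)
  d0 B rn sm E _ iF' (subst T G) g (subst T H) h P'.
- exact: dhomog_subst.
- exact: dhomog_subst.
- by rewrite -ei.
- exact: monic_map.
- rewrite -!ei; suff -> : map_poly iota' P' = map_poly iota P by [].
  by rewrite /P' -map_poly_comp; apply: eq_map_poly => p /=; rewrite substVK.
by exists (subst (invmx T) Y); rewrite !ei eY substKV.
Qed.

(** * Pure equations *)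

Section AffineSymmetries.
Variable E : fieldType.

Lemma coef_XaddC_exp (R : comNzRingType) (c : R) m i :
  (('X + c%:P) ^+ m)`_i = c ^+ (m - i) *+ 'C(m, i).
Proof.
rewrite addrC exprDn coef_sum.
under eq_bigr => k _ do rewrite coefMn -polyC_exp coefCM coefXn.
have [hi|hi] := ltnP i m.+1; last first.
  rewrite bin_small // mulr0n big1 // => k _.
  by rewrite gtn_eqF ?mulr0 ?mul0rn // (leq_trans _ hi).
rewrite (bigD1 (Ordinal hi)) //= eqxx mulr1 big1 ?addr0 // => k hk.
by rewrite eq_sym (negbTE (_ : (k : nat) != i)) ?mulr0 ?mul0rn.
Qed.

Lemma derivn_comp_affine (p : {poly E}) b c k :
  (p \Po (b *: 'X + c%:P))^`(k) = b ^+ k *: (p^`(k) \Po (b *: 'X + c%:P)).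
Proof.
elim: k => [|k IH]; first by rewrite expr0 scale1r.
rewrite derivnS IH derivZ deriv_comp derivD derivZ derivX derivC addr0 -derivnS.
by rewrite alg_polyC mulrC mul_polyC scalerA exprSr.
Qed.

Lemma coef_comp_scaleX (p : {poly E}) b i : (p \Po (b *: 'X))`_i = b ^+ i * p`_i.
Proof.
have [hi|hi] := ltnP i (size p); last first.
  rewrite [p`_i]nth_default // mulr0 nth_default //; apply: leq_trans hi.
  have [->|p0] := eqVneq p 0; first by rewrite comp_poly0 size_poly0.
  apply: leq_trans (size_comp_poly_leq _ _) _.
  have : (size (b *: 'X : {poly E})%R <= 2)%N by apply: leq_trans (size_scale_leq _ _) _; rewrite size_polyX.
  move: (size (b *: 'X)) => k hk; move: p0; rewrite -size_poly_gt0 => p0.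
  have hk1 : (k.-1 <= 1)%N by lia.
  by apply: leq_ltn_trans (leq_mul (leqnn _) hk1) _; rewrite muln1 ltn_predL.
rewrite coef_comp_poly (bigD1 (Ordinal hi)) //= big1 ?addr0 => [|k hk].
  by rewrite exprZn coefZ coefXn eqxx mulr1 mulrC.
by rewrite exprZn coefZ coefXn eq_sym (negbTE (_ : (k : nat) != i)) // !mulr0.
Qed.

(** An affine map preserving [p] up to a factor fixes the root - dl of the derivative of order d -
    2, so around this point the maps are scalings by b. A nonzero coefficient of index i strictly
    between 0 and d - 1 would give b^(d-1-i) = 1 for d - 1 distinct values of b. *)
Lemma affine_symmetries d (p : {poly E}) (x : E) (s : seq E) :
  (3 <= d)%N -> [pchar E] =i pred0 -> size p = d -> uniq s -> size s = d.-1 ->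
  (forall z, z \in s -> exists b c, [/\ b != 0, z = b * x + c &
     p \Po (b *: 'X + c%:P) = b ^+ d.-1 *: p]) ->
  exists dl e, p = lead_coef p *: ('X + dl%:P) ^+ d.-1 + e%:P.
Proof.
move=> hd ch sp us ss hs; have ep : d = d.-2.+2 by lia.
have nz m : (0 < m)%N -> m%:R != 0 :> E by rewrite ((pcharf0P E).1 ch) lt0n.
pose h := p^`(d.-2); have sh i : h`_i = if (i < 2)%N then p`_(d.-2 + i) *+ (d.-2 + i) ^_ d.-2 else 0.
  rewrite coef_derivn; case: ifP => // hi; rewrite nth_default ?mul0rn // sp; lia.
have p1 : p`_d.-1 != 0 by rewrite -{1}sp -lead_coefE lead_coef_eq0 -size_poly_gt0 sp; lia.
have h1 : h`_1 != 0.
  rewrite sh /= addn1 -mulr_natr mulf_neq0 ?nz ?ffact_gt0 //.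
  by have -> : d.-2.+1 = d.-1 by lia.
have hX u : h.[u] = h`_0 + h`_1 * u.
  have shl : (size h <= 2)%N.
    by apply/leq_sizeP => i hi; rewrite sh ltnNge hi.
  by rewrite (horner_coef_wide _ shl) !big_ord_recl big_ord0 expr0 mulr1 expr1 addr0.
pose dl := h`_0 / h`_1.
have hdl u : h.[u] = 0 -> u = - dl.
  rewrite hX => /eqP; rewrite addrC addr_eq0 => /eqP e.
  by apply: (mulfI h1); rewrite e /dl mulrN mulrCA divff // mulr1.
have dl0 : h.[- dl] = 0 by rewrite hX /dl mulrN mulrCA divff // mulr1 subrr.
pose g := p \Po ('X - dl%:P).
have eg : p = g \Po ('X + dl%:P).
  by rewrite /g -comp_polyA comp_polyB comp_polyX comp_polyC addrK comp_polyXr.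
have sym z : z \in s -> exists2 b, b != 0 /\ z = b * (x + dl) - dl & g \Po (b *: 'X) = b ^+ d.-1 *: g.
  move=> /hs [b [c [b0 ez e]]]; have ec : c = b * dl - dl.
    suff e2 : b * - dl + c = - dl by rewrite -[LHS](addKr (b * - dl)) e2 mulrN opprK.
    have := congr1 (fun q => q^`(d.-2).[- dl]) e.
    rewrite derivn_comp_affine derivnZ !hornerZ -/h dl0 mulr0 horner_comp !hornerE.
    move/eqP; rewrite mulf_eq0 expf_eq0 (negbTE b0) andbF /= => /eqP /hdl.
    by [].
  exists b; first by split=> //; rewrite ez ec mulrDr addrA.
  rewrite /g -comp_polyA comp_polyB comp_polyX comp_polyC -comp_polyZ -e -comp_polyA.
  have aff (u : E) : b *: 'X - u%:P = b *: ('X - u%:P) + (b * u - u)%:P.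
    by rewrite scalerBr polyCB polyCM -!mul_polyC; ring.
  by congr (_ \Po _); rewrite comp_polyD comp_polyZ comp_polyX comp_polyC ec aff.
have x0 : x + dl != 0.
  apply/eqP => x0; have hc z : z \in s -> z = - dl.
    by move=> /sym [b [_ ->] _]; rewrite x0 mulr0 add0r.
  have : (size s <= size [:: - dl])%N.
    by apply: uniq_leq_size => // z /hc ->; rewrite mem_seq1.
  by rewrite ss /=; lia.
have gi i : (0 < i < d.-1)%N -> g`_i = 0.
  move=> hi; apply/eqP; apply: contraT => gi0.
  pose e := (d.-1 - i)%N; pose t := [seq (z + dl) / (x + dl) | z <- s].
  have e0 : (0 < e)%N by rewrite /e; lia.
  have : (size t < size ('X^e - 1%:P : {poly E})%R)%N.
    apply: max_poly_roots.
    - by rewrite -size_poly_eq0 size_XnsubC.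
    - apply/allP => _ /mapP [z /sym [b [b0 ->] eb] ->]; rewrite subrK mulfK //.
      have := congr1 (fun q : {poly E} => q`_i) eb; rewrite coef_comp_scaleX coefZ.
      have -> : d.-1 = (e + i)%N by rewrite /e; lia.
      rewrite exprD -{1}[b ^+ i]mul1r => /(mulIf gi0) /(mulIf (expf_neq0 i b0)) be.
      by rewrite /root !hornerE -be subrr.
    - rewrite map_inj_in_uniq // => z z' _ _ /(mulIf _) hh; apply: (@addIr _ dl); apply: hh.
      by rewrite invr_eq0.
  by rewrite size_map ss size_XnsubC // /e; lia.
have gd : g`_d.-1 = lead_coef p.
  have s2 : size ('X - dl%:P) = 2%N by rewrite size_XsubC.
  have sg : size g = d.
    have := size_comp_poly2 p s2; rewrite sp //.
  have := lead_coef_comp p (_ : (1 < size ('X - dl%:P)%R)%N); rewrite s2 => /(_ isT).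
  by rewrite lead_coefXsubC expr1n mulr1 lead_coefE -/g sg.
exists dl, g`_0; rewrite {1}eg; have -> : g = lead_coef p *: 'X^(d.-1) + (g`_0)%:P.
  apply/polyP => i; rewrite coefD coefZ coefXn coefC.
  have [->|i0] := eqVneq i 0%N; first by rewrite (ltn_eqF (_ : (0 < d.-1)%N)) ?mulr0 ?add0r //; lia.
  have [->|i1] := eqVneq i d.-1; first by rewrite mulr1 addr0.
  rewrite mulr0 addr0; have [hi|hi] := ltnP i d.-1; first by apply: gi; rewrite lt0n i0.
  rewrite nth_default // (size_comp_poly2 p) ?size_XsubC // sp; lia.
by rewrite comp_polyD comp_polyZ comp_Xn_poly comp_polyC coefD coefZ coefXn coefC eqxx
  (ltn_eqF (_ : (0 < d.-1)%N)) ?mulr0 ?add0r //; lia.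
Qed.
End AffineSymmetries.

Section Descent.
Variables (R : idomainType) (E : fieldType) (j : {rmorphism R -> E}) (x : E).
Variables (d : nat) (f : {poly R}).
Hypotheses (inj_j : injective j) (hd : (4 <= d)%N) (sf : size f = d) (pf : prime_elt f).
Hypotheses (chE : [pchar E] =i pred0) (fker : forall q, (map_poly j q).[x] = 0 -> divides f q).
Let ell := lead_coef f.
Let fE := map_poly j f.

Let f0 : f != 0. Proof. by rewrite -size_poly_gt0 sf; lia. Qed.
Let ell0 : ell != 0. Proof. by rewrite lead_coef_eq0. Qed.
Let jell0 : j ell != 0. Proof. by rewrite -(rmorph0 j) (inj_eq inj_j). Qed.
Let sfE : size fE = d. Proof. by rewrite size_map_poly_id0. Qed.
Let ledE : lead_coef fE = j ell. Proof. by rewrite lead_coef_map_id0 ?rmorph0. Qed.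

(** Phi(ell X) = ell^(d-1) f(X): it turns statements on z into statements on ell z, and
    substitutions into it keep coefficients in [R]. *)
Let Phi := \poly_(i < d) (f`_i * ell ^+ (d.-1 - i)).

Let Phi_scale : Phi \Po (ell *: 'X) = ell ^+ d.-1 *: f.
Proof.
rewrite /Phi poly_def linear_sum [f in RHS](_ : f = \sum_(i < d) f`_i *: 'X^i); last first.
  by rewrite -poly_def -sf coefK.
rewrite scaler_sumr; apply: eq_bigr => i _.
rewrite linearZ /= comp_Xn_poly exprZn !scalerA; congr (_ *: _).
by rewrite -mulrA -exprD subnK 1?[RHS]mulrC //; have := ltn_ord i; lia.
Qed.

Let PhiE_scale (u : {poly E}) : map_poly j Phi \Po (j ell *: u) = j ell ^+ d.-1 *: (fE \Po u).
Proof.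
have := congr1 (fun q => map_poly j q \Po u) Phi_scale.
rewrite map_comp_poly !map_polyZ /= map_polyX -comp_polyA.
rewrite !comp_polyZ comp_polyX => ->.
by rewrite rmorphXn.
Qed.

Let PhiE_root z : fE.[z] = 0 -> (map_poly j Phi).[j ell * z] = 0.
Proof.
move=> rz; have := PhiE_scale z%:P; rewrite -mul_polyC -polyCM !comp_polyCr rz scaler0.
by move/eqP; rewrite polyC_eq0 => /eqP.
Qed.

(** Such a root would split a linear factor off ell^(d-1) f, while [f] is prime of degree at least
    3. *)
Lemma no_base_root c z : j ell * z = j c -> fE.[z] <> 0.
Proof.
move=> ez /PhiE_root; rewrite ez horner_map => /eqP; rewrite -(rmorph0 j) (inj_eq inj_j).
move=> /factor_theorem [q eq]; have [_ _ hp] := pf.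
have e : ell ^+ d.-1 *: f = (q \Po (ell *: 'X)) * (ell *: 'X - c%:P).
  by rewrite -Phi_scale eq comp_polyM comp_polyB comp_polyX comp_polyC.
have s2 : size (ell *: 'X - c%:P) = 2%N.
  by rewrite size_polyDl size_scale ?size_polyX // size_polyN (leq_ltn_trans (size_polyC_leq1 _)).
have n2 : ell *: 'X - c%:P != 0 by rewrite -size_poly_gt0 s2.
have el0 : ell ^+ d.-1 != 0 by rewrite expf_neq0.
have /hp [[h eh]|[h eh]] : divides f ((q \Po (ell *: 'X)) * (ell *: 'X - c%:P)).
- by exists (ell ^+ d.-1)%:P; rewrite mul_polyC e.
- move: e; rewrite eh -mul_polyC mulrAC => /(mulIf f0) e.
  have := congr1 (fun q : {poly R} => size q) e; rewrite size_polyC el0.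
  have h0 : h != 0 by apply: contra_neq el0 => h0; apply/eqP; rewrite -polyC_eq0 e h0 mul0r.
  by rewrite size_mul // s2 addn2 /=; move: h0; rewrite -size_poly_gt0; case: (size h).
- have h0 : h != 0 by apply: contra_neq n2 => h0; rewrite eh h0 mul0r.
  have := congr1 (fun q : {poly R} => size q) eh; rewrite s2 size_mul // sf.
  by move: h0; rewrite -size_poly_gt0; lia.
Qed.

(** As z = b x + c is a root of [f], x is a root of f(b X + c); by minimality of [f] the two
    polynomials are proportional, and the leading coefficients give the factor b^(d-1). *)
Lemma root_symmetry be c z : j ell * z = j (be * ell) * x + j c -> fE.[z] = 0 ->
  exists b cc, [/\ b != 0, z = b * x + cc & fE \Po (b *: 'X + cc%:P) = b ^+ d.-1 *: fE].
Proof.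
move=> ez rz; have be0 : j be != 0.
  apply/eqP => be0; have := @no_base_root c z _ rz; apply.
  by rewrite ez rmorphM be0 !mul0r add0r.
exists (j be), (j c / j ell); split=> //.
  by apply: (mulfI jell0); rewrite ez rmorphM /=; field.
pose p := Phi \Po ((be * ell) *: 'X + c%:P).
have ejp : map_poly j p = j ell ^+ d.-1 *: (fE \Po (j be *: 'X + (j c / j ell)%:P)).
  rewrite -PhiE_scale map_comp_poly rmorphD /= map_polyZ map_polyX map_polyC /=.
  congr (_ \Po _); rewrite scalerDr scalerA -mul_polyC rmorphM [j ell * _]mulrC mul_polyC.
  by rewrite -[j ell *: (_)%:P]mul_polyC -polyCM mulrCA divff // mulr1.
have [|q eq] := fker (q := p).
  rewrite map_comp_poly horner_comp rmorphD /= map_polyZ map_polyX map_polyC /= !hornerE -ez.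
  exact: PhiE_root.
have sp : (size p <= d)%N.
  apply: leq_trans (size_comp_poly_leq _ _) _.
  have h1 : (size Phi <= d)%N by apply: size_poly.
  have h2 : (size ((be * ell) *: 'X + c%:P : {poly R})%R <= 2)%N.
    rewrite (leq_trans (size_polyD _ _)) // geq_max (leq_trans (size_scale_leq _ _)) ?size_polyX //.
    by rewrite (leq_trans (size_polyC_leq1 _)).
  have h3 : ((size ((be * ell) *: 'X + c%:P : {poly R})%R).-1 <= 1)%N by lia.
  have h4 : ((size Phi).-1 <= d.-1)%N by lia.
  by apply: leq_ltn_trans (leq_mul h4 h3) _; lia.
have sq : (size q <= 1)%N.
  have [->|q0] := eqVneq q 0; first by rewrite size_poly0.
  by move: sp; rewrite eq size_mul // sf; lia.
have [k ek] : exists k, fE \Po (j be *: 'X + (j c / j ell)%:P) = k *: fE.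
  exists (j q`_0 / j ell ^+ d.-1).
  have := congr1 (map_poly j) eq; rewrite ejp {1}(size1_polyC sq) mul_polyC map_polyZ.
  move=> h; apply: (scalerI (expf_neq0 d.-1 jell0)); rewrite h scalerA mulrCA divff ?mulr1 //.
  by rewrite expf_neq0.
rewrite ek; congr (_ *: _).
have s2 : size (j be *: 'X + (j c / j ell)%:P) = 2%N.
  by rewrite size_polyDl size_scale ?size_polyX // (leq_ltn_trans (size_polyC_leq1 _)).
have := lead_coef_comp fE (_ : (1 < size (j be *: 'X + (j c / j ell)%:P)%R)%N).
rewrite s2 => /(_ isT); rewrite ek lead_coefZ sfE ledE lead_coefDl; last first.
  by rewrite size_scale ?size_polyX // (leq_ltn_trans (size_polyC_leq1 _)).
by rewrite lead_coefZ lead_coefX mulr1 [_ * j ell]mulrC => /(mulfI jell0).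
Qed.

Hypotheses (natU : forall m, (0 < m)%N -> (m%:R : R) \is a GRing.unit)
  (sqell : forall a m, (0 < m)%N -> divides ell (a ^+ 2 *+ m) -> divides ell a).

(** Over [E] the symmetries give f = ell (X + dl)^(d-1) + e. The coefficients of index d - 2 and d -
    3 are (d-1) ell dl and C(d-1, 2) ell dl^2, undisturbed by e as d - 3 > 0. So [ell] divides a
    multiple of the square of the former, hence the former itself, and dl comes from [R]. *)
Lemma pure_form (s : seq E) : uniq s -> size s = d.-1 -> (forall z, z \in s -> fE.[z] = 0) ->
  (forall z, z \in s -> exists be c, j ell * z = j (be * ell) * x + j c) ->
  exists lam a0, f = ell *: ('X + lam%:P) ^+ d.-1 + a0%:P.
Proof.
move=> us ss rs hs; have [|dl [e eF]] := @affine_symmetries E d fE x s (ltnW hd) chE sfE us ss.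
  by move=> z zs; have [be [c h]] := hs z zs; apply: root_symmetry h (rs z zs).
rewrite ledE in eF.
have cf i : j f`_i = j ell * (dl ^+ (d.-1 - i) *+ 'C(d.-1, i)) + (e *+ (i == 0%N)).
  have := congr1 (fun q : {poly E} => q`_i) eF; rewrite coef_map /= => ->.
  by rewrite coefD coefZ coef_XaddC_exp coefC; case: eqP.
have c2 := cf d.-2; have c3 := cf (d - 3)%N.
rewrite gtn_eqF ?mulr0n ?addr0 in c2; last by lia.
rewrite gtn_eqF ?mulr0n ?addr0 in c3; last by lia.
have e2 : (d.-1 - d.-2)%N = 1%N by lia.
have e3 : (d.-1 - (d - 3))%N = 2%N by lia.
rewrite e2 expr1 -(bin_sub (_ : (d.-2 <= d.-1)%N)) ?e2 ?bin1 in c2; last by lia.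
rewrite e3 -(bin_sub (_ : (d - 3 <= d.-1)%N)) ?e3 in c3; last by lia.
have C2 : (0 < 'C(d.-1, 2))%N by rewrite bin_gt0; lia.
have [w ew] : divides ell f`_d.-2.
  apply: (sqell C2); exists (f`_(d - 3) *+ d.-1 ^ 2); apply: inj_j.
  have eN (a : R) m : j (a *+ m) = j a * m%:R by rewrite rmorphMn mulr_natr.
  rewrite eN rmorphM eN rmorphXn /= c2 c3 -[dl *+ _]mulr_natr -[dl ^+ 2 *+ _]mulr_natr natrX.
  by ring.
have U := natU (_ : (0 < d.-1)%N); have {U}U : (d.-1%:R : R) \is a GRing.unit by apply: U; lia.
have Uj : (d.-1%:R : E) != 0 by rewrite ((pcharf0P E).1 chE); lia.
pose lam := w / d.-1%:R.
have edl : dl = j lam.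
  have jl : j lam * d.-1%:R = j w by rewrite -(rmorph_nat j d.-1) -rmorphM divrK.
  apply: (mulfI jell0); apply: (mulIf Uj).
  by rewrite -[RHS]mulrA jl -[LHS]mulrA mulr_natr -c2 ew rmorphM mulrC.
exists lam, (f`_0 - ell * lam ^+ d.-1); apply: (map_inj_poly inj_j (rmorph0 j)).
rewrite -/fE {1}eF rmorphD /= map_polyZ rmorphXn /= rmorphD /= map_polyX !map_polyC /= -edl.
congr (_ + _%:P); rewrite rmorphB rmorphM rmorphXn -edl cf eqxx subn0 bin0 !mulr1n /=.
by rewrite addrAC subrr add0r.
Qed.
End Descent.

Section HomogeneousFacts.
Variable K : closedFieldType.

Lemma homog0_unit n (p : {mpoly K[n]}) : p \is 0.-homog -> p != 0 -> p \is a GRing.unit.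
Proof.
move=> hp p0; apply/mpoly_unitP; exists p@_0; last exact: homog0C.
by apply: contra_neq p0 => h; rewrite (homog0C hp) h mpolyC0.
Qed.

Lemma linear_prime n (l : {mpoly K[n]}) : l \is 1.-homog -> l != 0 -> prime_elt l.
Proof.
move=> hl l0; apply: (irr_prime (@ufd_mpoly K n)); split=> //.
  apply/negP => /mpoly_unitP [c c0 e].
  have : l \is 0.-homog by rewrite e -alg_mpolyC; apply: rpredZ; apply: dhomog1.
  by move=> h; have := dhomog_uniq l0 hl h.
move=> G H e; have GH0 : G * H != 0 by rewrite -e.
have [G0 H0] : G != 0 /\ H != 0 by apply/andP; move: GH0; rewrite mulf_eq0 negb_or.
have [k hk _] : exists2 k, G \is k.-homog & (k <= 1)%N.
  by apply: (@dhomog_factor _ _ _ G H) => //; rewrite -e.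
have [m hm _] : exists2 m, H \is m.-homog & (m <= 1)%N.
  by apply: (@dhomog_factor _ _ _ H G); rewrite mulrC // -e.
have := dhomog_uniq l0 hl (_ : l \is (k + m).-homog); rewrite e => /(_ (dhomogM hk hm)) km.
have [k0|m0] : k = 0%N \/ m = 0%N by lia.
  by left; apply: homog0_unit (dhomog_cast k0 hk) G0.
by right; apply: homog0_unit (dhomog_cast m0 hm) H0.
Qed.

Lemma linear_lin n (l : {mpoly K[n]}) : l \is 1.-homog -> exists c : 'cV[K]_n, l = lin c.
Proof.
move=> hl; exists (\col_i l@_U_(i)%MM); rewrite {1}[l]mpolyE big_seq /lin.
apply/mpolyP => m; rewrite -big_seq -mpolyE raddf_sum /=.
under eq_bigr => i _ do rewrite mxE mcoeffZ mcoeffX.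
have [hm|hm] := eqVneq (mdeg m) 1%N; last first.
  rewrite (dhomog_nemf_coeff hl) // big1 // => i _; case: eqP => [e|]; rewrite ?mulr0 //.
  by move: hm; rewrite -e mdeg1.
have /mdeg1P [i /eqP ->] : mdeg m == 1%N by apply/eqP.
rewrite (bigD1 i) //= eqxx mulr1 big1 ?addr0 // => k /negbTE hk.
by rewrite eq_mnm1 hk mulr0.
Qed.

Lemma mpoly_nat_unit n m : [pchar K] =i pred0 -> (0 < m)%N -> (m%:R : {mpoly K[n]}) \is a GRing.unit.
Proof.
move=> ch m0; apply/mpoly_unitP; exists m%:R; last by rewrite -mpolyC_nat.
by rewrite ((pcharf0P K).1 ch) -lt0n.
Qed.
End HomogeneousFacts.

Section CommonDenominator.
Variables (R : idomainType) (E M : fieldType) (j : {rmorphism R -> E}) (g : {rmorphism M -> E}).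
Hypothesis inj_j : injective j.

Lemma common_denominator (p : {poly M}) :
  (forall i, exists a b, b != 0 /\ g p`_i = j a / j b) ->
  exists q h, h != 0 /\ map_poly j q = j h *: map_poly g p.
Proof.
elim/poly_ind: p => [|p c IH] hp.
  by exists 0, 1; rewrite oner_neq0 !map_poly0 scaler0.
have [|q [h [h0 e]]] := IH.
  by move=> i; have := hp i.+1; rewrite coefD coefMX coefC addr0.
have [a [b [b0 ec]]] := hp 0%N; rewrite coefD coefMX coefC eqxx add0r in ec.
exists (b *: (q * 'X) + (h * a)%:P), (b * h); split; first by rewrite mulf_neq0.
have jb0 : j b != 0 by rewrite -(rmorph0 j) (inj_eq inj_j).
have e1 : map_poly j (b *: (q * 'X) + (h * a)%:P) = j b *: (map_poly j q * 'X) + (j h * j a)%:P.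
  by rewrite raddfD /= map_polyZ (rmorphM (map_poly j)) /= map_polyX map_polyC /= rmorphM.
have e2 : map_poly g (p * 'X + c%:P) = map_poly g p * 'X + (g c)%:P.
  by rewrite raddfD /= (rmorphM (map_poly g)) /= map_polyX map_polyC.
rewrite e1 e2 e scalerDr -scalerAl scalerA rmorphM; congr (_ + _).
by rewrite -mul_polyC -polyCM ec; congr _%:P; field.
Qed.
End CommonDenominator.

Lemma prod_XsubC_scale (E : fieldType) (w : E) (s : seq E) : w != 0 ->
  \prod_(b <- s) ('X - b%:P) \Po (w^-1 *: 'X) =
  w ^- size s *: \prod_(b <- s) ('X - (w * b)%:P).
Proof.
move=> w0; elim: s => [|b s IH]; first by rewrite !big_nil expr0 invr1 scale1r comp_polyC.
rewrite !big_cons comp_polyM IH comp_polyB comp_polyX comp_polyC.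
have -> : w^-1 *: 'X - b%:P = w^-1 *: ('X - (w * b)%:P).
  by rewrite scalerBr -[_ *: (w * b)%:P]mul_polyC -polyCM mulKf.
by rewrite -scalerAl -scalerAr scalerA /= exprS invfM.
Qed.

(** * From a Galois group to a pure equation *)

Section ForwardGalois.
Variables (K : closedFieldType) (charK : [pchar K] =i pred0) (n d : nat) (F : {mpoly K[n.+2]}).
Hypotheses (hd : (4 <= d)%N) (hF : F \is d.-homog) (irrF : irreducible_elt F).
Hypotheses (Fl : F.@[elast K n.+1 0] = 0) (smooth : ~ singular F (elast K n.+1)).
Local Notation R := {mpoly K[n.+1]}.
Let f : {poly R} := muni F.
Let ell := f`_d.-1.

(** [ell] is the differential of [F] at the last basis vector: without it [F] vanishes there to
    order two in every direction. *)
Lemma smooth_lead : ell != 0.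
Proof.
apply: contra_notN smooth => /eqP l0; apply: singular_dird => // u.
have [w [t ->]] := rowptE u; rewrite dird_deriv0.
have -> : linep F (elast K n.+1) (rowpt w t) =
    'X^2 * \sum_(k < d.-1) (f`_k).@[w 0] *: ('X^(d - 2 - k) * (1%:P + t *: 'X) ^+ k).
  apply: poly_ext => s; rewrite linep_eval -rowpt_delta rowpt_scale.
  have -> : rowpt 0 1 + rowpt (s *: w) (s * t) = rowpt (s *: w) (1 + s * t).
    by apply/rowP => i; rewrite !mxE; case: unliftP => [k _|_]; rewrite ?mxE ?add0r.
  rewrite meval_rowpt -/f hornerM hornerXn horner_sum.
  have sz : (size (map_poly (meval ((s *: w)%R 0%R)) f) <= d.-1)%N.
    apply/leq_sizeP => k hk; rewrite coef_map /=.
    have [->|k1] := eqVneq k d.-1; first by rewrite -/ell l0 meval0.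
    have [->|k2] := eqVneq k d; first by rewrite /f (coef_muni_top hF) Fl mpolyC0 meval0.
    by rewrite /f (coef_muni_big hF) ?meval0 //; lia.
  rewrite (horner_coef_wide _ sz) mulr_sumr; apply: eq_bigr => k _.
  have hk := ltn_ord k; rewrite coef_map /= (dhomog_eval_scale _ _ (coef_muni_homog hF _)); last by lia.
  rewrite hornerZ hornerM hornerXn horner_exp hornerD hornerC hornerZ hornerX.
  have -> : (d - k = 2 + (d - 2 - k))%N by lia.
  by rewrite exprD [s * t]mulrC -!mulrA; do 2!congr (_ * _); apply: mulrCA.
by rewrite derivM derivXn hornerD !hornerM hornerMn !hornerXn expr0n /= !(mul0r, mul0rn, mulr0n, addr0).
Qed.

Let size_f : size f = d.
Proof.
apply/eqP; rewrite eqn_leq; apply/andP; split.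
  apply/leq_sizeP => k hk; have [->|k2] := eqVneq k d.
    by rewrite /f (coef_muni_top hF) Fl mpolyC0.
  by rewrite /f (coef_muni_big hF) //; lia.
rewrite leqNgt; apply: contraNN smooth_lead => h.
have h' : (size f <= d.-1)%N by lia.
by rewrite /ell nth_default.
Qed.
Let lead_f : lead_coef f = ell. Proof. by rewrite lead_coefE size_f. Qed.
Let ell_homog : ell \is 1.-homog.
Proof. by apply: dhomog_cast (coef_muni_homog hF _); lia. Qed.
Let ell_prime : prime_elt ell. Proof. exact: linear_prime ell_homog smooth_lead. Qed.
Let prime_f : prime_elt f.
Proof. by apply/prime_muni; apply: irr_prime irrF; apply: ufd_mpoly. Qed.

Variables (E : fieldType) (iota : {rmorphism {mpoly K[n.+2]} -> E}).
Hypothesis iF : coord_fraction_field F iota.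
Hypothesis normal : forall G g H h (P : {poly {mpoly K[n.+2]}}),
  G \is g.-homog -> H \is h.-homog -> iota H != 0 -> P \is monic ->
  root (map_poly iota P) (iota G / iota H) -> exists Y, iota G / iota H = iota Y.
Variables (j : {rmorphism R -> E}) (x : E).
Hypotheses (jE : forall a, j a = iota (mwiden a))
  (jx : forall q, (map_poly j q).[x] = iota (munif q)).

Let fker q : (map_poly j q).[x] = 0 -> divides f q.
Proof. by rewrite jx => /(iota_eq0 iF). Qed.

Let inj_j : injective j.
Proof.
move=> a b /eqP; rewrite -subr_eq0 -rmorphB => /eqP e; apply/eqP; rewrite -subr_eq0.
apply/negPn/negP => ab0; have [|q eq] := fker (q := (a - b)%:P).
  by rewrite map_polyC hornerC.
have q0 : q != 0 by apply: contra_neq ab0 => q0; apply/eqP; rewrite -polyC_eq0 eq q0 mul0r.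
have f0 : f != 0 by rewrite -size_poly_gt0 size_f; lia.
have := congr1 (fun q : {poly R} => size q) eq; rewrite size_polyC ab0 size_mul // size_f.
by move: q0; rewrite -size_poly_gt0; lia.
Qed.

Let j_eq0 a : (j a == 0) = (a == 0). Proof. by rewrite -(rmorph0 j) (inj_eq inj_j). Qed.

Let charE : [pchar E] =i pred0.
Proof.
by move=> p; rewrite -charK -(fmorph_pchar (iota \o @mpolyC n.+2 K : {rmorphism _ -> _})).
Qed.

Let sqell a m : (0 < m)%N -> divides ell (a ^+ 2 *+ m) -> divides ell a.
Proof.
move=> m0; rewrite -mulr_natr; have [_ _ h] := ell_prime => /h [|/(prime_unit ell_prime)].
  exact: prime_exp.
by rewrite mpoly_nat_unit // => /(_ isT).
Qed.

(** Monic, with Phi'(ell X) = ell^(d-2) f(X): it makes ell z integral for every root z of [f]. *)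
Let Phi' : {poly R} := \poly_(i < d) (if i == d.-1 then 1 else f`_i * ell ^+ (d.-2 - i)).

Let monic_Phi' : Phi' \is monic.
Proof.
by rewrite monicE lead_coefE size_poly_eq ?eqxx ?oner_eq0 // coef_poly eqxx ltn_predL; case: ifP => //; lia.
Qed.

Let Phi'_root z : (map_poly j f).[z] = 0 -> (map_poly j Phi').[j ell * z] = 0.
Proof.
move=> rz; have l0 : j ell != 0 by rewrite j_eq0 smooth_lead.
apply: (mulfI l0); rewrite mulr0 -(mulr0 (j ell ^+ d.-1)) -rz.
have sz : (size (map_poly j Phi') <= d)%N by apply: leq_trans (size_poly _ _) (size_poly _ _).
have sf : (size (map_poly j f) <= d)%N by rewrite -size_f; apply: size_poly.
rewrite (horner_coef_wide _ sz) (horner_coef_wide _ sf) !mulr_sumr; apply: eq_bigr => i _.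
have hi := ltn_ord i; rewrite !coef_map /= coef_poly hi exprMn.
case: eqP => [->|ne]; first by rewrite rmorph1 mul1r -/ell; ring.
have -> : j ell ^+ d.-1 = j ell * (j ell ^+ (d.-2 - i) * j ell ^+ i).
  by rewrite -exprD -exprS; congr (_ ^+ _); lia.
by rewrite rmorphM rmorphXn /=; ring.
Qed.

(* A root [z] of [f] of degree 1 in the function field: [ell * z] is integral,
   hence the class of a quadratic form, and comparing leading coefficients
   leaves no quadratic term in the last variable. *)
Lemma integral_root e G H z : G \is e.-homog -> H \is e.-homog -> iota H != 0 ->
  z = j 'X_ord0 * (iota G / iota H) -> (map_poly j f).[z] = 0 ->
  exists be c, j ell * z = j (be * ell) * x + j c.
Proof.
move=> hG hH H0 ez rz; pose G' := mwiden ell * (mwiden 'X_ord0 * G).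
have hG' : G' \is (2 + e).-homog.
  have hX : ('X_ord0 : R) \is 1.-homog by rewrite dhomogX /= mdeg1.
  apply: (dhomogM (d := 1) (e := 1 + e)); first exact: dhomog_widen ell_homog.
  by apply: dhomogM => //; apply: dhomog_widen.
have ez' : j ell * z = iota G' / iota H by rewrite ez !jE /G' !rmorphM /= !mulrA.
have [|Y eY] := normal hG' hH H0 (monic_map (@mwiden n.+1 K) monic_Phi').
  rewrite -map_poly_comp (_ : map_poly _ Phi' = map_poly j Phi').
    by rewrite /root -ez' Phi'_root.
  by apply: eq_map_poly => a /=; rewrite jE.
rewrite -ez' in eY; pose Y2 := pihomog mdeg 2 Y.
(* Y H - G' is a multiple of the form [F], hence so is its component of degree 2 + e. *)
have eY2 : j ell * z = iota Y2.
  have [Q eQ] : exists Q, Y * H - G' = Q * F.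
    by apply/iF.1; rewrite rmorphB rmorphM -eY ez' divfK // subrr.
  apply: (mulIf H0); rewrite {1}ez' divfK // -rmorphM; apply/eqP; rewrite -subr_eq0 -rmorphB.
  have -> : G' - Y2 * H = - pihomog mdeg (2 + e) (Y * H - G').
    have e1 : pihomog mdeg (2 + e) (Y * H) = Y2 * H.
      by rewrite [(2 + e)%N]addnC mulrC (pihomogMl _ _ hH) mulrC.
    by rewrite raddfB /= e1 (pihomog_dE hG') opprB.
  rewrite eQ rmorphN oppr_eq0; apply/eqP/iF.1; rewrite mulrC.
  have [de|de] := leqP d (2 + e).
    by exists (pihomog mdeg (2 + e - d) Q); rewrite -{1}(subnKC de) (pihomogMl _ _ hF) mulrC.
  by exists 0; rewrite (pihomogMr_lt _ hF de) mul0r.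
have hY2 : Y2 \is 2.-homog by apply: pihomogP.
pose q := muni Y2; have jq : j ell * z = (map_poly j q).[x] by rewrite jx muniK.
have sq : (size q <= 3)%N by apply/leq_sizeP => i hi; rewrite /q (coef_muni_big hY2).
have [h eh] : divides f (Phi' \Po q).
  by apply: fker; rewrite map_comp_poly horner_comp -jq Phi'_root.
have sP : size Phi' = d by rewrite size_poly_eq ?eqxx ?oner_eq0.
have [w ew] : exists w, q = (w * ell) *: 'X + (q`_0)%:P; last first.
  by exists w, q`_0; rewrite jq {1}ew rmorphD /= map_polyZ map_polyX map_polyC !hornerE.
have [sq1|sq1] := leqP (size q) 1.
  by exists 0; rewrite mul0r scale0r add0r -size1_polyC.
have /(prime_exp ell_prime) lq : divides ell (lead_coef q ^+ d.-1).
  exists (lead_coef h); rewrite -lead_f -lead_coefM -eh lead_coef_comp //.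
  by rewrite (monicP monic_Phi') mul1r sP.
have q0 : q != 0 by rewrite -size_poly_gt0 (ltnW sq1).
have [s2|s2] := eqVneq (size q) 2%N.
  case: lq => w ew; exists w; apply/polyP => i; rewrite -ew coefD coefZ coefX coefC lead_coefE s2 /=.
  case: i => [|[|i]]; rewrite ?mulr0 ?add0r ?mulr1 ?addr0 // nth_default ?s2 //.
case: (prime_unit ell_prime _ lq); apply: homog0_unit; last by rewrite lead_coef_eq0.
rewrite lead_coefE; have -> : (size q).-1 = 2%N by move: sq sq1 s2; clear; lia.
by apply: dhomog_cast (coef_muni_homog hY2 _).
Qed.

Hypothesis gal : galois_subfields
  [set z | exists e (G H : R), [/\ G \is e.-homog, H \is e.-homog, j H != 0 & z = j G / j H]]
  (function_field iota).
Hypothesis xE : x = iota 'X_ord_max.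

(** The minimal polynomial of x / X_0 over the base splits into distinct linear factors in K(X).
    Cleared of denominators and homogenized with X_0 it has the root [x]; so [f] divides it, and the
    roots of [f] are products of X_0 with elements of K(X). *)
Lemma galois_roots : exists s : seq E, [/\ uniq s, size s = d.-1 &
  forall z, z \in s -> (map_poly j f).[z] = 0 /\
    exists be c, j ell * z = j (be * ell) * x + j c].
Proof.
case: gal => k0 [M [psi [psiL psik galM]]].
pose w := j 'X_ord0; have w0 : w != 0 by rewrite j_eq0 mpolyX_neq0.
have [t _ et] : (psi @` setT) (x / w).
  rewrite psiL; exists 1%N, 'X_ord_max, (mwiden 'X_ord0); rewrite -jE -/w -xE.
  by split=> //; [rewrite dhomogX /= mdeg1|apply: dhomog_widen; rewrite dhomogX /= mdeg1].
have /(galois_factors (sub1v _)) /(_ t (memvf t)) [r /= [_ ur em]] := galM.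
set ra := [seq _ | _ <- r] in ur em.
have [|q [h [h0 eq]]] := @common_denominator R E M j psi inj_j (minPoly 1 t).
  move=> i; have : (psi @` [set y : M | y \in 1%VS]) (psi (minPoly 1 t)`_i).
    by exists (minPoly 1 t)`_i => //; apply: (polyOverP (minPolyOver _ _)).
  by rewrite psik => -[e [G [H [_ _ H0 ->]]]]; exists G, H; rewrite -j_eq0.
pose q' := \poly_(i < size q) (q`_i * 'X_ord0 ^+ (size q - i)) : {poly R}.
have eq' : map_poly j q' = w ^+ size q *: (map_poly j q \Po (w^-1 *: 'X)).
  apply/polyP => i; rewrite coef_map /= coefZ coef_comp_scaleX coef_map /= coef_poly.
  case: ltnP => hi; last by rewrite nth_default // rmorph0 !mulr0.
  rewrite rmorphM rmorphXn -/w -{2}(subnK (ltnW hi)) exprD -mulrA [w ^+ i * _]mulrA -exprMn.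
  by rewrite divff // expr1n mul1r mulrC.
pose zs := [seq w * psi b | b <- ra].
have uzs : uniq zs.
  by rewrite map_inj_uniq // => b b' /(mulfI w0) /fmorph_inj.
have emap : map_poly j q' = (w ^+ size q * j h * w ^- size (map psi ra)) *: \prod_(z <- zs) ('X - z%:P).
  rewrite eq' eq em rmorph_prod comp_polyZ /=.
  have -> : \prod_(i <- ra) map_poly psi ('X - i%:P) = \prod_(b <- map psi ra) ('X - b%:P).
    by rewrite big_map; apply: eq_bigr => b _; rewrite rmorphB /= map_polyX map_polyC.
  by rewrite prod_XsubC_scale // !scalerA /zs !big_map.
have c0 : w ^+ size q * j h * w ^- size (map psi ra) != 0.
  apply: mulf_neq0; last by rewrite invr_eq0 expf_neq0.
  by apply: mulf_neq0; [exact: expf_neq0|rewrite j_eq0].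
have [|g eg] := fker (q := q').
  rewrite eq' hornerZ horner_comp hornerZ hornerX mulrC.
  have -> : (map_poly j q).[w^-1 * x] = 0; last by rewrite mul0r.
  by rewrite mulrC -et eq hornerZ horner_map minPolyxx rmorph0 mulr0.
have : map_poly j f %| \prod_(z <- zs) ('X - z%:P).
  by rewrite -(dvdpZr _ _ c0) -emap eg rmorphM dvdp_mulIr.
move=> /(@dvdp_prod_XsubC _ _ zs id) [m em'].
have f0 : map_poly j f != 0 by rewrite -size_poly_gt0 size_map_inj_poly ?rmorph0 // size_f (leq_trans _ hd).
exists (mask m zs); split; first exact: mask_uniq.
  by have := eqp_size em'; rewrite size_prod_XsubC size_map_inj_poly ?rmorph0 // size_f => ->.
move=> z zm; have rz : (map_poly j f).[z] = 0.
  by apply/rootP; rewrite (eqp_root em') root_prod_XsubC.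
split=> //; have /mapP [b _ ez] := mem_mask zm.
have : function_field iota (psi b) by rewrite -psiL; exists b.
move=> [e [G [H [hG hH H0 eb]]]]; apply: integral_root hG hH H0 _ rz.
by rewrite ez eb.
Qed.

(** The shift is a linear form because (d-1) ell lam is the coefficient of index d - 2, a quadratic
    form. *)
Lemma normal_form : exists lam a0 : R, lam \is 1.-homog /\ f = ell *: ('X + lam%:P) ^+ d.-1 + a0%:P.
Proof.
have [s [us ss hs]] := galois_roots.
have sq a m : (0 < m)%N -> divides (lead_coef f) (a ^+ 2 *+ m) -> divides (lead_coef f) a.
  by rewrite lead_f; apply: sqell.
have hs' z : z \in s -> exists be c, j (lead_coef f) * z = j (be * lead_coef f) * x + j c.
  by rewrite lead_f => /hs [].
have [lam [a0 e]] := @pure_form R E j x d f inj_j hd size_f prime_f charE fker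
   (fun m => mpoly_nat_unit n.+1 charK (m := m)) sq s us ss (fun z zs => (hs z zs).1) hs'.
exists lam, a0; split; last by rewrite -lead_f.
rewrite lead_f in e; have [->|lam0] := eqVneq lam 0; first exact: dhomog0.
have h2 : f`_d.-2 \is 2.-homog by apply: dhomog_cast (coef_muni_homog hF _); lia.
have e2 : f`_d.-2 = (ell * d.-1%:R) * lam.
  rewrite e coefD coefZ coef_XaddC_exp coefC gtn_eqF ?addr0; last by lia.
  have -> : (d.-1 - d.-2 = 1)%N by lia.
  rewrite expr1 -(bin_sub (_ : (d.-2 <= d.-1)%N)); last by lia.
  have -> : (d.-1 - d.-2 = 1)%N by lia.
  by rewrite bin1 -mulrA [_ * lam]mulrC mulr_natr.
have uN : (d.-1%:R : R) \is a GRing.unit by apply: mpoly_nat_unit charK _; lia.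
have N0 : ell * d.-1%:R != 0 :> R.
  by rewrite mulf_neq0 ?smooth_lead //; apply: contraTneq uN => ->; rewrite unitr0.
have p0 : ell * d.-1%:R * lam != 0 by rewrite mulf_neq0.
have [k hk _] : exists2 k, lam \is k.-homog & (k <= 2)%N.
  by apply: (@dhomog_factor _ _ _ lam (ell * d.-1%:R)); rewrite mulrC // -e2.
have hN : ell * d.-1%:R \is 1.-homog.
  by rewrite mulr_natr; apply: rpredMn.
have := dhomog_uniq p0 (dhomogM hN hk) (_ : _ \is 2.-homog); rewrite -e2 => /(_ h2) k1.
by apply: dhomog_cast hk; move: k1; clear; lia.
Qed.
End ForwardGalois.

(** * The equation of a Galois point *)

(* [v] is, up to the smoothness of [F] at [v], a Galois point of [F = 0] lying
   on it: in coordinates in which [v] is the last basis vector and [L] the last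
   variable, [F = l X^(d-1) + G] with [l] and [G] free of [X]. *)
Definition galois_form (K : closedFieldType) n d (F : {mpoly K[n]}) (v : 'rV[K]_n) :=
  exists l L : 'cV[K]_n, [/\ l != 0, v *m l = 0, (v *m L) 0 0 = 1 &
    forall x : 'rV[K]_n, F.@[x 0] = (x *m l) 0 0 * (x *m L) 0 0 ^+ d.-1
      + F.@[(x - (x *m L) 0 0 *: v) 0]].

Section GaloisFormForward.
Variable K : closedFieldType.

Lemma mwiden_subst n (p : {mpoly K[n]}) : mwiden p = subst (prmx K n) p.
Proof.
apply: mpoly_ext => x; have [y [t ->]] := rowptE x.
by rewrite mwiden_eval subst_eval rowpt_prmx.
Qed.

Lemma comp_linear_forms n (B : 'M[K]_(n.+1, n)) G : G \mPo linear_forms B = subst B G.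
Proof.
rewrite /subst; congr (_ \mPo _); apply: eq_from_tnth => i; rewrite !tnth_mktuple.
by apply: eq_bigr => k _; rewrite mxE.
Qed.

Lemma elast_prmx n : elast K n *m prmx K n = 0.
Proof. by rewrite -rowpt_delta rowpt_prmx. Qed.

Lemma prmx_section n : (prmx K n)^T *m prmx K n = 1%:M.
Proof.
apply/row_matrixP => i; rewrite row_mul row1.
have -> : row i (prmx K n)^T = rowpt (delta_mx 0 i) 0.
  apply/rowP => k; rewrite !mxE; case: unliftP => [k' ->|->].
    by rewrite (inj_eq lift_inj) mxE eqxx eq_sym.
  by rewrite eq_sym (negbTE (neq_lift _ _)).
by rewrite rowpt_prmx.
Qed.

Lemma exists_dual n (v : 'rV[K]_n) : v != 0 -> exists c : 'cV[K]_n, v *m c = 1%:M.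
Proof.
move=> v0; have [i hi] := row_neq0 v0; exists ((v 0 i)^-1 *: delta_mx i 0).
by apply/rowP => k; rewrite ord1 -scalemxAr -colE !mxE eqxx mulVf.
Qed.

(** The inverse of [T] has the columns of [B] followed by [c]; it is invertible since the kernel of
    [B] is the line of [v], on which [c] is not zero. In the new coordinates the projection forgets
    the last one, and this is the form [c]. *)
Lemma projection_frame n (B : 'M[K]_(n.+1, n)) (v : 'rV[K]_n.+1) (c : 'cV[K]_n.+1) :
  \rank B = n -> v *m B = 0 -> v *m c = 1%:M ->
  exists T, [/\ T \in unitmx, elast K n *m T = v, invmx T *m prmx K n = B &
    T *m c = (elast K n)^T].
Proof.
move=> rB vB vc.
have v0 : v != 0.
  by apply: contraTneq (oner_neq0 'M[K]_1) => v0; rewrite -[1]vc v0 mul0mx eqxx.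
pose D := B *m (prmx K n)^T + c *m elast K n.
have vD : v *m D = elast K n by rewrite mulmxDr !mulmxA vB mul0mx add0r vc mul1mx.
have DB : D *m prmx K n = B.
  by rewrite mulmxDl -!mulmxA prmx_section mulmx1 elast_prmx mulmx0 addr0.
have uD : D \in unitmx.
  rewrite -row_free_unit -kermx_eq0; apply/eqP/row_matrixP => k; rewrite row0.
  set x := row k _; have xD : x *m D = 0 by apply/sub_kermxP; apply: row_sub.
  have xB : x *m B = 0 by rewrite -DB mulmxA xD mul0mx.
  have kv : (kermx B <= v)%MS.
    have vk : (v <= kermx B)%MS by apply/sub_kermxP.
    have := mxrank_leqif_sup vk; rewrite mxrank_ker rB subSnn rank_rV v0 => -[_ <-].
    by [].
  have /sub_rVP [a ea] : (x <= v)%MS by apply: submx_trans kv; apply/sub_kermxP.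
  move: xD; rewrite ea -scalemxAl vD => /rowP /(_ ord_max); rewrite !mxE !eqxx mulr1 => ->.
  by rewrite scale0r.
have Dc : D *m (elast K n)^T = c.
  rewrite mulmxDl -!mulmxA -trmx_mul elast_prmx trmx0 mulmx0 add0r.
  rewrite -[RHS]mulmx1; congr (_ *m _); apply/matrixP => i k; rewrite !ord1 mxE.
  by rewrite (bigD1 ord_max) //= big1 => [|m hm]; rewrite !mxE !eqxx ?mulr1 ?addr0 // (negbTE hm) mul0r.
exists (invmx D); split; rewrite ?unitmx_inv ?invmxK //; first by rewrite -vD mulmxK.
by rewrite -Dc mulKmx.
Qed.

Variables (charK : [pchar K] =i pred0) (n d : nat) (F : {mpoly K[n.+2]}) (s : int).
Hypotheses (hd : (4 <= d)%N) (hF : F \is d.-homog) (irrF : irreducible_elt F).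
Hypotheses (hs : has_dim (Sing F) s) (hsn : s <= n%:Z - 2).

Lemma Delta_galois_form P v : Delta F P -> v \in val P -> v != 0 ->
  [/\ F.@[v 0] = 0, ~ singular F v & galois_form d F v].
Proof.
move=> [[FP smP] [_ [E [iota [B [iF [rB hB] gal]]]]]] vP v0.
have Fv : F.@[v 0] = 0 by apply: FP.
have sv : ~ singular F v.
  by move=> /(cone_of_Sing hF v0) /(cone_of_point vP v0).
split=> //; have [c0 vc0] := exists_dual v0.
have [T [uT eT TB _]] := projection_frame rB (hB v vP) vc0.
pose F' := subst T F; have hF' : F' \is d.-homog by apply: dhomog_subst.
have Fl : F'.@[elast K n.+1 0] = 0 by rewrite subst_eval eT.
have sF' : ~ singular F' (elast K n.+1) by move=> /(singular_subst uT); rewrite eT.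
pose iota' : {rmorphism {mpoly K[n.+2]} -> E} := (iota \o subst (invmx T) : {rmorphism _ -> _}).
have iF' : coord_fraction_field F' iota' := coord_fraction_subst uT iF.
have ei p : iota p = iota' (subst T p) by rewrite /iota' /= substVK.
have irrF' := irreducible_subst uT irrF.
have normal G g H h (P' : {poly {mpoly K[n.+2]}}) : G \is g.-homog -> H \is h.-homog ->
    iota' H != 0 -> P' \is monic -> root (map_poly iota' P') (iota' G / iota' H) ->
    exists Y, iota' G / iota' H = iota' Y.
  move=> hG hH H0 mP rP.
  have [|Y eY] := normality (P := map_poly (subst (invmx T)) P') hF irrF hs hsn iF
    (dhomog_subst (invmx T) hG) (dhomog_subst (invmx T) hH) H0 (monic_map _ mP).
    by rewrite -map_poly_comp.
  by exists (subst T Y); rewrite -ei -eY.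
pose j : {rmorphism {mpoly K[n.+1]} -> E} := (iota' \o @mwiden n.+1 K : {rmorphism _ -> _}).
have jE a : j a = iota' (mwiden a) by [].
pose x := iota' 'X_ord_max.
have jx q : (map_poly j q).[x] = iota' (munif q).
  by rewrite /munif /x -horner_map -map_poly_comp.
have jB G : j G = iota (G \mPo linear_forms B).
  by rewrite jE mwiden_subst /iota' /= subst_comp TB comp_linear_forms.
have gal' : galois_subfields
    [set z | exists e (G H : {mpoly K[n.+1]}), [/\ G \is e.-homog, H \is e.-homog, j H != 0 & z = j G / j H]]
    (function_field iota').
  have -> : function_field iota' = function_field iota.
    apply/seteqP; split=> z [e [G [H [hG hH H0 ->]]]].
      by exists e, (subst (invmx T) G), (subst (invmx T) H); split; rewrite // dhomog_subst.
    by exists e, (subst T G), (subst T H); split; rewrite ?dhomog_subst // -!ei.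
  suff -> : [set z | exists e (G H : {mpoly K[n.+1]}), [/\ G \is e.-homog, H \is e.-homog, j H != 0 & z = j G / j H]]
    = pullback_field iota B by [].
  apply/seteqP; split=> z [e [G [H [hG hH H0 ->]]]]; exists e, G, H.
    by rewrite -!jB.
  by rewrite !jB.
have [lam [a0 [hlam ef]]] := normal_form charK hd hF' irrF' Fl sF' iF' normal jE jx gal' erefl.
have hl : (muni F')`_d.-1 \is 1.-homog by apply: dhomog_cast (coef_muni_homog hF' _); move: hd; clear; lia.
have l0 := smooth_lead hd hF' Fl sF'.
have [c ec] := linear_lin hl; have [c' ec'] := linear_lin hlam.
have F'E (y : 'rV[K]_n.+1) t : F'.@[(rowpt y t) 0] = (y *m c) 0 0 * (t + (y *m c') 0 0) ^+ d.-1 + a0.@[y 0].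
  rewrite meval_rowpt ef ec rmorphD /= map_polyZ rmorphXn /= rmorphD /= map_polyX !map_polyC /=.
  by rewrite !hornerE lin_eval ec' lin_eval.
pose l := B *m c; pose L := invmx T *m (prmx K n.+1 *m c' + (elast K n.+1)^T).
have vi : v *m invmx T = elast K n.+1 by rewrite -eT mulmxK.
exists l, L; split.
- apply: contra_neq l0 => h; rewrite ec; have -> : c = 0; last first.
    by rewrite /lin big1 // => i _; rewrite mxE scale0r.
  have := rB; rewrite -mxrank_tr => /eqP fB.
  apply: trmx_inj; rewrite trmx0; apply: (@row_free_inj _ _ _ _ (B^T) fB).
  by rewrite mul0mx -trmx_mul -/l h trmx0.
- by rewrite /l mulmxA hB // mul0mx.
- rewrite /L mulmxA vi mulmxDr mulmxA elast_prmx mul0mx add0r.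
  by rewrite mxE (bigD1 ord_max) //= big1 => [|i hi]; rewrite !mxE ?eqxx ?mulr1 ?addr0 // (negbTE hi) mul0r.
move=> u; have [y [t e]] := rowptE (u *m invmx T).
have eu : u = rowpt y t *m T by rewrite -e mulmxKV.
have uL : (u *m L) 0 0 = t + (y *m c') 0 0.
  rewrite /L mulmxA e mulmxDr mulmxA rowpt_prmx mxE addrC; congr (_ + _).
  by rewrite mxE (bigD1 ord_max) //= big1 => [|i hi]; rewrite !mxE ?eqxx ?mulr1 ?addr0 ?unlift_none // (negbTE hi) mulr0.
have ul : (u *m l) 0 0 = (y *m c) 0 0 by rewrite /l mulmxA -TB mulmxA e rowpt_prmx.
have -> : u - (u *m L) 0 0 *: v = rowpt y (- (y *m c') 0 0) *m T.
  rewrite uL eu -eT scalemxAl -mulmxBl; congr (_ *m _); rewrite -rowpt_delta rowpt_scale scaler0 mulr1.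
  by apply/rowP => i; rewrite !mxE; case: unliftP => [k _|_]; rewrite ?mxE ?subr0 // opprD addrA subrr add0r.
rewrite {1}eu -!subst_eval -/F' !F'E uL ul addNr expr0n gtn_eqF ?mulr0 ?add0r //.
by move: hd; clear; lia.
Qed.
End GaloisFormForward.

(** * Kummer extensions *)

Section SubfieldType.
Variables (E : fieldType) (S : divringClosed E).
(** The subset [S] of [E] as a field type: the degree zero fractions have to serve as the base field
    of an extension. *)
Record subfield := Subfield { subfield_val : E; _ : subfield_val \in S }.
HB.instance Definition _ := [isSub for subfield_val].
HB.instance Definition _ := [Choice of subfield by <:].
HB.instance Definition _ := [SubChoice_isSubIntegralDomain of subfield by <:].
HB.instance Definition _ := [SubIntegralDomain_isSubField of subfield by <:].
End SubfieldType.

Section Fractions.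
Variable R : idomainType.
Local Notation Q := {fraction R}.
Local Notation frac := (@FracField.tofrac R).

Lemma fraction_quotient (x : Q) : exists a b, b != 0 /\ x = frac a / frac b.
Proof.
elim/quotW: x => r; exists (fraction.frac r).1, (fraction.frac r).2; split; first exact: denom_ratioP.
have b0 : frac (fraction.frac r).2 != 0 by rewrite tofrac_eq0 denom_ratioP.
apply: (mulIf b0); rewrite mulfVK //.
have -> : \pi_(Q)%qT r * frac (fraction.frac r).2 = FracField.mul (\pi_(Q)%qT r) (frac (fraction.frac r).2) by [].
rewrite !piE; apply/eqP; rewrite piE /FracField.equivf /FracField.mulf.
by rewrite !numden_Ratio ?(oner_eq0, mulf_neq0, denom_ratioP) // !mulr1 mulrC.
Qed.

Lemma tofrac_inj : injective frac.
Proof. by move=> a b /eqP; rewrite tofrac_eq => /eqP. Qed.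

Lemma clear_denominators (q : {poly Q}) :
  exists q' h, h != 0 /\ map_poly frac q' = frac h *: q.
Proof.
have [|q' [h [h0 e]]] := @common_denominator R Q Q frac idfun tofrac_inj q.
  by move=> i; apply: fraction_quotient.
by exists q', h; rewrite e map_poly_id.
Qed.

Variables (f : {poly R}) (pf : prime_elt f) (sf : (1 < size f)%N).

(** Clearing denominators in a factorization over the fraction field gives one of a constant
    multiple of [f] over [R]; [f] divides one of the factors, and sizes decide which. *)
Lemma prime_irreducible_fraction : irreducible_poly (map_poly frac f).
Proof.
have sm p : size (map_poly frac p) = size p by rewrite size_map_inj_poly ?rmorph0 //; exact: tofrac_inj.
have p0 : map_poly frac f != 0 by rewrite -size_poly_gt0 sm ltnW.
split; first by rewrite sm.
move=> q sq hq; rewrite -dvdp_size_eqp //; have [r er] := dvdpP _ _ hq.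
have [q0 r0] : q != 0 /\ r != 0 by apply/andP; move: p0; rewrite er mulf_eq0 negb_or andbC.
have [q' [h [h0 eq]]] := clear_denominators q; have [r' [k [k0 er']]] := clear_denominators r.
have sz p p' c : c != 0 -> map_poly frac p' = frac c *: p -> size p' = size p.
  by move=> c0 e; rewrite -sm e size_scale // tofrac_eq0.
have e : (h * k)%:P * f = r' * q'.
  apply: (map_inj_poly tofrac_inj (rmorph0 _)).
  rewrite mul_polyC map_polyZ (rmorphM (map_poly frac)) /= eq er' er (rmorphM frac).
  by rewrite -scalerAl -scalerAr scalerA [frac k * _]mulrC.
have [_ _ hp] := pf; have [|[c ec]|[c ec]] := hp r' q'.
- by exists (h * k)%:P.
- case/eqP: sq; have c0 : c != 0.
    by apply: contra_neq r0 => c0; apply/eqP; rewrite -size_poly_eq0 -(sz _ _ _ k0 er') ec c0 mul0r size_poly0.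
  have f0 : f != 0 by rewrite -size_poly_gt0 ltnW.
  have := congr1 (fun p : {poly R} => size p) ec; rewrite size_mul // (sz _ _ _ k0 er').
  have := congr1 (fun p : {poly Q} => size p) er; rewrite size_mul // sm.
  by move: c0 r0 q0; rewrite -!size_poly_gt0; move: (size c) (size r) (size q) (size f); lia.
- rewrite eqn_leq dvdp_leq // sm -(sz _ _ _ h0 eq) ec; have c0 : c != 0.
    by apply: contra_neq q0 => c0; apply/eqP; rewrite -size_poly_eq0 -(sz _ _ _ h0 eq) ec c0 mul0r size_poly0.
  have f0 : f != 0 by rewrite -size_poly_gt0 ltnW.
  by rewrite size_mul //= ; move: c0; rewrite -size_poly_gt0; case: (size c) => //= m _; apply: leq_addl.
Qed.

Variables (L : fieldExtType Q) (z : L).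
Hypothesis rz : root (map_poly (in_alg L) (map_poly frac f)) z.

Lemma prime_kernel q : (map_poly (in_alg L) (map_poly frac q)).[z] = 0 -> divides f q.
Proof.
move=> qz; have irr := prime_irreducible_fraction.
have sm p : size (map_poly frac p) = size p by rewrite size_map_inj_poly ?rmorph0 //; exact: tofrac_inj.
have [/dvdpP [r er]|nd] := boolP (map_poly frac f %| map_poly frac q); last first.
  have : coprimep (map_poly frac f) (map_poly frac q) by rewrite irreducible_poly_coprime.
  move/Bezout_eq1_coprimepP => [[u v] /= e].
  have := congr1 (fun p => (map_poly (in_alg L) p).[z]) e.
  rewrite rmorphD !rmorphM /= hornerD !hornerM qz (eqP rz) !mulr0 addr0 rmorph1 hornerC => /eqP.
  by rewrite eq_sym oner_eq0.
have [r' [k [k0 er']]] := clear_denominators r; have [f0 _ hp] := pf.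
have e : k%:P * q = r' * f.
  apply: (map_inj_poly tofrac_inj (rmorph0 _)).
  by rewrite !rmorphM /= er' er map_polyC /= mul_polyC scalerAl.
have [|[c ec]|//] := hp k%:P q; first by exists r'.
have c0 : c != 0 by apply: contra_neq k0 => c0; apply/eqP; rewrite -polyC_eq0 ec c0 mul0r.
have := congr1 (fun p : {poly R} => size p) ec; rewrite size_polyC k0 size_mul //.
by move: c0; rewrite -size_poly_gt0; move: sf; lia.
Qed.
End Fractions.

Lemma XnsubC_split (K : closedFieldType) m : [pchar K] =i pred0 -> (0 < m)%N ->
  exists s : seq K, uniq s /\ 'X^m - 1%:P = \prod_(w <- s) ('X - w%:P).
Proof.
move=> ch m0; have [s es] := closed_field_poly_normal ('X^m - 1%:P : {poly K}).
have l1 : lead_coef ('X^m - 1%:P : {poly K}) = 1 by apply/monicP/monicXnsubC.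
rewrite l1 scale1r in es; exists s; split=> //.
rewrite -(separable_prod_XsubC s) -es; apply: cyclotomic.separable_Xn_sub_1.
by rewrite ((pcharf0P K).1 ch) -lt0n.
Qed.

Section MapPoly.
Variables (A B : comNzRingType) (v : {rmorphism A -> B}).

Lemma map_XnsubC (g : A) m : map_poly v ('X^m - g%:P) = 'X^m - (v g)%:P.
Proof. by rewrite raddfB /= map_polyXn map_polyC. Qed.

Lemma map_mulXaddC (q : {poly A}) (c : A) :
  map_poly v (q * 'X + c%:P) = map_poly v q * 'X + (v c)%:P.
Proof. by rewrite raddfD /= rmorphM /= map_polyX map_polyC. Qed.

Lemma map_prod_XsubC (s : seq A) :
  map_poly v (\prod_(w <- s) ('X - w%:P)) = \prod_(w <- map v s) ('X - w%:P).
Proof.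
rewrite rmorph_prod big_map; apply: eq_bigr => c _.
by rewrite raddfB /= map_polyX map_polyC.
Qed.
End MapPoly.

Section Kummer.
Variables (k0 E : fieldType) (v : {rmorphism k0 -> E}) (z : E) (N : nat) (g : k0) (s : seq k0).
Hypotheses (zN : z ^+ N = v g) (z0 : z != 0) (N0 : (0 < N)%N) (us : uniq s)
  (es : 'X^N - 1%:P = \prod_(w <- s) ('X - w%:P)).
Let P : {poly k0} := 'X^N - g%:P.
Hypothesis irrP : irreducible_poly P.

Let rootP : root (map_poly v P) z.
Proof.
by rewrite /root /P raddfB /= map_polyXn map_polyC /= hornerD hornerN hornerXn hornerC zN subrr.
Qed.
Let P0 : P != 0. Proof. by rewrite -size_poly_gt0 size_XnsubC. Qed.

Let M := SubFieldExtType rootP irrP.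
Let psi : {rmorphism M -> E} := @subfx_inj k0 E v z P.
Let r : M := @subfx_root k0 E v z P.
Let psi_r : psi r = z. Proof. exact: (subfx_inj_root rootP P0). Qed.
Let psi_alg (c : k0) : psi c%:A = v c. Proof. exact: (subfx_inj_base rootP P0). Qed.

Let split_P : exists rs : seq M, [/\ uniq rs, r \in rs &
  map_poly (in_alg M) P = \prod_(y <- rs) ('X - y%:P)].
Proof.
pose y (c : k0) : M := c%:A * r.
have py c : psi (y c) = z * v c by rewrite rmorphM psi_alg psi_r mulrC.
exists (map y s); split.
- by rewrite map_inj_uniq // => c c' /(congr1 psi); rewrite !py => /(mulfI z0) /fmorph_inj.
- apply/mapP; exists 1; last by rewrite /y scale1r mul1r.
  by rewrite -root_prod_XsubC -es /root !hornerE expr1n subrr.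
apply: (map_inj_poly (fmorph_inj psi) (rmorph0 _)).
rewrite -map_poly_comp (_ : map_poly _ P = 'X^N - (v g)%:P); last first.
  rewrite -psi_alg /P (_ : map_poly _ _ = map_poly (psi \o in_alg M : {rmorphism _ -> _}) ('X^N - g%:P)) //.
  by rewrite raddfB /= map_polyXn map_polyC.
rewrite rmorph_prod /= big_map.
under eq_bigr => c _ do rewrite raddfB /= map_polyX map_polyC /= py.
have eE : 'X^N - 1%:P = \prod_(b <- map v s) ('X - b%:P).
  have := congr1 (map_poly v) es; rewrite raddfB /= map_polyXn map_polyC /= rmorph1 => ->.
  rewrite rmorph_prod big_map; apply: eq_bigr => c _.
  by rewrite raddfB /= map_polyX map_polyC.
have := congr1 (fun q => z ^+ N *: (q \Po (z^-1 *: 'X))) eE.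
rewrite prod_XsubC_scale // comp_polyB comp_polyC comp_Xn_poly exprZn scalerBr scalerA.
have -> : z ^+ N * z^-1 ^+ N = 1 by rewrite -exprMn divff // expr1n.
rewrite scale1r -mul_polyC -polyCM mulr1 zN => ->.
rewrite size_map scalerA.
have -> : size s = N.
  have := congr1 (fun q : {poly k0} => size q) es; rewrite size_XnsubC // size_prod_XsubC.
  by case.
by rewrite -zN divff ?scale1r ?expf_neq0 // big_map.
Qed.

Let P_over : map_poly (in_alg M) P \is a polyOver 1%VS.
Proof. by apply/polyOverP => i; rewrite coef_map; apply: rpredZ; apply: mem1v. Qed.

Let splitting : exists rs : seq M, [/\ uniq rs,
  map_poly (in_alg M) P = \prod_(y <- rs) ('X - y%:P) & <<1 & rs>>%VS = {:M}%VS].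
Proof.
have [rs [ur rr e]] := split_P; exists rs; split=> //.
apply/eqP; rewrite eqEsubv subvf /=; apply/subvP => y _.
have [q ->] := subfxEroot rootP P0 y; apply: rpred_horner; last exact: seqv_sub_adjoin.
apply/polyOverP => i; rewrite coef_map; apply: rpredZ; apply: mem1v.
Qed.

Let axM : splitting_field_axiom M.
Proof.
have [rs [_ e f]] := splitting; exists (map_poly (in_alg M) P) => //.
by exists rs; first by rewrite e eqpxx.
Qed.

(** The roots of X^N - g are the products of one root r with the N-th roots of unity in [s]. They
    are distinct and lie in k0(r), which is thus the splitting field of a separable polynomial; the
    embedding in [E] sends r to [z]. *)
Lemma kummer_extension : exists (L : splittingFieldType k0) (phi : {rmorphism L -> E}),
  [/\ galois 1%VS {:L}, forall c, phi c%:A = v c, exists r, phi r = z &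
    forall y, exists q, phi y = (map_poly v q).[z]].
Proof.
pose M' : splittingFieldType k0 := HB.pack M (FieldExt_isSplittingField.Build k0 M axM).
exists M', psi; split=> //.
- apply/splitting_galoisField; have [rs [ur e f]] := splitting.
  exists (map_poly (in_alg M) P); split=> //.
    by rewrite e separable_prod_XsubC.
  by exists rs; first by rewrite e eqpxx.
- by exists r.
- move=> y; have [q ->] := subfxEroot rootP P0 y; exists q.
  rewrite -horner_map -/psi psi_r -map_poly_comp; congr (_.[_]).
  by apply: eq_map_poly => c; apply: psi_alg.
Qed.
End Kummer.

(** * The cyclic extension defined by a pure equation *)

Section CyclicExtension.
Variables (K : closedFieldType) (charK : [pchar K] =i pred0) (n d : nat) (F : {mpoly K[n.+2]}).
Local Notation R := {mpoly K[n.+1]}.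
Variables (E : fieldType) (iota : {rmorphism {mpoly K[n.+2]} -> E}) (j : {rmorphism R -> E}).

Definition base_fraction : pred E := fun z =>
  `[< exists e (G H : R), [/\ G \is e.-homog, H \is e.-homog, j H != 0 & z = j G / j H] >].

Lemma base_fraction_closed : divring_closed base_fraction.
Proof.
split.
- by apply/asboolP; exists 0%N, 1, 1; rewrite rmorph1 oner_neq0 divr1 dhomog1.
- move=> _ _ /asboolP [e [G [H [hG hH H0 ->]]]] /asboolP [e' [G' [H' [hG' hH' H'0 ->]]]].
  apply/asboolP; exists (e + e')%N, (G * H' - H * G'), (H * H').
  rewrite rmorphB !rmorphM mulf_neq0 //; split=> //; last by field; rewrite H0 H'0.
    by apply: rpredB; apply: dhomogM.
  exact: dhomogM.
- move=> _ _ /asboolP [e [G [H [hG hH H0 ->]]]] /asboolP [e' [G' [H' [hG' hH' H'0 ->]]]].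
  apply/asboolP; have [G'0|G'0] := eqVneq (j G') 0.
    by exists 0%N, 0, 1; rewrite G'0 mul0r invr0 mulr0 rmorph0 mul0r rmorph1 oner_neq0 dhomog0 dhomog1.
  exists (e + e')%N, (G * H'), (H * G'); rewrite !rmorphM mulf_neq0 //; split=> //.
  + exact: dhomogM.
  + exact: dhomogM.
  + by field; rewrite H0 H'0 G'0.
Qed.
HB.instance Definition _ := GRing.isDivringClosed.Build E base_fraction base_fraction_closed.
Definition base_ring : divringClosed E := GRing.DivringClosed.clone E base_fraction _.
Local Notation k0 := (@subfield E base_ring).

Lemma base_ringP z : reflect (exists e (G H : R),
  [/\ G \is e.-homog, H \is e.-homog, j H != 0 & z = j G / j H]) (z \in base_ring).
Proof. exact: asboolP. Qed.

Variable x : E.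
Hypotheses (hd : (4 <= d)%N) (hF : F \is d.-homog) (irrF : irreducible_elt F).
Hypothesis iF : coord_fraction_field F iota.
Hypotheses (jE : forall a, j a = iota (mwiden a))
  (jx : forall q, (map_poly j q).[x] = iota (munif q)) (xE : x = iota 'X_ord_max).
Variables (ell a0 : R).
Hypotheses (hell : ell \is 1.-homog) (ell0 : ell != 0) (ha0 : a0 \is d.-homog)
  (ef : muni F = ell *: 'X^(d.-1) + a0%:P).
Let f := muni F.

Let size_f : size f = d.
Proof.
have s1 : size (ell *: 'X^(d.-1) : {poly R}) = d by rewrite size_scale // size_polyXn prednK //; lia.
by rewrite /f ef size_polyDl s1 // (leq_ltn_trans (size_polyC_leq1 _)) //; lia.
Qed.
Let f0 : f != 0. Proof. by rewrite -size_poly_gt0 size_f; lia. Qed.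

Let fker q : (map_poly j q).[x] = 0 -> divides f q.
Proof. by rewrite jx => /(iota_eq0 iF). Qed.

Let small_ker (q : {poly R}) : (size q < d)%N -> (map_poly j q).[x] = 0 -> q = 0.
Proof.
move=> sq /fker [c ec]; apply/eqP; apply: contraTT sq => q0; rewrite -leqNgt ec.
have c0 : c != 0 by apply: contra_neq q0 => c0; rewrite ec c0 mul0r.
by rewrite size_mul // size_f; move: c0; rewrite -size_poly_gt0; case: (size c) => //= m _; apply: leq_addl.
Qed.

Let j_eq0 a : (j a == 0) = (a == 0).
Proof.
apply/eqP/eqP => [ja|->]; last exact: rmorph0.
apply/eqP; rewrite -polyC_eq0; apply/eqP; apply: small_ker; last by rewrite map_polyC hornerC.
by apply: leq_ltn_trans (size_polyC_leq1 _) _; lia.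
Qed.

Let inj_j : injective j.
Proof. by move=> a b /eqP; rewrite -subr_eq0 -rmorphB j_eq0 subr_eq0 => /eqP. Qed.

Let w := j 'X_ord0.
Let w0 : w != 0. Proof. by rewrite j_eq0 mpolyX_neq0. Qed.
Let z0 := x / w.

Let x0 : x != 0.
Proof.
apply/eqP => x0; have : ('X : {poly R}) = 0.
  by apply: small_ker; rewrite ?size_polyX ?map_polyX ?hornerX //; lia.
by move/eqP; rewrite polyX_eq0.
Qed.
Let z00 : z0 != 0. Proof. by rewrite /z0 mulf_neq0 // invr_eq0. Qed.

Let gE := j (- a0) / j (ell * 'X_ord0 ^+ d.-1).

Let hX0 : ('X_ord0 : R) \is 1.-homog. Proof. by rewrite dhomogX /= mdeg1. Qed.
Let hX0n k : ('X_ord0 ^+ k : R) \is k.-homog.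
Proof. by have := dhomogMn k hX0; rewrite mul1n. Qed.

Let gS : gE \in base_ring.
Proof.
apply/base_ringP; exists d, (- a0), (ell * 'X_ord0 ^+ d.-1); split=> //.
- by apply: rpredNr.
- by have := dhomogM hell (hX0n d.-1); rewrite add1n prednK //; apply: leq_trans hd.
- by rewrite j_eq0 mulf_neq0 // expf_neq0 // mpolyX_neq0.
Qed.
Let g : k0 := Subfield gS.
Let v : {rmorphism k0 -> E} := \val.
Let vE (c : k0) : v c = subfield_val c. Proof. by []. Qed.

Let z0n : z0 ^+ d.-1 = gE.
Proof.
have h : j ell * x ^+ d.-1 + j a0 = 0.
  have := jx f; rewrite muniK; have -> : iota F = 0 by apply/iF.1; exists 1; rewrite mul1r.
  by rewrite /f ef rmorphD /= map_polyZ map_polyXn map_polyC hornerD hornerZ hornerXn hornerC.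
have l0 : j ell != 0 by rewrite j_eq0.
rewrite /z0 exprMn exprVn /gE rmorphN rmorphM rmorphXn -/w; move/eqP: h; rewrite addr_eq0 => /eqP <-.
by field; rewrite expf_neq0 //= l0.
Qed.

Let gP : z0 ^+ d.-1 = v g. Proof. by rewrite z0n. Qed.

(** A polynomial of degree below d - 1 over the base field with root x / X_0 becomes, cleared of
    denominators and homogenized with X_0, one over [R] with root [x]; being shorter than [f] it is
    zero. *)
Let irrP : irreducible_poly ('X^(d.-1) - g%:P).
Proof.
have d1 : (0 < d.-1)%N by move: hd; clear; lia.
have sP : size ('X^(d.-1) - g%:P) = d by rewrite size_XnsubC // prednK // (leq_trans _ hd).
have P0 : 'X^(d.-1) - g%:P != 0 by rewrite -size_poly_gt0 sP (leq_trans _ hd).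
have rP : root (map_poly v ('X^(d.-1) - g%:P)) z0.
  by rewrite /root map_XnsubC hornerD hornerN hornerXn hornerC gP subrr.
apply/(subfx_irreducibleP rP P0) => q rq q0; rewrite sP leqNgt; apply: contraNN q0 => sq.
have [|q' [h [h0 eq]]] := @common_denominator R E k0 j v inj_j q.
  move=> i; have /base_ringP [e [G [H [_ _ H0 e1]]]] : subfield_val q`_i \in base_ring := valP q`_i.
  by exists G, H; rewrite -j_eq0 vE.
have jh0 : j h != 0 by rewrite j_eq0.
have sq' : size q' = size q.
  rewrite -(size_map_inj_poly inj_j (rmorph0 _)) eq size_scale //.
  by rewrite size_map_inj_poly ?rmorph0 //; apply: fmorph_inj.
pose q2 := \poly_(i < size q') (q'`_i * 'X_ord0 ^+ (size q' - i)) : {poly R}.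
have q20 : q2 = 0.
  apply: small_ker; first by apply: leq_ltn_trans (size_poly _ _) _; rewrite sq'.
  have -> : map_poly j q2 = w ^+ size q' *: (map_poly j q' \Po (w^-1 *: 'X)).
    apply/polyP => i; rewrite coef_map /= coefZ coef_comp_scaleX coef_map /= coef_poly.
    case: ltnP => hi; last by rewrite nth_default // rmorph0 !mulr0.
    rewrite rmorphM rmorphXn -/w -{2}(subnK (ltnW hi)) exprD -mulrA [w ^+ i * _]mulrA -exprMn.
    by rewrite divff // expr1n mul1r mulrC.
  by rewrite hornerZ horner_comp hornerZ hornerX [w^-1 * x]mulrC eq hornerZ (eqP rq) !mulr0.
suff q'0 : q' = 0 by rewrite -size_poly_eq0 -sq' q'0 size_poly0.
apply/polyP => i; rewrite coef0; have [hi|hi] := ltnP i (size q'); last by rewrite nth_default.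
have := congr1 (fun q : {poly R} => q`_i) q20; rewrite coef_poly hi coef0 => /eqP.
by rewrite mulf_eq0 expf_eq0 (negbTE (mpolyX_neq0 _ _)) andbF orbF => /eqP.
Qed.

Let kconst c : j c%:MP \in base_ring.
Proof.
by apply/base_ringP; exists 0%N, c%:MP, 1; rewrite rmorph1 oner_neq0 divr1 dhomog1 -alg_mpolyC rpredZ // dhomog1.
Qed.

Let unity : exists s : seq k0, uniq s /\ 'X^(d.-1) - 1%:P = \prod_(w <- s) ('X - w%:P).
Proof.
have [|s [us es]] := XnsubC_split charK (m := d.-1); first by move: hd; clear; lia.
pose y (c : K) : k0 := Subfield (kconst c).
have vy c : v (y c) = j c%:MP by rewrite vE.
exists (map y s); split.
  rewrite map_inj_uniq // => c c' /(congr1 v); rewrite !vy => /inj_j /eqP.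
  by rewrite mpolyC_eq => /eqP.
apply: (map_inj_poly (fmorph_inj v) (rmorph0 _)).
pose jK : {rmorphism K -> E} := (j \o @mpolyC n.+1 K : {rmorphism _ -> _}).
have := congr1 (map_poly jK) es; rewrite !map_XnsubC !rmorph1 map_prod_XsubC => ->.
by rewrite map_prod_XsubC -map_comp; congr (\prod_(w <- _) _); apply: eq_map => c /=; rewrite vy.
Qed.

Let ffD z z' : function_field iota z -> function_field iota z' -> function_field iota (z + z').
Proof.
move=> [e [G [H [hG hH H0 ->]]]] [e' [G' [H' [hG' hH' H'0 ->]]]].
exists (e + e')%N, (G * H' + H * G'), (H * H'); rewrite rmorphD !rmorphM mulf_neq0 //; split=> //.
- by apply: rpredD; apply: dhomogM.
- exact: dhomogM.
- by field; rewrite H0 H'0.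
Qed.
Let ffM z z' : function_field iota z -> function_field iota z' -> function_field iota (z * z').
Proof.
move=> [e [G [H [hG hH H0 ->]]]] [e' [G' [H' [hG' hH' H'0 ->]]]].
exists (e + e')%N, (G * G'), (H * H'); rewrite !rmorphM mulf_neq0 //; split=> //.
- exact: dhomogM.
- exact: dhomogM.
- by field; rewrite H0 H'0.
Qed.
Let ff_base z : z \in base_ring -> function_field iota z.
Proof.
move=> /base_ringP [e [G [H [hG hH H0 ->]]]]; exists e, (mwiden G), (mwiden H).
by rewrite -!jE; split=> //; apply: dhomog_widen.
Qed.
Let ff_z0 : function_field iota z0.
Proof.
exists 1%N, 'X_ord_max, (mwiden 'X_ord0); rewrite -jE -/w -xE; split=> //.
  by rewrite dhomogX /= mdeg1.
exact: dhomog_widen.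
Qed.

(** The power d - 1 of x / X_0 is - a0 / (ell X_0^(d-1)), in the base field. It generates K(X): a
    form of degree e divided by X_0^e is a polynomial in x / X_0. *)
Lemma cyclic_galois : galois_subfields
  [set z | exists e (G H : R), [/\ G \is e.-homog, H \is e.-homog, j H != 0 & z = j G / j H]]
  (function_field iota).
Proof.
have [s [us es]] := unity; have d1 : (0 < d.-1)%N by move: hd; clear; lia.
have [M [psi [galM psi_alg [r psi_r] psiE]]] := kummer_extension gP z00 d1 us es irrP.
have ratio_image e (G : {mpoly K[n.+2]}) : G \is e.-homog -> exists y, psi y = iota G / w ^+ e.
  move=> hG; have cS (i : 'I_e.+1) : j (muni G)`_i / j ('X_ord0 ^+ (e - i)) \in base_ring.
    apply/base_ringP; exists (e - i)%N, (muni G)`_i, ('X_ord0 ^+ (e - i)); split=> //.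
      by apply: coef_muni_homog hG _; rewrite -ltnS.
    by rewrite j_eq0 expf_neq0 // mpolyX_neq0.
  exists (\sum_(i < e.+1) (Subfield (cS i) : k0)%:A * r ^+ i).
  have -> : iota G = (map_poly j (muni G)).[x] by rewrite jx muniK.
  have sG : (size (map_poly j (muni G)) <= e.+1)%N.
    by apply/leq_sizeP => k hk; rewrite coef_map /= (coef_muni_big hG) // rmorph0.
  rewrite (horner_coef_wide _ sG) raddf_sum mulr_suml; apply: eq_bigr => i _ /=.
  rewrite rmorphM rmorphXn psi_alg psi_r coef_map vE /= [j ('X_ord0 ^+ _)]rmorphXn -/w /z0 exprMn exprVn.
  have hi : (i <= e)%N by rewrite -ltnS.
  have -> : w ^+ e = w ^+ (e - i) * w ^+ i by rewrite -exprD subnK.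
  by field; rewrite !expf_neq0.
exists k0, M, psi; split=> //.
- apply/seteqP; split=> [_ [y _ <-]|_ [e [G [H [hG hH H0 ->]]]]].
    have [q ->] := psiE y; elim/poly_ind: q => [|q c IH].
      by rewrite map_poly0 horner0; apply: ff_base; apply: rpred0.
    rewrite map_mulXaddC hornerD hornerM hornerX hornerC.
    by apply: ffD; [apply: ffM|apply: ff_base; apply: (valP c)].
  have [y ey] := ratio_image _ _ hG; have [y' ey'] := ratio_image _ _ hH.
  exists (y / y') => //; rewrite fmorph_div ey ey'.
  by field; rewrite H0 expf_neq0.
- apply/seteqP; split=> [_ [y /vlineP [c ->] <-]|z hz].
    by rewrite psi_alg vE; apply/base_ringP; apply: (valP c).
  have zS : z \in base_ring by apply/base_ringP.
  exists ((Subfield zS : k0)%:A); first by apply/vlineP; exists (Subfield zS).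
  by rewrite psi_alg vE.
Qed.
End CyclicExtension.

Section GaloisFormBackward.
Variables (K : closedFieldType) (charK : [pchar K] =i pred0) (n d : nat).
Hypothesis hd : (4 <= d)%N.

Lemma cyclic_galois_iota (F : {mpoly K[n.+2]}) (ell a0 : {mpoly K[n.+1]}) (E : fieldType)
    (iota : {rmorphism {mpoly K[n.+2]} -> E}) :
  F \is d.-homog -> irreducible_elt F -> ell \is 1.-homog -> ell != 0 -> a0 \is d.-homog ->
  muni F = ell *: 'X^(d.-1) + a0%:P -> coord_fraction_field F iota ->
  galois_subfields
      [set z | exists e (G H : {mpoly K[n.+1]}), [/\ G \is e.-homog, H \is e.-homog,
         iota (mwiden H) != 0 & z = iota (mwiden G) / iota (mwiden H)]]
      (function_field iota).
Proof.
move=> hF irrF hell ell0 ha0 ef iF.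
pose j : {rmorphism {mpoly K[n.+1]} -> E} := (iota \o @mwiden n.+1 K : {rmorphism _ -> _}).
have jE a : j a = iota (mwiden a) by [].
have jx (q : {poly {mpoly K[n.+1]}}) : (map_poly j q).[iota 'X_ord_max] = iota (munif q).
  by rewrite /munif -horner_map -map_poly_comp.
exact: (cyclic_galois charK hd hF iF jE jx erefl hell ell0 ha0 ef).
Qed.

(** Being a Galois point asks for some field with a map from the coordinate ring. It is obtained by
    adjoining a root z of [f] to the fraction field of K[X_0, ..., X_n]; the polynomials vanishing
    at z are the multiples of [f], since [f] is prime. *)
Lemma cyclic_model (F : {mpoly K[n.+2]}) (ell a0 : {mpoly K[n.+1]}) :
  F \is d.-homog -> irreducible_elt F -> ell \is 1.-homog -> ell != 0 -> a0 \is d.-homog ->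
  muni F = ell *: 'X^(d.-1) + a0%:P ->
  exists (E : fieldType) (iota : {rmorphism {mpoly K[n.+2]} -> E}),
    coord_fraction_field F iota /\ galois_subfields
      [set z | exists e (G H : {mpoly K[n.+1]}), [/\ G \is e.-homog, H \is e.-homog,
         iota (mwiden H) != 0 & z = iota (mwiden G) / iota (mwiden H)]]
      (function_field iota).
Proof.
move=> hF irrF hell ell0 ha0 ef; set f := muni F in ef.
have d1 : (0 < d.-1)%N by move: hd; clear; lia.
have dp : (0 < d)%N by move: hd; clear; lia.
have pf : prime_elt f by apply/prime_muni; apply: irr_prime irrF; apply: ufd_mpoly.
have sf : size f = d.
  have s1 : size (ell *: 'X^(d.-1) : {poly {mpoly K[n.+1]}}) = d by rewrite size_scale // size_polyXn prednK.
  by rewrite ef size_polyDl s1 // (leq_ltn_trans (size_polyC_leq1 _)) //; move: hd; clear; lia.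
have sf1 : (1 < size f)%N by rewrite sf; move: hd; clear; lia.
have [L _ [z rz gz]] := irredp_FAdjoin (prime_irreducible_fraction pf sf1).
pose frac := @FracField.tofrac {mpoly K[n.+1]}.
pose emb : {rmorphism {mpoly K[n.+1]} -> L} := (in_alg L \o frac : {rmorphism _ -> _}).
have emb0 a : a != 0 -> emb a != 0.
  by move=> a0'; rewrite fmorph_eq0 tofrac_eq0.
pose iota : {rmorphism {mpoly K[n.+2]} -> L} :=
  (horner_eval z \o (map_poly emb \o @muni n.+1 K) : {rmorphism _ -> _}).
have iotaE G : iota G = (map_poly (in_alg L) (map_poly frac (muni G))).[z].
  by rewrite /iota /= /horner_eval -map_poly_comp.
have iotaW a : iota (mwiden a) = emb a.
  by rewrite /iota /= muni_widen map_polyC /horner_eval hornerC.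
have iF : coord_fraction_field F iota.
  split=> [G|y].
    split=> [|[Q ->]]; last first.
      have iF0 : iota F = 0 by rewrite iotaE; apply/eqP.
      by rewrite rmorphM iF0 mulr0.
    rewrite iotaE => /(prime_kernel pf sf1 rz) [q eq]; exists (munif q); apply: (@muni_inj _ K).
    by rewrite muniM munifK.
  have /Fadjoin_polyP [q qL ey] : y \in <<1; z>>%VS by rewrite gz memvf.
  have [q0 eq0] : exists q0, q = map_poly (in_alg L) q0.
    pose q0 := \poly_(i < size q) (projT1 (sig_eqW (vlineP _ _ (polyOverP qL i)))).
    exists q0; apply/polyP => i; rewrite coef_map coef_poly /=.
    case: ltnP => hi; last by rewrite nth_default // scale0r.
    by case: (sig_eqW _) => c /= ->.
  have [q1 [h [h0 eq1]]] := clear_denominators q0.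
  exists (munif q1), (mwiden h); rewrite iotaW emb0 //; split=> //.
  rewrite iotaE munifK eq1 map_polyZ hornerZ -eq0 -ey /=.
  by rewrite mulrC mulKf // emb0.
exists L, iota; split=> //.
exact: (cyclic_galois_iota hF irrF hell ell0 ha0 ef iF).
Qed.

Lemma galois_form_Delta (F : {mpoly K[n.+2]}) (P : ppoint K n.+1) v : F \is d.-homog ->
  irreducible_elt F -> v \in val P -> v != 0 -> F.@[v 0] = 0 -> ~ singular F v ->
  galois_form d F v -> Delta F P.
Proof.
move=> hF irrF vP v0 Fv sv [l [L [l0 vl vL hx]]].
have FP : hypersurface F P by apply/(vanishes_atP hF vP v0).
have sm : smooth_locus F P.
  split=> // sP; apply: sv; apply/(cone_of_Sing hF v0); by exists P.
have dp : (0 < d.-1)%N by move: hd; clear; lia.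
split=> //; split; first by left.
have [T0 uT0 eT0] := exists_row_unitmx v0.
pose B := invmx T0 *m prmx K n.+1.
have vB : v *m B = 0 by rewrite /B mulmxA -eT0 mulmxK // elast_prmx.
have rB : \rank B = n.+1.
  rewrite /B eqmxMfull ?row_full_unit ?unitmx_inv //.
  by apply/eqP; rewrite eqn_leq rank_leq_col -{1}(@mxrank1 K n.+1) -prmx_section mxrankM_maxr.
have vL1 : v *m L = 1%:M by apply/matrixP => i k; rewrite !ord1 vL mxE.
have [T [uT eT TB TL]] := projection_frame rB vB vL1.
pose F' := subst T F; have hF' : F' \is d.-homog by apply: dhomog_subst.
have irrF' := irreducible_subst uT irrF.
pose c := (prmx K n.+1)^T *m (T *m l).
pose a0 := subst ((prmx K n.+1)^T *m T) F.
have sec (y : 'rV[K]_n.+1) : y *m (prmx K n.+1)^T = rowpt y 0.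
  apply/rowP => i; rewrite !mxE; case: unliftP => [k ->|->].
    rewrite (bigD1 k) //= !mxE eqxx mulr1 big1 ?addr0 // => m hm.
    by rewrite !mxE (inj_eq lift_inj) (negbTE hm) mulr0.
  by rewrite big1 // => m _; rewrite !mxE eq_sym (negbTE (neq_lift _ _)) mulr0.
have Tl (y : 'rV[K]_n.+1) t : (rowpt y t *m T *m l) 0 0 = (y *m c) 0 0.
  have -> : rowpt y t = rowpt y 0 + t *: elast K n.+1.
    by rewrite -rowpt_delta; apply/rowP => i; rewrite !mxE; case: unliftP => [k _|_]; rewrite ?mxE ?mulr0 ?addr0 ?mulr1 ?add0r.
  by rewrite !mulmxDl -!scalemxAl eT vl scaler0 addr0 /c mulmxA sec mulmxA.
have xL (y : 'rV[K]_n.+1) t : (rowpt y t *m T *m L) 0 0 = t.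
  rewrite -mulmxA TL mxE (bigD1 ord_max) //= big1 => [|i hi].
    by rewrite !mxE !eqxx unlift_none mulr1 addr0.
  by rewrite !mxE (negbTE hi) mulr0.
have eF' : F' = munif (lin c *: 'X^(d.-1) + a0%:P).
  apply: mpoly_ext => x; have [y [t ->]] := rowptE x.
  rewrite subst_eval hx xL Tl [RHS]meval_rowpt munifK raddfD /= map_polyZ map_polyXn map_polyC.
  have ea0 : a0.@[y 0] = F.@[(rowpt y 0 *m T) 0] by rewrite /a0 subst_eval mulmxA sec.
  rewrite hornerD hornerZ hornerXn hornerC /= lin_eval ea0.
  congr (_ + F.@[_ 0]); rewrite -eT scalemxAl -mulmxBl; congr (_ *m _).
  rewrite -rowpt_delta; apply/rowP => i; rewrite !mxE; case: unliftP => [k _|_].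
    by rewrite mxE mulr0 subr0.
  by rewrite mulr1 subrr.
have ef : muni F' = lin c *: 'X^(d.-1) + a0%:P by rewrite eF' munifK.
have c0 : lin c != 0.
  apply: contra_neq l0 => lc; apply/matrixP => i k; rewrite ord1 [RHS]mxE.
  have [y [t e]] := rowptE (delta_mx 0 i *m invmx T).
  have := Tl y t; rewrite -e mulmxKV // -rowE mxE => ->.
  by rewrite -lin_eval lc meval0.
have [E [iota [iF gal]]] := cyclic_model hF' irrF' (lin_homog c) c0 (dhomog_subst _ hF) ef.
have uT' : invmx T \in unitmx by rewrite unitmx_inv.
pose iota0 : {rmorphism {mpoly K[n.+2]} -> E} := (iota \o subst (invmx (invmx T)) : {rmorphism _ -> _}).
have iF0 : coord_fraction_field F iota0.
  by have := coord_fraction_subst uT' iF; rewrite /F' substVK.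
have e0 p : iota0 p = iota (subst T p) by rewrite /iota0 /= invmxK.
have eB G : iota0 (G \mPo linear_forms B) = iota (mwiden G).
  by rewrite e0 comp_linear_forms -TB -subst_comp substKV // mwiden_subst.
exists E, iota0, B; split=> //.
  by split=> // u; rewrite (point_vline vP v0) => /vlineP [t ->]; rewrite -scalemxAl vB scaler0.
have -> : function_field iota0 = function_field iota.
  apply/seteqP; split=> z [e [G [H [hG hH H0 ->]]]].
    by exists e, (subst T G), (subst T H); rewrite -!e0; split; rewrite // dhomog_subst.
  exists e, (subst (invmx T) G), (subst (invmx T) H); rewrite !e0 !substKV //.
  by split; rewrite // dhomog_subst.
suff -> : pullback_field iota0 B = [set z | exists e (G H : {mpoly K[n.+1]}),
   [/\ G \is e.-homog, H \is e.-homog, iota (mwiden H) != 0 & z = iota (mwiden G) / iota (mwiden H)]] by [].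
apply/seteqP; split=> z [e [G [H [hG hH H0 ->]]]]; exists e, G, H; last by rewrite !eB.
by rewrite -!eB.
Qed.
End GaloisFormBackward.

(** * Pairs of Galois points *)

Section Dot.
Variables (K : closedFieldType) (N : nat).
Implicit Types (x y : 'rV[K]_N) (c e : 'cV[K]_N).

Definition dot x c : K := (x *m c) 0 0.

Lemma dotDl x y c : dot (x + y) c = dot x c + dot y c.
Proof. by rewrite /dot mulmxDl mxE. Qed.
Lemma dotZl a x c : dot (a *: x) c = a * dot x c.
Proof. by rewrite /dot -scalemxAl mxE. Qed.
Lemma dotNl x c : dot (- x) c = - dot x c.
Proof. by rewrite /dot mulNmx mxE. Qed.
Lemma dotDr x c e : dot x (c + e) = dot x c + dot x e.
Proof. by rewrite /dot mulmxDr mxE. Qed.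
Lemma dotZr a x c : dot x (a *: c) = a * dot x c.
Proof. by rewrite /dot -scalemxAr mxE. Qed.
Lemma dotNr x c : dot x (- c) = - dot x c.
Proof. by rewrite /dot mulmxN mxE. Qed.
Lemma dot0r x : dot x 0 = 0. Proof. by rewrite /dot mulmx0 mxE. Qed.
Lemma dot0l c : dot 0 c = 0. Proof. by rewrite /dot mul0mx mxE. Qed.
Definition dotE := (dotDl, dotZl, dotNl, dotDr, dotZr, dotNr, dot0r, dot0l).

Lemma lin_dot c x : (lin c).@[x 0] = dot x c. Proof. exact: lin_eval. Qed.

Lemma dot_ext c e : (forall x, dot x c = dot x e) -> c = e.
Proof.
by move=> h; apply/colP => i; have := h (delta_mx 0 i); rewrite /dot -!rowE !mxE.
Qed.

Lemma lin0 : lin (0 : 'cV[K]_N) = 0.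
Proof. by apply: mpoly_ext => x; rewrite lin_dot dot0r meval0. Qed.

Lemma lin_eq0 c : lin c = 0 -> c = 0.
Proof. by move=> h; apply: dot_ext => x; rewrite dot0r -lin_dot h meval0. Qed.

Lemma lin_prime c : c != 0 -> prime_elt (lin c).
Proof. by move=> c0; apply: linear_prime (lin_homog c) _; apply: contra_neq c0 => /lin_eq0. Qed.

Lemma lin_divides c e : c != 0 -> divides (lin c) (lin e) -> exists a, e = a *: c.
Proof.
move=> c0 [p ep]; have [e0|e0] := eqVneq e 0; first by exists 0; rewrite scale0r.
have l0 : lin e != 0 by apply: contra_neq e0 => /lin_eq0.
have pc0 : p * lin c != 0 by rewrite -ep.
have [k hk _] : exists2 k, p \is k.-homog & (k <= 1)%N.
  by apply: (@dhomog_factor _ _ _ p (lin c)) => //; rewrite -ep lin_homog.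
have := dhomog_uniq pc0 (dhomogM hk (lin_homog c)) (_ : _ \is 1.-homog).
rewrite -ep lin_homog addn1 => /(_ isT) [k0]; rewrite k0 in hk.
exists p@_0; apply: dot_ext => x; rewrite dotZr -!lin_dot ep mevalM {1}(homog0C hk).
by rewrite mevalC.
Qed.

Lemma deriv_const (p : {poly K}) : [pchar K] =i pred0 -> p^`() = 0 -> p = (p.[0])%:P.
Proof.
move=> ch hp; apply/polyP => i; rewrite coefC horner_coef0; case: i => [|i] //=.
have := congr1 (fun q : {poly K} => q`_i) hp; rewrite coef_deriv coef0 -mulr_natr => /eqP.
by rewrite mulf_eq0 ((pcharf0P K).1 ch) orbF => /eqP.
Qed.
End Dot.

Section GaloisVectors.
Variables (K : closedFieldType) (charK : [pchar K] =i pred0) (N d : nat) (F : {mpoly K[N]}).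
Hypotheses (hd : (4 <= d)%N) (hF : F \is d.-homog).
Implicit Types (u v w x y : 'rV[K]_N) (l L m M : 'cV[K]_N).

Let natK p : (0 < p)%N -> p%:R != 0 :> K.
Proof. by rewrite ((pcharf0P K).1 charK) lt0n. Qed.

(** [galois_form] with its two forms made explicit, as two Galois vectors are compared through their
    forms. *)
Definition gp v l L := [/\ l != 0, dot v l = 0, dot v L = 1 &
  forall x, F.@[x 0] = dot x l * dot x L ^+ d.-1 + F.@[(x - dot x L *: v) 0]].

Lemma galois_formP v : galois_form d F v <-> exists l L, gp v l L.
Proof.
split=> [[l [L [h1 h2 h3 h4]]]|[l [L [h1 h2 h3 h4]]]]; exists l, L; split=> //.
  by rewrite /dot h2 mxE.
by apply/matrixP => i j; rewrite !ord1 [RHS]mxE.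
Qed.

Lemma gp_line v l L x s : gp v l L ->
  F.@[(x + s *: v) 0] = dot x l * (dot x L + s) ^+ d.-1 + F.@[(x - dot x L *: v) 0].
Proof.
move=> [_ vl vL hx]; rewrite hx !dotDl !dotZl vl vL mulr0 addr0 mulr1; congr (_ + F.@[_ 0]).
by rewrite scalerDl opprD addrACA subrr addr0.
Qed.

Lemma gp_neq0 v l L : gp v l L -> v != 0.
Proof. by move=> [_ _ vL _]; apply: contra_eq_neq vL => ->; rewrite dot0l eq_sym oner_neq0. Qed.

Lemma gp_L_neq0 v l L : gp v l L -> L != 0.
Proof. by move=> [_ _ vL _]; apply: contra_eq_neq vL => ->; rewrite dot0r eq_sym oner_neq0. Qed.

Lemma gp_dird v l L : gp v l L -> dird v F = d.-1%:R *: (lin l * lin L ^+ d.-2).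
Proof.
move=> h; apply: mpoly_ext => x; rewrite dird_deriv0.
have -> : linep F x v = (dot x l)%:P * ('X + (dot x L)%:P) ^+ d.-1 + (F.@[(x - dot x L *: v) 0])%:P.
  apply: poly_ext => s; rewrite linep_eval (gp_line _ _ h) hornerD hornerM horner_exp.
  by rewrite hornerD hornerX !hornerC [s + _]addrC.
rewrite derivD derivC addr0 derivM derivC mul0r add0r deriv_exp derivD derivX derivC addr0 mul1r.
rewrite hornerM hornerMn horner_exp hornerD hornerX !hornerC add0r.
by rewrite mevalZ mevalM mevalXn !lin_dot -[_ *+ _]mulr_natl mulrCA.
Qed.

(** The differential of [F] at [v] is [l], which is not zero. *)
Lemma gp_on_singular v l L : gp v l L -> F.@[v 0] = 0 /\ ~ singular F v.
Proof.
move=> h; have [l0 vl vL hx] := h; have d0 : (0 < d)%N by apply: leq_trans hd.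
split.
  by rewrite hx vl mul0r add0r vL scale1r subrr (dhomog_eval0 hF d0).
move=> [_ sv]; have [x hxl] : exists x, dot x l != 0.
  apply: contra_notP (negP l0) => h0; apply/eqP/dot_ext => x; rewrite dot0r.
  by apply: contrapT => /eqP hn; apply: h0; exists x.
have : (dird x F).@[v 0] = dot x l.
  rewrite dird_deriv0.
  have -> : linep F v x = (dot x l *: 'X) * (1%:P + dot x L *: 'X) ^+ d.-1
      + F.@[(x - dot x L *: v) 0] *: 'X^d.
    apply: poly_ext => s; rewrite linep_eval hx !dotDl !dotZl vl vL add0r.
    have -> : v + s *: x - (1 + s * dot x L) *: v = s *: (x - dot x L *: v).
      by rewrite scalerBr scalerDl scale1r scalerA opprD addrACA addrA subrr add0r.
    rewrite (dhomog_eval_scale _ _ hF) hornerD hornerM horner_exp hornerD !hornerZ hornerXn hornerX hornerC.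
    by rewrite [s ^+ d * _]mulrC [s * dot x l]mulrC [s * dot x L]mulrC.
  set Q := (1%:P + _) ^+ _; have Q0 : Q.[0] = 1.
    by rewrite horner_exp hornerD hornerZ hornerX mulr0 addr0 hornerC expr1n.
  rewrite derivD derivM !derivZ derivX derivXn hornerD hornerD hornerM Q0 hornerM !hornerZ hornerX.
  rewrite mulr0 mul0r addr0 hornerMn hornerXn expr0n.
  have -> : (d.-1 == 0)%N = false by move: hd; clear; case: (d) => [|[]].
  by rewrite mul0rn mulr0 addr0 -[1]/(1%:P) hornerC !mulr1.
by rewrite dird_eval big1 => [/esym/eqP|i _]; [rewrite (negbTE hxl)|rewrite sv mulr0].
Qed.

Definition vertex u := forall x s, F.@[(x + s *: u) 0] = F.@[x 0].

Lemma dird_vertex u : dird u F = 0 -> vertex u.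
Proof.
move=> h x s; rewrite -linep_eval.
have -> : linep F x u = ((linep F x u).[0])%:P.
  by apply: deriv_const charK _; rewrite deriv_linep h; apply: poly_ext => t; rewrite linep_eval meval0 horner0.
by rewrite hornerC linep_eval scale0r addr0.
Qed.

Lemma dirdZ a u p : dird (a *: u) p = a *: dird u p.
Proof.
by rewrite /dird scaler_sumr; apply: eq_bigr => i _; rewrite mxE scalerA.
Qed.

Lemma dirdDl u v p : dird (u + v) p = dird u p + dird v p.
Proof.
by rewrite /dird -big_split; apply: eq_bigr => i _; rewrite mxE scalerDl.
Qed.

Lemma dirdB u v p : dird (u - v) p = dird u p - dird v p.
Proof. by rewrite dirdDl -[- v]scaleN1r dirdZ scaleN1r. Qed.

Lemma dird_scale a u p : dird u (a *: p) = a *: dird u p.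
Proof.
by rewrite /dird scaler_sumr; apply: eq_bigr => i _; rewrite mderivZ !scalerA mulrC.
Qed.

Lemma dird_lin u c : dird u (lin c) = (dot u c)%:MP.
Proof.
apply: mpoly_ext => x; rewrite dird_deriv0 mevalC.
have -> : linep (lin c) x u = (dot x c)%:P + dot u c *: 'X.
  by apply: poly_ext => s; rewrite linep_eval lin_dot dotDl dotZl hornerD hornerZ hornerX hornerC mulrC.
by rewrite derivD derivC add0r derivZ derivX hornerZ hornerC mulr1.
Qed.

Lemma dird_exp u p k : dird u (p ^+ k) = k%:R *: (dird u p * p ^+ k.-1).
Proof.
apply: mpoly_ext => x; rewrite dird_deriv0.
have -> : linep (p ^+ k) x u = linep p x u ^+ k.
  by apply: poly_ext => s; rewrite horner_exp !linep_eval mevalXn.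
rewrite deriv_exp deriv_linep hornerMn hornerM horner_exp !linep_eval scale0r addr0.
by rewrite mevalZ mevalM mevalXn mulr_natl.
Qed.

Lemma dirdC u v p : dird u (dird v p) = dird v (dird u p).
Proof.
have e u' v' : dird u' (dird v' p) = \sum_i \sum_j (u' 0 i * v' 0 j) *: p^`M(j)^`M(i).
  rewrite /dird; apply: eq_bigr => i _.
  have -> : (\sum_j v' 0 j *: p^`M(j))^`M(i) = \sum_j v' 0 j *: p^`M(j)^`M(i).
    by rewrite linear_sum; apply: eq_bigr => j _; rewrite /= mderivZ.
  by rewrite scaler_sumr; apply: eq_bigr => j _; rewrite scalerA.
rewrite !e exchange_big /=; apply: eq_bigr => i _; apply: eq_bigr => j _.
by rewrite mulrC mderiv_comm.
Qed.

Lemma dird_pair u l L k : dird u (lin l * lin L ^+ k.+1) =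
  lin L ^+ k * lin (dot u l *: L + (k.+1%:R * dot u L) *: l).
Proof.
rewrite dirdM dird_exp !dird_lin; apply: mpoly_ext => x.
rewrite !mevalD !mevalM mevalZ !mevalM !mevalC !mevalXn !lin_dot dotDr !dotZr /= exprSr; ring.
Qed.

Lemma gp_cross v l L w m M : gp v l L -> gp w m M ->
  lin L ^+ (d - 3) * lin (dot w l *: L + (d.-2%:R * dot w L) *: l) =
  lin M ^+ (d - 3) * lin (dot v m *: M + (d.-2%:R * dot v M) *: m).
Proof.
move=> hv hw; have := dirdC w v F; rewrite (gp_dird hv) (gp_dird hw) !dird_scale.
have -> : d.-2 = (d - 3).+1 by move: hd; clear; lia.
rewrite !dird_pair; apply: scalerI; apply: natK; move: hd; clear; lia.
Qed.

Definition orthogonal_gp v l L w m M := [/\ dot w l = 0, dot w L = 0, dot v m = 0 & dot v M = 0].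

Lemma linear_zero v l L a b : gp v l L -> a *: L + b *: l = 0 -> a = 0 /\ b = 0.
Proof.
move=> [l0 vl vL _] e; have := congr1 (dot v) e; rewrite dotDr !dotZr vl vL mulr0 addr0 mulr1 dot0r => a0.
split=> //; move/eqP: e; rewrite a0 scale0r add0r scaler_eq0 (negbTE l0) orbF => /eqP.
by [].
Qed.

(* [L] and [M] proportional forces [D_(w - c v) F = 0]. *)
Lemma gp_parallel v l L w m M c : gp v l L -> gp w m M -> L = c *: M -> vertex (w - c *: v).
Proof.
move=> hv hw eL; have [l0 vl vL _] := hv; have [m0 wm wM _] := hw.
have wL : dot w L = c by rewrite eL dotZr wM mulr1.
have c0 : c != 0 by apply: contraNneq (gp_L_neq0 hv) => c0; rewrite eL c0 scale0r.
have vM : dot v M = c^-1 by apply: (mulfI c0); rewrite -dotZr -eL vL divff.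
have M0 : lin M ^+ (d - 3) != 0 by rewrite expf_neq0 //; apply: contra_neq (gp_L_neq0 hw) => /lin_eq0.
set A := dot w l; set B := dot v m.
pose n2 : K := d.-2%:R; have n20 : n2 != 0 by apply: natK; move: hd; clear; lia.
have key x : c ^+ (d - 3) * (A * dot x L + n2 * c * dot x l) = B * dot x M + n2 * c^-1 * dot x m.
  have := gp_cross hv hw; rewrite -/A -/B wL vM.
  have -> : lin L = c%:MP * lin M.
    by apply: mpoly_ext => z; rewrite mevalM mevalC !lin_dot eL dotZr.
  rewrite exprMn => h; have {}h : lin M ^+ (d - 3) * (c%:MP ^+ (d - 3) * lin (A *: L + (d.-2%:R * c) *: l)) =
      lin M ^+ (d - 3) * lin (B *: M + (d.-2%:R * c^-1) *: m) by rewrite -h mulrCA mulrA.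
  have := congr1 (meval (x 0)) (mulfI M0 h).
  by rewrite mevalM mevalXn mevalC !lin_dot !dotDr !dotZr.
have e1 : c ^+ (d - 3) * A = (B + n2 * B) / c.
  by have := key v; rewrite vl vL vM mulr0 addr0 mulr1 => ->; rewrite -/B; ring.
have e2 : c ^+ (d - 3) * A * ((1 + n2) * c) = B.
  by have := key w; rewrite wL wM wm mulr0 addr0 mulr1 -/A => <-; ring.
(* Evaluation at v and at w gives B = (d-1)^2 B, and (d-1)^2 - 1 = (d-2) d is not zero. *)
have B0 : B = 0.
  have e3 : B * ((1 + n2) ^+ 2 - 1) = 0.
    have e4 : B * (1 + n2) ^+ 2 = B by rewrite -[RHS]e2 e1; field.
    by rewrite mulrBr e4 mulr1 subrr.
  apply/eqP; move/eqP: e3; rewrite mulf_eq0 => /orP[//|].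
  have -> : (1 + n2) ^+ 2 - 1 = (d.-2 * (d.-2 + 2))%N%:R :> K by rewrite natrM natrD /n2; ring.
  by rewrite (negbTE (natK _)) //; move: hd; clear; case: (d) => [|[|[|]]].
have A0 : A = 0.
  by apply/eqP; move/eqP: e1; rewrite B0 mulr0 addr0 mul0r mulf_eq0 expf_eq0 (negbTE c0) andbF.
have em : m = c ^+ d.-1 *: l.
  apply: dot_ext => x; have := key x; rewrite A0 B0 !mul0r !add0r => e.
  apply: (mulfI (mulf_neq0 n20 (invr_neq0 c0))); rewrite -e dotZr.
  have -> : d.-1 = ((d - 3) + 2)%N by move: hd; clear; lia.
  by rewrite exprD; field.
apply: dird_vertex; rewrite dirdB dirdZ (gp_dird hv) (gp_dird hw); apply: mpoly_ext => x.
rewrite meval0 mevalB !mevalZ !mevalM !mevalXn !lin_dot em eL !dotZr.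
have -> : d.-1 = d.-2.+1 by move: hd; clear; lia.
by rewrite exprMn exprS; ring.
Qed.

Hypothesis no_vertex : forall u, vertex u -> u = 0.

(** [gp_cross] reads L^(d-3) A = M^(d-3) B with A and B linear or zero. If A = 0, then B = 0, and
    both relations say that the vectors are orthogonal. Otherwise L and M are not proportional, for
    want of vertices, so M divides A and L^(d-3) is M^(d-4) B up to a constant; for d > 4 this would
    make M divide L. *)
Lemma gp_pair v l L w m M : gp v l L -> gp w m M -> (forall c, w <> c *: v) ->
  orthogonal_gp v l L w m M \/ d = 4%N /\ exists c, [/\ c != 0,
    dot w l *: L + (2 * dot w L) *: l = c *: M & dot v m *: M + (2 * dot v M) *: m = c *: L].
Proof.
move=> hv hw hn; have e := gp_cross hv hw.
have n20 : d.-2%:R != 0 :> K by apply: natK; move: hd; clear; lia.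
set A := dot w l *: L + _ in e; set B := dot v m *: M + _ in e.
have L0 := gp_L_neq0 hv; have M0 := gp_L_neq0 hw.
have lL0 : lin L != 0 by apply: contra_neq L0 => /lin_eq0.
have lM0 : lin M != 0 by apply: contra_neq M0 => /lin_eq0.
have [A0|A0] := eqVneq A 0.
  have B0 : B = 0.
    apply: lin_eq0; move/eqP: e; rewrite A0 lin0.
    by rewrite mulr0 eq_sym mulf_eq0 expf_eq0 (negbTE lM0) andbF => /eqP.
  have [h1 /eqP h2] := linear_zero hv A0; have [h3 /eqP h4] := linear_zero hw B0.
  left; split=> //; apply/eqP.
    by move: h2; rewrite mulf_eq0 (negbTE n20).
  by move: h4; rewrite mulf_eq0 (negbTE n20).
have par c : L = c *: M -> False.
  by move=> /(gp_parallel hv hw) /no_vertex /eqP; rewrite subr_eq0 => /eqP; apply: hn.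
have [_ _ pM] := lin_prime M0.
have d3 : (d - 3 = (d - 4).+1)%N by move: hd; clear; lia.
have /pM [/(prime_exp (lin_prime M0)) /(lin_divides M0) [c /par //]|] :
    divides (lin M) (lin L ^+ (d - 3) * lin A).
  by rewrite e d3 exprS -mulrA; apply: divides_mulr; apply: divides_refl.
move=> /(lin_divides M0) [c eA].
have c0 : c != 0 by apply: contraNneq A0 => c0; rewrite eA c0 scale0r.
have e' : c *: lin L ^+ (d - 3) = lin M ^+ (d - 4) * lin B.
  apply: (mulfI lM0); rewrite mulrA -exprS -d3 -e eA.
  by apply: mpoly_ext => x; rewrite !mevalM mevalZ mevalXn !lin_dot dotZr; ring.
have d4 : d = 4%N.
  apply/eqP; rewrite eqn_leq hd andbT leqNgt; apply/negP => d5.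
  have : divides (lin M) (c%:MP * lin L ^+ (d - 3)).
    rewrite mul_mpolyC e' (_ : d - 4 = (d - 5).+1)%N; last by move: d5; clear; lia.
    by rewrite exprS -mulrA; apply: divides_mulr; apply: divides_refl.
  move=> /pM [|/(prime_exp (lin_prime M0)) /(lin_divides M0) [k /par //]].
  by apply: prime_unit (lin_prime M0) _; apply/mpoly_unitP; exists c.
right; split=> //; exists c; move: eA e'; clear e A0; rewrite /A /B d4 => eA e'; split=> //.
apply: dot_ext => x; have := congr1 (meval (x 0)) e'; rewrite expr1 expr0 mul1r mevalZ !lin_dot => <-.
by rewrite dotZr.
Qed.
End GaloisVectors.

Section LinkedVectors.
Variables (K : closedFieldType) (charK : [pchar K] =i pred0) (N : nat) (F : {mpoly K[N]}).
Hypothesis no_vertex : forall u, vertex F u -> u = 0.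
Implicit Types (u v w x y : 'rV[K]_N) (l L m M : 'cV[K]_N).
Local Notation gp := (gp 4 F).

Let natK p : (0 < p)%N -> p%:R != 0 :> K.
Proof. by rewrite ((pcharf0P K).1 charK) lt0n. Qed.
Let n2 : (2 : K) != 0. Proof. exact: (natK (p := 2)). Qed.
Let n3 : (3 : K) != 0. Proof. exact: (natK (p := 3)). Qed.

(* [y] spans with [v] the plane of the Galois vectors linked to [v]: they are
   the multiples of [v] and of [v + a y] for the three cube roots [a]. *)
Definition link_direction l L a y :=
  [/\ a != 0, dot y L = 0, dot y l = 1 & dird y F = lin L ^+ 3 - (4 / a ^+ 3) *: lin l ^+ 3].

Definition linked v l L w m M := exists c, [/\ c != 0,
  dot w l *: L + (2 * dot w L) *: l = c *: M & dot v m *: M + (2 * dot v M) *: m = c *: L].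

(** Evaluating the relations at v and w gives c = 3 w(l) w(L), so both factors are nonzero. With t =
    w(L) and a = w(l) / t, the vector y defined by w = t (v + a y) satisfies y(L) = 0 and y(l) = 1,
    and D_y F is computed by linearity from D_v F and D_w F. *)
Lemma linked_direction v l L w m M : gp v l L -> gp w m M -> linked v l L w m M ->
  exists a y c, [/\ link_direction l L a y, c != 0 & w = c *: (v + a *: y)].
Proof.
move=> hv hw [c [c0 e1 e2]]; have [l0 vl vL _] := hv; have [m0 wm wM _] := hw.
have wl : dot w l = c * dot v M.
  by have := congr1 (dot v) e1; rewrite !dotE vl vL mulr1 mulr0 addr0.
have e3 : 3 * dot w l * dot w L = c.
  by have := congr1 (dot w) e1; rewrite !dotE wM => h; rewrite mulr1 in h; rewrite -[RHS]h; ring.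
have e4 : dot v m = c * dot w L.
  by have := congr1 (dot w) e2; rewrite !dotE wm wM mulr1 mulr0 addr0.
have [wL0 wl0] : dot w L != 0 /\ dot w l != 0.
  apply/andP; move: c0; rewrite -e3; apply: contraR; rewrite negb_and !negbK.
  by case/orP => /eqP ->; rewrite ?mulr0 ?mul0r.
pose t := dot w L; pose a := dot w l / t; pose y := a^-1 *: (t^-1 *: w - v).
have a0 : a != 0 by rewrite mulf_neq0 // invr_eq0.
exists a, y, t; split=> //; last first.
  by rewrite /y scalerA divff // scale1r addrC subrK scalerA divff // scale1r.
split=> //.
- by rewrite /y !dotE vL mulVf // subrr mulr0.
- by rewrite /y !dotE vl subr0 /a [t^-1 * _]mulrC mulVf.
have eM x : dot x M = (dot w l * dot x L + 2 * t * dot x l) / c.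
  have := congr1 (dot x) e1; rewrite !dotE -/t => ->.
  by rewrite mulrC mulKf.
have em x : dot x m = (c * dot x L - dot v m * dot x M) / (2 * dot v M).
  have vM0 : dot v M != 0 by move: wl0; rewrite wl mulf_eq0 negb_or => /andP[].
  have := congr1 (dot x) e2; rewrite !dotE => <-.
  by rewrite addrAC subrr add0r mulrC mulKf // mulf_neq0.
rewrite /y dirdZ dirdB dirdZ (gp_dird hv) (gp_dird hw); apply: mpoly_ext => x.
have vMe : dot v M = dot w l / c by rewrite wl mulrC mulKf.
rewrite !(mevalZ, mevalB, mevalM, mevalXn, lin_dot) em vMe e4 -/t eM -e3 -/t /a /=.
have := n2; have := n3; move: wl0 wL0; rewrite -/t => h1 h2 h3 h4.
by field; rewrite ?h1 ?h2 ?h3 ?h4.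
Qed.

(** The difference e of two directions is killed by [l] and [L], and D_e F = k l^3 for a constant k.
    Comparing D_y D_e F = 3 k l^2 with D_e D_y F = 0 gives k = 0, so e is a vertex. *)
Lemma direction_unique v l L a y a' y' : gp v l L ->
  link_direction l L a y -> link_direction l L a' y' -> y = y' /\ a ^+ 3 = a' ^+ 3.
Proof.
move=> hv [a0 yL yl hy] [a'0 y'L y'l hy']; have [l0 vl vL _] := hv.
pose e := y - y'; have eL : dot e L = 0 by rewrite /e !dotE yL y'L subrr.
have el : dot e l = 0 by rewrite /e !dotE yl y'l subrr.
pose k := 4 / a' ^+ 3 - 4 / a ^+ 3.
have he : dird e F = k *: lin l ^+ 3.
  rewrite dirdB hy hy'; apply: mpoly_ext => x.
  by rewrite !(mevalZ, mevalB) /k; ring.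
have lin_pow u c j : dird u (lin c ^+ j.+1) = (j.+1%:R * dot u c) *: lin c ^+ j.
  by rewrite dird_exp dird_lin; apply: mpoly_ext => x; rewrite !(mevalZ, mevalM, mevalC) mulrA.
have k0 : k = 0.
  have := dirdC y e F; rewrite hy he dird_scale lin_pow yl.
  have -> : dird e (lin L ^+ 3 - (4 / a ^+ 3) *: lin l ^+ 3) = 0.
    have dB p q : dird e (p - q) = dird e p - dird e q.
      by rewrite dirdD -scaleN1r dird_scale scaleN1r.
    by rewrite dB dird_scale !lin_pow eL el !mulr0 !scale0r scaler0 subrr.
  have l20 : lin l ^+ 2 != 0 by rewrite expf_neq0 //; apply: contra_neq l0 => /lin_eq0.
  move/eqP; rewrite mulr1 scalerA scaler_eq0 (negbTE l20) orbF mulf_eq0 (negbTE n3) orbF.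
  by move/eqP.
have e0 : e = 0 by apply/no_vertex/(dird_vertex charK); rewrite he k0 scale0r.
split; first by apply/eqP; rewrite -subr_eq0 -/e e0.
move/eqP: k0; rewrite subr_eq0 => /eqP /(mulfI (natK (p := 4) isT)) /invr_inj.
by [].
Qed.

(** From a point z with L = l = 0, the derivative of s -> F(z + s y) is - 4 s^3 / a^3, so F(z + s y)
    + s^4 / a^3 is constant. *)
Lemma direction_line v l L a y x : gp v l L -> link_direction l L a y ->
  F.@[x 0] = dot x l * dot x L ^+ 3 - dot x l ^+ 4 / a ^+ 3 +
    F.@[(x - dot x L *: v - dot x l *: y) 0].
Proof.
move=> hv [a0 yL yl hy]; have [l0 vl vL hx] := hv; rewrite hx -addrA; congr (_ + _).
set z := _ - _ *: y; have zL : dot z L = 0.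
  by rewrite /z !dotE vL yL mulr0 subr0 mulr1 subrr.
have zl : dot z l = 0 by rewrite /z !dotE vl yl mulr0 subr0 mulr1 subrr.
have -> : x - dot x L *: v = z + dot x l *: y by rewrite subrK.
clearbody z.
pose p := linep F z y + a ^- 3 *: 'X^4.
have p' : p^`() = 0.
  rewrite derivD deriv_linep derivZ derivXn hy; apply: poly_ext => s.
  rewrite hornerD linep_eval mevalB mevalZ !mevalXn !lin_dot !dotE zL zl yL yl.
  by rewrite hornerZ hornerMn hornerXn horner0 -[_ *+ 4]mulr_natr; field.
have := deriv_const charK p' => /(congr1 (fun q => q.[dot x l])).
rewrite hornerC /p !hornerD !linep_eval !hornerZ !hornerXn scale0r addr0 expr0n mulr0 addr0 => e.
by rewrite -[in RHS]e; field.
Qed.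

(* Scale [l] by a fourth root of [-1/a^3]. *)
Lemma linked_block v l L a y : gp v l L -> link_direction l L a y ->
  exists be ga, [/\ be != 0, ga != 0 & forall x,
    F.@[x 0] = dot x (be *: l) * dot x (ga *: L) ^+ 3 + dot x (be *: l) ^+ 4 +
      F.@[(x - dot x (ga *: L) *: (ga^-1 *: v) - dot x (be *: l) *: (be^-1 *: y)) 0]].
Proof.
move=> hv hy; have [a0 _ _ _] := hy.
have root k (t : K) : (0 < k)%N -> t != 0 -> exists2 b, b != 0 & b ^+ k = t.
  move=> k0 t0; have : size ('X^k - t%:P) != 1%N by rewrite size_XnsubC // eqSS -lt0n.
  move=> /closed_rootP [b]; rewrite /root hornerD hornerN hornerXn hornerC subr_eq0 => /eqP bt.
  by exists b => //; apply: contra_neq t0 => b0; rewrite -bt b0 expr0n gtn_eqF.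
have a30 : - a ^- 3 != 0 by rewrite oppr_eq0 invr_eq0 expf_neq0.
have [be be0 ebe] := root 4%N _ isT a30.
have be'0 : be^-1 != 0 by rewrite invr_eq0.
have [ga ga0 ega] := root 3%N _ isT be'0.
have can (b t : K) : b != 0 -> b * t / b = t by move=> b0; rewrite mulrC mulKf.
exists be, ga; split=> // x; rewrite (direction_line x hv hy) !dotZr !scalerA.
rewrite (can ga) // (can be) //; congr (_ + _).
by rewrite !exprMn ega ebe; field; rewrite be0 a0.
Qed.

(** The forms of w are combinations of those of v, hence kill u as well. A link between w and u
    would then make the form [Nn] of u zero, so the dichotomy leaves orthogonality. *)
Lemma orthogonal_transfer v l L w m M u n Nn : gp v l L -> gp w m M -> gp u n Nn ->
  linked v l L w m M -> orthogonal_gp v l L u n Nn -> orthogonal_gp w m M u n Nn.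
Proof.
move=> hv hw hu hl [ul uL vn vN].
have [a [y [c [[a0 yL yl _] c0 ew]]]] := linked_direction hv hw hl.
have [k [k0 e1 e2]] := hl.
have uM : dot u M = 0.
  by apply: (mulfI k0); rewrite mulr0 -dotZr -e1 !dotE ul uL !mulr0 addr0.
have um : dot u m = 0.
  have [_ wm wM _] := hw; have [_ vl vL _] := hv.
  have vM0 : dot v M != 0.
    apply: contraNneq a0 => vM; have := congr1 (dot v) e1; rewrite !dotE vl vL vM !mulr0 addr0 mulr1.
    by rewrite ew !dotE vl yl add0r mulr1 => /eqP; rewrite mulf_eq0 (negbTE c0) => /eqP ->.
  apply: (mulfI (mulf_neq0 n2 vM0)); rewrite mulr0; have := congr1 (dot u) e2.
  by rewrite !dotE uL uM !mulr0 add0r.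
have [|//|[_ [k' [k'0 e3 _]]]] := gp_pair charK (leqnn 4) no_vertex hw hu.
  move=> c' eu; have := congr1 (fun q => dot q L) eu; rewrite ew !dotE.
  have [_ vl vL _] := hv; rewrite vL yL mulr0 addr0 mulr1 uL => /esym/eqP.
  rewrite mulf_eq0 (negbTE c0) orbF => /eqP c'0.
  by have := gp_neq0 hu; rewrite eu c'0 scale0r eqxx.
have := gp_L_neq0 hu; rewrite -(inj_eq (scalerI k'0)) -e3 um uM scale0r mulr0 scale0r addr0 scaler0.
by rewrite eqxx.
Qed.
End LinkedVectors.

(** * Splitting off Galois points *)

Section Representatives.
Variables (K : closedFieldType) (charK : [pchar K] =i pred0) (n d : nat) (F : {mpoly K[n.+2]}) (s : int).
Hypotheses (hd : (4 <= d)%N) (hF : F \is d.-homog) (irrF : irreducible_elt F).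
Hypotheses (hs : has_dim (Sing F) s) (hsn : s <= n%:Z - 2) (finD : finite_set (Delta F)).
Local Notation V := 'rV[K]_n.+2.

Lemma DeltaP (P : ppoint K n.+1) (v : V) : v \in val P -> v != 0 -> (Delta F P <-> exists l L, gp d F v l L).
Proof.
move=> vP v0; split=> [DP|[l [L h]]].
  by have [_ _ /galois_formP] := Delta_galois_form charK hd hF irrF hs hsn DP vP v0.
have [Fv sv] := gp_on_singular hd hF h.
by apply: (galois_form_Delta charK hd hF irrF vP v0 Fv sv); apply/galois_formP; exists l, L.
Qed.

Definition nonproportional (t : seq V) := forall v w, v \in t -> w \in t -> v != w -> forall c, w <> c *: v.

Lemma point_choice : exists pt : V -> ppoint K n.+1, forall v, v != 0 -> v \in val (pt v).
Proof.
have : forall v : V, exists P : ppoint K n.+1, v != 0 -> v \in val P.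
  move=> v; have [->|v0] := eqVneq v 0; last by have [P vP] := point_exists v0; exists P.
  have e0 : elast K n.+1 != 0 :> V.
    by apply/eqP => /rowP /(_ ord_max); rewrite !mxE !eqxx => /eqP; rewrite oner_eq0.
  by have [P _] := point_exists e0; exists P; rewrite ?eqxx.
by move=> /choice [pt hpt]; exists pt.
Qed.

Lemma card_Delta_ge (t : seq V) : uniq t -> nonproportional t ->
  (forall v, v \in t -> exists l L, gp d F v l L) -> (size t)%:Z <= card_Delta F.
Proof.
move=> ut np ht; have [pt hpt] := point_choice.
have t0 v : v \in t -> v != 0 by move=> /ht [l [L /gp_neq0]].
have um : uniq (map pt t).
  rewrite map_inj_in_uniq // => v w vt wt e; apply/eqP; apply: contraT => vw.
  have := hpt w (t0 w wt); rewrite -e (point_vline (hpt v (t0 v vt)) (t0 v vt)) => /vlineP [c].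
  by move/(np v w vt wt vw).
rewrite /card_Delta lez_nat -(size_map pt); apply: uniq_leq_size => // _ /mapP [v vt ->].
by rewrite in_fset_set //; apply/mem_set/(DeltaP (hpt v (t0 v vt)) (t0 v vt)); apply: ht.
Qed.

Lemma Delta_representatives : exists t : seq V, [/\ uniq t, nonproportional t,
  (size t)%:Z = card_Delta F & forall v, v \in t -> exists l L, gp d F v l L].
Proof.
have /choice [rep hrep] : forall P : ppoint K n.+1, exists v, v \in val P /\ v != 0.
  by move=> P; have [v vP v0] := point_neq0 P; exists v.
have inj : injective rep.
  move=> P Q e; have [h1 h2] := hrep P; have [h3 _] := hrep Q.
  by apply: (point_eq h1) h2; rewrite e.
exists (map rep (fset_set (Delta F))); split.
- by rewrite map_inj_uniq // fset_uniq.
- move=> _ _ /mapP [P _ ->] /mapP [Q _ ->] ne c e; case/eqP: ne.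
  have [h1 h2] := hrep P; have [h3 h4] := hrep Q; congr (rep _); apply: (point_eq _ h3 h4).
  by rewrite e memvZ.
- by rewrite size_map.
move=> v /mapP [P hP ->]; move: hP; rewrite in_fset_set // => /set_mem hP.
by have [h1 h2] := hrep P; apply/(DeltaP h1 h2).
Qed.

(** Differentiating D_v F along a vertex u shows that [l] and [L] kill u. So all v + i u are Galois
    vectors with the same [l] and [L], pairwise nonproportional if u is not zero, and one more than
    [card_Delta F] of them is too many. *)
Lemma gp_no_vertex (v : V) l L : gp d F v l L -> forall u, vertex F u -> u = 0.
Proof.
move=> hv u hu; apply/eqP; apply: contraT => u0; have [l0 vl vL hx] := hv.
have hz : dird u (dird v F) = 0.
  rewrite dirdC; have -> : dird u F = 0; last by rewrite /dird big1 // => i _; rewrite mderiv0 scaler0.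
  apply: mpoly_ext => x; rewrite dird_deriv0 meval0.
  have -> : linep F x u = (F.@[x 0])%:P by apply: poly_ext => t; rewrite linep_eval hornerC hu.
  by rewrite derivC horner0.
have n1 p : (0 < p)%N -> p%:R != 0 :> K by rewrite ((pcharf0P K).1 charK) lt0n.
have lL0 : lin L != 0 by apply: contra_neq (gp_L_neq0 hv) => /lin_eq0.
have hl : dot u l *: L + (d.-2%:R * dot u L) *: l = 0.
  apply: lin_eq0; move: hz; rewrite (gp_dird hv) dird_scale.
  rewrite (_ : d.-2 = (d - 3).+1); last by move: hd; clear; lia.
  move/eqP; rewrite scaler_eq0 (negbTE (n1 _ _)); last by move: hd; clear; lia.
  by rewrite dird_pair mulf_eq0 expf_eq0 (negbTE lL0) andbF /= => /eqP.
have [ul /eqP] := linear_zero hv hl; rewrite mulf_eq0 (negbTE (n1 _ _)); last by move: hd; clear; lia.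
move=> /eqP uL.
pose t := [seq v + i%:R *: u | i <- iota 0 `|card_Delta F|.+1].
have vne i j c : v + i%:R *: u = c *: (v + j%:R *: u) -> i = j.
  move=> e; have := congr1 (fun z => dot z L) e; rewrite !dotE vL uL !mulr0 !addr0 mulr1 => /esym c1.
  move: e; rewrite c1 scale1r => /addrI /eqP; rewrite -subr_eq0 -scalerBl scaler_eq0 (negbTE u0) orbF subr_eq0.
  have natI (a b : nat) : (a <= b)%N -> a%:R = b%:R :> K -> a = b.
    move=> ab e; apply/eqP; rewrite eqn_leq ab -subn_eq0 -((pcharf0P K).1 charK) natrB // e.
    by rewrite subrr eqxx.
  by case: (leqP i j) => [ij|/ltnW ji] /eqP; [apply: natI|move/esym/(natI _ _ ji)].
have : (size t)%:Z <= card_Delta F; last by rewrite size_map size_iota /card_Delta /=; lia.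
apply: card_Delta_ge.
- rewrite map_inj_uniq ?iota_uniq // => i j e; apply: (vne i j 1).
  by rewrite scale1r.
- move=> _ _ /mapP [i _ ->] /mapP [j _ ->] ne c /vne e; by rewrite e eqxx in ne.
- move=> _ /mapP [i _ ->]; exists l, L; split=> //; rewrite ?dotE ?vl ?ul ?vL ?uL ?mulr0 ?addr0 //.
  move=> x; have -> : x - dot x L *: (v + i%:R *: u) = x - dot x L *: v + (- (dot x L * i%:R)) *: u.
    by rewrite scalerDr opprD addrA scalerA scaleNr.
  by rewrite hu hx.
Qed.
End Representatives.

Lemma maximal_pairwise (T : eqType) (R : T -> T -> Prop) (rs : seq T) :
  (forall x y, R x y -> R y x) -> uniq rs ->
  exists t, [/\ uniq t, {subset t <= rs}, forall x y, x \in t -> y \in t -> x != y -> R x y &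
    forall x, x \in rs -> x \in t \/ exists2 y, y \in t & ~ R x y].
Proof.
move=> sR; elim: rs => [|a rs IH] /=; first by exists [::]; split.
move=> /andP [ars /IH [t [ut st pt mt]]].
have [ha|ha] := pselect (forall y, y \in t -> R a y).
  exists (a :: t); split=> /=.
  - by rewrite ut andbT; apply: contra ars => /st.
  - by move=> x; rewrite !inE => /orP [->//|/st ->]; rewrite orbT.
  - move=> x y; rewrite !inE => /predU1P [->|xt] /predU1P [->|yt] //; rewrite ?eqxx //.
    + by move=> _; apply: ha.
    + by move=> _; apply/sR/ha.
    + exact: pt.
  move=> x; rewrite !inE => /predU1P [->|/mt [xt|[y yt h]]]; first by left; rewrite eqxx.
    by left; rewrite xt orbT.
  by right; exists y; rewrite // inE yt orbT.
exists t; split=> //; first by move=> x /st; rewrite inE => ->; rewrite orbT.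
move=> x; rewrite inE => /predU1P [->|/mt //]; right.
by have [y /not_implyP [yt h]] := (existsNP _).2 ha; exists y.
Qed.

Section Covers.
Variables (K : closedFieldType) (N : nat).
Implicit Types (t cl : seq 'rV[K]_N).

Lemma size_cover t cl : uniq t -> (forall v w, v \in t -> w \in t -> v != w -> forall c, w <> c *: v) ->
  (forall v, v \in t -> v != 0) ->
  (forall v, v \in t -> exists2 w, w \in cl & exists c, v = c *: w) -> (size t <= size cl)%N.
Proof.
move=> ut np t0 ht.
have /choice [f hf] : forall v, exists w, v \in t -> w \in cl /\ exists c, v = c *: w.
  move=> v; have [vt|vt] := boolP (v \in t); last by exists 0.
  by have [w wcl e] := ht v vt; exists w.
rewrite -(size_map f); apply: uniq_leq_size; last first.
  by move=> _ /mapP [v vt ->]; have [] := hf v vt.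
rewrite map_inj_in_uniq // => v w vt wt e; apply/eqP; apply: contraT => vw.
have [_ [c ec]] := hf v vt; have [_ [c' ec']] := hf w wt.
have c0 : c != 0 by apply: contra_neq (t0 v vt) => c0; rewrite ec c0 scale0r.
case: (np v w vt wt vw (c' / c)); rewrite ec' ec -e scalerA mulfVK //.
Qed.

Lemma cube_roots (a : K) : exists r : seq K, size r = 3%N /\ forall b, b ^+ 3 = a -> b \in r.
Proof.
have [r hr] := closed_field_poly_normal ('X^3 - a%:P : {poly K}).
have m : lead_coef ('X^3 - a%:P) = 1 by apply/eqP; rewrite -monicE; apply: monicXnsubC.
rewrite m scale1r in hr.
exists r; split.
  by have := size_XnsubC a (isT : (0 < 3)%N); rewrite hr size_prod_XsubC => -[].
by move=> b eb; rewrite -root_prod_XsubC -hr /root !hornerE eb subrr.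
Qed.
End Covers.

Section Pieces.
Variables (K : closedFieldType) (N d : nat) (F : {mpoly K[N]}).
Local Notation V := 'rV[K]_N.
Local Notation W := 'cV[K]_N.

(* A summand [l L^(d-1)] (or [l L^3 + l^4], when [pb] holds) that splits off
   from [F], with the vectors [pr], [py] dual to [L] and [l]. *)
Definition piece := (bool * V * V * W * W)%type.
Definition pb (P : piece) := P.1.1.1.1.
Definition pr (P : piece) := P.1.1.1.2.
Definition py (P : piece) := P.1.1.2.
Definition pL (P : piece) := P.1.2.
Definition pl (P : piece) := P.2.
Definition piece_val P x := dot x (pl P) * dot x (pL P) ^+ d.-1 + (pb P)%:R * dot x (pl P) ^+ 4.
Definition piece_disp P x := dot x (pL P) *: pr P + dot x (pl P) *: py P.
Definition is_piece P := [/\ pl P != 0,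
  [/\ dot (pr P) (pL P) = 1, dot (pr P) (pl P) = 0, dot (py P) (pL P) = 0 & dot (py P) (pl P) = (pb P)%:R],
  ~~ pb P -> py P = 0, pb P -> d = 4%N &
  forall x : V, F.@[x 0] = piece_val P x + F.@[(x - piece_disp P x) 0]].
Definition pkill (P Q : piece) :=
  [/\ dot (pr P) (pL Q) = 0, dot (pr P) (pl Q) = 0, dot (py P) (pL Q) = 0 & dot (py P) (pl Q) = 0].

Lemma pieces_decomposition Ps : (forall P, P \in Ps -> is_piece P) -> uniq Ps ->
  (forall P Q, P \in Ps -> Q \in Ps -> P != Q -> pkill P Q) ->
  forall x : V, F.@[x 0] = \sum_(P <- Ps) piece_val P x + F.@[(x - \sum_(P <- Ps) piece_disp P x) 0].
Proof.
elim: Ps => [|P Ps IH] hP uP kP x; first by rewrite !big_nil add0r subr0.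
have [_ _ _ _ hx] := hP P (mem_head _ _); rewrite hx.
have [nP uPs] : P \notin Ps /\ uniq Ps by apply/andP.
rewrite IH => [|Q Qs|//|Q R Qs Rs]; last 2 first.
- by apply: hP; rewrite inE Qs orbT.
- by apply: kP; rewrite inE ?Qs ?Rs orbT.
have kill Q : Q \in Ps -> dot (x - piece_disp P x) (pL Q) = dot x (pL Q) /\ dot (x - piece_disp P x) (pl Q) = dot x (pl Q).
  move=> Qs; have PQ : P != Q by apply: contraNneq nP => ->.
  have [k1 k2 k3 k4] := kP P Q (mem_head _ _) (mem_behead (s := P :: Ps) Qs) PQ.
  by rewrite /piece_disp !dotE k1 k2 k3 k4 !mulr0 !addr0 !oppr0 !addr0.
have e1 : \sum_(Q <- Ps) piece_val Q (x - piece_disp P x) = \sum_(Q <- Ps) piece_val Q x.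
  by apply: eq_big_seq => Q /kill [e1 e2]; rewrite /piece_val e1 e2.
have e2 : \sum_(Q <- Ps) piece_disp Q (x - piece_disp P x) = \sum_(Q <- Ps) piece_disp Q x.
  by apply: eq_big_seq => Q /kill [e3 e4]; rewrite /piece_disp e3 e4.
rewrite !big_cons e1 e2; set S := \sum_(Q <- Ps) piece_disp Q x.
have -> : x - (piece_disp P x + S) = x - piece_disp P x - S by rewrite opprD addrA.
exact: addrA.
Qed.
End Pieces.

Section PiecesOfPoints.
Variables (K : closedFieldType) (charK : [pchar K] =i pred0) (N d : nat) (F : {mpoly K[N]}).
Hypothesis hd : (4 <= d)%N.
Hypothesis no_vertex : forall u, vertex F u -> u = 0.
Variables (rs : seq 'rV[K]_N) (lf Lf : 'rV[K]_N -> 'cV[K]_N).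
Hypothesis hrs : forall v, v \in rs -> gp d F v (lf v) (Lf v).
Hypothesis nprs : forall v w, v \in rs -> w \in rs -> v != w -> forall c, w <> c *: v.

Definition orth v w := orthogonal_gp v (lf v) (Lf v) w (lf w) (Lf w).

Lemma orth_sym v w : orth v w -> orth w v. Proof. by move=> [? ? ? ?]. Qed.

Lemma linked_of v w : v \in rs -> w \in rs -> v != w -> ~ orth v w ->
  d = 4%N /\ linked v (lf v) (Lf v) w (lf w) (Lf w).
Proof.
move=> vt wt vw no.
by have [] := gp_pair charK hd no_vertex (hrs vt) (hrs wt) (nprs vt wt vw).
Qed.

Lemma exists_piece v : v \in rs -> exists P cl, [/\ is_piece d F P, size cl = (if pb P then 4 else 1)%N,
  forall u, u \in rs -> u = v \/ ~ orth u v -> exists2 w, w \in cl & exists c, u = c *: w,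
  [/\ exists c, pr P = c *: v, exists c, pL P = c *: Lf v & exists c, pl P = c *: lf v] &
  forall u, u \in rs -> orth v u -> dot (py P) (Lf u) = 0 /\ dot (py P) (lf u) = 0].
Proof.
move=> vt; have hv := hrs vt; have [l0 vl vL hx] := hv.
have [[w [wt vw no]]|no] := pselect (exists w, [/\ w \in rs, v != w & ~ orth v w]); last first.
  exists (false, v, 0, Lf v, lf v), [:: v]; split=> //=.
  - split=> //=; first by split=> //=; rewrite /pL /pl /py /pr /= ?dotE.
    by move=> x; rewrite /piece_val /piece_disp /pL /pl /py /pr /= mul0r addr0 scaler0 addr0.
  - move=> u ut [->|h]; first by exists v; rewrite ?inE //; exists 1; rewrite scale1r.
    exists v; rewrite ?inE //; exists 1; rewrite scale1r; apply/eqP; apply: contraT => uv.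
    by case: no; exists u; split=> //; rewrite 1?eq_sym // => /orth_sym.
  - by split; exists 1; rewrite scale1r.
  - by move=> u ut _; rewrite /py /= !dotE.
have [d4 hl] := linked_of vt wt vw no.
have G4 u : u \in rs -> gp 4 F u (lf u) (Lf u) by rewrite -d4; apply: hrs.
have [a [y [c [hy c0 ew]]]] := linked_direction charK (G4 _ vt) (G4 _ wt) hl.
have [a0 yL yl _] := hy.
have [be [ga [be0 ga0 hblock]]] := linked_block charK (G4 _ vt) hy.
have [cr [scr hcr]] := cube_roots (a ^+ 3).
exists (true, ga^-1 *: v, be^-1 *: y, ga *: Lf v, be *: lf v), (v :: [seq v + b *: y | b <- cr]); split=> //=.
- split=> //=; rewrite ?scaler_eq0 ?negb_or ?be0 //.
    by split; rewrite /pL /pl /py /pr /= !dotE ?vL ?vl ?yL ?yl ?mulr0 ?mulr1 // ?mulVf // mulfV.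
  by move=> x; rewrite {1}hblock /piece_val /piece_disp /pL /pl /py /pr /= d4 mul1r opprD addrA.
- by rewrite size_map scr.
- move=> u ut h; have [->|uv] := eqVneq u v.
    by exists v; rewrite ?inE ?eqxx //; exists 1; rewrite scale1r.
  case: h => [e|h]; first by rewrite e eqxx in uv.
  have [|//|_ hl'] := linked_of vt ut; [by rewrite eq_sym | by move=> /orth_sym|].
  have [a' [y' [c' [hy' c'0 eu]]]] := linked_direction charK (G4 _ vt) (G4 _ ut) hl'.
  have [ey ea] := direction_unique charK no_vertex (G4 _ vt) hy hy'.
  exists (v + a' *: y); last by exists c'; rewrite eu ey.
  by rewrite inE; apply/orP; right; apply/mapP; exists a' => //; apply: hcr.
- by split; [exists ga^-1|exists ga|exists be].
move=> u ut hu; have [h1 h2 h3 h4] := hu.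
have [k1 k2 k3 k4] := orthogonal_transfer charK no_vertex (G4 _ vt) (G4 _ wt) (G4 _ ut) hl hu.
move: k3 k4; rewrite /py /= ew !dotE h3 h4 !add0r => /eqP k3 /eqP k4.
move: k3 k4; rewrite !mulf_eq0 (negbTE c0) (negbTE a0) /= => /eqP -> /eqP ->.
by rewrite mulr0.
Qed.

(** One piece for each member of a maximal pairwise orthogonal subfamily. Any vector of [rs] is a
    member or fails to be orthogonal to one, whose list then covers it; this bounds the size of
    [rs]. *)
Lemma Galois_pieces : uniq rs -> exists Ps, [/\ forall P, P \in Ps -> is_piece d F P, uniq Ps,
  forall P Q, P \in Ps -> Q \in Ps -> P != Q -> pkill P Q &
  (size rs <= \sum_(P <- Ps) (if pb P then 4 else 1))%N].
Proof.
move=> urs; have [O [uO sO pO mO]] := maximal_pairwise orth_sym urs.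
have /choice [pc hpc] : forall v, exists Pc : piece K N * seq 'rV[K]_N, v \in O ->
  [/\ is_piece d F Pc.1, size Pc.2 = (if pb Pc.1 then 4 else 1)%N,
  forall u, u \in rs -> u = v \/ ~ orth u v -> exists2 w, w \in Pc.2 & exists c, u = c *: w,
  [/\ exists c, pr Pc.1 = c *: v, exists c, pL Pc.1 = c *: Lf v & exists c, pl Pc.1 = c *: lf v] &
  forall u, u \in rs -> orth v u -> dot (py Pc.1) (Lf u) = 0 /\ dot (py Pc.1) (lf u) = 0].
  move=> v; have [vO|vO] := boolP (v \in O); last by exists (false, 0, 0, 0, 0, [::]).
  by have [P [cl h]] := exists_piece (sO v vO); exists (P, cl).
pose p v := (pc v).1.
have kill v w : v \in O -> w \in O -> v != w -> pkill (p v) (p w).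
  move=> vO wO vw; have [_ _ _ [[c1 e1] _ _] hy] := hpc v vO.
  have [_ _ _ [_ [c2 e2] [c3 e3]] _] := hpc w wO.
  have hvw := pO v w vO wO vw; have [h1 h2 h3 h4] := hvw.
  have [k1 k2] := hy w (sO w wO) hvw.
  by split; rewrite /p ?e1 ?e2 ?e3 !dotE ?h1 ?h2 ?h3 ?h4 ?k1 ?k2 ?mulr0.
have pinj : {in O &, injective p}.
  move=> v w vO wO e; apply/eqP; apply: contraT => /(kill v w vO wO) [+ _ _ _].
  by rewrite -e; have [[_ [-> _ _ _] _ _ _] _ _ _ _] := hpc v vO; move/eqP; rewrite oner_eq0.
exists (map p O); split.
- by move=> _ /mapP [v vO ->]; have [] := hpc v vO.
- by rewrite map_inj_in_uniq.
- by move=> _ _ /mapP [v vO ->] /mapP [w wO ->] ne; apply: kill => //; apply: contra_neq ne => ->.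
have -> : (\sum_(P <- map p O) (if pb P then 4 else 1) = size (flatten [seq (pc v).2 | v <- O]))%N.
  rewrite size_flatten /shape -map_comp sumnE !big_map; apply: eq_big_seq => v vO.
  by have [_ e _ _ _] := hpc v vO; rewrite /= e.
apply: size_cover => // [v vt|v vt]; first exact: gp_neq0 (hrs vt).
have [o oO ho] : exists2 o, o \in O & v = o \/ ~ orth v o.
  by have [vO|[o oO h]] := mO v vt; [exists v => //; left|exists o => //; right].
have [_ _ /(_ v vt ho) [w ww e] _ _] := hpc o oO; exists w => //.
by apply/flatten_mapP; exists o.
Qed.
End PiecesOfPoints.

(** Invariance under [tailv p] expresses that a function depends only on the coordinates from index
    [p] on. *)
Definition tailv (K : closedFieldType) N p (x : 'rV[K]_N) : 'rV[K]_N := \row_i (if (p <= i)%N then x 0 i else 0).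
Definition co (K : closedFieldType) N (x : 'rV[K]_N.+1) i : K := x 0 (inord i).

(** The rows of [A], completed by a basis of the common kernel of the forms [C], are a basis in
    which these forms are the first [p] coordinates. *)
Lemma dual_system_basis (K : closedFieldType) N p (A : 'M[K]_(p, N)) (C : 'M[K]_(N, p)) : A *m C = 1%:M ->
  exists D : 'M[K]_N, [/\ D \in unitmx, (p <= N)%N,
    forall (z : 'rV_N) (i : 'I_p) (j : 'I_N), j = i :> nat -> (z *m D *m C) 0 i = z 0 j &
    forall z : 'rV_N, z *m D - (z *m D *m C) *m A = tailv p z *m D].
Proof.
move=> AC; have rC : \rank C = p.
  by apply/eqP; rewrite eqn_leq rank_leq_col -{1}(mxrank1 K p) -AC mxrankM_maxr.
have pN : (p <= N)%N by rewrite -rC rank_leq_row.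
have [t [R [eN RC fR]]] : exists t (R : 'M[K]_(t, N)), [/\ (p + t = N)%N, R *m C = 0 & row_free R].
  exists (\rank (kermx C)), (row_base (kermx C)); split; last exact: row_base_free.
    by rewrite mxrank_ker rC subnKC.
  by apply/eqP; rewrite -sub_kermx eq_row_base.
clear rC pN; move: A C R AC RC fR; case: N / eN => A C R AC RC fR.
have dec (z : 'rV_(p + t)) : z *m col_mx A R = lsubmx z *m A + rsubmx z *m R.
  by rewrite -{1}[z]hsubmxK mul_row_col.
have zC (z : 'rV_(p + t)) : z *m col_mx A R *m C = lsubmx z.
  by rewrite dec mulmxDl -!mulmxA AC RC mulmx1 mulmx0 addr0.
exists (col_mx A R); split; first 2 last.
- move=> z i j ji; rewrite zC mxE; congr (z 0 _); exact: val_inj.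
- move=> z; rewrite zC dec addrAC subrr add0r dec.
  have -> : lsubmx (tailv p z) = 0.
    by apply/rowP => i; rewrite !mxE /= leqNgt ltn_ord.
  by rewrite mul0mx add0r; congr (_ *m _); apply/rowP => i; rewrite !mxE /= leq_addr.
- rewrite -row_free_unit; apply/inj_row_free => z hz.
  have h1 : lsubmx z = 0 by rewrite -zC hz mul0mx.
  move: hz; rewrite dec h1 mul0mx add0r => h2.
  have h3 : rsubmx z = 0 by apply/(row_free_inj fR); rewrite h2 mul0mx.
  by rewrite -[z]hsubmxK h1 h3 row_mx0.
exact: leq_addr.
Qed.

Section NormalForm.
Variables (K : closedFieldType) (n d : nat).
Local Notation V := 'rV[K]_n.+2.

(* Coordinates are ordered as q variables X, k variables Z, q variables Y and
   the remaining ones T; the [lam j] and [g] only involve T. *)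
Definition gnf q k (lam : nat -> 'cV[K]_n.+2) (g F : {mpoly K[n.+2]}) :=
  [/\ (q + k + q <= n.+2)%N,
    forall j, (j < k)%N -> forall x : V, dot x (lam j) = dot (tailv (q + k + q) x) (lam j),
    g \is d.-homog, forall x : V, g.@[x 0] = g.@[(tailv (q + k + q) x) 0] &
    forall x : V, F.@[x 0] = \sum_(i < q) (co x (q + k + i) * co x i ^+ 3 + co x (q + k + i) ^+ 4)
      + \sum_(j < k) dot x (lam j) * co x (q + j) ^+ d.-1 + g.@[x 0]].

Local Notation pb' := (@pb K n.+2).

(** The vectors of the pieces, in the order X, Z, Y, are dual to the forms [pL] of the blocks, [pL]
    of the single points and [pl] of the blocks; completed to a basis they give the coordinates. The
    remaining form [pl] of a single point vanishes on all these vectors, so it involves only T. *)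
Lemma gnf_of_pieces (F : {mpoly K[n.+2]}) (Ps : seq (piece K n.+2)) : F \is d.-homog -> (forall P, P \in Ps -> is_piece d F P) -> uniq Ps ->
  (forall P Q, P \in Ps -> Q \in Ps -> P != Q -> pkill P Q) ->
  exists D lam g, [/\ D \in unitmx, gnf (count pb' Ps) (count (predC pb') Ps) lam g (subst D F) &
    forall j, (j < count (predC pb') Ps)%N -> lam j != 0].
Proof.
move=> hF hP uP kP; have hx := pieces_decomposition hP uP kP.
pose Q2 := filter pb' Ps; pose Q1 := filter (predC pb') Ps.
rewrite -!size_filter -/Q2 -/Q1.
set q := size Q2; set k := size Q1.
pose P0 : piece K n.+2 := (false, 0, 0, 0, 0).
pose bv i := if (i < q)%N then pr (nth P0 Q2 i) else
  if (i < q + k)%N then pr (nth P0 Q1 (i - q)) else py (nth P0 Q2 (i - (q + k))).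
pose bc i := if (i < q)%N then pL (nth P0 Q2 i) else
  if (i < q + k)%N then pL (nth P0 Q1 (i - q)) else pl (nth P0 Q2 (i - (q + k))).
have in2 i : (i < q)%N -> nth P0 Q2 i \in Ps /\ pb (nth P0 Q2 i).
  by move=> /(mem_nth P0); rewrite mem_filter => /andP [-> ->].
have in1 i : (i < k)%N -> nth P0 Q1 i \in Ps /\ ~~ pb (nth P0 Q1 i).
  by move=> /(mem_nth P0); rewrite mem_filter => /andP [h1 h2].
have rL P Q : P \in Ps -> Q \in Ps -> dot (pr P) (pL Q) = (P == Q)%:R.
  move=> hP1 hQ; case: eqP => [<-|/eqP ne]; first by have [_ [-> _ _ _] _ _ _] := hP P hP1.
  by have [-> _ _ _] := kP P Q hP1 hQ ne.
have rl P Q : P \in Ps -> Q \in Ps -> dot (pr P) (pl Q) = 0.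
  move=> hP1 hQ; case: (eqVneq P Q) => [<-|ne]; first by have [_ [_ -> _ _] _ _ _] := hP P hP1.
  by have [_ -> _ _] := kP P Q hP1 hQ ne.
have yL P Q : P \in Ps -> Q \in Ps -> dot (py P) (pL Q) = 0.
  move=> hP1 hQ; case: (eqVneq P Q) => [<-|ne]; first by have [_ [_ _ -> _] _ _ _] := hP P hP1.
  by have [_ _ -> _] := kP P Q hP1 hQ ne.
have yl P Q : P \in Ps -> Q \in Ps -> pb P -> dot (py P) (pl Q) = (P == Q)%:R.
  move=> hP1 hQ hb; case: eqP => [<-|/eqP ne]; first by have [_ [_ _ _ ->] _ _ _] := hP P hP1; rewrite hb.
  by have [_ _ _ ->] := kP P Q hP1 hQ ne.
have u2 i j : (i < q)%N -> (j < q)%N -> (nth P0 Q2 i == nth P0 Q2 j) = (i == j).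
  by move=> iq jq; rewrite nth_uniq // filter_uniq.
have u1 i j : (i < k)%N -> (j < k)%N -> (nth P0 Q1 i == nth P0 Q1 j) = (i == j).
  by move=> iq jq; rewrite nth_uniq // filter_uniq.
have u12 i j : (i < q)%N -> (j < k)%N -> (nth P0 Q2 i == nth P0 Q1 j) = false.
  by move=> /in2 [_ h] /in1 [_ h']; apply: contraNF h' => /eqP <-.
have dual i j : (i < q + k + q)%N -> (j < q + k + q)%N -> dot (bv i) (bc j) = (i == j)%:R.
  rewrite /bv /bc => hi hj; case: (ltnP i q) => iq; case: (ltnP j q) => jq.
  - have [h1 h2] := in2 i iq; have [h3 h4] := in2 j jq; by rewrite rL // u2.
  - have [h1 h2] := in2 i iq; have -> : (i == j) = false by apply/eqP; move: iq jq; clear; lia.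
    case: (ltnP j (q + k)) => jk.
      have jk' : (j - q < k)%N by move: jq jk; clear; lia.
      by have [h3 h4] := in1 _ jk'; rewrite rL // u12.
    have jk' : (j - (q + k) < q)%N by move: hj jk; clear; lia.
    by have [h3 h4] := in2 _ jk'; rewrite rl.
  - have [h3 h4] := in2 j jq; have -> : (i == j) = false by apply/eqP; move: iq jq; clear; lia.
    case: (ltnP i (q + k)) => ik.
      have ik' : (i - q < k)%N by move: iq ik; clear; lia.
      by have [h1 h2] := in1 _ ik'; rewrite rL // eq_sym u12.
    have ik' : (i - (q + k) < q)%N by move: hi ik; clear; lia.
    by have [h1 h2] := in2 _ ik'; rewrite yL.
  case: (ltnP i (q + k)) => ik; case: (ltnP j (q + k)) => jk.
  - have ik' : (i - q < k)%N by move: iq ik; clear; lia.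
    have jk' : (j - q < k)%N by move: jq jk; clear; lia.
    have [h1 h2] := in1 _ ik'; have [h3 h4] := in1 _ jk'; rewrite rL // u1 //.
    by congr (_%:R); congr nat_of_bool; apply/eqP/eqP; move: iq jq; clear; lia.
  - have ik' : (i - q < k)%N by move: iq ik; clear; lia.
    have jk' : (j - (q + k) < q)%N by move: hj jk; clear; lia.
    have [h1 h2] := in1 _ ik'; have [h3 h4] := in2 _ jk'; rewrite rl //.
    by have -> : (i == j) = false by apply/eqP; move: ik jk; clear; lia.
  - have ik' : (i - (q + k) < q)%N by move: hi ik; clear; lia.
    have jk' : (j - q < k)%N by move: jq jk; clear; lia.
    have [h1 h2] := in2 _ ik'; have [h3 h4] := in1 _ jk'; rewrite yL //.
    by have -> : (i == j) = false by apply/eqP; move: ik jk; clear; lia.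
  have ik' : (i - (q + k) < q)%N by move: hi ik; clear; lia.
  have jk' : (j - (q + k) < q)%N by move: hj jk; clear; lia.
  have [h1 h2] := in2 _ ik'; have [h3 h4] := in2 _ jk'; rewrite yl // u2 //.
  by congr (_%:R); congr nat_of_bool; apply/eqP/eqP; move: ik jk; clear; lia.
pose A : 'M[K]_(q + k + q, n.+2) := \matrix_i bv i.
pose C : 'M[K]_(n.+2, q + k + q) := \matrix_(j, i) bc i j 0.
have colC i : col i C = bc i by apply/colP => j; rewrite !mxE.
have xC x i : (x *m C) 0 i = dot x (bc i).
  by rewrite /dot !mxE; apply: eq_bigr => j _; rewrite !mxE.
have AC : A *m C = 1%:M.
  apply/matrixP => i j; have -> : (A *m C) i j = dot (row i A) (bc j) by rewrite -xC -row_mul [RHS]mxE.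
  by rewrite rowK [RHS]mxE dual.
have sumP (W : zmodType) (f : piece K n.+2 -> W) : \sum_(P <- Ps) f P =
    \sum_(i < q) f (nth P0 Q2 i) + \sum_(i < k) f (nth P0 Q1 i).
  have hp : perm_eq Ps (Q2 ++ Q1) by rewrite perm_sym perm_filterC.
  by rewrite (perm_big _ hp) big_cat /= !(big_nth P0) !big_mkord.
have bvi (i : 'I_q) : bv i = pr (nth P0 Q2 i) /\ bc i = pL (nth P0 Q2 i) by rewrite /bv /bc ltn_ord.
have bvj (i : 'I_k) : bv (q + i)%N = pr (nth P0 Q1 i) /\ bc (q + i)%N = pL (nth P0 Q1 i).
  by rewrite /bv /bc ltnNge leq_addr /= ltn_add2l ltn_ord addKn.
have bvy (i : 'I_q) : bv (q + k + i)%N = py (nth P0 Q2 i) /\ bc (q + k + i)%N = pl (nth P0 Q2 i).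
  by rewrite /bv /bc ltnNge -addnA leq_addr /= ltnNge addnA leq_addr /= addKn.
have disp x : \sum_(P <- Ps) piece_disp P x = (x *m C) *m A.
  rewrite mulmx_sum_row (eq_bigr (fun i : 'I_(q + k + q) => dot x (bc i) *: bv i)); last first.
    by move=> i _; rewrite xC rowK.
  rewrite !big_split_ord /= sumP /piece_disp big_split /= -!addrA; congr (_ + _).
    by apply: eq_bigr => i _; have [-> ->] := bvi i.
  rewrite addrC; congr (_ + _).
    apply: eq_bigr => i _; have [-> ->] := bvj i.
    have [h1 h2] := in1 i (ltn_ord i); have [_ _ h3 _ _] := hP _ h1.
    by rewrite h3 // scaler0 addr0.
  by apply: eq_bigr => i _; have [-> ->] := bvy i.
have [D [uD pN hD1 hD2]] := dual_system_basis AC.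
pose Tm : 'M[K]_n.+2 := diag_mx (\row_i (if (q + k + q <= i)%N then 1 else 0)).
have tE x : tailv (q + k + q) x = x *m Tm.
  apply/rowP => i; rewrite !mxE (bigD1 i) //= !mxE eqxx mulr1n big1 ?addr0 => [|j ji].
    by case: ifP; rewrite ?mulr1 ?mulr0.
  by rewrite !mxE (negbTE ji) mulr0n mulr0.
have tK (x : V) : tailv (q + k + q) (tailv (q + k + q) x) = tailv (q + k + q) x.
  by apply/rowP => i; rewrite !mxE; case: (q + k + q <= i)%N.
have cD z i : (i < q + k + q)%N -> dot (z *m D) (bc i) = co z i.
  move=> hi; rewrite -(xC _ (Ordinal hi)) (hD1 _ _ (inord i)) //=.
  by rewrite inordK //; exact: leq_trans pN.
exists D, (fun j => D *m pl (nth P0 Q1 j)), (subst (Tm *m D) F); split=> //; last first.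
  move=> j jk; have [h1 _] := in1 j jk; have [l0 _ _ _ _] := hP _ h1.
  by apply: contra_neq l0 => e; rewrite -[pl _](mulKmx uD) e mulmx0.
have dotM z c : dot z (D *m c) = dot (z *m D) c by rewrite /dot mulmxA.
split=> //.
- move=> j jk x; rewrite !dotM; rewrite -hD2 /dot mulmxBl -[x *m D *m C *m A *m _]mulmxA.
  have [h1 _] := in1 j jk.
  have -> : A *m pl (nth P0 Q1 j) = 0.
    apply/colP => i; rewrite [RHS]mxE -[LHS](_ : dot (bv i) (pl (nth P0 Q1 j)) = _); last first.
      by rewrite /dot -(rowK bv) -row_mul mxE.
    rewrite /bv; case: ifP => iq; first by have [h2 _] := in2 i iq; rewrite rl.
    case: ifP => ik.
      have ik' : (i - q < k)%N by move: iq ik; clear; lia.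
      by have [h2 _] := in1 _ ik'; rewrite rl.
    have ik' : (i - (q + k) < q)%N by have := ltn_ord i; move: ik; clear; lia.
    by have [h2 h3] := in2 _ ik'; rewrite yl // u12.
  by rewrite mulmx0 subr0.
- exact: dhomog_subst.
- by move=> x; rewrite !subst_eval !mulmxA -!tE tK.
move=> x; rewrite subst_eval hx disp hD2 subst_eval mulmxA -tE sumP; congr (_ + _ + _).
  apply: eq_bigr => i _; have [h1 h2] := in2 i (ltn_ord i); have [_ _ _ d4 _] := hP _ h1.
  have [_ e1] := bvi i; have [_ e2] := bvy i.
  have iq : (i < q + k + q)%N by rewrite -addnA ltn_addr.
  have iy : (q + k + i < q + k + q)%N by rewrite ltn_add2l.
  by rewrite /piece_val h2 (d4 h2) mul1r -e1 -e2 !cD.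
apply: eq_bigr => i _; have [h1 /negbTE h2] := in1 i (ltn_ord i); have [_ e1] := bvj i.
have iz : (q + i < q + k + q)%N by rewrite ltn_addr // ltn_add2l.
by rewrite /piece_val h2 mul0r addr0 -e1 cD // dotM.
Qed.
End NormalForm.

(** * Dimension of the singular locus *)

Section SquarefreeLine.
Variables (K : closedFieldType) (charK : [pchar K] =i pred0).

(** [p] divides h p', and p' is nonzero and shorter than [p]. *)
Lemma mul_self_deriv (R : idomainType) (p h : {poly R}) : (forall m, (0 < m)%N -> m%:R != 0 :> R) ->
  prime_elt p -> (1 < size p)%N -> divides p (h * p)^`() -> divides p h.
Proof.
move=> n0 pp sp; rewrite derivM => hdiv.
have : divides p (h * p^`()).
  have -> : h * p^`() = (h^`() * p + h * p^`()) - h^`() * p by rewrite addrAC subrr add0r.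
  by apply: dividesB => //; apply: divides_mull; apply: divides_refl.
have [p0 _ hp] := pp; case/hp => // -[z ez].
have sp' : (size p^`() < size p)%N by apply: lt_size_deriv.
have d0 : p^`() != 0.
  apply/eqP => /(congr1 (fun q : {poly R} => q`_(size p).-2)).
  rewrite coef_deriv coef0 -mulr_natr (_ : (size p).-2.+1 = (size p).-1); last by move: sp; clear; lia.
  move/eqP; rewrite mulf_eq0 -/(lead_coef p) lead_coef_eq0 (negbTE p0) /= (negbTE (n0 _ _)) //.
  by rewrite -subn1 subn_gt0.
have z0 : z != 0 by apply: contra_neq d0 => z0; rewrite ez z0 mul0r.
have sz : (0 < size z)%N by rewrite size_poly_gt0.
move: sp'; rewrite ez size_mul //; move: sz sp; clear; lia.
Qed.

(** With o off P = 0 as last basis vector, P and its derivative along o have a nonzero eliminant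
    [D], which plays the part of the discriminant: a common prime factor would be a square factor of
    P. Over a point w where [D] does not vanish P has only simple zeros. *)
Lemma squarefree_line N d (P : {mpoly K[N.+1]}) : P \is d.-homog -> P != 0 ->
  ~ has_multiple_component P -> exists o w : 'rV[K]_N.+1, P.@[o 0] != 0 /\
    forall a, ~ (P.@[(a *: o + w) 0] = 0 /\ (dird o P).@[(a *: o + w) 0] = 0).
Proof.
move=> hP P0 sqf; have [|o ho] := @mpoly_nonroots K N.+1 [:: P; 'X_ord0].
  move=> p; rewrite !inE => /orP [/eqP ->|/eqP ->] //; apply/eqP.
  move/(congr1 (fun q => q.@[(const_mx 1 : 'rV[K]_N.+1) 0])); rewrite mevalXU mxE meval0 => /eqP.
  by rewrite oner_eq0.
have Po : P.@[o 0] != 0 by apply: ho; rewrite inE eqxx.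
have o0 : o != 0.
  have : ('X_ord0 : {mpoly K[N.+1]}).@[o 0] != 0 by apply: ho; rewrite !inE eqxx orbT.
  by rewrite mevalXU; apply: contra_neq => ->; rewrite mxE.
have [T uT eT] := exists_row_unitmx o0.
pose G := subst T P; pose f := muni G.
have Gl : G.@[elast K N 0] != 0 by rewrite subst_eval eT.
have [sf lf] := size_muni_top (dhomog_subst T hP) Gl.
have f0 : f != 0 by rewrite -size_poly_gt0 sf.
have nM m : (0 < m)%N -> m%:R != 0 :> {mpoly K[N]}.
  by move=> m0; rewrite -mpolyC_nat mpolyC_eq0 ((pcharf0P K).1 charK) -lt0n.
have [|u [v [D [D0 eD]]]] := @bezout_coprime _ (@ufd_mpoly K N) f f^`() f0.
  move=> p pp sp [h eh]; rewrite eh => /(mul_self_deriv nM pp sp) [z ez].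
  apply: sqf; exists (subst (invmx T) (munif p)), (subst (invmx T) (munif z)); split; last first.
    rewrite -[P](substVK uT) -/G -[G]muniK -/f eh ez !munifM !substM expr2.
    by rewrite -[LHS]mulrA; exact: mulrC.
  rewrite ltnNge; apply/negP => /msize1_polyC e.
  move: sp; have -> : p = (muni (subst T (subst (invmx T) (munif p)))) by rewrite substKV // munifK.
  by rewrite e substC muniC ltnNge size_polyC leq_b1.
have [y Dy] := mpoly_nonroot D0.
exists o, (rowpt y 0 *m T); split=> // a [h1 h2].
have ept : a *: o + rowpt y 0 *m T = (rowpt y 0 + a *: elast K N) *m T.
  by rewrite mulmxDl -scalemxAl eT addrC.
have el : linep G (rowpt y 0) (elast K N) = map_poly (meval (y 0)) f.
  apply: poly_ext => t; rewrite linep_eval -meval_rowpt -rowpt_delta rowpt_scale.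
  congr (_.@[_]); apply/funext => i; rewrite !mxE; case: unliftP => [j _|_]; rewrite ?mxE ?mulr0 ?addr0 //.
  by rewrite add0r mulr1.
case/eqP: Dy; have := congr1 (fun q => (map_poly (meval (y 0)) q).[a]) eD.
rewrite map_polyC hornerC => ->; rewrite rmorphD !rmorphM /= hornerD !hornerM.
have -> : (map_poly (meval (y 0)) f).[a] = 0 by rewrite -el linep_eval subst_eval -ept.
have -> : (map_poly (meval (y 0)) f^`()).[a] = 0.
  by rewrite -deriv_map -el deriv_linep linep_eval dird_subst eT -ept.
by rewrite !mulr0 addr0.
Qed.
End SquarefreeLine.

Section FormsAvoid.
Variable K : closedFieldType.

Lemma linear_prime_cone k (T : 'M[K]_k) : is_prime (fun v : 'rV[K]_k => exists x : 'rV_k, v = x *m T).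
Proof.
move=> d e f g hf hg h.
have : subst T f * subst T g = 0.
  by apply: mpoly_ext => x; rewrite -substM subst_eval meval0; apply: h; exists x.
move/eqP; rewrite mulf_eq0 => /orP [/eqP e0|/eqP e0]; [left|right].
  by move=> _ [x ->]; rewrite -subst_eval e0 meval0.
by move=> _ [x ->]; rewrite -subst_eval e0 meval0.
Qed.

(** The coordinate subspaces form a chain of k irreducible cones, to which [chain_bound] applies. *)
Lemma forms_avoid k D r (h : 'I_r -> {mpoly K[k]}) : (0 < D)%N -> (forall j, h j \is D.-homog) ->
  (forall v : 'rV_k, (forall j, (h j).@[v 0] = 0) -> v = 0) -> (k <= r)%N.
Proof.
move=> D0 hh avoid.
pose C i (v : 'rV[K]_k) := forall j : 'I_k, (i < j)%N -> v 0 j = 0.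
have CX i (j : 'I_k) : (i < j)%N -> vI (C i) 'X_j by move=> ij v hv; rewrite mevalXU hv.
have Cd i (j : 'I_k) : (j <= i)%N -> C i (delta_mx 0 j).
  by move=> ji l il; rewrite mxE eqxx /=; case: eqP il => // ->; rewrite ltnNge ji.
apply: (@chain_bound K k D k r h C) => //; last by move=> v _ _; apply: avoid.
- move=> i ik; split.
  + by move=> t v hv j ij; rewrite mxE hv // mulr0.
  + by move=> v hv j ij; have := hv _ (CX i j ij); rewrite mevalXU.
  + pose T : 'M[K]_k := \matrix_(a, b) ((a == b) && (b <= i)%N)%:R.
    have xT (x : 'rV_k) j : (x *m T) 0 j = if (j <= i)%N then x 0 j else 0.
      rewrite mxE (bigD1 j) //= mxE eqxx /= big1 ?addr0 => [|l lj].
        by case: ifP; rewrite ?mulr1 ?mulr0.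
      by rewrite mxE (negbTE lj) mulr0.
    have -> : C i = (fun v : 'rV[K]_k => exists x : 'rV_k, v = x *m T).
      apply/funext => v; apply/propext; split=> [hv|[x ->] j ij]; last by rewrite xT leqNgt ij.
      by exists v; apply/rowP => j; rewrite xT leqNgt; case: ltnP => // /hv.
    exact: linear_prime_cone.
  exists (delta_mx 0 (Ordinal ik)); first exact: Cd.
  by apply/eqP => /rowP /(_ (Ordinal ik)); rewrite !mxE !eqxx => /eqP; rewrite oner_eq0.
move=> i ik; split; first by move=> v hv j ij; apply: hv; apply: ltnW.
exists 1%N, 'X_(Ordinal ik); split; first by rewrite dhomogX /= mdeg1.
  exact: CX.
move=> h'; have := h' _ (Cd i.+1 (Ordinal ik) (leqnn _)).
by rewrite mevalXU mxE !eqxx => /eqP; rewrite oner_eq0.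
Qed.
End FormsAvoid.

Section Structure.
Variables (K : closedFieldType) (charK : [pchar K] =i pred0) (n d : nat) (F : {mpoly K[n.+2]}) (s : int).
Hypotheses (hd : (4 <= d)%N) (hF : F \is d.-homog) (irrF : irreducible_elt F).
Hypotheses (hs : has_dim (Sing F) s) (hsn : s <= n%:Z - 2) (finD : finite_set (Delta F)).
Local Notation V := 'rV[K]_n.+2.

Lemma Delta_structure : card_Delta F = 0 \/
  (forall u : V, vertex F u -> u = 0) /\ exists D q k lam g, [/\ D \in unitmx,
    gnf d q k lam g (subst D F), forall j, (j < k)%N -> lam j != 0,
    card_Delta F <= (4 * q + k)%N%:Z & (4 < d)%N -> q = 0%N].
Proof.
have [t [ut np st ht]] := Delta_representatives charK hd hF irrF hs hsn finD.
case: (eqVneq t [::]) => [t0|tn]; first by left; rewrite -st t0.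
right; have nv : forall u : V, vertex F u -> u = 0.
  case: t tn ht {ut np st} => // v t _ ht u; have [l [L hv]] := ht v (mem_head _ _).
  exact: (gp_no_vertex charK hd hF irrF hs hsn finD hv).
split=> //.
have /choice [lL hlL] : forall v, exists lL : 'cV[K]_n.+2 * 'cV[K]_n.+2, v \in t -> gp d F v lL.1 lL.2.
  move=> v; have [vt|vt] := boolP (v \in t); last by exists (0, 0).
  by have [l [L h]] := ht v vt; exists (l, L).
have [Ps [hP uP kP sP]] := @Galois_pieces K charK _ d F hd nv t (fun v => (lL v).1) (fun v => (lL v).2) hlL np ut.
have [D [lam [g [uD hg lam0]]]] := gnf_of_pieces hF hP uP kP.
exists D, (count (@pb K n.+2) Ps), (count (predC (@pb K n.+2)) Ps), lam, g; split=> //.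
  rewrite -st lez_nat; apply: leq_trans sP _; clear; elim: Ps => [|P Ps IH]; first by rewrite big_nil.
  by rewrite big_cons /=; case: (pb P); move: IH; rewrite /=; lia.
move=> d4; apply/eqP; rewrite -leqn0 leqNgt -has_count; apply/negP => /hasP [P /hP [_ _ _ h4 _]].
by move=> /h4 e; rewrite e ltnn in d4.
Qed.

Section SingularDimension.
Variables (D : 'M[K]_n.+2) (uD : D \in unitmx).

Lemma sing_upper r (H : 'M[K]_(n.+2, r)) :
  (forall v : V, singular (subst D F) v -> v *m H = 0 -> v = 0) -> s + 1 <= r%:Z.
Proof.
move=> h; apply: (@dim_upper_mx K n.+1 (Sing F) s r (invmx D *m H)) => // v.
have [->//|v0] := eqVneq v 0 => /(cone_of_Sing hF v0) sv vH.
have e : v *m invmx D = 0.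
  apply: h; first by apply/(singular_subst uD); rewrite mulmxKV.
  by rewrite -mulmxA.
by rewrite -[v](mulmxKV uD) e mul0mx.
Qed.

Lemma sing_lower : exists r (H : 'M[K]_(n.+2, r)), r%:Z = s + 1 /\
  forall v : V, singular (subst D F) v -> v *m H = 0 -> v = 0.
Proof.
have [|r [B [er hB]]] := dim_lower (zclosed_Sing hF) hs (H := 1%:M).
  by move=> v _; rewrite mulmx1.
exists r, (D *m (1%:M *m B)); split=> // v /(singular_subst uD) sv; rewrite mulmxA => hv.
have [v0|v0] := eqVneq (v *m D) 0; first by rewrite -[v](mulmxK uD) v0 mul0mx.
have : v *m D = 0 by apply: hB => //; apply/(cone_of_Sing hF v0).
by move=> e; rewrite e eqxx in v0.
Qed.
End SingularDimension.
End Structure.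

Section Coordinates.
Variables (K : closedFieldType) (n : nat).
Local Notation V := 'rV[K]_n.+2.

Definition ev i : V := delta_mx 0 (inord i).

Lemma co_ev i j : (i < n.+2)%N -> (j < n.+2)%N -> co (ev i) j = (i == j)%:R.
Proof.
move=> hi hj; rewrite /co /ev mxE eqxx /= eq_sym; congr (_%:R); congr nat_of_bool.
by apply/eqP/eqP => [/(congr1 val)|->] //; rewrite /= !inordK.
Qed.

Lemma coD (x y : V) i : co (x + y) i = co x i + co y i. Proof. by rewrite /co mxE. Qed.
Lemma coZ a (x : V) i : co (a *: x) i = a * co x i. Proof. by rewrite /co mxE. Qed.
Lemma co0 i : co (0 : V) i = 0. Proof. by rewrite /co mxE. Qed.
Definition coE := (coD, coZ, co0).

Lemma co_ext (x y : V) : (forall i, (i < n.+2)%N -> co x i = co y i) -> x = y.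
Proof. by move=> h; apply/rowP => i; have := h i (ltn_ord i); rewrite /co inord_val. Qed.

Lemma co_tailv p (x : V) i : (i < n.+2)%N -> co (tailv p x) i = if (p <= i)%N then co x i else 0.
Proof. by move=> hi; rewrite /co mxE inordK. Qed.

Lemma tailvD p (x y : V) : tailv p (x + y) = tailv p x + tailv p y.
Proof. by apply/rowP => i; rewrite !mxE; case: ifP; rewrite ?addr0. Qed.
Lemma tailvZ p a (x : V) : tailv p (a *: x) = a *: tailv p x.
Proof. by apply/rowP => i; rewrite !mxE; case: ifP; rewrite ?mulr0. Qed.
Lemma tailv_ev p i : (i < p)%N -> (i < n.+2)%N -> tailv p (ev i) = 0.
Proof.
move=> ip hi; apply: co_ext => j hj; rewrite co_tailv // co_ev // co0.
by case: ifP => // pj; rewrite (ltn_eqF (leq_trans ip pj)).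
Qed.
Lemma tailvK p (x : V) : tailv p (tailv p x) = tailv p x.
Proof. by apply/rowP => i; rewrite !mxE; case: (p <= i)%N. Qed.

Lemma co_evmx m (idx : 'I_m -> nat) (z : 'rV[K]_m) a : injective idx -> (forall b, (idx b < n.+2)%N) ->
  co (z *m \matrix_b ev (idx b)) (idx a) = z 0 a.
Proof.
move=> idxI idxN; rewrite /co mxE (bigD1 a) //= big1 ?addr0 => [|b ba].
  have -> : (\matrix_b ev (idx b)) a (inord (idx a)) = co (ev (idx a)) (idx a) by rewrite /co mxE.
  by rewrite co_ev // eqxx mulr1.
have -> : (\matrix_b ev (idx b)) b (inord (idx a)) = co (ev (idx b)) (idx a) by rewrite /co mxE.
by rewrite co_ev // (inj_eq idxI) (negbTE ba) mulr0.
Qed.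
End Coordinates.

Section NormalFormGeometry.
Variables (K : closedFieldType) (charK : [pchar K] =i pred0) (n d q k : nat).
Variables (lam : nat -> 'cV[K]_n.+2) (g G : {mpoly K[n.+2]}) (s : int).
Local Notation V := 'rV[K]_n.+2.
Local Notation p := (q + k + q)%N.
Hypotheses (hd : (4 <= d)%N) (hG : gnf d q k lam g G).
Hypothesis upper : forall r (H : 'M[K]_(n.+2, r)),
  (forall v : V, singular G v -> v *m H = 0 -> v = 0) -> s + 1 <= r%:Z.
Hypothesis lower : exists r (H : 'M[K]_(n.+2, r)), r%:Z = s + 1 /\
  forall v : V, singular G v -> v *m H = 0 -> v = 0.

Let natK m : (0 < m)%N -> m%:R != 0 :> K.
Proof. by rewrite ((pcharf0P K).1 charK) lt0n. Qed.
Let pN : (p <= n.+2)%N. Proof. by have [] := hG. Qed.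
Let lamT j : (j < k)%N -> forall x : V, dot x (lam j) = dot (tailv p x) (lam j).
Proof. by have [_ h _ _ _] := hG; apply: h. Qed.
Let hg : g \is d.-homog. Proof. by have [] := hG. Qed.
Let gT (x : V) : g.@[x 0] = g.@[(tailv p x) 0]. Proof. by have [] := hG. Qed.
Let GE (x : V) : G.@[x 0] = \sum_(i < q) (co x (q + k + i) * co x i ^+ 3 + co x (q + k + i) ^+ 4)
      + \sum_(j < k) dot x (lam j) * co x (q + j) ^+ d.-1 + g.@[x 0].
Proof. by have [] := hG. Qed.

Let ltX i : (i < q)%N -> (i < n.+2)%N. Proof. by move=> h; apply: leq_trans pN; rewrite -addnA ltn_addr. Qed.
Let ltZ j : (j < k)%N -> (q + j < n.+2)%N.
Proof. by move=> h; apply: leq_trans pN; rewrite ltn_addr // ltn_add2l. Qed.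
Let ltY i : (i < q)%N -> (q + k + i < n.+2)%N. Proof. by move=> h; apply: leq_trans pN; rewrite ltn_add2l. Qed.

Lemma gnf_homog : d = 4%N -> G \is 4.-homog.
Proof.
move=> d4; have hg' := hg; rewrite d4 in hg'; apply: dhomog_ext => x t; rewrite !GE !mulrDr.
rewrite (dhomog_eval_scale _ _ hg') d4 /= !mulr_sumr; congr (_ + _ + _).
  by apply: eq_bigr => i _; rewrite !coE; ring.
by apply: eq_bigr => j _; rewrite !coE dotZl; ring.
Qed.

Definition lam_mx : 'M[K]_(k, n.+2) := \matrix_(j, i) lam j i 0.

Lemma lam_mxE (w : 'rV[K]_k) (u : V) : dot u (w *m lam_mx)^T = \sum_(j < k) dot u (lam j) * w 0 j.
Proof.
rewrite /dot mxE (eq_bigr (fun i => \sum_(j < k) u 0 i * lam j i 0 * w 0 j)); last first.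
  by move=> i _; rewrite !mxE mulr_sumr; apply: eq_bigr => j _; rewrite !mxE; ring.
by rewrite exchange_big; apply: eq_bigr => j _; rewrite mxE mulr_suml.
Qed.

Lemma rank_lam_mx : (\rank lam_mx + p <= n.+2)%N.
Proof.
pose E : 'M[K]_(n.+2, p) := \matrix_(i, j) (i == j :> nat)%:R.
have EE : E^T *m E = 1%:M.
  apply/matrixP => a b; rewrite !mxE (bigD1 (inord a)) //= !mxE inordK ?eqxx; last exact: leq_trans (ltn_ord a) pN.
  rewrite mul1r big1 ?addr0 // => i ia; rewrite !mxE.
  case: eqP => [e|]; rewrite ?mul0r //; case/eqP: ia; apply: val_inj; rewrite /= -e inordK //.
have rE : \rank E = p.
  by apply/eqP; rewrite eqn_leq rank_leq_col -{1}(mxrank1 K p) -EE mxrankM_maxr.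
rewrite -[X in (_ + X <= _)%N]rE; apply: mulmx0_rank_max; apply/matrixP => j a.
have la : lam j (inord a) 0 = 0.
  have := lamT (ltn_ord j) (ev K n a); rewrite tailv_ev // ?dot0l; last exact: leq_trans (ltn_ord a) pN.
  by rewrite /dot /ev -rowE mxE.
rewrite !mxE (bigD1 (inord a)) //= !mxE la mul0r add0r big1 // => i ia; rewrite !mxE.
case: eqP => [e|]; rewrite ?mulr0 //; case/eqP: ia; apply: val_inj; rewrite /= e inordK //.
exact: leq_trans (ltn_ord _) pN.
Qed.

(** At a point with no other coordinates than Z, the blocks and g vanish to order at least four, and
    each summand lam_j Z_j^(d-1) contributes lam_j(u) Z_j^(d-1) to the derivative along u. *)
Lemma singular_Z (v : V) : (forall i, (i < n.+2)%N -> ~~ (q <= i < q + k)%N -> co v i = 0) ->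
  (forall u : V, \sum_(j < k) dot u (lam j) * co v (q + j) ^+ d.-1 = 0) -> singular G v.
Proof.
move=> v0 hv; have tv : tailv p v = 0.
  apply: co_ext => i hi; rewrite co_tailv // co0; case: ifP => // pi; apply: v0 => //.
  by rewrite negb_and -!leqNgt; apply/orP; right; apply: leq_trans pi; rewrite leq_addr.
have d0 : (0 < d)%N by move: hd; clear; lia.
have lv j : (j < k)%N -> dot v (lam j) = 0 by move=> jk; rewrite lamT // tv dot0l.
have vX i : (i < q)%N -> co v i = 0.
  by move=> iq; apply: v0; rewrite ?ltX // negb_and -ltnNge iq.
have vY i : (i < q)%N -> co v (q + k + i) = 0.
  by move=> iq; apply: v0; rewrite ?ltY // negb_and -leqNgt leq_addr orbT.
have Gv (t : K) (u : V) : G.@[(v + t *: u) 0] =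
    t ^+ 4 * (\sum_(i < q) (co u (q + k + i) * co u i ^+ 3 + co u (q + k + i) ^+ 4)) +
    t * (\sum_(j < k) dot u (lam j) * (co v (q + j) + t * co u (q + j)) ^+ d.-1) + t ^+ d * g.@[u 0].
  rewrite GE; congr (_ + _ + _).
  - by rewrite mulr_sumr; apply: eq_bigr => i _; rewrite !coE (vX i) // (vY i) //; ring.
  - by rewrite mulr_sumr; apply: eq_bigr => j _; rewrite !coE !dotE lv //; ring.
  by rewrite gT tailvD tailvZ tv add0r (dhomog_eval_scale _ _ hg) -gT.
apply: singular_dird => [|u].
  have := Gv 0 0; rewrite scaler0 addr0 !expr0n mul0r (gtn_eqF d0) !mul0r => ->.
  by rewrite !addr0.
rewrite dird_deriv0.
have -> : linep G v u = 'X * ((\sum_(i < q) (co u (q + k + i) * co u i ^+ 3 + co u (q + k + i) ^+ 4))%:P * 'X^3 +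
    (\sum_(j < k) (dot u (lam j))%:P * ((co v (q + j))%:P + (co u (q + j))%:P * 'X) ^+ d.-1) +
    g.@[u 0]%:P * 'X^(d.-1)).
  apply: poly_ext => t; rewrite linep_eval Gv hornerM hornerX !hornerD !mulrDr !hornerM !hornerC !hornerXn.
  congr (_ + _ + _); [by rewrite !hornerX; ring| |by rewrite -{1}(prednK d0) exprS; ring].
  congr (_ * _); rewrite horner_sum; apply: eq_bigr => j _.
  by rewrite hornerM hornerC horner_exp hornerD hornerM !hornerC hornerX [t * _]mulrC.
rewrite derivM derivX mul1r hornerD [('X * _).[0]]hornerM hornerX mul0r addr0 !hornerD !hornerM !hornerXn !expr0n /=.
rewrite (gtn_eqF (_ : (0 < d.-1)%N)) ?mulr0 ?add0r ?addr0; last by move: hd; clear; lia.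
rewrite !hornerX !mul0r !mulr0 add0r horner_sum -[RHS](hv u); apply: eq_bigr => j _.
by rewrite hornerM hornerC horner_exp hornerD hornerM !hornerC hornerX mulr0 addr0.
Qed.

(** In the space of the Z the locus sum_j lam_j Z_j^(d-1) = 0 is given by rank(lam) forms of degree
    d - 1 and consists of singular points. Together with the s + 1 linear forms avoiding the
    singular locus, raised to the power d - 1 to match degrees, they have no nonzero common zero, so
    k is at most their number. *)
Lemma fibre_bound : k%:Z <= s + 1 + (\rank lam_mx)%:Z.
Proof.
have [r [H [<- hH]]] := lower; rewrite -PoszD lez_nat.
have d0 : (0 < d.-1)%N by move: hd; clear; lia.
pose E : 'M[K]_(k, n.+2) := \matrix_(j < k) ev K n (q + j).
pose h (j : 'I_(r + \rank lam_mx)) : {mpoly K[k]} := match fintype.split j with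
  | inl a => lin (col a (E *m H)) ^+ d.-1
  | inr b => \sum_(i < k) (col_base lam_mx) i b *: 'X_i ^+ d.-1 end.
apply: (@forms_avoid K k d.-1 _ h) => // [j|v hv].
  rewrite /h; case: fintype.splitP => a _.
    by have := dhomogMn d.-1 (lin_homog (col a (E *m H))); rewrite mul1n.
  apply: rpred_sum => i _; apply: rpredZ.
  by apply: dhomog_ext => x t; rewrite !mevalXn !mevalXU mxE exprMn.
have coE' j : (j < n.+2)%N -> co (v *m E) j = if (q <= j < q + k)%N then
    (if insub (j - q)%N is Some a then v 0 a else 0) else 0.
  move=> hj; rewrite /co mxE; case: ifP => [/andP [qj jk]|nj].
    have jk' : (j - q < k)%N by move: qj jk; clear; lia.
    rewrite insubT (bigD1 (Ordinal jk')) //= big1 => [|i ij]; last first.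
      rewrite mxE -/(co _ _) co_ev ?ltZ //; case: eqP => [e|]; rewrite ?mulr0 //.
      by case/eqP: ij; apply: val_inj; rewrite /= -e addKn.
    by rewrite mxE -/(co _ _) co_ev ?ltZ // subnKC // eqxx mulr1 addr0.
  apply: big1 => i _; rewrite mxE -/(co _ _) co_ev ?ltZ //; case: eqP => [e|]; rewrite ?mulr0 //.
  by move: nj; rewrite -e leq_addr ltn_add2l ltn_ord.
have coZ' (j : 'I_k) : co (v *m E) (q + j) = v 0 j.
  by rewrite coE' ?ltZ // leq_addr ltn_add2l ltn_ord /= addKn valK.
have vE : v *m E = 0.
  apply: hH; last first.
    apply/rowP => a; have := hv (lshift _ a); rewrite /h (unsplitK (inl a)) mevalXn lin_eval => /eqP.
    rewrite expf_eq0 d0 /= => /eqP e; rewrite -mulmxA [RHS]mxE -e !mxE.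
    by apply: eq_bigr => i _; rewrite [in RHS]mxE.
  apply: singular_Z => [i hi hn|u]; first by rewrite coE' // (negbTE hn).
  pose w : 'rV[K]_k := \row_j v 0 j ^+ d.-1.
  have wL : w *m lam_mx = 0.
    rewrite -(mulmx_base lam_mx) mulmxA; have -> : w *m col_base lam_mx = 0; last by rewrite mul0mx.
    apply/rowP => b; have e := hv (rshift _ b); rewrite /h (unsplitK (inr b)) in e.
    rewrite [RHS]mxE -e.
    rewrite raddf_sum mxE; apply: eq_bigr => i _ /=.
    by rewrite mxE mevalZ mevalXn mevalXU mulrC.
  have := lam_mxE w u; rewrite wL trmx0 dot0r => e; rewrite [RHS]e; apply: eq_bigr => j _.
  by rewrite coZ' mxE.
by apply/rowP => j; rewrite -coZ' vE co0 mxE.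
Qed.
End NormalFormGeometry.

Lemma deriv0_quartic (K : fieldType) (a b y : K) :
  (a%:P + b *: 'X + (y%:P + 'X) ^+ 4)^`().[0] = b + 4 * y ^+ 3.
Proof. by rewrite !exprS expr0 !derivE !hornerE /=; ring. Qed.

Lemma deriv0_cubic (K : fieldType) (a b x : K) :
  (a%:P + b *: (x%:P + 'X) ^+ 3)^`().[0] = 3 * (b * x ^+ 2).
Proof. by rewrite !exprS expr0 !derivE !hornerE /=; ring. Qed.

Section QuarticNormalForm.
Variables (K : closedFieldType) (charK : [pchar K] =i pred0) (n q k : nat).
Variables (lam : nat -> 'cV[K]_n.+2) (g G : {mpoly K[n.+2]}) (s : int).
Local Notation V := 'rV[K]_n.+2.
Local Notation p := (q + k + q)%N.
Hypotheses (hG : gnf 4 q k lam g G).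
Hypothesis lam0 : forall j, (j < k)%N -> lam j != 0.
Hypothesis upper : forall r (H : 'M[K]_(n.+2, r)),
  (forall v : V, singular G v -> v *m H = 0 -> v = 0) -> s + 1 <= r%:Z.

Let natK m : (0 < m)%N -> m%:R != 0 :> K.
Proof. by rewrite ((pcharf0P K).1 charK) lt0n. Qed.
Let pN : (p <= n.+2)%N. Proof. by have [] := hG. Qed.
Let lamT j : (j < k)%N -> forall x : V, dot x (lam j) = dot (tailv p x) (lam j).
Proof. by have [_ h _ _ _] := hG; apply: h. Qed.
Let hg : g \is 4.-homog. Proof. by have [] := hG. Qed.
Let gT (x : V) : g.@[x 0] = g.@[(tailv p x) 0]. Proof. by have [] := hG. Qed.
Let GE (x : V) : G.@[x 0] = \sum_(i < q) (co x (q + k + i) * co x i ^+ 3 + co x (q + k + i) ^+ 4)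
      + \sum_(j < k) dot x (lam j) * co x (q + j) ^+ 3 + g.@[x 0].
Proof. by have [] := hG. Qed.
Let hGh : G \is 4.-homog. Proof. exact: gnf_homog hG _. Qed.

Let ltX i : (i < q)%N -> (i < n.+2)%N. Proof. by move=> h; apply: leq_trans pN; rewrite -addnA ltn_addr. Qed.
Let ltZ j : (j < k)%N -> (q + j < n.+2)%N.
Proof. by move=> h; apply: leq_trans pN; rewrite ltn_addr // ltn_add2l. Qed.
Let ltY i : (i < q)%N -> (q + k + i < n.+2)%N. Proof. by move=> h; apply: leq_trans pN; rewrite ltn_add2l. Qed.

(** The projection that sets X = Y = 0. Composition with it leaves the form R = sum_j lam_j Z_j^3 +
    g, called [residue] below. *)
Definition blocks_out : 'M[K]_n.+2 :=
  diag_mx (\row_i ((q <= i < q + k) || (p <= i))%N%:R).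
Local Notation Pm := blocks_out.

Lemma co_out (x : V) i : (i < n.+2)%N ->
  co (x *m Pm) i = if ((q <= i < q + k) || (p <= i))%N then co x i else 0.
Proof.
move=> hi; rewrite /co mul_mx_diag !mxE inordK //.
by case: ifP => _; rewrite ?mulr1 ?mulr0.
Qed.

Lemma tailv_out (x : V) : tailv p (x *m Pm) = tailv p x.
Proof.
apply: co_ext => i hi; rewrite !co_tailv // co_out //.
by case: ifP => // ->; rewrite orbT.
Qed.

Lemma out_id : Pm *m Pm = Pm.
Proof.
rewrite mulmx_diag; congr diag_mx; apply/rowP => i.
by rewrite !mxE -natrM mulnb andbb.
Qed.

Definition residue := subst Pm G.

Lemma residueE (x : V) : residue.@[x 0] = \sum_(j < k) dot x (lam j) * co x (q + j) ^+ 3 + g.@[x 0].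
Proof.
rewrite subst_eval GE gT tailv_out -gT big1 ?add0r.
  congr (_ + _); apply: eq_bigr => j _; rewrite lamT // tailv_out -lamT // co_out ?ltZ //.
  by rewrite leq_addr ltn_add2l ltn_ord.
move=> i _; rewrite (co_out _ (ltX (ltn_ord i))) (co_out _ (ltY (ltn_ord i))) !ifF ?mul0r ?add0r ?expr0n //.
  by apply/negP; have := ltn_ord i; clear; lia.
by apply/negP; have := ltn_ord i; clear; lia.
Qed.

Lemma residue_homog : residue \is 4.-homog. Proof. exact: dhomog_subst. Qed.

Lemma rank_out : (\rank Pm + (q + q) <= n.+2)%N.
Proof.
pose idx (a : 'I_(q + q)) := if (a < q)%N then nat_of_ord a else (q + k + (a - q))%N.
have idxI : injective idx.
  move=> a b; rewrite /idx => e; apply: val_inj; move: e; rewrite /=.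
  by case: (ltnP a q); case: (ltnP b q); clear; lia.
have idxp a : (idx a < p)%N.
  by rewrite /idx; have := ltn_ord a; case: (ltnP a q); clear; lia.
have idxN a : (idx a < n.+2)%N by apply: leq_trans (idxp a) pN.
pose E : 'M[K]_(q + q, n.+2) := \matrix_a ev K n (idx a).
have fE : row_free E.
  by apply/inj_row_free => z z0; apply/rowP => a; rewrite mxE -(co_evmx z a idxI idxN) z0 co0.
have rE : \rank E = (q + q)%N by apply/eqP.
rewrite -[X in (_ + X)%N]rE addnC; apply: mulmx0_rank_max.
apply/row_matrixP => a; rewrite row_mul row0 rowK; apply: co_ext => j hj; rewrite co_out // co0.
case: ifP => // h; rewrite co_ev //; case: eqP => // e; move: h; rewrite -e /idx.
by have := ltn_ord a; case: (ltnP a q); clear; lia.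
Qed.

(** In each block the derivatives along Y and X give X^3 + 4 Y^3 = 0 and 3 Y X^2 = 0, which force X
    = Y = 0. *)
Lemma singular_out (v : V) : singular G v -> v *m Pm = v.
Proof.
move=> [Gv sv]; have dv u : (dird u G).@[v 0] = 0 by rewrite dird_eval big1 // => i _; rewrite sv mulr0.
have hx i : (i < q)%N -> co v i = 0 /\ co v (q + k + i) = 0.
  move=> iq; pose x := co v i; pose y := co v (q + k + i).
  have tX (t : K) a : (a < p)%N -> tailv p (v + t *: ev K n a) = tailv p v.
    by move=> ap; rewrite tailvD tailvZ tailv_ev ?scaler0 ?addr0 //; apply: leq_trans ap pN.
  have rest (t : K) a : (a < p)%N -> (forall j, (j < k)%N -> q + j != a)%N ->
      \sum_(j < k) dot (v + t *: ev K n a) (lam j) * co (v + t *: ev K n a) (q + j) ^+ 3 +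
        g.@[(v + t *: ev K n a) 0] = \sum_(j < k) dot v (lam j) * co v (q + j) ^+ 3 + g.@[v 0].
    move=> ap ha; rewrite [g.@[(v + _) 0]]gT tX // -gT; congr (_ + _); apply: eq_bigr => j _.
    rewrite lamT // tX // -lamT // !coE co_ev ?ltZ //; last exact: leq_trans ap pN.
    by rewrite eq_sym (negbTE (ha j _)) // mulr0 addr0.
  have iY : (q + k + i < p)%N by rewrite ltn_add2l.
  have iX : (i < p)%N by rewrite -addnA ltn_addr.
  have iXN := ltX iq; have iYN := ltY iq.
  have e1 : x ^+ 3 + 4 * y ^+ 3 = 0.
    rewrite -[RHS](dv (ev K n (q + k + i))) dird_deriv0.
    have -> : linep G v (ev K n (q + k + i)) = (G.@[v 0] - y ^+ 4)%:P + x ^+ 3 *: 'X + (y%:P + 'X) ^+ 4.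
      apply: poly_ext => t; rewrite linep_eval [in LHS]GE -addrA rest //; last first.
        by move=> j jk; apply/eqP; move: jk; clear; lia.
      rewrite (bigD1 (Ordinal iq)) //= [G.@[v 0]]GE [X in _ = ((X + _ + _ - _)%:P + _ + _).[_]](bigD1 (Ordinal iq)) //=.
      rewrite (eq_bigr (fun i0 : 'I_q => co v (q + k + i0) * co v i0 ^+ 3 + co v (q + k + i0) ^+ 4)); last first.
        move=> j ji; have jXN := ltX (ltn_ord j); have jYN := ltY (ltn_ord j); rewrite !coE !co_ev // eqn_add2l.
        have -> : (i == j) = false by apply/negP => /eqP e; case/eqP: ji; apply: val_inj.
        by rewrite (_ : (_ == _) = false) ?mulr0 ?addr0 //; apply/eqP; have := ltn_ord j; clear; lia.
      rewrite !coE !co_ev // eqxx (_ : (q + k + i == i)%N = false); last first.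
        by apply/eqP; have := iq; clear; lia.
      by rewrite !hornerD horner_exp hornerD hornerZ hornerX !hornerC -/x -/y -[true%:R]/(1 : K) -[false%:R]/(0 : K); ring.
    by rewrite deriv0_quartic.
  have e2 : 3 * (y * x ^+ 2) = 0.
    rewrite -[RHS](dv (ev K n i)) dird_deriv0.
    have -> : linep G v (ev K n i) = (G.@[v 0] - y * x ^+ 3)%:P + y *: (x%:P + 'X) ^+ 3.
      apply: poly_ext => t; rewrite linep_eval [in LHS]GE -addrA rest //; last first.
        by move=> j jk; apply/eqP; have := iq; clear; lia.
      rewrite (bigD1 (Ordinal iq)) //= [G.@[v 0]]GE [X in _ = ((X + _ + _ - _)%:P + _).[_]](bigD1 (Ordinal iq)) //=.
      rewrite (eq_bigr (fun i0 : 'I_q => co v (q + k + i0) * co v i0 ^+ 3 + co v (q + k + i0) ^+ 4)); last first.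
        move=> j ji; have jXN := ltX (ltn_ord j); have jYN := ltY (ltn_ord j); rewrite !coE !co_ev //.
        have -> : (i == j) = false by apply/negP => /eqP e; case/eqP: ji; apply: val_inj.
        by rewrite (_ : (_ == _) = false) ?mulr0 ?addr0 //; apply/eqP; have := iq; clear; lia.
      rewrite !coE !co_ev // eqxx (_ : (i == q + k + i)%N = false); last first.
        by apply/eqP; have := iq; clear; lia.
      by rewrite !hornerD hornerZ horner_exp hornerD hornerX !hornerC -/x -/y -[true%:R]/(1 : K) -[false%:R]/(0 : K); ring.
    by rewrite deriv0_cubic.
  have [x0|x0] := eqVneq x 0.
    split=> //; move/eqP: e1; rewrite x0 expr0n add0r mulf_eq0 (negbTE (natK (m := 4) isT)) expf_eq0 /=.
    by move/eqP.
  have y0 : y = 0.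
    move/eqP: e2; rewrite mulf_eq0 (negbTE (natK (m := 3) isT)) mulf_eq0 expf_eq0 (negbTE x0) andbF orbF.
    by move/eqP.
  by move/eqP: e1; rewrite y0 expr0n mulr0 addr0 expf_eq0 (negbTE x0).
apply: co_ext => i hi; rewrite co_out //; case: ifP => // /negbT; rewrite negb_or negb_and -!leqNgt -!ltnNge => h.
have [iq|qi] := ltnP i q; first by have [-> _] := hx i iq.
have i' : (i - (q + k) < q)%N by move: h qi; clear; lia.
have [_ e] := hx _ i'; rewrite -{1}e; congr co; move: h qi; clear; lia.
Qed.

(** Singular points lie in the space X = Y = 0 of dimension at most n + 2 - 2 q. The linear forms on
    it that cut out [W] therefore have no common zero on the singular locus, and their number is
    smaller by e than that dimension. *)
Lemma upper_subspace e (W : 'M[K]_(e, n.+2)) : row_free W -> W *m Pm = W ->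
  (forall v : V, singular G v -> (v <= W)%MS -> v = 0) -> s + 1 + (q + q + e)%N%:Z <= n.+2%:Z.
Proof.
move=> fW WP hW; pose M := Pm *m cokermx W; have hr : (\rank M + e <= \rank Pm)%N.
  rewrite -(mxrank_mul_ker Pm (cokermx W)) leq_add2l -{1}(eqP (fW : \rank W == e)).
  apply: mxrankS; rewrite sub_capmx -{1}WP submxMl /=.
  by rewrite sub_kermx mulmx_coker.
have := @upper _ (col_base M); have := rank_out; move: hr.
move=> h1 h2 /(_ _) h3; have : s + 1 <= (\rank M)%:Z.
  apply: h3 => v sv hv; apply: hW => //; rewrite submxE.
  have : v *m M = 0 by rewrite -(mulmx_base M) mulmxA hv mul0mx.
  by rewrite /M mulmxA singular_out // => ->.
move: h1 h2; clear; lia.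
Qed.

Lemma upper0 : s + 1 + (q + q)%N%:Z <= n.+2%:Z.
Proof.
have := @upper_subspace 0 (0 : 'M_(0, n.+2)); rewrite addn0; apply.
- by apply/inj_row_free => v _; apply/rowP => -[].
- by rewrite mul0mx.
by move=> v _ /submxP [z ->]; rewrite mulmx0.
Qed.

Lemma upper1 : residue != 0 -> s + 2 + (q + q)%N%:Z <= n.+2%:Z.
Proof.
move=> /mpoly_nonroot [o ho]; pose o' := o *m Pm.
have Go : G.@[o' 0] != 0 by move: ho; rewrite subst_eval.
have o0 : o' != 0 by apply: contra_neq Go => ->; rewrite (dhomog_eval0 hGh).
suff : s + 1 + (q + q + 1)%N%:Z <= n.+2%:Z by lia.
apply: (upper_subspace (W := o')).
- by rewrite /row_free rank_rV o0.
- by rewrite /o' -mulmxA out_id.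
move=> v [Gv _] /sub_rVP [c ec]; move: Gv; rewrite ec (dhomog_eval_scale _ _ hGh) => /eqP.
by rewrite mulf_eq0 (negbTE Go) orbF expf_eq0 /= => /eqP ->; rewrite scale0r.
Qed.

(** [W] is the plane provided by [squarefree_line]: o is off R = 0, and at every other point of the
    projective line R or its derivative along o is nonzero. *)
Lemma upper2 : residue != 0 -> ~ has_multiple_component residue -> s + 3 + (q + q)%N%:Z <= n.+2%:Z.
Proof.
move=> r0 sqf; have [o [w [ho how]]] := squarefree_line charK residue_homog r0 sqf.
pose W : 'M[K]_(1 + 1, n.+2) := col_mx (o *m Pm) (w *m Pm).
have Go : G.@[(o *m Pm) 0] != 0 by move: ho; rewrite subst_eval.
have s0 : singular G 0.
  split; first exact: dhomog_eval0 hGh _.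
  by move=> i; apply: (dhomog_eval0 (dhomog_deriv i hGh)).
have key (z : 'rV_(1 + 1)) : singular G (z *m W) -> z = 0.
  rewrite -[z]hsubmxK mul_row_col [lsubmx z]mx11_scalar [rsubmx z]mx11_scalar !mul_scalar_mx.
  set a := _ 0 0; set b := _ 0 0 => sv.
  have b0 : b = 0.
    apply/eqP; apply: contraT => b0; have := singular_scale b^-1 hGh sv.
    rewrite scalerDr !scalerA mulVf // scale1r scalemxAl -mulmxDl => -[h1 h2].
    case: (how (b^-1 * a)); split; first by rewrite subst_eval.
    by rewrite /residue dird_subst dird_eval big1 // => i _; rewrite h2 mulr0.
  move: sv; rewrite b0 scale0r addr0 => -[+ _]; rewrite (dhomog_eval_scale _ _ hGh) => /eqP.
  by rewrite mulf_eq0 (negbTE Go) orbF expf_eq0 /= => /eqP ->; rewrite !raddf0 row_mx0.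
suff : s + 1 + (q + q + 2)%N%:Z <= n.+2%:Z by lia.
apply: (upper_subspace (W := W)).
- by apply/inj_row_free => z hz; apply: key; rewrite hz.
- by rewrite mul_col_mx -!mulmxA out_id.
by move=> v sv /submxP [z ez]; rewrite ez (key z) ?mul0mx // -ez.
Qed.

Lemma residue_lin : residue = \sum_(j < k) lin (lam j) * 'X_(inord (q + j)) ^+ 3 + g.
Proof.
apply: mpoly_ext => x; rewrite residueE mevalD raddf_sum /=; congr (_ + _).
by apply: eq_bigr => j _; rewrite mevalM mevalXn mevalXU lin_dot.
Qed.

Let lamX j m : (j < k)%N -> (m < p)%N -> dot (ev K n m) (lam j) = 0.
Proof. by move=> jk mp; rewrite lamT // tailv_ev ?dot0l //; apply: leq_trans mp pN. Qed.
Let zP j : (j < k)%N -> (q + j < p)%N. Proof. by move=> jk; rewrite ltn_addr // ltn_add2l. Qed.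

Let lam_dual j : (j < k)%N -> exists2 u : V, tailv p u = u & dot u (lam j) = 1.
Proof.
move=> jk; have : lin (lam j) != 0 by apply: contra_neq (lam0 jk) => /lin_eq0.
move=> /mpoly_nonroot [u]; rewrite lin_dot lamT // => u0.
exists ((dot (tailv p u) (lam j))^-1 *: tailv p u); first by rewrite tailvZ tailvK.
by rewrite dotZl mulVf.
Qed.

Let coT (u : V) m : tailv p u = u -> (m < p)%N -> co u m = 0.
Proof. by move=> <- mp; rewrite co_tailv ?(leq_trans mp pN) // leqNgt mp. Qed.

Lemma residue_line (j : 'I_k) (u : V) (c t : K) : tailv p u = u ->
  residue.@[(c *: ev K n (q + j) + t *: u) 0] = t * dot u (lam j) * c ^+ 3 + t ^+ 4 * g.@[u 0].
Proof.
move=> hu; rewrite residueE (bigD1 j) //= big1 ?addr0 => [|l lj].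
  rewrite !dotE lamX ?zP // !coE co_ev ?ltZ // eqxx (coT hu) ?zP // mulr0 add0r mulr1 mulr0 addr0.
  rewrite gT tailvD !tailvZ tailv_ev ?zP ?ltZ // scaler0 add0r hu.
  by rewrite (dhomog_eval_scale _ _ hg).
rewrite !coE co_ev ?ltZ // (coT hu) ?zP // eqn_add2l (_ : (j == l :> nat) = false).
  by rewrite !mulr0 addr0 expr0n mulr0.
by apply/negP => /eqP e; case/eqP: lj; apply: val_inj.
Qed.

Lemma residue_neq0 : (0 < k)%N -> residue != 0.
Proof.
move=> k0; have [u hu u1] := lam_dual k0; apply/eqP => r0.
have h c := residue_line (Ordinal k0) c 1 hu.
have := h 1; have := h 0; rewrite r0 !meval0 u1 !mul1r !expr1n !mul1r expr0n add0r => <-.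
by rewrite addr0 => /esym/eqP; rewrite oner_eq0.
Qed.

(** A prime whose square divides R divides the derivative 3 lam_j Z_j^2, so up to a unit it is some
    lam_j or Z_j. The former is impossible as R vanishes to first order along a line transversal to
    lam_j = 0, the latter as R does not vanish on Z_j = 0, where another lam or g survives. *)
Lemma residue_squarefree : (0 < k)%N -> (k != 1)%N || (g != 0) -> ~ has_multiple_component residue.
Proof.
move=> k0 kg [Q [R [sQ eR]]]; have r0 := residue_neq0 k0.
have Q0 : Q != 0 by apply: contra_neq r0 => Q0; rewrite eR Q0 expr0n mul0r.
have [[|c s0] hc [w uw eQ]] := @ufd_mpoly K n.+2 Q Q0.
  move: sQ; rewrite eQ big_nil mulr1; move: uw => /mpoly_unitP [a a0 ->].
  by rewrite ltnNge msizeC; case: (a != 0).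
have pc : prime_elt c by apply: hc; rewrite mem_head.
have {eQ Q0 sQ} [R' {}eR] : exists R', residue = c * (c * R').
  by rewrite eR eQ big_cons; eexists; rewrite expr2; set P := \prod_(_ <- _) _; rewrite -[LHS]/(w * (c * P) * (w * (c * P)) * R) (_ : _ * R = c * (c * (w * w * P * P * R))) //; ring.
have cdiv (u : V) : divides c (dird u residue).
  rewrite eR dirdM; apply: dividesD.
    by apply: divides_mull; apply: divides_mulr; apply: divides_refl.
  by apply: divides_mulr; apply: divides_refl.
pose j0 := Ordinal k0.
have XE m : (m < n.+2)%N -> 'X_(inord m) = lin (delta_mx (inord m) 0 : 'cV[K]_n.+2).
  move=> hm; apply: mpoly_ext => x; rewrite mevalXU lin_dot /dot mxE (bigD1 (inord m)) //= mxE !eqxx mulr1.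
  by rewrite big1 ?addr0 // => i im; rewrite mxE (negbTE im) mulr0.
have delta0 m : (delta_mx (inord m) 0 : 'cV[K]_n.+2) != 0.
  by apply/eqP => /colP /(_ (inord m)); rewrite !mxE !eqxx => /eqP; rewrite oner_eq0.
have dZ (j : 'I_k) : dird (ev K n (q + j)) residue = 3 *: (lin (lam j) * 'X_(inord (q + j)) ^+ 2).
  have jj := zP (ltn_ord j).
  apply: mpoly_ext => x; rewrite dird_deriv0 mevalZ mevalM mevalXn mevalXU lin_dot -/(co x _).
  have -> : linep residue x (ev K n (q + j)) =
      (residue.@[x 0] - dot x (lam j) * co x (q + j) ^+ 3)%:P + dot x (lam j) *: ((co x (q + j))%:P + 'X) ^+ 3.
    apply: poly_ext => t; rewrite linep_eval !residueE (bigD1 j) //= [\sum_(_ < _) _ in RHS](bigD1 j) //=.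
    rewrite gT tailvD tailvZ tailv_ev ?ltZ // scaler0 addr0 -gT !dotE lamX // mulr0 addr0.
    rewrite !coE co_ev ?ltZ // eqxx mulr1.
    rewrite (eq_bigr (fun l : 'I_k => dot x (lam l) * co x (q + l) ^+ 3)).
      by rewrite !hornerD hornerZ horner_exp hornerD hornerX !hornerC; ring.
    move=> l lj; rewrite !dotE lamX // mulr0 addr0 !coE co_ev ?ltZ // eqn_add2l (_ : (j == l :> nat) = false).
      by rewrite mulr0 addr0.
    by apply/negP => /eqP e; case/eqP: lj; apply: val_inj.
  by rewrite deriv0_cubic.
have assoc (b : 'cV[K]_n.+2) : b != 0 -> divides c (lin b) -> divides (lin b) c.
  move=> b0 hb; have [u uu e] := prime_assoc pc (lin_prime b0) hb.
  by exists u^-1; rewrite e mulrA mulVr // mul1r.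
have [cl|cX] : divides c (lin (lam j0)) \/ exists j : 'I_k, divides c 'X_(inord (q + j)).
  have := cdiv (ev K n (q + j0)); rewrite dZ -mul_mpolyC => h.
  have [_ _ hp] := pc; case/hp: h => [h|/hp [h|/(prime_exp pc) h]]; [|by left|by right; exists j0].
  case: (prime_unit pc _ h); apply/mpoly_unitP; exists 3 => //; exact: (natK (m := 3) isT).
  have [z ez] := assoc _ (lam0 k0) cl.
  have [u hu u1] := lam_dual k0.
  have hl (t : K) : residue.@[(1 *: ev K n (q + j0) + t *: u) 0] = t ^+ 2 * (z * z * R').@[(1 *: ev K n (q + j0) + t *: u) 0].
    rewrite eR ez !mevalM lin_dot !dotE lamX ?zP // mulr0 add0r u1; ring.
  pose f := linep (z * z * R') (1 *: ev K n (q + j0)) u.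
  have : 'X + g.@[u 0] *: 'X^4 = 'X^2 * f.
    apply: poly_ext => t; rewrite hornerM hornerXn /f linep_eval -hl residue_line // u1.
    by rewrite hornerD hornerX hornerZ hornerXn; ring.
  move/(congr1 (fun r : {poly K} => r`_1)); rewrite coefD coefX coefZ !coefXnM coefXn /= mulr0 addr0 => /eqP.
  by rewrite oner_eq0.
have [j hj] := cX; rewrite XE ?ltZ // in hj.
have [z ez] := assoc _ (delta0 _) hj.
have vanish (x : V) : co x (q + j) = 0 -> residue.@[x 0] = 0.
  move=> x0; rewrite eR ez -XE ?ltZ // !mevalM mevalXU -/(co x _) x0; ring.
case/orP: kg => [k1|g0].
  have [j' jj'] : exists j' : 'I_k, j' != j.
    have k2 : (1 < k)%N by have := k0; move: k1; clear; lia.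
    by case: (eqVneq j j0) => [->|ne]; [exists (Ordinal k2)|exists j0; rewrite eq_sym].
  have [u hu u1] := lam_dual (ltn_ord j').
  have h (c' : K) : residue.@[(c' *: ev K n (q + j') + 1 *: u) 0] = 0.
    apply: vanish; rewrite !coE co_ev ?ltZ // (coT hu) ?zP // eqn_add2l (_ : (j' == j :> nat) = false).
      by rewrite !mulr0 addr0.
    by apply/negP => /eqP e; case/eqP: jj'; apply: val_inj.
  have := h 1; have := h 0; rewrite !residue_line // u1 !mul1r !expr1n !mul1r expr0n add0r => ->.
  by rewrite addr0 => /eqP; rewrite oner_eq0.
have [x hx] := mpoly_nonroot g0; case/eqP: hx; rewrite gT.
have := residue_line j0 0 1 (tailvK p x); rewrite scale0r add0r scale1r vanish ?(coT (tailvK p x)) ?zP //.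
by rewrite expr0n mulr0 add0r expr1n mul1r => <-.
Qed.

Lemma vertex_gnf (u : V) : g = 0 -> tailv p u = u -> (forall j, (j < k)%N -> dot u (lam j) = 0) -> vertex G u.
Proof.
move=> g0 hu hl x t; rewrite !GE g0 !meval0; congr (_ + _ + _); apply: eq_bigr => i _.
  by rewrite !coE !(coT hu) ?mulr0 ?addr0 //; have := ltn_ord i; clear; lia.
by rewrite !coE dotDl dotZl hl // !(coT hu) ?zP // !mulr0 !addr0.
Qed.

(** With g = 0 the variables T occur only through the lam_j, of which there is at most one; any
    further direction of T would be a vertex. *)
Lemma tail_dimension : g = 0 -> (k <= 1)%N -> (forall u : V, vertex G u -> u = 0) -> n.+2 = (p + k)%N.
Proof.
move=> g0 k1 nv; apply/eqP; rewrite eqn_leq andbC.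
have tev m : (p <= m)%N -> (m < n.+2)%N -> tailv p (ev K n m) = ev K n m.
  move=> pm hm; apply: co_ext => i hi; rewrite co_tailv // co_ev //.
  by case: ifP => // ip; rewrite (_ : (m == i) = false) //; apply/eqP; move: pm ip; clear; lia.
have evN m : (m < n.+2)%N -> ev K n m != 0.
  by move=> hm; apply/eqP => /(congr1 (fun x => co x m)); rewrite co_ev // co0 eqxx => /eqP; rewrite oner_eq0.
have [k0|k0] := posnP k.
  have -> : (p + k = p)%N by move: k0; clear; lia.
  apply/andP; split; first exact: pN; rewrite leqNgt; apply/negP => h.
  by have := evN p h; rewrite (nv (ev K n p)) ?eqxx //; apply: vertex_gnf => //; rewrite ?tev // k0.
have {k1 k0} k1 : k = 1%N by move: k1 k0; clear; lia.
have jk : (0 < k)%N by rewrite k1.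
have -> : (p + k = p.+1)%N by move: k1; clear; lia.
have [u hu u1] := lam_dual jk; apply/andP; split.
  rewrite ltnNge; apply/negP => h; case/eqP: (oner_neq0 K); rewrite -u1.
  rewrite (_ : u = 0) ?dot0l //; apply: co_ext => i hi; rewrite (coT hu) ?co0 //; exact: leq_trans hi h.
rewrite leqNgt; apply/negP => h.
have h' := ltnW h.
pose l m := dot (ev K n m) (lam 0).
have hl (w : V) : dot w (lam 0) = 0 -> forall j, (j < k)%N -> dot w (lam j) = 0.
  by move=> w0 j; rewrite k1 ltnS leqn0 => /eqP ->.
have [e|e] := eqVneq (l p) 0.
  by have := evN p h'; rewrite (nv (ev K n p)) ?eqxx //; apply: vertex_gnf => //; [rewrite tev|apply: hl].
pose w : V := ev K n p.+1 - (l p.+1 / l p) *: ev K n p.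
have : w = 0.
  apply/nv/vertex_gnf => //; first by rewrite /w -scaleNr tailvD !tailvZ !tev.
  by apply: hl; rewrite /w !dotE -/(l _) -/(l _) mulfVK // subrr.
move/(congr1 (fun x => co x p.+1)); rewrite /w -scaleNr !coE !co_ev // eqxx (_ : (p == p.+1) = false).
  by rewrite mulr0 addr0 => /eqP; rewrite oner_eq0.
by apply/eqP; clear; lia.
Qed.
End QuarticNormalForm.

(** * Projective equivalence and Galois points of the normal form *)

(* The binary quartic [Y u^3 + Y^4] of a block is [l L^3] plus a form in
   [u + Y] only, for a suitable form [L]. *)
Lemma block_identity (K : fieldType) (a u Y : K) : 3 != 0 :> K ->
  a = 3 * (u + Y) * (- 3^-1 * (u - 2 * Y)) ^+ 3 +
  (a - (Y * u ^+ 3 + Y ^+ 4) +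
   ((Y - - 3^-1 * (u - 2 * Y)) * (u + - 3^-1 * (u - 2 * Y)) ^+ 3 +
    (Y - - 3^-1 * (u - 2 * Y)) ^+ 4)).
Proof. by move=> n3; field; rewrite n3. Qed.

Section ProjectiveEquivalence.
Variables (K : closedFieldType) (N d : nat).
Local Notation V := 'rV[K]_N.+1.

(** A linear map from one hypersurface onto the other makes the pullback of H vanish on F = 0, so it
    is a multiple of the irreducible F. The degrees agree, the factor is a constant, and its d-th
    root is absorbed into the matrix. *)
Lemma proj_equivP (F H : {mpoly K[N.+1]}) : (0 < d)%N -> F \is d.-homog -> irreducible_elt F -> H \is d.-homog ->
  proj_equiv (hypersurface F) (hypersurface H) <-> exists2 D : 'M[K]_N.+1, D \in unitmx & subst D F = H.
Proof.
move=> d0 hF irrF hH; split=> [[T [hT eT]]|[D uD eD]].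
  pose M := lin1_mx T.
  have TE (v : V) : T v = v *m M by rewrite mul_rV_lin1.
  have Tinj : injective T by apply/lker0P.
  have uM : M \in unitmx.
    rewrite -row_free_unit; apply/inj_row_free => v v0; apply: Tinj.
    by rewrite TE v0 linear0.
  have FH (x : V) : F.@[x 0] = 0 <-> H.@[(x *m M) 0] = 0.
    have [->|x0] := eqVneq x 0; first by rewrite mul0mx !(dhomog_eval0 hF, dhomog_eval0 hH).
    have xM0 : x *m M != 0 by rewrite -TE; apply: contra_neq x0 => e; apply: Tinj; rewrite e linear0.
    have [P xP] := point_exists x0; have xTP : x *m M \in val (ptransf hT P) by rewrite -TE /= memv_img.
    rewrite -(vanishes_atP hF xP x0) -(vanishes_atP hH xTP xM0); split=> h.
      have : hypersurface H (ptransf hT P) by rewrite -eT; exists P.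
      by [].
    have : hypersurface H (ptransf hT P) by [].
    rewrite -eT => -[Q FQ eQ].
    suff -> : P = Q by [].
    have [y yQ y0] := point_neq0 Q.
    have : T y \in val (ptransf hT P) by rewrite -eQ /= memv_img.
    by move=> /memv_imgP [z zP /Tinj ez]; rewrite ez in yQ y0; apply: (point_eq zP yQ y0).
  have [R eR] := irreducible_dvd irrF (fun x h => etrans (subst_eval M H x) ((FH x).1 h)).
  have [F0 _ _] := irrF.
  have MH0 : subst M H != 0.
    apply: contra_neq F0 => e; apply: mpoly_ext => x; rewrite meval0; apply/FH.
    by rewrite -subst_eval e meval0.
  have hRF : R * F \is d.-homog by rewrite -eR dhomog_subst.
  have RF0 : R * F != 0 by rewrite -eR.
  have [e hR led] := dhomog_factor RF0 hRF.
  have : e = 0%N.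
    have := dhomog_uniq MH0 (dhomog_subst M hH) (_ : subst M H \is (e + d).-homog).
    by rewrite {1}eR => /(_ (dhomogM hR hF)); move: led; clear; lia.
  move=> e0; rewrite e0 in hR.
  have R0 : R != 0 by apply: contra_neq MH0 => R0; rewrite eR R0 mul0r.
  have [c c0 eRc] : exists2 c, c != 0 & R = c%:MP by apply/mpoly_unitP/(homog0_unit hR R0).
  have : size ('X^d - c%:P) != 1%N by rewrite size_XnsubC // eqSS -lt0n.
  move=> /closed_rootP [r]; rewrite /root hornerD hornerN hornerXn hornerC subr_eq0 => /eqP er.
  have r0 : r != 0 by apply: contra_neq c0 => r0; rewrite -er r0 expr0n gtn_eqF.
  exists (r *: invmx M); first by rewrite unitmxZ ?unitmx_inv // unitfE.
  apply: mpoly_ext => x; rewrite subst_eval -scalemxAr (dhomog_eval_scale _ _ hF) er.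
  have := congr1 (fun q => q.@[(x *m invmx M) 0]) eR.
  by rewrite subst_eval mulmxKV // mevalM eRc mevalC.
have Ti : lker (linfun (mulmxr (invmx D)) : 'End(V)) == 0%VS.
  apply/lker0P => x y; rewrite !lfunE /= => e; rewrite -[x](mulmxK (_ : invmx D \in unitmx)) ?unitmx_inv // e.
  by rewrite mulmxK // unitmx_inv.
exists (linfun (mulmxr (invmx D))), Ti; apply/seteqP; split=> [_ [P FP <-] v|P HP].
  by move=> /memv_imgP [w wP ->]; rewrite lfunE /= -eD subst_eval mulmxKV //; apply: FP.
have [v vP v0] := point_neq0 P.
have vD0 : v *m D != 0 by apply: contra_neq v0 => e; rewrite -[v](mulmxK uD) e mul0mx.
have [Q vQ] := point_exists vD0; exists Q.
  by apply/(vanishes_atP hF vQ vD0); rewrite -subst_eval eD; apply: HP.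
apply: (@point_eq _ _ _ _ v) => //=.
by apply/memv_imgP; exists (v *m D); rewrite // lfunE /= mulmxK.
Qed.
End ProjectiveEquivalence.

Section GaloisPointsOfNormalForm.
Variables (K : closedFieldType) (charK : [pchar K] =i pred0) (n d q k : nat).
Variables (lam : nat -> 'cV[K]_n.+2) (g G : {mpoly K[n.+2]}).
Local Notation V := 'rV[K]_n.+2.
Local Notation p := (q + k + q)%N.
Hypotheses (hG : gnf d q k lam g G).

Let pN : (p <= n.+2)%N. Proof. by have [] := hG. Qed.
Let lamT j : (j < k)%N -> forall x : V, dot x (lam j) = dot (tailv p x) (lam j).
Proof. by have [_ h _ _ _] := hG; apply: h. Qed.
Let gT (x : V) : g.@[x 0] = g.@[(tailv p x) 0]. Proof. by have [] := hG. Qed.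
Let GE (x : V) : G.@[x 0] = \sum_(i < q) (co x (q + k + i) * co x i ^+ 3 + co x (q + k + i) ^+ 4)
      + \sum_(j < k) dot x (lam j) * co x (q + j) ^+ d.-1 + g.@[x 0].
Proof. by have [] := hG. Qed.
Let ltX i : (i < q)%N -> (i < n.+2)%N. Proof. by move=> h; apply: leq_trans pN; rewrite -addnA ltn_addr. Qed.
Let ltZ j : (j < k)%N -> (q + j < n.+2)%N.
Proof. by move=> h; apply: leq_trans pN; rewrite ltn_addr // ltn_add2l. Qed.
Let ltY i : (i < q)%N -> (q + k + i < n.+2)%N. Proof. by move=> h; apply: leq_trans pN; rewrite ltn_add2l. Qed.

Let tail_shift (x : V) t m : (m < p)%N -> tailv p (x + t *: ev K n m) = tailv p x.
Proof. by move=> mp; rewrite tailvD tailvZ tailv_ev ?scaler0 ?addr0 //; apply: leq_trans mp pN. Qed.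

Lemma gnf_shift_block (x : V) i a b : (i < q)%N ->
  G.@[(x + a *: ev K n i + b *: ev K n (q + k + i)) 0] = G.@[x 0]
    - (co x (q + k + i) * co x i ^+ 3 + co x (q + k + i) ^+ 4)
    + ((co x (q + k + i) + b) * (co x i + a) ^+ 3 + (co x (q + k + i) + b) ^+ 4).
Proof.
move=> iq; have iX := ltX iq; have iY := ltY iq.
have iXp : (i < p)%N by rewrite -addnA ltn_addr.
have iYp : (q + k + i < p)%N by rewrite ltn_add2l.
have c1 : (i == q + k + i)%N = false by apply/eqP; have := iq; clear; lia.
have c2 : (q + k + i == i)%N = false by rewrite eq_sym.
rewrite !GE (bigD1 (Ordinal iq)) //= [\sum_(i0 < q) _ in RHS](bigD1 (Ordinal iq)) //=.
rewrite !coE !co_ev // !eqxx c1 c2 gT !tail_shift // -gT.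
rewrite (eq_bigr (fun l : 'I_q => co x (q + k + l) * co x l ^+ 3 + co x (q + k + l) ^+ 4)); last first.
  move=> l li; have lX := ltX (ltn_ord l); have lY := ltY (ltn_ord l).
  rewrite !coE !co_ev // eqn_add2l (_ : (i == l) = false); last first.
    by apply/negP => /eqP e; case/eqP: li; apply: val_inj.
  rewrite (_ : (i == q + k + l)%N = false); last by apply/eqP; have := iq; clear; lia.
  rewrite (_ : (q + k + i == l)%N = false); last by apply/eqP; have := ltn_ord l; clear; lia.
  by rewrite !mulr0 !addr0.
rewrite (eq_bigr (fun l : 'I_k => dot x (lam l) * co x (q + l) ^+ d.-1)); last first.
  move=> l _; rewrite lamT // !tail_shift // -lamT //; have lZ := ltZ (ltn_ord l).
  rewrite !coE !co_ev // (_ : (i == q + l)%N = false); last by apply/eqP; have := iq; clear; lia.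
  rewrite (_ : (q + k + i == q + l)%N = false); last by apply/eqP; have := ltn_ord l; clear; lia.
  by rewrite !mulr0 !addr0.
rewrite -[true%:R]/(1 : K) -[false%:R]/(0 : K); ring.
Qed.

Lemma gnf_shift_point (x : V) j c : (j < k)%N ->
  G.@[(x + c *: ev K n (q + j)) 0] = G.@[x 0]
    - dot x (lam j) * co x (q + j) ^+ d.-1 + dot x (lam j) * (co x (q + j) + c) ^+ d.-1.
Proof.
move=> jk; have jZ := ltZ jk; have jp : (q + j < p)%N by rewrite ltn_addr // ltn_add2l.
rewrite !GE (bigD1 (Ordinal jk)) //= [\sum_(i0 < k) _ in RHS](bigD1 (Ordinal jk)) //=.
rewrite gT tail_shift // -gT lamT // tail_shift // -lamT // !coE co_ev // eqxx mulr1.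
rewrite (eq_bigr (fun l : 'I_q => co x (q + k + l) * co x l ^+ 3 + co x (q + k + l) ^+ 4)); last first.
  move=> l _; have lX := ltX (ltn_ord l); have lY := ltY (ltn_ord l).
  rewrite !coE !co_ev // (_ : (q + j == l)%N = false); last by apply/eqP; have := ltn_ord l; clear; lia.
  rewrite (_ : (q + j == q + k + l)%N = false); last by apply/eqP; have := jk; clear; lia.
  by rewrite !mulr0 !addr0.
rewrite (eq_bigr (fun l : 'I_k => dot x (lam l) * co x (q + l) ^+ d.-1)); last first.
  move=> l lj; rewrite lamT // tail_shift // -lamT //; have lZ := ltZ (ltn_ord l).
  rewrite !coE !co_ev // eqn_add2l (_ : (j == l) = false) ?mulr0 ?addr0 //.
  by apply/negP => /eqP e; case/eqP: lj; apply: val_inj.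
ring.
Qed.

Let cf i : 'cV[K]_n.+2 := delta_mx (inord i) 0.
Let dot_cf (x : V) i : dot x (cf i) = co x i.
Proof. by rewrite /dot /cf -colE mxE. Qed.

Let cf0 i : cf i != 0.
Proof. by apply/eqP => /colP /(_ (inord i)); rewrite !mxE !eqxx => /eqP; rewrite oner_eq0. Qed.

Lemma gp_point j : (1 < d)%N -> (j < k)%N -> lam j != 0 -> gp d G (ev K n (q + j)) (lam j) (cf (q + j)).
Proof.
move=> d1 jk l0; have jp : (q + j < p)%N by rewrite ltn_addr // ltn_add2l.
split=> //; first by rewrite lamT // tailv_ev ?dot0l // ltZ.
  by rewrite dot_cf co_ev ?eqxx // ltZ.
move=> x; rewrite dot_cf -scaleNr gnf_shift_point // subrr.
have -> : (0 : K) ^+ d.-1 = 0 by rewrite expr0n gtn_eqF //; move: d1; clear; lia.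
ring.
Qed.

Lemma gp_block_vertex i : d = 4%N -> (i < q)%N -> gp d G (ev K n i) (cf (q + k + i)) (cf i).
Proof.
move=> d4 iq; have iX := ltX iq; have iY := ltY iq.
split=> //; rewrite ?dot_cf ?co_ev ?eqxx //.
  by rewrite (_ : (_ == _)%N = false) //; apply/eqP; have := iq; clear; lia.
move=> x; rewrite !dot_cf d4 /=; have := gnf_shift_block x (- co x i) 0 iq.
by rewrite scale0r addr0 scaleNr => ->; ring.
Qed.

(** The three Galois vectors of a block other than its vertex. Writing the cubic term with u = z^2
    X, whose cube is that of X, reduces the claim to z = 1, which is [block_identity]. *)
Lemma gp_block_root i z : d = 4%N -> (i < q)%N -> z ^+ 3 = 1 ->
  gp d G (ev K n (q + k + i) - z *: ev K n i) (3 *: (z ^+ 2 *: cf i + cf (q + k + i)))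
    ((- 3^-1) *: (z ^+ 2 *: cf i - 2 *: cf (q + k + i))).
Proof.
move=> d4 iq z3; have iX := ltX iq; have iY := ltY iq.
have n3 : (3 : K) != 0 by rewrite ((pcharf0P K).1 charK).
have c1 : (i == q + k + i)%N = false by apply/eqP; have := iq; clear; lia.
have c2 : (q + k + i == i)%N = false by rewrite eq_sym.
have ezz : z ^+ 2 * z = 1 by rewrite -exprSr.
split.
- apply/eqP => e; have := congr1 (dot (ev K n (q + k + i))) e.
  rewrite !dotE !dot_cf !co_ev // c2 eqxx mulr0 add0r mulr1 => /eqP.
  by rewrite (negbTE n3).
- rewrite !dotE !dot_cf !co_ev // c1 c2 !eqxx /= -[true%:R]/(1 : K) -[false%:R]/(0 : K).
  have -> : 3 * (z ^+ 2 * (0 : K) + 1) + 3 * - (z * (z ^+ 2 * 1 + (0 : K))) = 3 - 3 * (z ^+ 2 * z) by ring.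
  by rewrite ezz mulr1 subrr.
- rewrite !dotE !dot_cf !co_ev // c1 c2 !eqxx /= -[true%:R]/(1 : K) -[false%:R]/(0 : K).
  have -> : - 3^-1 * (z ^+ 2 * (0 : K) - 2 * 1) - z * (- 3^-1 * (z ^+ 2 * 1 - 2 * (0 : K))) =
      3^-1 * (z ^+ 2 * z + 2) by ring.
  by rewrite ezz; field.
move=> x; rewrite !dotE !dot_cf; set X := co x i; set Y := co x (q + k + i).
pose u := z ^+ 2 * X; have eX : X = z * u by rewrite /u mulrA [z * _]mulrC ezz mul1r.
set L := _ * (_ - _); have eL : L = - 3^-1 * (u - 2 * Y) by [].
clearbody L; have := gnf_shift_block x (L * z) (- L) iq.
have -> : x + (L * z) *: ev K n i + - L *: ev K n (q + k + i) = x - L *: (ev K n (q + k + i) - z *: ev K n i).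
  by rewrite scalerBr scalerA opprB scaleNr addrA.
move=> ->; rewrite -/X -/Y d4 /= -/u eX.
have -> : z * u + L * z = z * (u + L) by ring.
have e1 : (z * u) ^+ 3 = u ^+ 3 by rewrite exprMn z3 mul1r.
have e2 : (z * (u + L)) ^+ 3 = (u + L) ^+ 3 by rewrite exprMn z3 mul1r.
rewrite e1 e2 eL; exact: block_identity.
Qed.
End GaloisPointsOfNormalForm.

Section CountGaloisPoints.
Variables (K : closedFieldType) (charK : [pchar K] =i pred0) (n d : nat) (F : {mpoly K[n.+2]}) (s : int).
Hypotheses (hd : (4 <= d)%N) (hF : F \is d.-homog) (irrF : irreducible_elt F).
Hypotheses (hs : has_dim (Sing F) s) (hsn : s <= n%:Z - 2) (finD : finite_set (Delta F)).
Local Notation V := 'rV[K]_n.+2.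
Variables (q k : nat) (lam : nat -> 'cV[K]_n.+2) (g : {mpoly K[n.+2]}) (D : 'M[K]_n.+2).
Hypotheses (uD : D \in unitmx) (hG : gnf d q k lam g (subst D F)).
Hypotheses (qd : q = 0%N \/ d = 4%N).
Hypothesis qk : (0 < q)%N \/ exists2 j, (j < k)%N & lam j != 0.

Let pN : (q + k + q <= n.+2)%N. Proof. by have [] := hG. Qed.
Let ltX i : (i < q)%N -> (i < n.+2)%N. Proof. by move=> h; apply: leq_trans pN; rewrite -addnA ltn_addr. Qed.
Let ltZ j : (j < k)%N -> (q + j < n.+2)%N.
Proof. by move=> h; apply: leq_trans pN; rewrite ltn_addr // ltn_add2l. Qed.
Let ltY i : (i < q)%N -> (q + k + i < n.+2)%N. Proof. by move=> h; apply: leq_trans pN; rewrite ltn_add2l. Qed.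

Lemma gp_subst (v : V) l L : gp d (subst D F) v l L -> gp d F (v *m D) (invmx D *m l) (invmx D *m L).
Proof.
have dE (x : V) c : dot x (invmx D *m c) = dot (x *m invmx D) c by rewrite /dot mulmxA.
move=> [l0 vl vL hx]; split; rewrite ?dE ?mulmxK //.
  by apply: contra_neq l0 => e; rewrite -[l](mulKVmx uD) e mulmx0.
move=> x; rewrite !dE; have := hx (x *m invmx D); rewrite !subst_eval mulmxBl mulmxKV // -scalemxAl.
by move=> ->.
Qed.

(** If lam_j were zero, Z_j would be missing from the equation and its direction would be a vertex,
    although there is a Galois vector. *)
Lemma gnf_lam_neq0 j : (j < k)%N -> lam j != 0.
Proof.
move=> jk; apply/eqP => l0.
have [v [l [L hv]]] : exists v l L, gp d F v l L.
  case: qk => [q0|[j' jk' lj']].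
    case: qd => [e|d4]; first by rewrite e in q0.
    by have := gp_subst (gp_block_vertex hG d4 q0); do 3 eexists; eauto.
  by have := gp_subst (gp_point hG (ltnW (ltnW hd)) jk' lj'); do 3 eexists; eauto.
have : ev K n (q + j) *m D = 0.
  apply: (gp_no_vertex charK hd hF irrF hs hsn finD hv) => x t.
  have := gnf_shift_point hG (x *m invmx D) t jk; rewrite l0 !dot0r !mul0r subr0 addr0 !subst_eval.
  by rewrite mulmxDl mulmxKV // -scalemxAl.
move/(congr1 (mulmx^~ (invmx D))); rewrite mulmxK // mul0mx => /(congr1 (fun x : V => co x (q + j))).
by rewrite co_ev ?ltZ // co0 eqxx => /eqP; rewrite oner_eq0.
Qed.

(** Each block contributes e_X and the vectors e_Y - z e_X for the three cube roots of unity z, each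
    Z_j one more. These are pairwise nonproportional. *)
Lemma gnf_card : (4 * q + k)%N%:Z <= card_Delta F.
Proof.
have n3 : (3 : K) != 0 by rewrite ((pcharf0P K).1 charK).
have [z ez] : exists z : K, z ^+ 2 + z + 1 = 0.
  have := @solve_monicpoly K 2 (fun i => - 1) isT => -[z]; rewrite !big_ord_recl big_ord0 expr0 /bump /= expr1 => e.
  by exists z; rewrite e; ring.
have z3 : z ^+ 3 = 1.
  have : (z - 1) * (z ^+ 2 + z + 1) = 0 by rewrite ez mulr0.
  have -> : (z - 1) * (z ^+ 2 + z + 1) = z ^+ 3 - 1 by ring.
  by move/eqP; rewrite subr_eq0 => /eqP.
have z0 : z != 0 by apply: contra_eq_neq z3 => ->; rewrite expr0n eq_sym oner_eq0.
have z1 : z != 1 by apply: contra_neq n3 => e; rewrite -[RHS]ez e; ring.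
pose rt (a : 'I_3) : K := z ^+ a.
have rt3 a : rt a ^+ 3 = 1 by rewrite /rt -exprM mulnC exprM z3 expr1n.
have rt0 a : rt a != 0 by rewrite expf_neq0.
have rtI : injective rt.
  have h (a b : 'I_3) : (a <= b)%N -> rt a = rt b -> a = b.
    move=> ab; rewrite /rt -{1}(subnK ab) exprD; have : (b - a < 3)%N by have := ltn_ord b; clear; lia.
    case e : (b - a)%N => [|[|[|//]]] _.
    - by move=> _; apply: val_inj; move: ab e => /=; clear; lia.
    - by rewrite expr1 => h; case/eqP: z1; apply: (mulIf (expf_neq0 a z0)); rewrite mul1r -h.
    move=> h; case/eqP: z1; have : z ^+ 2 = 1 by apply: (mulIf (expf_neq0 a z0)); rewrite mul1r -h.
    by move=> z2; rewrite -[RHS]z3 exprS z2 mulr1.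
  move=> a b e; case: (leqP a b) => [ab|/ltnW ba]; first exact: h.
  by apply/esym/h.
pose vec (x : 'I_q * option 'I_3 + 'I_k) : V := match x with
  | inl (i, None) => ev K n i
  | inl (i, Some a) => ev K n (q + k + i) - rt a *: ev K n i
  | inr j => ev K n (q + j) end.
have vX i b : co (vec (inl (i, b))) i = if b is Some a then - rt a else 1.
  have iX := ltX (ltn_ord i); have iY := ltY (ltn_ord i).
  case: b => [a|] /=; rewrite -?scaleNr ?coE !co_ev // ?eqxx // mulr1.
  by rewrite (_ : (_ == _)%N = false) ?add0r //; apply/eqP; have := ltn_ord i; clear; lia.
have vY i b : co (vec (inl (i, b))) (q + k + i) = if b is Some a then 1 else 0.
  have iX := ltX (ltn_ord i); have iY := ltY (ltn_ord i).
  have c1 : (i == (q + k + i)%N :> nat) = false by apply/eqP; have := ltn_ord i; clear; lia.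
  by case: b => [a|] /=; rewrite -?scaleNr ?coE !co_ev // c1 // eqxx mulr0 addr0.
have vX' i l b : i != l -> co (vec (inl (i, b))) l = 0.
  move=> il; have iX := ltX (ltn_ord i); have iY := ltY (ltn_ord i); have lX := ltX (ltn_ord l).
  have c1 : (i == l :> nat) = false by apply/negP => /eqP e; case/eqP: il; apply: val_inj.
  have c2 : ((q + k + i)%N == l :> nat) = false by apply/eqP; have := ltn_ord l; clear; lia.
  by case: b => [a|] /=; rewrite -?scaleNr ?coE !co_ev // c1 ?c2 // mulr0 addr0.
have vZ i b j : (j < k)%N -> co (vec (inl (i, b))) (q + j) = 0.
  move=> jk; have iX := ltX (ltn_ord i); have iY := ltY (ltn_ord i); have jZ := ltZ jk.
  have c1 : (i == (q + j)%N :> nat) = false by apply/eqP; have := ltn_ord i; clear; lia.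
  have c2 : ((q + k + i)%N == (q + j)%N) = false by apply/eqP; have := jk; clear; lia.
  by case: b => [a|] /=; rewrite -?scaleNr ?coE !co_ev // c1 ?c2 // mulr0 addr0.
have xnz b : (if b is Some a then - rt a else 1) != 0 :> K by case: b => [a|]; rewrite ?oppr_eq0 ?oner_eq0.
have vecI x y c : vec y = c *: vec x -> x = y.
  move=> e; have eco m : co (vec y) m = c * co (vec x) m by rewrite e coZ.
  case: x y e eco => [[i b]|j] [[i' b']|j'] e eco.
  - have := eco i'; rewrite vX; case: (eqVneq i i') => [ii|ii]; last first.
      by rewrite vX' // mulr0 => /eqP; rewrite (negbTE (xnz b')).
    rewrite -ii vX; have := eco (q + k + i')%N; rewrite vY -ii vY.
    case: b {e eco} => [a|]; case: b' => [a'|] //.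
    + by rewrite mulr1 => <-; rewrite mul1r => /oppr_inj /rtI ->.
    + by rewrite mulr1 => <-; rewrite mul0r => /eqP; rewrite oner_eq0.
    by rewrite mulr0 => /eqP; rewrite oner_eq0.
  - have := eco (q + j')%N; rewrite vZ // mulr0 /= co_ev ?ltZ // eqxx => /eqP.
    by rewrite oner_eq0.
  - have := eco i'; have iX := ltX (ltn_ord i'); have jZ := ltZ (ltn_ord j).
    rewrite vX /= co_ev // (_ : (_ == _)%N = false); last first.
      by apply/eqP; have := ltn_ord i'; clear; lia.
    by rewrite mulr0 => /eqP; rewrite (negbTE (xnz b')).
  have := eco (q + j')%N; rewrite /= !co_ev ?ltZ // eqxx eqn_add2l; case: eqP => [/val_inj -> //|_].
  by rewrite mulr0 => /eqP; rewrite oner_eq0.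
pose t := [seq vec x *m D | x <- enum {: 'I_q * option 'I_3 + 'I_k}].
have st : size t = (4 * q + k)%N.
  by rewrite size_map -cardE card_sum card_prod card_option !card_ord mulnC.
have DI c x y : vec y *m D = c *: (vec x *m D) -> x = y.
  move=> e; apply: (vecI x y c); rewrite -[vec y](mulmxK uD) e -!scalemxAl mulmxK //.
rewrite -st; apply: (card_Delta_ge charK hd hF irrF hs hsn finD).
- by rewrite map_inj_uniq ?enum_uniq // => x y e; apply/esym/(DI 1); rewrite scale1r.
- by move=> _ _ /mapP [x _ ->] /mapP [y _ ->] ne c /DI e; rewrite e eqxx in ne.
move=> _ /mapP [x _ ->]; case: x => [[i [a|]]|j] /=; do 2 eexists; apply: gp_subst.
- by apply: (gp_block_root charK hG _ (ltn_ord i) (rt3 a)); case: qd => // q0; have := ltn_ord i; rewrite {2}q0.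
- by apply: (gp_block_vertex hG _ (ltn_ord i)); case: qd => // q0; have := ltn_ord i; rewrite {2}q0.
by apply: (gp_point hG (ltnW (ltnW hd)) (ltn_ord j) (gnf_lam_neq0 (ltn_ord j))).
Qed.
End CountGaloisPoints.

(** * Normalization *)

Lemma sum_range (R : nmodType) N (f : nat -> R) (P : pred 'I_N) a c : (a + c <= N)%N ->
  (forall i : 'I_N, P i = (a <= i < a + c)%N) -> \sum_(i < N | P i) f i = \sum_(j < c) f (a + j)%N.
Proof.
move=> acN hP; rewrite (eq_bigl _ _ hP) -(big_mkord (fun i => a <= i < a + c)%N f).
rewrite -(big_mkord xpredT (fun j => f (a + j)%N)).
have -> : \sum_(0 <= j < c) f (a + j)%N = \sum_(a <= i < a + c) f i.
  by rewrite -{2}(add0n a) big_addn addKn; apply: eq_bigr => i _; rewrite addnC.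
rewrite [RHS](big_nat_widen _ _ N) // [RHS](big_nat_widenl _ 0) //.
by apply: eq_bigl => i; rewrite /= andbC.
Qed.

Section Variables.
Variables (K : closedFieldType) (charK : [pchar K] =i pred0) (n : nat).
Local Notation V := 'rV[K]_n.+2.
Implicit Types (G : {mpoly K[n.+2]}) (x y : V).

Lemma in_vars_eval J G x y : @in_vars K n.+1 J G -> (forall j : 'I_n.+2, J j%:Z -> x 0 j = y 0 j) ->
  G.@[x 0] = G.@[y 0].
Proof.
move=> hJ hxy; rewrite !mevalE !big_seq; apply: eq_bigr => mon hm; congr (_ * _).
apply: eq_bigr => j _; have [/hxy -> //|nJ] := boolP (J j%:Z).
by rewrite (hJ mon j hm nJ) !expr0.
Qed.

(** Invariance under translation along a basis vector makes the partial derivative vanish, and in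
    characteristic 0 the variable then occurs in no monomial. *)
Lemma in_vars_tail (J : pred int) p G : (forall x, G.@[x 0] = G.@[(tailv p x) 0]) ->
  (forall j : 'I_n.+2, ~~ J j%:Z -> (j < p)%N) -> @in_vars K n.+1 J G.
Proof.
move=> hG hJ mon j hm /hJ jp; apply/eqP; apply: contraT; rewrite -lt0n => mj.
have dG : G^`M(j) = 0.
  apply: mpoly_ext => x; rewrite meval0.
  have -> : G^`M(j).@[x 0] = (dird (ev K n j) G).@[x 0].
    rewrite dird_eval (bigD1 j) //= /ev mxE inord_val !eqxx mul1r big1 ?addr0 // => i ij.
    by rewrite mxE (negbTE ij) andbF mul0r.
  rewrite dird_deriv0 (_ : linep _ _ _ = (G.@[x 0])%:P) ?derivC ?horner0 //.
  apply: poly_ext => t; rewrite linep_eval hornerC [LHS]hG tailvD tailvZ tailv_ev // scaler0 addr0.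
  by rewrite -hG.
have em : (mon = (mon - U_(j)) + U_(j))%MM.
  by rewrite submK //; apply/mnm_lepP => i; rewrite mnm1E; case: eqP => [<-|].
have := congr1 (mcoeff (mon - U_(j))%MM) dG; rewrite mcoeff_mderiv mcoeff0 -em -mulr_natr => /eqP.
rewrite mulf_eq0 ((pcharf0P K).1 charK) orbF; move: hm; rewrite mcoeff_msupp => /negbTE ->.
by [].
Qed.

Lemma index_mx (c : nat -> K) (sg : nat -> nat) : (forall i, c i != 0) -> (forall i j, (i < n.+2)%N -> (j < n.+2)%N -> sg i = sg j -> i = j) ->
  (forall i, (i < n.+2)%N -> (sg i < n.+2)%N) ->
  exists2 E : 'M[K]_n.+2, E \in unitmx & forall x i, (i < n.+2)%N -> co (x *m E) (sg i) = c i * co x i.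
Proof.
move=> c0 sI sN; pose E : 'M[K]_n.+2 := \matrix_(a, b) (c a * (sg a == b)%:R).
have hE x i : (i < n.+2)%N -> co (x *m E) (sg i) = c i * co x i.
  move=> iN; rewrite /co mxE (bigD1 (inord i)) //= mxE !inordK ?eqxx ?sN // mulr1 mulrC big1 ?addr0 // => a ai.
  rewrite mxE inordK ?sN //; case: eqP => [/sI e|]; rewrite ?mulr0 //.
  by case/eqP: ai; apply: val_inj; rewrite /= inordK // e.
exists E => //; rewrite -row_free_unit; apply/inj_row_free => x x0; apply: co_ext => i iN.
by apply: (mulfI (c0 i)); rewrite -hE // x0 !co0 mulr0.
Qed.

Lemma gnf_subst d q k lam g G (mu : nat -> K) (E : 'M[K]_n.+2) : gnf d q k lam g G ->
  (forall x i, (i < q)%N -> co (x *m E) i = co x i) ->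
  (forall x i, (i < q)%N -> co (x *m E) (q + k + i) = co x (q + k + i)) ->
  (forall x j, (j < k)%N -> co (x *m E) (q + j) = mu j * co x (q + j)) ->
  (forall x, tailv (q + k + q) (x *m E) = tailv (q + k + q) x *m E) ->
  gnf d q k (fun j => mu j ^+ d.-1 *: (E *m lam j)) (subst E g) (subst E G).
Proof.
move=> [pN lT hg gT GE] hX hY hZ hT; split=> //.
- by move=> j jk x; rewrite !dotZr /dot !mulmxA -!/(dot _ _) lT // hT [in RHS]lT // -hT tailvK hT.
- exact: dhomog_subst.
- by move=> x; rewrite !subst_eval [LHS]gT hT [RHS]gT hT tailvK.
move=> x; rewrite !subst_eval GE; congr (_ + _ + _); apply: eq_bigr => i _.
  by rewrite (hX x i) // (hY x i).
by rewrite hZ // exprMn dotZr /dot mulmxA; ring.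
Qed.

End Variables.

(** The change of coordinates is the identity on the first [p] of them and takes r independent forms
    in the others to the first r of these. *)
Lemma tail_basis (K : closedFieldType) N p r (L : 'M[K]_(N, r)) : (p <= N)%N ->
  (forall x : 'rV[K]_N, x *m L = tailv p x *m L) -> \rank L = r -> exists E : 'M[K]_N, [/\ E \in unitmx, (p + r <= N)%N,
    forall (x : 'rV_N) (i : 'I_N), (i < p)%N -> (x *m E) 0 i = x 0 i,
    forall x : 'rV_N, tailv p (x *m E) = tailv p x *m E &
    forall (x : 'rV_N) (j : 'I_r) (i : 'I_N), i = (p + j)%N :> nat -> (x *m E *m L) 0 j = x 0 i].
Proof.
move=> pN; have eN : (p + (N - p) = N)%N by rewrite subnKC.
move: (N - p)%N eN => t eN; move: L; case: N / eN {pN} => L hL rL.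
have tE (x : 'rV[K]_(p + t)) : tailv p x = row_mx 0 (rsubmx x).
  apply/rowP => i; rewrite mxE -[i]splitK; case: (fintype.split i) => j /=.
    by rewrite row_mxEl mxE leqNgt ltn_ord.
  by rewrite row_mxEr mxE leq_addr.
have eL : L = col_mx 0 (dsubmx L).
  apply/row_matrixP => i; rewrite !rowE hL tE -[in LHS](vsubmxK L) mul_row_col mul0mx add0r.
  by rewrite -[in RHS](hsubmxK (delta_mx 0 i)) mul_row_col mulmx0 add0r.
have xL (x : 'rV[K]_(p + t)) : x *m L = rsubmx x *m dsubmx L.
  by rewrite eL -{1}[x]hsubmxK mul_row_col mulmx0 add0r col_mxKd.
have full : row_full (dsubmx L).
  rewrite /row_full eqn_leq rank_leq_col -{1}rL {1}eL.
  by rewrite -addsmxE; apply: leq_trans (mxrank_adds_leqif _ _) _; rewrite mxrank0.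
have [D [uD rt hD1 _]] := dual_system_basis (mulVpmx full).
pose E : 'M[K]_(p + t) := block_mx 1%:M 0 0 D.
have xE (x : 'rV[K]_(p + t)) : x *m E = row_mx (lsubmx x) (rsubmx x *m D).
  by rewrite -{1}[x]hsubmxK mul_row_block !mulmx0 mulmx1 addr0 add0r.
exists E; split.
- by rewrite unitmxE det_lblock det1 mul1r -unitmxE.
- by rewrite leq_add2l.
- move=> x i ip; rewrite xE (_ : i = lshift t (Ordinal ip)) ?row_mxEl ?mxE //; exact: val_inj.
- by move=> x; rewrite !tE !xE row_mxKr row_mxKl row_mxKr.
move=> x j i ei; have jt : (j < t)%N by apply: leq_trans (ltn_ord j) rt.
rewrite xL xE row_mxKr (hD1 _ _ (Ordinal jt)) // mxE; congr (x 0 _); exact: val_inj.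
Qed.

Section NormalFormPolynomials.
Variables (K : closedFieldType) (charK : [pchar K] =i pred0) (n d : nat).
Local Notation V := 'rV[K]_n.+2.
Local Notation "''Y_' i" := ('X_(inord i) : {mpoly K[n.+2]}) (at level 8, i at level 2, format "''Y_' i").
Implicit Types (lam : nat -> 'cV[K]_n.+2) (A : nat -> {mpoly K[n.+2]}) (g G : {mpoly K[n.+2]}).

Definition nfpoly q k A G := \sum_(i < q) ('Y_(q + k + i) * 'Y_i ^+ 3 + 'Y_(q + k + i) ^+ 4)
  + \sum_(j < k) A j * 'Y_(q + j) ^+ d.-1 + G.

Definition tail_only p G := forall x : V, G.@[x 0] = G.@[(tailv p x) 0].

Lemma meval_co (x : V) i : ('Y_i).@[x 0] = co x i. Proof. by rewrite mevalXU. Qed.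

Lemma nfpoly_eval q k A G (x : V) : (nfpoly q k A G).@[x 0] =
  \sum_(i < q) (co x (q + k + i) * co x i ^+ 3 + co x (q + k + i) ^+ 4)
  + \sum_(j < k) (A j).@[x 0] * co x (q + j) ^+ d.-1 + G.@[x 0].
Proof.
rewrite /nfpoly !mevalD !raddf_sum /=; congr (_ + _ + _); apply: eq_bigr => i _.
  by rewrite mevalD mevalM !mevalXn !meval_co.
by rewrite mevalM mevalXn meval_co.
Qed.

Lemma nfpoly_gnf q k A G : (q + k + q <= n.+2)%N ->
  (forall j, (j < k)%N -> A j \is 1.-homog /\ tail_only (q + k + q) (A j)) ->
  G \is d.-homog -> tail_only (q + k + q) G ->
  exists2 lam, gnf d q k lam G (nfpoly q k A G) & forall j, (j < k)%N -> A j = lin (lam j).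
Proof.
move=> pN hA hG tG; have /choice [lam hlam] : forall j, exists c, (j < k)%N -> A j = lin c.
  move=> j; case: (ltnP j k) => [jk|]; last by exists 0.
  by have [c ->] := linear_lin (hA j jk).1; exists c.
exists lam => //; split=> // [j jk x|x].
  by rewrite -!lin_dot -hlam //; apply: (hA j jk).2.
rewrite nfpoly_eval; congr (_ + _ + _); apply: eq_bigr => j _.
by rewrite hlam // lin_dot.
Qed.

Lemma gnf_nfpoly q k lam g G : gnf d q k lam g G -> G = nfpoly q k (fun j => lin (lam j)) g.
Proof.
move=> [_ _ _ _ h]; apply: mpoly_ext => x; rewrite nfpoly_eval h; congr (_ + _ + _).
by apply: eq_bigr => j _; rewrite lin_dot.
Qed.

Lemma tail_only_lin q k lam g G j : gnf d q k lam g G -> (j < k)%N -> tail_only (q + k + q) (lin (lam j)).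
Proof. by move=> [_ h _ _ _] jk x; rewrite !lin_dot h. Qed.

Lemma tail_only_X p i : (p <= i)%N -> (i < n.+2)%N -> tail_only p 'Y_i.
Proof. by move=> pi iN x; rewrite !meval_co co_tailv // pi. Qed.

Lemma X_homog i : 'Y_i \is 1.-homog. Proof. by rewrite dhomogX /= mdeg1. Qed.

Lemma gnf_homog_deg q k lam g G : (q = 0%N \/ d = 4%N) -> (0 < d)%N -> gnf d q k lam g G -> G \is d.-homog.
Proof.
move=> qd d0 [_ _ hg _ GE]; apply: dhomog_ext => x t; rewrite !GE !mulrDr.
have et : t ^+ d = t * t ^+ d.-1 by rewrite -exprS prednK.
rewrite (dhomog_eval_scale _ _ hg) !mulr_sumr; congr (_ + _ + _).
  case: qd => [->|->]; first by rewrite !big_ord0.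
  by apply: eq_bigr => i _; rewrite !coE; ring.
by apply: eq_bigr => j _; rewrite !coE dotZl exprMn et; ring.
Qed.

Lemma closed_root r (c : K) : (0 < r)%N -> c != 0 -> exists2 b, b != 0 & b ^+ r = c.
Proof.
move=> r0 c0; have : size ('X^r - c%:P) != 1%N by rewrite size_XnsubC // eqSS -lt0n.
move=> /closed_rootP [b]; rewrite /root hornerD hornerN hornerXn hornerC subr_eq0 => /eqP e.
by exists b => //; apply: contra_neq c0 => b0; rewrite -e b0 expr0n gtn_eqF.
Qed.

(** With a single variable T, every lam_j is c_j T with c_j nonzero, and g is a0 T^d. A scaling of T
    by rho makes a0 equal to 0 or 1; then Z_j is scaled by a root of order d - 1 of the inverse of
    c_j rho. *)
Lemma normalize_line q k lam g G : (1 < d)%N -> n.+2 = (q + k + q).+1 -> gnf d q k lam g G ->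
  (forall j, (j < k)%N -> lam j != 0) -> exists E a, [/\ E \in unitmx, a = 0 \/ a = 1, a = 0 <-> g = 0 &
    subst E G = nfpoly q k (fun=> 'Y_(q + k + q)) (a *: 'Y_(q + k + q) ^+ d)].
Proof.
move=> d1 nE hG lam0; have [pN lT hg gT GE] := hG; set p := (q + k + q)%N in nE pN lT gT GE *.
have pp : (p < n.+2)%N by rewrite nE.
have tE (x : V) : tailv p x = co x p *: ev K n p.
  apply: co_ext => i iN; rewrite co_tailv // coZ co_ev //.
  have [->|ip] := eqVneq p i; first by rewrite leqnn mulr1.
  by rewrite mulr0 ifF //; apply/negP => pi; move: iN ip; rewrite nE ltnS => ip; rewrite eqn_leq pi ip.
pose c j := dot (ev K n p) (lam j); pose a0 := g.@[(ev K n p) 0].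
have lE j x : (j < k)%N -> dot x (lam j) = co x p * c j by move=> jk; rewrite lT // tE dotZl.
have gE (x : V) : g.@[x 0] = co x p ^+ d * a0 by rewrite gT tE (dhomog_eval_scale _ _ hg).
have c0 j : (j < k)%N -> c j != 0.
  move=> jk; apply: contra_neq (lam0 j jk) => cj; apply: dot_ext => x.
  by rewrite lE // cj mulr0 dot0r.
have d0 : (0 < d)%N by apply: ltnW.
have d10 : (0 < d.-1)%N by rewrite -subn1 subn_gt0.
pose a : K := (a0 != 0)%:R.
have [rho r0 er] : exists2 rho, rho != 0 & rho ^+ d * a0 = a.
  rewrite /a; have [->|a00] := eqVneq a0 0; first by exists 1; rewrite ?oner_eq0 ?mulr0.
  by have [r r0 e] := closed_root d0 (invr_neq0 a00); exists r; rewrite // e mulVf.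
have /choice [mu hmu] : forall j, exists b, b != 0 /\ ((j < k)%N -> b ^+ d.-1 * (c j * rho) = 1).
  move=> j; case: (ltnP j k) => [jk|_]; last by exists 1; rewrite oner_eq0.
  have h : c j * rho != 0 by rewrite mulf_neq0 ?c0.
  have [b b0 e] := closed_root d10 (invr_neq0 h); exists b; split=> // _.
  by rewrite e mulVf.
pose sc i := if i == p then rho else if (q <= i < q + k)%N then mu (i - q)%N else 1.
have [|||E uE hE] := @index_mx K n sc id.
- by move=> i; rewrite /sc; case: ifP => // _; case: ifP; rewrite ?oner_eq0 // => _; have [] := hmu (i - q)%N.
- by [].
- by [].
exists E, a; split=> //.
- by rewrite /a; case: (a0 != 0); [right|left].
- rewrite /a; split=> [|g0]; last by rewrite /a0 g0 meval0 eqxx.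
  case: eqVneq => [e _|_ /eqP]; last by rewrite oner_eq0.
  by apply: mpoly_ext => x; rewrite gE e mulr0 meval0.
have sp : sc p = rho by rewrite /sc eqxx.
apply: mpoly_ext => x; rewrite subst_eval nfpoly_eval GE; congr (_ + _ + _).
- apply: eq_bigr => i _; have iq := ltn_ord i.
  have s1 : sc i = 1.
    by rewrite /sc !ifF //; apply/negP; rewrite /p; have := iq; clear; lia.
  have s2 : sc (q + k + i)%N = 1.
    by rewrite /sc !ifF //; apply/negP; rewrite /p; have := iq; clear; lia.
  have i1 : (i < n.+2)%N by rewrite nE /p; have := iq; clear; lia.
  have i2 : (q + k + i < n.+2)%N by rewrite nE /p; have := iq; clear; lia.
  by rewrite !hE // s1 s2 !mul1r.
- apply: eq_bigr => j _; have jk := ltn_ord j.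
  have s1 : sc (q + j)%N = mu j.
    rewrite /sc ifF ?ifT ?addKn //; first by rewrite leq_addr ltn_add2l.
    by apply/negP; rewrite /p; have := jk; clear; lia.
  have i1 : (q + j < n.+2)%N by rewrite nE /p; have := jk; clear; lia.
  have [_ /(_ jk) e] := hmu j.
  rewrite lE // !hE // s1 sp meval_co exprMn.
  by rewrite -[RHS]mul1r -e; ring.
by rewrite gE hE // sp mevalZ mevalXn meval_co exprMn -er; ring.
Qed.

Definition lam_col r lam : 'M[K]_(n.+2, r) := \matrix_(i, j) lam j i 0.

Lemma dot_lam_col r lam (x : V) (j : 'I_r) : (x *m lam_col r lam) 0 j = dot x (lam j).
Proof. by rewrite /dot !mxE; apply: eq_bigr => i _; rewrite mxE. Qed.

Lemma straighten q k lam g G r : gnf d q k lam g G -> (r <= k)%N -> \rank (lam_col r lam) = r ->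
  exists E lam' g', [/\ E \in unitmx, (q + k + q + r <= n.+2)%N, gnf d q k lam' g' (subst E G) &
    forall j, (j < r)%N -> lin (lam' j) = 'Y_(q + k + q + j)].
Proof.
move=> hG rk rL; have [pN lT hg gT GE] := hG; set p := (q + k + q)%N in pN lT gT GE *.
have [|E [uE prN h1 h2 h3]] := tail_basis pN _ rL.
  by move=> x; apply/rowP => j; rewrite !dot_lam_col lT //; apply: leq_trans (ltn_ord j) rk.
have coE' (x : V) i : (i < p)%N -> co (x *m E) i = co x i.
  by move=> ip; rewrite /co h1 // inordK //; apply: leq_trans ip pN.
have hg' := gnf_subst (mu := fun=> 1) (E := E) hG; exists E, (fun j => E *m lam j), (subst E g); split=> //.
  have e : (fun j => 1 ^+ d.-1 *: (E *m lam j)) = (fun j => E *m lam j).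
    by apply/funext => j; rewrite expr1n scale1r.
  rewrite -e; apply: hg' => [x i iq|x i iq|x j jk|x]; rewrite -/p ?coE' ?mul1r //.
  - by rewrite /p -addnA ltn_addr.
  - by rewrite /p ltn_add2l.
  - by rewrite /p ltn_addr // ltn_add2l.
move=> j jr; have jN : (p + j < n.+2)%N by apply: leq_trans prN; rewrite ltn_add2l.
apply: mpoly_ext => x; rewrite lin_dot meval_co /dot mulmxA.
have := h3 x (Ordinal jr) (inord (p + j)); rewrite inordK // => /(_ erefl).
by rewrite dot_lam_col.
Qed.

(** A permutation of the variables Z brings r independent rows of [lam_mx], selected by
    [maxrankfun], to the front. *)
Lemma reorder k lam g G r : gnf d 0 k lam g G -> (r <= \rank (lam_mx k lam))%N ->
  exists E lam', [/\ E \in unitmx, gnf d 0 k lam' g (subst E G) & \rank (lam_col r lam') = r].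
Proof.
move=> hG; have [pN lT hg gT GE] := hG; rewrite !add0n addn0 in pN lT gT GE.
set Lm := lam_mx k lam => rL; pose f := maxrankfun Lm; pose w := widen_ord rL.
pose l0 := [seq val (f (w j)) | j <- enum 'I_r].
have ul0 : uniq l0.
  rewrite map_inj_uniq ?enum_uniq // => a b /val_inj /(@maxrankfun_inj _ _ _ _) e.
  by apply: val_inj; have := congr1 val (e : w a = w b).
pose l := l0 ++ [seq i <- iota 0 k | i \notin l0].
have pl : perm_eq l (iota 0 k).
  apply: uniq_perm; rewrite ?iota_uniq //.
    rewrite cat_uniq ul0 filter_uniq ?iota_uniq // andbT; apply/hasPn => i.
    by rewrite mem_filter => /andP[].
  move=> i; rewrite mem_cat mem_filter; case: (boolP (i \in l0)) => //= /mapP [j _ ->].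
  by rewrite mem_iota /= add0n ltn_ord.
have sl : size l = k by rewrite (perm_size pl) size_iota.
have ul : uniq l by rewrite (perm_uniq pl) iota_uniq.
have lk i : (i < k)%N -> (nth 0 l i < k)%N.
  by move=> ik; have := mem_nth 0%N (s := l); rewrite sl => /(_ i ik); rewrite (perm_mem pl) mem_iota.
pose sg i := if (i < k)%N then nth 0%N l i else i.
have [|||E uE hE] := @index_mx K n (fun=> 1) sg.
- by move=> _; rewrite oner_eq0.
- move=> i j iN jN; rewrite /sg; case: (ltnP i k) => ik; case: (ltnP j k) => jk //.
  + by move/eqP; rewrite nth_uniq ?sl // => /eqP.
  + by move=> e; have := lk i ik; rewrite e ltnNge jk.
  by move=> e; have := lk j jk; rewrite -e ltnNge ik.
- by move=> i iN; rewrite /sg; case: (ltnP i k) => // ik; apply: leq_trans (lk i ik) pN.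
have coE1 (x : V) i : (i < k)%N -> co (x *m E) (nth 0%N l i) = co x i.
  by move=> ik; have := hE x i (leq_trans ik pN); rewrite /sg ik mul1r.
have tE (x : V) : tailv k (x *m E) = tailv k x.
  apply: co_ext => i iN; rewrite !co_tailv //; case: ifP => // ki.
  by have := hE x i iN; rewrite /sg ltnNge ki /= mul1r.
exists E, (fun j => lam (nth 0%N l j)); split=> //.
  split; rewrite ?add0n ?addn0 //; first by move=> j jk x; apply: lT; apply: lk.
  move=> x; rewrite subst_eval GE !big_ord0 add0r [in RHS]add0r gT tE -gT; congr (_ + _).
  rewrite -(big_mkord xpredT (fun j => dot (x *m E) (lam j) * co (x *m E) (0 + j) ^+ d.-1)).
  rewrite -(big_mkord xpredT (fun j => dot x (lam (nth 0%N l j)) * co x (0 + j) ^+ d.-1)).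
  have ep (h : nat -> K) : \sum_(0 <= j < k) h j = \sum_(0 <= j < k) h (nth 0%N l j).
    rewrite -{2}sl -(big_nth 0%N xpredT h) /index_iota subn0; apply: perm_big.
    by rewrite perm_sym.
  rewrite ep !big_mkord; apply: eq_bigr => j _.
  by rewrite !add0n coE1 // lT ?lk // tE -lT ?lk.
have -> : lam_col r (fun j => lam (nth 0%N l j)) = (rowsub w (rowsub f Lm))^T.
  apply/matrixP => i j; rewrite !mxE nth_cat size_map size_enum_ord ltn_ord.
  by rewrite (nth_map j) ?size_enum_ord // nth_ord_enum.
rewrite mxrank_tr; have fM : row_free (rowsub f Lm) by apply: maxrowsub_free.
have -> : rowsub w (rowsub f Lm) = rowsub w 1%:M *m rowsub f Lm by rewrite mul_rowsub_mx mul1mx.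
rewrite mxrankMfree //; apply/eqP; rewrite eqn_leq rank_leq_row -{1}(mxrank1 K r).
have -> : 1%:M = rowsub w 1%:M *m (rowsub w 1%:M)^T :> 'M[K]_r.
  apply/matrixP => i j; rewrite !mxE (bigD1 (w i)) //= !mxE eqxx mul1r big1 ?addr0 => [|a ai].
    by rewrite eq_sym; congr (_%:R).
  by rewrite !mxE eq_sym (negbTE ai) mul0r.
exact: mxrankM_maxl.
Qed.
End NormalFormPolynomials.

(** * Bounds and equality cases *)

Section Bounds.
Variables (K : closedFieldType) (charK : [pchar K] =i pred0) (n d : nat) (F : {mpoly K[n.+2]}) (s : int).
Hypotheses (hd : (4 <= d)%N) (hF : F \is d.-homog) (irrF : irreducible_elt F).
Hypotheses (hs : has_dim (Sing F) s) (hsn : s <= n%:Z - 2) (finD : finite_set (Delta F)).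
Local Notation V := 'rV[K]_n.+2.

Lemma sing_dim_ge : -1 <= s.
Proof.
have [r [H [e _]]] := sing_lower hF hs (unitmx1 K n.+2).
by move: e; clear; lia.
Qed.

Lemma equiv_subst D H : D \in unitmx -> subst D F = H -> proj_equiv (hypersurface F) (hypersurface H).
Proof.
move=> uD e; apply/(proj_equivP (ltnW (ltnW (ltnW hd))) hF irrF); last by exists D.
by rewrite -e dhomog_subst.
Qed.

(** The converse in all equality cases: together with the upper bound, the Galois points visible in
    a normal form give equality. *)
Lemma nf_card q k A G : (q = 0%N \/ d = 4%N) -> (q + k + q <= n.+2)%N ->
  (forall j, (j < k)%N -> A j \is 1.-homog /\ tail_only (q + k + q) (A j)) ->
  G \is d.-homog -> tail_only (q + k + q) G -> (0 < q)%N \/ (exists2 j, (j < k)%N & A j != 0) ->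
  proj_equiv (hypersurface F) (hypersurface (nfpoly d q k A G)) -> (4 * q + k)%N%:Z <= card_Delta F.
Proof.
move=> qd pN hA hG tG nz; have [lam hN eA] := nfpoly_gnf pN hA hG tG.
have d0 := ltnW (ltnW (ltnW hd)).
move/(proj_equivP d0 hF irrF (gnf_homog_deg qd d0 hN)) => [D uD eD]; rewrite -eD in hN.
apply: (gnf_card charK hd hF irrF hs hsn finD uD hN qd).
case: nz => [|[j jk Aj]]; first by left.
by right; exists j => //; apply: contra_neq Aj => e; rewrite eA // e lin0.
Qed.

Lemma lam_tail q k lam (g G : {mpoly K[n.+2]}) t j : gnf d q k lam g G -> n.+2 = (q + k + q + t)%N -> (j < k)%N -> lam j != 0 -> (0 < t)%N.
Proof.
move=> [_ hl _ _ _] eN jk l0; rewrite lt0n; apply: contra_neq l0 => t0; apply: dot_ext => x.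
rewrite hl // (_ : tailv _ x = 0) ?dot0l ?dot0r //; apply: co_ext => i iN; rewrite co_tailv // co0 ifF //.
by apply/negP; move: iN; rewrite eN t0; clear; lia.
Qed.

(** All that the singular locus says about q, k and the number t of variables T: k <= s + 1 + t from
    the singular points in the space of the Z, the other inequalities from linear spaces free of
    singular points. The bounds and the numbers in the equality cases follow by integer
    arithmetic. *)
Lemma quartic_structure : d = 4%N -> card_Delta F = 0 \/ exists D q k t lam g,
  [/\ D \in unitmx, gnf 4 q k lam g (subst D F), forall j, (j < k)%N -> lam j != 0,
      card_Delta F <= (4 * q + k)%N%:Z & n.+2 = (q + k + q + t)%N] /\
  [/\ k%:Z <= s + 1 + t%:Z, (0 < k)%N -> (0 < t)%N,
      (0 < k)%N -> (k != 1%N) || (g != 0) -> s + 3 <= k%:Z + t%:Z,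
      k = 0%N -> g != 0 -> s + 2 <= t%:Z /\ (~ has_multiple_component g -> s + 3 <= t%:Z) &
      g = 0 -> (k <= 1)%N -> t = k /\ s + 1 <= k%:Z].
Proof.
move=> d4; have hF4 := hF; rewrite d4 in hF4.
case: (Delta_structure charK hd hF irrF hs hsn finD) => [->|[nv [D [q [k [lam [g [uD hG lam0 hc _]]]]]]]]; first by left.
right; rewrite d4 in hG; have [pN _ _ _ _] := hG.
have eN : n.+2 = (q + k + q + (n.+2 - (q + k + q)))%N by rewrite subnKC.
exists D, q, k, (n.+2 - (q + k + q))%N, lam, g; move: (n.+2 - _)%N eN => t eN; split; first by split.
have up r (H : 'M[K]_(n.+2, r)) := @sing_upper K n 4 F s hF4 hs D uD r H.
have low := sing_lower hF hs uD.
have fb := fibre_bound (leqnn 4) hG low; have rk := rank_lam_mx hG.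
have u0 := upper0 charK hG up; have u1 := upper1 charK hG up; have u2 := upper2 charK hG up.
have r0 : k = 0%N -> residue q k (subst D F) = g.
  by move=> k0; rewrite (residue_lin hG) k0 big_ord0 add0r.
have nvG (u : V) : vertex (subst D F) u -> u = 0.
  move=> hu; have : u *m D = 0.
    apply: nv => x c; have := hu (x *m invmx D) c; rewrite !subst_eval mulmxDl mulmxKV // -scalemxAl.
    by [].
  by move=> e; rewrite -[u](mulmxK uD) e mul0mx.
split.
- by move: fb rk eN; move: (\rank (lam_mx k lam)) => r; clear; lia.
- move=> k0; have := lam_tail; rewrite d4 => h; exact: (h _ _ _ _ _ _ 0%N hG eN k0 (lam0 _ k0)).
- move=> k0 kg; have := u2 (residue_neq0 hG lam0 k0) (residue_squarefree charK hG lam0 k0 kg).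
  by rewrite eN; clear; lia.
- move=> k0 g0; rewrite r0 // in u1 u2; split; first by have := u1 g0; rewrite eN; move: k0; clear; lia.
  by move=> sq; have := u2 g0 sq; rewrite eN; move: k0; clear; lia.
move=> g0 k1; have e := tail_dimension hG lam0 g0 k1 nvG.
have tk : t = k by move: e; rewrite eN; clear; lia.
split=> //; have [k0|k0] := posnP k; first by move: u0; rewrite eN tk k0; clear; lia.
by have := u1 (residue_neq0 hG lam0 k0); rewrite eN tk; move: k1 k0; clear; lia.
Qed.

Lemma structure_high : (5 <= d)%N -> card_Delta F = 0 \/ exists D k lam g,
  [/\ D \in unitmx, gnf d 0 k lam g (subst D F), card_Delta F <= k%:Z,
      k%:Z <= s + 1 + (\rank (lam_mx k lam))%:Z & (\rank (lam_mx k lam) + k <= n.+2)%N].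
Proof.
move=> d5; case: (Delta_structure charK hd hF irrF hs hsn finD) => [->|[nv [D [q [k [lam [g [uD hG lam0 hc q0]]]]]]]]; first by left.
right; rewrite q0 // in hG hc; exists D, k, lam, g; split=> //.
  exact: (fibre_bound hd hG (sing_lower hF hs uD)).
by have := rank_lam_mx hG; rewrite add0n addn0.
Qed.
End Bounds.

Lemma addr_shuffle (V : zmodType) (a b c e g : V) : a + b + c + e + g = a + e + (b + c) + g.
Proof. by rewrite -!addrA; congr (_ + _); rewrite [RHS]addrCA; congr (_ + _); exact: addrCA. Qed.

(** * The equations of the statement as normal forms *)

Section Targets.
Variables (K : closedFieldType) (n : nat).
Local Notation M := {mpoly K[n.+2]}.

Lemma sum_ord_range (f : nat -> M) (Fi : 'I_n.+2 -> M) (P : pred 'I_n.+2) a c : (a + c <= n.+2)%N ->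
  (forall i : 'I_n.+2, P i = (a <= i < a + c)%N) -> (forall i : 'I_n.+2, P i -> Fi i = f i) ->
  \sum_(i < n.+2 | P i) Fi i = \sum_(j < c) f (a + j)%N.
Proof. by move=> h1 h2 h3; rewrite -(sum_range f h1 h2); apply: eq_bigr. Qed.

Lemma xvarE (z : int) i : z = i%:Z -> xvar K n.+1 z = 'X_(inord i).
Proof. by rewrite /xvar => ->. Qed.

Lemma sum_blocks (u : int) q k : (q + k + q <= n.+2)%N -> u = (q + k)%N%:Z ->
  \sum_(i < n.+2 | i%:Z <= q%:Z - 1) xvar K n.+1 (u + i%:Z) * 'X_i ^+ 3 =
  \sum_(i < q) 'X_(inord (q + k + i)) * 'X_(inord i) ^+ 3.
Proof.
move=> pN eu; apply: (@sum_ord_range (fun i => 'X_(inord (q + k + i)) * 'X_(inord i) ^+ 3) _ _ 0 q).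
- by move: pN; clear; lia.
- by move=> i; apply/idP/idP; clear; lia.
by move=> i _; rewrite inord_val (@xvarE _ (q + k + i)) // eu; clear; lia.
Qed.

Lemma sum_powers (lo hi : int) a c r : (a + c <= n.+2)%N -> lo = a%:Z -> hi = (a + c)%N%:Z - 1 ->
  \sum_(i < n.+2 | lo <= i%:Z <= hi) 'X_i ^+ r = \sum_(i < c) 'X_(inord (a + i)) ^+ r :> M.
Proof.
move=> acN -> ->; apply: (@sum_ord_range (fun i => 'X_(inord i) ^+ r) _ _ a c) => //.
- by move=> i; apply/idP/idP; clear; lia.
by move=> i _; rewrite inord_val.
Qed.

Lemma sum_coefs (A : 'I_n.+2 -> M) (lo hi : int) a c r : (a + c <= n.+2)%N -> lo = a%:Z -> hi = (a + c)%N%:Z - 1 ->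
  \sum_(i < n.+2 | lo <= i%:Z <= hi) A i * 'X_i ^+ r =
  \sum_(i < c) A (inord (a + i)) * 'X_(inord (a + i)) ^+ r :> M.
Proof.
move=> acN -> ->; apply: (@sum_ord_range (fun i => A (inord i) * 'X_(inord i) ^+ r) _ _ a c) => //.
- by move=> i; apply/idP/idP; clear; lia.
by move=> i _; rewrite inord_val.
Qed.

Lemma nfpoly_split d q k A (G : M) : nfpoly d q k A G =
  \sum_(i < q) 'X_(inord (q + k + i)) * 'X_(inord i) ^+ 3 + \sum_(i < q) 'X_(inord (q + k + i)) ^+ 4
  + \sum_(j < k) A j * 'X_(inord (q + j)) ^+ d.-1 + G.
Proof. by rewrite /nfpoly big_split. Qed.

Lemma target_I0 (m : int) q t : m + 1 = q%:Z -> n.+2 = (q + 0 + q + t)%N ->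
  (\sum_(i < n.+2 | i%:Z <= m) xvar K n.+1 (m + 1 + i%:Z) * 'X_i ^+ 3
         + \sum_(i < n.+2 | m + 1 <= i%:Z) 'X_i ^+ 4)
  = nfpoly 4 q 0 (fun=> 0) (\sum_(i < t) 'X_(inord (q + 0 + q + i)) ^+ 4).
Proof.
move=> mq eN; have -> : m = q%:Z - 1 by move: mq; clear; lia.
rewrite subrK [X in X + _ = _](@sum_blocks _ q 0) ?addn0 //; last by rewrite eN; clear; lia.
rewrite [X in _ + X = _](eq_bigl (fun i : 'I_n.+2 => q%:Z <= i%:Z <= n.+1%:Z)); last first.
  by move=> i; have := ltn_ord i; clear; move=> h; apply/idP/idP; move: h; clear; lia.
rewrite [X in _ + X = _](@sum_powers _ _ q (q + t)) //; [|by rewrite eN; clear; lia|by move: eN; clear; lia].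
rewrite nfpoly_split big_ord0 addr0 big_split_ord /= addrA; congr (_ + _ + _).
- by apply: eq_bigr => i _; rewrite addn0.
- by apply: eq_bigr => i _; rewrite addn0.
by apply: eq_bigr => i _; rewrite addnA.
Qed.

Lemma target_I1 (m s : int) (a : K) q k : m - s - 1 = q%:Z -> s + 2 = k%:Z -> n.+2 = (q + k + q).+1 ->
  (\sum_(i < n.+2 | i%:Z <= m - s - 2) xvar K n.+1 (m + 1 + i%:Z) * 'X_i ^+ 3
   + xvar K n.+1 (2 * m - s) * \sum_(i < n.+2 | m - s - 1 <= i%:Z <= m) 'X_i ^+ 3
   + \sum_(i < n.+2 | m + 1 <= i%:Z <= 2 * m - s - 1) 'X_i ^+ 4
   + a *: xvar K n.+1 (2 * m - s) ^+ 4)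
  = nfpoly 4 q k (fun=> 'X_(inord (q + k + q))) (a *: 'X_(inord (q + k + q)) ^+ 4).
Proof.
move=> mq sk eN; have -> : m - s - 2 = q%:Z - 1 by move: mq; clear; lia.
rewrite [X in X + _ + _ + _ = _](@sum_blocks _ q k); [|by rewrite eN; clear; lia|by move: mq sk; clear; lia].
rewrite [X in _ + _ * X + _ + _ = _](@sum_powers _ _ q k); [|by rewrite eN; clear; lia|by []|by move: mq sk; clear; lia].
rewrite [X in _ + _ + X + _ = _](@sum_powers _ _ (q + k) q); [|by rewrite eN; clear; lia|by move: mq sk; clear; lia|by move: mq sk; clear; lia].
rewrite (@xvarE _ (q + k + q)); last by move: mq sk; clear; lia.
by rewrite nfpoly_split -mulr_sumr; congr (_ + _); exact: addrAC.
Qed.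

Lemma target_I2 (m : int) q : m = q%:Z -> n.+2 = (q + 1 + q).+1 ->
  (\sum_(i < n.+2 | i%:Z <= m) xvar K n.+1 (m + 1 + i%:Z) * 'X_i ^+ 3
         + \sum_(i < n.+2 | m + 1 <= i%:Z <= 2 * m) 'X_i ^+ 4)
  = nfpoly 4 q 1 (fun=> 'X_(inord (q + 1 + q))) 0.
Proof.
move=> -> eN.
(* The range i <= m has one term more than there are blocks: the term i = m is the only T times the
   cube of the only Z. *)
rewrite [X in X + _ = _](_ : _ = \sum_(i < q.+1) 'X_(inord (q + 1 + i)) * 'X_(inord i) ^+ 3); last first.
  apply: (@sum_ord_range (fun i => 'X_(inord (q + 1 + i)) * 'X_(inord i) ^+ 3) _ _ 0 q.+1).
  - by rewrite eN; clear; lia.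
  - by move=> i; apply/idP/idP; clear; lia.
  by move=> i _; rewrite inord_val (@xvarE _ (q + 1 + i)) //; clear; lia.
rewrite [X in _ + X = _](@sum_powers _ _ (q + 1) q); [|by rewrite eN; clear; lia|by clear; lia|by clear; lia].
by rewrite nfpoly_split [X in X + _ = _]big_ord_recr big_ord1 /= addn0 addr0; exact: addrAC.
Qed.

Lemma target_I3 (u v w : int) q (G : M) : u = q%:Z -> v = q%:Z - 1 -> w = (q + q)%N%:Z - 1 -> (q + q <= n.+2)%N ->
  (\sum_(i < n.+2 | i%:Z <= v) xvar K n.+1 (u + i%:Z) * 'X_i ^+ 3
   + \sum_(i < n.+2 | u <= i%:Z <= w) 'X_i ^+ 4 + G) = nfpoly 4 q 0 (fun=> 0) G.
Proof.
move=> -> -> -> qN; rewrite [X in X + _ + _ = _](@sum_blocks _ q 0) ?addn0 // [X in _ + X + _ = _](@sum_powers _ _ q q) //.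
by rewrite nfpoly_split big_ord0 addr0 addn0.
Qed.

Lemma target_I4 (m s : int) (A : 'I_n.+2 -> M) (G : M) q k : m - s - 1 = q%:Z -> s + 2 = k%:Z -> (0 < k)%N ->
  (q + k + q <= n.+2)%N ->
  (\sum_(i < n.+2 | i%:Z <= m - s - 2) xvar K n.+1 (m + 1 + i%:Z) * 'X_i ^+ 3
   + xvar K n.+1 (2 * m - s) * xvar K n.+1 (m - s - 1) ^+ 3
   + \sum_(i < n.+2 | m - s <= i%:Z <= m) A i * 'X_i ^+ 3
   + \sum_(i < n.+2 | m + 1 <= i%:Z <= 2 * m - s - 1) 'X_i ^+ 4
   + G)
  = nfpoly 4 q k (fun j => if j is j'.+1 then A (inord (q + j)) else 'X_(inord (q + k + q))) G.
Proof.
move=> mq sk k0 pN; have -> : m - s - 2 = q%:Z - 1 by move: mq; clear; lia.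
rewrite [X in X + _ + _ + _ + _ = _](@sum_blocks _ q k) //; last by move: mq sk; clear; lia.
rewrite [X in _ + _ + _ + X + _ = _](@sum_powers _ _ (q + k) q) //; [|by move: mq sk; clear; lia|by move: mq sk; clear; lia].
rewrite (@xvarE _ (q + k + q)); last by move: mq sk; clear; lia.
rewrite (@xvarE _ q) //; case: k k0 sk pN => // k _ sk pN.
rewrite [X in _ + _ + X + _ + _ = _](@sum_coefs _ _ _ q.+1 k); [|by move: pN; clear; lia|by move: mq sk; clear; lia|by move: mq sk; clear; lia].
rewrite nfpoly_split [X in _ = _ + X + _]big_ord_recl /= addn0 addr_shuffle; congr (_ + (_ + _) + _).
by apply: eq_bigr => i _; rewrite /bump /= add1n addnS.
Qed.

Lemma target_II d (m s : int) (A : 'I_n.+2 -> M) (G : M) r k : m - s = r%:Z -> m + 1 = k%:Z -> (r <= k)%N ->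
  (k <= n.+2)%N ->
  (\sum_(i < n.+2 | i%:Z <= m - s - 1) xvar K n.+1 (m + 1 + i%:Z) * 'X_i ^+ (d - 1)
   + \sum_(i < n.+2 | m - s <= i%:Z <= m) A i * 'X_i ^+ (d - 1) + G)
  = nfpoly d 0 k (fun j => if (j < r)%N then 'X_(inord (k + j)) else A (inord j)) G.
Proof.
move=> mr mk rk kN; rewrite subn1 nfpoly_split !big_ord0 !add0r; congr (_ + _).
rewrite [X in X + _ = _](_ : _ = \sum_(i < r) 'X_(inord (k + i)) * 'X_(inord i) ^+ d.-1); last first.
  apply: (@sum_ord_range (fun i => 'X_(inord (k + i)) * 'X_(inord i) ^+ d.-1) _ _ 0 r).
  - exact: leq_trans rk kN.
  - by move=> i; apply/idP/idP; move: mr; clear; lia.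
  by move=> i _; rewrite inord_val (@xvarE _ (k + i)) //; move: mk; clear; lia.
rewrite [X in _ + X = _](@sum_coefs _ _ _ r (k - r)) ?subnKC //; last by move: mk; clear; lia.
set f := fun j => (if (j < r)%N then 'X_(inord (k + j)) else A (inord j)) * 'X_(inord j) ^+ d.-1 : M.
have -> : \sum_(j < k) (if (j < r)%N then 'X_(inord (k + j)) else A (inord j)) * 'X_(inord (0 + j)) ^+ d.-1 = \sum_(j < k) f j.
  by [].
have e : \sum_(j < r + (k - r)) f j = \sum_(j < k) f j by rewrite subnKC.
rewrite -e big_split_ord /=; congr (_ + _); apply: eq_bigr => i _; rewrite /f.
  by rewrite ltn_ord.
by rewrite ltnNge leq_addr.
Qed.
End Targets.

Lemma int_nat (z : int) : 0 <= z -> exists q : nat, z = q%:Z.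
Proof. by move=> z0; exists (absz z); rewrite gez0_abs. Qed.

Lemma X_neq0 (K : closedFieldType) n i : ('X_(inord i) : {mpoly K[n.+2]}) != 0.
Proof.
apply/eqP => /(congr1 (fun q => q.@[(const_mx 1 : 'rV[K]_n.+2) 0])); rewrite mevalXU mxE meval0 => /eqP.
by rewrite oner_eq0.
Qed.

Lemma nfpoly_ext (K : closedFieldType) n d q k (A B : nat -> {mpoly K[n.+2]}) G :
  (forall j, (j < k)%N -> A j = B j) -> nfpoly d q k A G = nfpoly d q k B G.
Proof. by move=> h; rewrite /nfpoly; congr (_ + _ + _); apply: eq_bigr => j _; rewrite h. Qed.

Lemma in_vars_tail_only (K : closedFieldType) n (J : pred int) p (G : {mpoly K[n.+2]}) : @in_vars K n.+1 J G ->
  (forall j : 'I_n.+2, J j%:Z -> (p <= j)%N) -> tail_only p G.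
Proof. by move=> h hJ x; apply: (in_vars_eval h) => j /hJ pj; rewrite mxE pj. Qed.

Section Quartics.
Variables (K : closedFieldType) (charK : [pchar K] =i pred0) (n : nat) (F : {mpoly K[n.+2]}) (s m : int).
Hypotheses (hF : F \is 4.-homog) (irrF : irreducible_elt F).
Hypotheses (hs : has_dim (Sing F) s) (hsn : s <= n%:Z - 2) (finD : finite_set (Delta F)).
Hypothesis hm : m = ((n%:Z + s + 1) %/ 2)%Z.
Local Notation V := 'rV[K]_n.+2.
Local Notation M := {mpoly K[n.+2]}.

Let structure := quartic_structure charK (leqnn 4) hF irrF hs hsn finD erefl.
Let s_ge := sing_dim_ge hF hs.
Let count_ge := @nf_card K charK n 4 F s (leqnn 4) hF irrF hs hsn finD.
Let to_equiv := @equiv_subst K n 4 F (leqnn 4) hF irrF.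

Lemma gnf_no_tail q (lam : nat -> 'cV[K]_n.+2) (g G : M) : gnf 4 q 0 lam g G -> n.+2 = (q + 0 + q)%N -> g = 0.
Proof.
move=> [_ _ hg gT _] eN; apply: mpoly_ext => x; rewrite gT meval0 (_ : tailv _ x = 0) ?(dhomog_eval0 hg) //.
apply: co_ext => i iN; rewrite co_tailv // co0 ifF //.
by apply/negP; move: iN; rewrite eN; clear; lia.
Qed.

(** k <= t and n + 2 = 2 q + k + t bound q + k by m + 1, and equality leaves k = 0 and t <= 1. If t
    = 1, g is not zero, since g = 0 would give t = k; so g can be scaled to the fourth power of
    T. *)
Lemma quartic_smooth : s = -1 -> card_Delta F <= 4 * (m + 1) /\
     (card_Delta F = 4 * (m + 1) <->
      proj_equiv (hypersurface F) (hypersurface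
        (\sum_(i < n.+2 | i%:Z <= m) xvar K n.+1 (m + 1 + i%:Z) * 'X_i ^+ 3
         + \sum_(i < n.+2 | m + 1 <= i%:Z) 'X_i ^+ 4))).
Proof.
move=> s1; have mn : n%:Z = 2 * m \/ n%:Z = 2 * m + 1 by move: hm; rewrite s1; clear; lia.
have bound : card_Delta F <= 4 * (m + 1).
  case: structure => [->|[D [q [k [t [lam [g [[_ _ _ hc eN] [kt _ _ _ _]]]]]]]]]; first by move: mn; clear; lia.
  by move: mn hc eN kt; rewrite s1; move: (card_Delta F) => c; clear; lia.
split=> //; have [|q eq] := @int_nat (m + 1); first by move: mn; clear; lia.
have [t eN t1] : exists2 t, n.+2 = (q + 0 + q + t)%N & (t <= 1)%N.
  by exists (n.+2 - (q + 0 + q))%N; move: mn eq; clear; lia.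
rewrite (target_I0 _ eq eN); split=> [ec|h]; last first.
  apply/eqP; rewrite eq_le bound /= eq; apply: le_trans (count_ge (or_intror erefl) _ _ _ _ _ h) => //.
  - by move: eN; clear; lia.
  - by rewrite eN; clear; lia.
  - by apply: rpred_sum => i _; apply: dhomog_ext => x c; rewrite !mevalXn !meval_co coZ exprMn.
  - move=> x; rewrite !raddf_sum; apply: eq_bigr => i _ /=; rewrite !mevalXn !meval_co co_tailv //.
      by rewrite leq_addr.
    by rewrite eN; have := ltn_ord i; clear; lia.
  by left; move: mn eq; clear; lia.
case: structure => [e0|[D [q' [k [t' [lam [g [[uD hG lam0 hc eN'] [kt _ _ _ g0]]]]]]]]].
  by move: ec mn; rewrite e0; clear; lia.
have [eqq ek et] : [/\ q' = q, k = 0%N & t' = t].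
  by move: ec hc eN' kt mn eq eN t1; rewrite s1; move: (card_Delta F) => c; clear; move=> *; split; lia.
rewrite eqq ek et in hG lam0 hc eN' kt g0 *; case: t t1 eN {et eN' kt} g0 => [|[|//]] _ eN g0.
  apply: (to_equiv uD); rewrite (gnf_nfpoly hG) (gnf_no_tail hG) /nfpoly ?big_ord0 ?addr0 //.
  by rewrite eN addn0.
have eN1 : n.+2 = (q + 0 + q).+1 by rewrite eN addn1.
have [E [a [uE a01 ag eE]]] := normalize_line (isT : (1 < 4)%N) eN1 hG lam0.
have uED : E *m D \in unitmx by rewrite unitmx_mul uE.
apply: (to_equiv uED); rewrite -subst_comp eE.
have -> : a = 1 by case: a01 => // /ag /g0 /(_ isT) [].
by rewrite scale1r big_ord1 /nfpoly !big_ord0 !addn0.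
Qed.

(** Either k > 0 and R is squarefree, or k = 0 and g is not zero, or g = 0 and k <= 1; the
    arithmetic of the quartic cases is done in these three branches. *)
Let structure_cases : card_Delta F = 0 \/ exists D q k t lam g,
  [/\ D \in unitmx, gnf 4 q k lam g (subst D F), forall j, (j < k)%N -> lam j != 0,
      card_Delta F <= (4 * q + k)%N%:Z & n.+2 = (q + k + q + t)%N] /\
  [/\ k%:Z <= s + 1 + t%:Z, s >= -1 &
   [\/ [/\ (0 < k)%N, (0 < t)%N & s + 3 <= k%:Z + t%:Z],
       [/\ k = 0%N, s + 2 <= t%:Z & ~ has_multiple_component g -> s + 3 <= t%:Z] |
       [/\ g = 0, (k <= 1)%N, t = k & s + 1 <= k%:Z]]].
Proof.
case: structure => [->|[D [q [k [t [lam [g [h [h1 h2 h3 h4 h5]]]]]]]]]; first by left.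
right; exists D, q, k, t, lam, g; split=> //; split=> //; have [k0|k0] := posnP k.
  have [g0|g0] := eqVneq g 0; last by have [h6 h7] := h4 k0 g0; apply: Or32; split.
  by have k1 : (k <= 1)%N; [rewrite k0|have [h6 h7] := h5 g0 k1; apply: Or33; split].
have [kg|] := boolP ((k != 1%N) || (g != 0)); first by apply: Or31; split; [|exact: h2|exact: h3].
rewrite negb_or !negbK => /andP [/eqP k1 /eqP g0].
by have k1' : (k <= 1)%N; [rewrite k1|have [h6 h7] := h5 g0 k1'; apply: Or33; split].
Qed.

(** Equality leaves q = m - s - 1, k = s + 2 and a single variable T, so [normalize_line] applies; a
    = 0 exactly when g = 0. *)
Lemma quartic_odd : 0 <= s -> ~~ (2 %| n%:Z + s)%Z -> card_Delta F <= 4 * (m - s - 1) + (s + 2) /\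
     (card_Delta F = 4 * (m - s - 1) + (s + 2) <->
      exists a : K, (a = 0 \/ a = 1) /\
      proj_equiv (hypersurface F) (hypersurface
        (\sum_(i < n.+2 | i%:Z <= m - s - 2)
            xvar K n.+1 (m + 1 + i%:Z) * 'X_i ^+ 3
         + xvar K n.+1 (2 * m - s) *
             \sum_(i < n.+2 | m - s - 1 <= i%:Z <= m) 'X_i ^+ 3
         + \sum_(i < n.+2 | m + 1 <= i%:Z <= 2 * m - s - 1) 'X_i ^+ 4
         + a *: xvar K n.+1 (2 * m - s) ^+ 4))).
Proof.
move=> s0 par; have mn : 2 * m = n%:Z + s + 1 by move: hm par; clear; lia.
have bound : card_Delta F <= 4 * (m - s - 1) + (s + 2).
  case: structure_cases => [->|[D [q [k [t [lam [g [[_ _ _ hc eN] [kt _ cs]]]]]]]]].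
    by move: mn hsn s0; clear; lia.
  move: mn hc eN kt s0 hsn; move: (card_Delta F) => c.
  by case: cs => [[h1 h2 h3]|[h1 h2 _]|[_ h1 h2 h3]]; move: h1 h2; try move: h3; clear; lia.
split=> //; have [|q eq] := @int_nat (m - s - 1); first by move: mn hsn; clear; lia.
have [|k ek] := @int_nat (s + 2); first by move: s0; clear; lia.
have k0 : (0 < k)%N by move: ek s0; clear; lia.
have eN : n.+2 = (q + k + q).+1 by move: mn eq ek; clear; lia.
split=> [ec|[a [a01]]]; last first.
  rewrite (target_I1 a eq ek eN) => h.
  apply/eqP; rewrite eq_le bound /= eq ek; apply: le_trans (count_ge (or_intror erefl) _ _ _ _ _ h) => //.
  - by rewrite eN.
  - by move=> j _; split; [apply: X_homog|apply: tail_only_X; rewrite ?eN].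
  - by apply: rpredZ; apply: dhomog_ext => x c; rewrite !mevalXn !meval_co coZ exprMn.
  - by move=> x; rewrite !mevalZ !mevalXn !meval_co co_tailv ?eN // leqnn.
  by right; exists 0%N => //; apply: X_neq0.
case: structure_cases => [e0|[D [q' [k' [t' [lam [g [[uD hG lam0 hc eN'] [kt _ cs]]]]]]]]].
  by move: ec mn; rewrite e0; move: s0 hsn; clear; lia.
have [eqq ekk] : q' = q /\ k' = k.
  move: ec hc eN' kt mn eq ek eN s0 hsn; move: (card_Delta F) => c; clear - cs.
  by case: cs => [[h1 h2 h3]|[h1 h2 _]|[_ h1 h2 h3]]; move: h1 h2; try move: h3; clear; move=> *; split; lia.
rewrite eqq ekk in hG lam0.
have [E [a [uE a01 ag eE]]] := normalize_line (isT : (1 < 4)%N) eN hG lam0.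
exists a; split=> //; have uED : E *m D \in unitmx by rewrite unitmx_mul uE.
by apply: (to_equiv uED); rewrite -subst_comp eE (target_I1 a eq ek eN).
Qed.

(** Equality leaves q = m and k = t = 1. A nonzero g would give s + 3 <= k + t = 2, so g = 0. *)
Lemma quartic_isolated : s = 0 -> ~~ odd n -> card_Delta F <= 4 * m + 1 /\
     (card_Delta F = 4 * m + 1 <->
      proj_equiv (hypersurface F) (hypersurface
        (\sum_(i < n.+2 | i%:Z <= m) xvar K n.+1 (m + 1 + i%:Z) * 'X_i ^+ 3
         + \sum_(i < n.+2 | m + 1 <= i%:Z <= 2 * m) 'X_i ^+ 4))).
Proof.
move=> s0 par; have mn : 2 * m = n%:Z by move: hm par; rewrite s0; clear; lia.
have bound : card_Delta F <= 4 * m + 1.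
  case: structure_cases => [->|[D [q [k [t [lam [g [[_ _ _ hc eN] [kt _ cs]]]]]]]]].
    by move: mn; clear; lia.
  move: mn hc eN kt s0; move: (card_Delta F) => c.
  by case: cs => [[h1 h2 h3]|[h1 h2 _]|[_ h1 h2 h3]]; move: h1 h2; try move: h3; clear; lia.
split=> //; have [|q eq] := @int_nat m; first by move: mn; clear; lia.
have eN : n.+2 = (q + 1 + q).+1 by move: mn eq; clear; lia.
rewrite (@target_I2 K n _ _ eq eN); split=> [ec|h]; last first.
  apply/eqP; rewrite eq_le bound /= eq; apply: le_trans (count_ge (or_intror erefl) _ _ _ _ _ h) => //.
  - by rewrite eN.
  - by move=> j _; split; [apply: X_homog|apply: tail_only_X; rewrite ?eN].
  - exact: rpred0.
  - by move=> x; rewrite !meval0.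
  by right; exists 0%N => //; apply: X_neq0.
case: structure_cases => [e0|[D [q' [k' [t' [lam [g [[uD hG lam0 hc eN'] [kt _ cs]]]]]]]]].
  by move: ec mn; rewrite e0; clear; lia.
have [eqq ekk g0] : [/\ q' = q, k' = 1%N & g = 0].
  move: ec hc eN' kt mn eq eN s0; move: (card_Delta F) => c.
  by case: cs => [[h1 h2 h3]|[h1 h2 _]|[g0 h1 h2 h3]]; move: h1 h2; try move: h3; move=> *; split=> //; lia.
rewrite eqq ekk in hG lam0.
have [E [a [uE a01 ag eE]]] := normalize_line (isT : (1 < 4)%N) eN hG lam0.
have uED : E *m D \in unitmx by rewrite unitmx_mul uE.
by apply: (to_equiv uED); rewrite -subst_comp eE ag.2 // scale0r.
Qed.

(** Equality leaves q = m - 1, k = 0 and t = 3. As s + 3 = 4 exceeds t, g cannot be squarefree. *)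
Lemma quartic_curve : s = 1 -> (2 %| n%:Z + s)%Z -> card_Delta F <= 4 * (m - 1) /\
     (card_Delta F = 4 * (m - 1) <->
      exists G : {mpoly K[n.+2]},
        [/\ G \is 4.-homog,
            in_vars (fun j => [|| j == 2 * m - 2, j == 2 * m - 1
                                | j == n%:Z + 1]) G,
            has_multiple_component G &
            proj_equiv (hypersurface F) (hypersurface
              (\sum_(i < n.+2 | i%:Z <= m - 2)
                  xvar K n.+1 (m - 1 + i%:Z) * 'X_i ^+ 3
               + \sum_(i < n.+2 | m - 1 <= i%:Z <= 2 * m - 3) 'X_i ^+ 4
               + G))]).
Proof.
move=> s1 par; have mn : 2 * m = n%:Z + 1 by move: hm par; rewrite s1; clear; lia.
have bound : card_Delta F <= 4 * (m - 1).
  case: structure_cases => [->|[D [q [k [t [lam [g [[_ _ _ hc eN] [kt _ cs]]]]]]]]].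
    by move: mn hsn; clear; lia.
  move: mn hc eN kt s1; move: (card_Delta F) => c.
  by case: cs => [[h1 h2 h3]|[h1 h2 _]|[_ h1 h2 h3]]; move: h1 h2; try move: h3; clear; lia.
split=> //; have [|q eq] := @int_nat (m - 1); first by move: mn; clear; lia.
have eN : n.+2 = (q + q + 3)%N by move: mn eq; clear; lia.
have target G := @target_I3 K n (m - 1) (m - 2) (2 * m - 3) q G eq.
split=> [ec|[G [hG JG _]]]; last first.
  rewrite target; [|by move: eq; clear; lia|by move: eq; clear; lia|by rewrite eN leq_addr] => h.
  apply/eqP; rewrite eq_le bound /= eq; apply: le_trans (count_ge (or_intror erefl) _ _ _ _ _ h) => //.
  - by rewrite addn0.
  - by rewrite eN; clear; lia.
  - by apply: (in_vars_tail_only JG) => j; move: mn eq; clear; lia.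
  by left; move: mn eq hsn s1; clear; lia.
case: structure_cases => [e0|[D [q' [k' [t' [lam [g [[uD hG lam0 hc eN'] [kt _ cs]]]]]]]]].
  by move: ec mn; rewrite e0; move: hsn s1; clear; lia.
have [eqq ekk sq] : [/\ q' = q, k' = 0%N & has_multiple_component g].
  move: ec hc eN' kt mn eq eN s1; move: (card_Delta F) => c.
  case: cs => [[h1 h2 h3]|[h1 h2 h3]|[g0 h1 h2 h3]].
  - by move: h1 h2 h3; move=> *; exfalso; lia.
  - move=> e1 e2 e3 e4 e5 e6 e7 e8; split; [by lia|by []|apply: contrapT => /h3; lia].
  by move: h1 h2 h3; move=> *; exfalso; lia.
rewrite eqq ekk in hG lam0; have [_ _ hg tg _] := hG.
exists g; split=> //.
  by apply: (in_vars_tail charK tg) => j; have := ltn_ord j; move: mn eq eN; clear; lia.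
rewrite target; [|by move: eq; clear; lia|by move: eq; clear; lia|by rewrite eN leq_addr].
by apply: (to_equiv uD); rewrite (gnf_nfpoly hG); apply: nfpoly_ext.
Qed.

(** The bound is reached for q = m - s - 1, k = s + 2, t = 2, where lam_0 is taken as a variable;
    and, when s = 2, also for q = m - s, k = 0, t = 4, where s + 3 > t forces a multiple component
    of g. *)
Lemma quartic_even : 2 <= s -> (2 %| n%:Z + s)%Z -> card_Delta F <= 4 * (m - s - 1) + (s + 2) /\
     (card_Delta F = 4 * (m - s - 1) + (s + 2) <->
      (s = 2 /\
       exists G1 : {mpoly K[n.+2]},
         [/\ G1 \is 4.-homog,
             in_vars (fun j => 2 * m - 2 * s <= j) G1,
             has_multiple_component G1 &
             proj_equiv (hypersurface F) (hypersurface
               (\sum_(i < n.+2 | i%:Z <= m - s - 1)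
                   xvar K n.+1 (m - s + i%:Z) * 'X_i ^+ 3
                + \sum_(i < n.+2 | m - s <= i%:Z <= 2 * m - 2 * s - 1) 'X_i ^+ 4
                + G1))])
      \/
      (exists (A : 'I_n.+2 -> {mpoly K[n.+2]}) (G2 : {mpoly K[n.+2]}),
         [/\ forall i : 'I_n.+2, m - s <= i%:Z <= m ->
               A i \is 1.-homog /\
               in_vars (fun j => (j == 2 * m - s) || (j == n%:Z + 1)) (A i),
             G2 \is 4.-homog,
             in_vars (fun j => (j == 2 * m - s) || (j == n%:Z + 1)) G2 &
             proj_equiv (hypersurface F) (hypersurface
               (\sum_(i < n.+2 | i%:Z <= m - s - 2)
                   xvar K n.+1 (m + 1 + i%:Z) * 'X_i ^+ 3
                + xvar K n.+1 (2 * m - s) * xvar K n.+1 (m - s - 1) ^+ 3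
                + \sum_(i < n.+2 | m - s <= i%:Z <= m) A i * 'X_i ^+ 3
                + \sum_(i < n.+2 | m + 1 <= i%:Z <= 2 * m - s - 1) 'X_i ^+ 4
                + G2))])).
Proof.
move=> s2 par; have mn : 2 * m = n%:Z + s by move: hm par; clear; lia.
have bound : card_Delta F <= 4 * (m - s - 1) + (s + 2).
  case: structure_cases => [->|[D [q [k [t [lam [g [[_ _ _ hc eN] [kt _ cs]]]]]]]]].
    by move: mn hsn s2; clear; lia.
  move: mn hc eN kt s2 hsn; move: (card_Delta F) => c.
  by case: cs => [[h1 h2 h3]|[h1 h2 _]|[_ h1 h2 h3]]; move: h1 h2; try move: h3; clear; lia.
split=> //; have [|q eq] := @int_nat (m - s - 1); first by move: mn hsn; clear; lia.
have [|k ek] := @int_nat (s + 2); first by move: s2; clear; lia.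
have k0 : (0 < k)%N by move: ek s2; clear; lia.
have eN : n.+2 = (q + k + q + 2)%N by move: mn eq ek; clear; lia.
have pN : (q + k + q <= n.+2)%N by rewrite eN leq_addr.
have target1 G := @target_I3 K n (m - s) (m - s - 1) (2 * m - 2 * s - 1) q.+1 G.
have tail2 (G : M) : @in_vars K n.+1 (fun j => (j == 2 * m - s) || (j == n%:Z + 1)) G -> tail_only (q + k + q) G.
  by move=> JG; apply: (in_vars_tail_only JG) => j; move: mn eq ek; clear; lia.
have q1N : s = 2 -> (q.+1 + q.+1 <= n.+2)%N by move: eN ek; clear; lia.
split=> [ec|[[e2 [G [hG JG _]]]|[A [G [hA hG JG]]]]]; last 2 first.
- rewrite target1; [|by move: eq; clear; lia|by move: eq; clear; lia|by move: eq e2; clear; lia|exact: q1N] => h.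
  apply/eqP; rewrite eq_le bound /=; apply: le_trans (count_ge (or_intror erefl) _ _ _ _ _ h) => //.
  + by move: eq ek e2; clear; lia.
  + by rewrite addn0 q1N.
  + by apply: (in_vars_tail_only JG) => j; move: mn eq e2; clear; lia.
  by left.
- rewrite (target_I4 _ _ eq ek k0 pN) => h.
  apply/eqP; rewrite eq_le bound /= eq ek; apply: le_trans (count_ge (or_intror erefl) _ _ _ _ _ h) => //.
  + move=> [|j] jk; first by split; [apply: X_homog|apply: tail_only_X; rewrite ?eN; clear; lia].
    have jN : (q + j.+1 < n.+2)%N by rewrite eN; move: jk; clear; lia.
    have [|h1 /tail2 h2] := hA (inord (q + j.+1)); last by [].
    by rewrite inordK //; move: eq ek jk; clear; lia.
  + exact: tail2.
  by right; exists 0%N => //; apply: X_neq0.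
case: structure_cases => [e0|[D [q' [k' [t' [lam [g [[uD hG lam0 hc eN'] [kt _ cs]]]]]]]]].
  by move: ec mn; rewrite e0; move: hsn s2; clear; lia.
have [[e2 eqq ekk sq]|[eqq ekk]] : [/\ s = 2, q' = q.+1, k' = 0%N & has_multiple_component g] \/ q' = q /\ k' = k.
  move: ec hc eN' kt mn eq ek eN s2; move: (card_Delta F) => c.
  case: cs => [[h1 h2 h3]|[h1 h2 h3]|[g0 h1 h2 h3]] e1 e4 e5 e6 e7 e8 e9 e10 e11.
  - by right; split; move: h1 h2 h3 e1 e4 e5 e6 e7 e8 e9 e10 e11; clear; lia.
  - left; split=> //; [by move: h1 h2 e1 e4 e5 e6 e7 e8 e9 e10 e11; clear; lia
      |by move: h1 h2 e1 e4 e5 e6 e7 e8 e9 e10 e11; clear; lia|].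
    by apply: contrapT => /h3; move: h1 h2 e1 e4 e5 e6 e7 e8 e9 e10 e11; clear; lia.
  by exfalso; move: h1 h2 h3 e1 e4 e5 e6 e7 e8 e9 e10 e11; clear; lia.
- left; split=> //; rewrite eqq ekk in hG lam0; have [_ _ hg tg _] := hG.
  exists g; split=> //.
    by apply: (in_vars_tail charK tg) => j; have := ltn_ord j; move: mn eq e2; clear; lia.
  rewrite target1; [|by move: eq; clear; lia|by move: eq; clear; lia|by move: eq e2; clear; lia|exact: q1N].
  by apply: (to_equiv uD); rewrite (gnf_nfpoly hG); apply: nfpoly_ext.
right; rewrite eqq ekk in hG lam0.
have rL : \rank (lam_col 1 lam) = 1%N.
  apply/eqP; rewrite eqn_leq rank_leq_col lt0n mxrank_eq0; apply: contra_neq (lam0 0%N k0) => e.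
  by apply/colP => i; have := congr1 (fun A : 'M_(_, 1) => A i 0) e; rewrite !mxE.
have [E [lam' [g' [uE prN hG' h1]]]] := straighten hG k0 rL.
have uED : E *m D \in unitmx by rewrite unitmx_mul uE.
have [_ _ hg' tg' _] := hG'.
exists (fun i => lin (lam' (i - q)%N)), g'; split=> //.
- move=> i hi; split; first exact: lin_homog.
  apply: (in_vars_tail charK (p := (q + k + q)%N)).
    by apply: (tail_only_lin hG'); move: hi eq ek; clear; lia.
  by move=> j; have := ltn_ord j; move: mn eq ek eN; clear; lia.
- by apply: (in_vars_tail charK tg') => j; have := ltn_ord j; move: mn eq ek eN; clear; lia.
rewrite (target_I4 _ _ eq ek k0 pN); apply: (to_equiv uED).
rewrite -subst_comp (gnf_nfpoly hG'); apply: nfpoly_ext => -[|j] jk; first by rewrite h1 // addn0.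
by rewrite inordK ?addKn // eN; move: jk; clear; lia.
Qed.
End Quartics.

Section HighDegree.
Variables (K : closedFieldType) (charK : [pchar K] =i pred0) (n d : nat) (F : {mpoly K[n.+2]}) (s m : int).
Hypotheses (d5 : (5 <= d)%N) (hF : F \is d.-homog) (irrF : irreducible_elt F).
Hypotheses (hs : has_dim (Sing F) s) (hsn : s <= n%:Z - 2) (finD : finite_set (Delta F)).
Hypothesis hm : m = ((n%:Z + s + 1) %/ 2)%Z.

(** k <= s + 1 + rank(lam) and rank(lam) + k <= n + 2 add up to 2 k <= n + s + 3, that is k <= m +
    1. Equality forces rank(lam) >= m - s, so that, after a permutation of the Z, m - s of the lam_j
    can be taken as variables. *)
Lemma high_degree : card_Delta F <= m + 1 /\
     (card_Delta F = m + 1 <->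
      exists (A : 'I_n.+2 -> {mpoly K[n.+2]}) (G : {mpoly K[n.+2]}),
        [/\ forall i : 'I_n.+2, m - s <= i%:Z <= m ->
              A i \is 1.-homog /\ in_vars (fun j => m + 1 <= j) (A i),
            G \is d.-homog,
            in_vars (fun j => m + 1 <= j) G &
            proj_equiv (hypersurface F) (hypersurface
              (\sum_(i < n.+2 | i%:Z <= m - s - 1)
                  xvar K n.+1 (m + 1 + i%:Z) * 'X_i ^+ (d - 1)
               + \sum_(i < n.+2 | m - s <= i%:Z <= m) A i * 'X_i ^+ (d - 1)
               + G))]).
Proof.
have hd : (4 <= d)%N := ltnW d5; have s_ge := sing_dim_ge hF hs.
have mn : n%:Z + s = 2 * m \/ n%:Z + s + 1 = 2 * m by move: hm; clear; lia.
have str := structure_high charK hd hF irrF hs hsn finD d5.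
have bound : card_Delta F <= m + 1.
  case: str => [->|[D [k [lam [g [_ _ hc h1 h2]]]]]]; first by move: mn hsn s_ge; clear; lia.
  by move: mn hc h1 h2; move: (card_Delta F) (\rank _) => c r; clear; lia.
split=> //; have [|r er] := @int_nat (m - s); first by move: mn hsn; clear; lia.
have [|k ek] := @int_nat (m + 1); first by move: mn hsn s_ge; clear; lia.
have rk : (r <= k)%N by move: er ek s_ge; clear; lia.
have r0 : (0 < r)%N by move: er mn hsn; clear; lia.
have kN : (k + r <= n.+2)%N by move: er ek mn; clear; lia.
have kN' : (k <= n.+2)%N by apply: leq_trans kN; rewrite leq_addr.
split=> [ec|[A [G [hA hG JG]]]]; last first.
  rewrite (target_II _ _ _ er ek rk kN') => h.
  apply/eqP; rewrite eq_le bound /= ek -[k]add0n -[in X in X <= _](muln0 4).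
  apply: (nf_card charK hd hF irrF hs hsn finD (or_introl erefl) _ _ _ _ _ h); rewrite ?add0n ?addn0 //.
  - move=> j jk; case: ltnP => jr.
      split; first exact: X_homog.
      by apply: tail_only_X; [rewrite leq_addr|move: jr kN; clear; lia].
    have jN : (j < n.+2)%N by apply: leq_trans jk kN'.
    have [|h1 h2] := hA (inord j); first by rewrite inordK //; move: er ek jk jr; clear; lia.
    split=> //; apply: (in_vars_tail_only h2) => i; move: ek; clear; lia.
  - by apply: (in_vars_tail_only JG) => i; move: ek; clear; lia.
  by right; exists 0%N; [apply: leq_trans r0 rk|rewrite r0; apply: X_neq0].
case: str => [e0|[D [k' [lam [g [uD hG hc h1 h2]]]]]].
  by move: ec; rewrite e0; move: mn hsn s_ge; clear; lia.
have ekk : k' = k.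
  by move: mn ec hc h1 h2 ek; move: (card_Delta F) (\rank _) => c rr; clear; lia.
rewrite ekk in hG h1 h2.
have rL : (r <= \rank (lam_mx k lam))%N by move: h1 er ek; move: (\rank _) => rr; clear; lia.
have [E [lam' [uE hG' rL']]] := reorder hG rL.
have [E' [lam'' [g' [uE' prN hG'' h3]]]] := straighten hG' rk rL'.
have uED : E' *m (E *m D) \in unitmx by rewrite !unitmx_mul uE uE'.
have [_ _ hg' tg' _] := hG''; rewrite add0n addn0 in tg'.
exists (fun i => lin (lam'' i)), g'; split=> //.
- move=> i hi; split; first exact: lin_homog.
  have ik : (i < k)%N by move: hi ek; clear; lia.
  have tl := tail_only_lin hG'' ik; rewrite add0n addn0 in tl.
  by apply: (in_vars_tail charK tl) => j; move: ek; clear; lia.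
- by apply: (in_vars_tail charK tg') => j; move: ek; clear; lia.
rewrite (target_II _ _ _ er ek rk kN'); apply: (equiv_subst hd hF irrF uED).
rewrite -!subst_comp (gnf_nfpoly hG''); apply: nfpoly_ext => j jk; case: ifP => jr.
  by rewrite h3 // add0n addn0.
by rewrite inordK //; apply: leq_trans jk kN'.
Qed.
End HighDegree.

Theorem theorem1 (K : closedFieldType) (charK : [pchar K] =i pred0)
  (n d : nat) (hn : (1 <= n)%N) (hd : (4 <= d)%N)
  (F : {mpoly K[n.+2]}) (homF : F \is d.-homog) (irrF : irreducible_elt F)
  (s : int) (hs : has_dim (Sing F) s) (hsn : s <= n%:Z - 2)
  (m : int) (hm : m = ((n%:Z + s + 1) %/ 2)%Z)
  (finD : finite_set (Delta F)) :
  (* I-0 *)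
  (d = 4%N -> s = -1 ->
     card_Delta F <= 4 * (m + 1) /\
     (card_Delta F = 4 * (m + 1) <->
      proj_equiv (hypersurface F) (hypersurface
        (\sum_(i < n.+2 | i%:Z <= m) xvar K n.+1 (m + 1 + i%:Z) * 'X_i ^+ 3
         + \sum_(i < n.+2 | m + 1 <= i%:Z) 'X_i ^+ 4))))
  /\
  (* I-1 *)
  (d = 4%N -> 0 <= s -> ~~ (2 %| n%:Z + s)%Z ->
     card_Delta F <= 4 * (m - s - 1) + (s + 2) /\
     (card_Delta F = 4 * (m - s - 1) + (s + 2) <->
      exists a : K, (a = 0 \/ a = 1) /\
      proj_equiv (hypersurface F) (hypersurface
        (\sum_(i < n.+2 | i%:Z <= m - s - 2)
            xvar K n.+1 (m + 1 + i%:Z) * 'X_i ^+ 3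
         + xvar K n.+1 (2 * m - s) *
             \sum_(i < n.+2 | m - s - 1 <= i%:Z <= m) 'X_i ^+ 3
         + \sum_(i < n.+2 | m + 1 <= i%:Z <= 2 * m - s - 1) 'X_i ^+ 4
         + a *: xvar K n.+1 (2 * m - s) ^+ 4))))
  /\
  (* I-2 *)
  (d = 4%N -> s = 0 -> ~~ odd n ->
     card_Delta F <= 4 * m + 1 /\
     (card_Delta F = 4 * m + 1 <->
      proj_equiv (hypersurface F) (hypersurface
        (\sum_(i < n.+2 | i%:Z <= m) xvar K n.+1 (m + 1 + i%:Z) * 'X_i ^+ 3
         + \sum_(i < n.+2 | m + 1 <= i%:Z <= 2 * m) 'X_i ^+ 4))))
  /\
  (* I-3 *)
  (d = 4%N -> s = 1 -> (2 %| n%:Z + s)%Z ->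
     card_Delta F <= 4 * (m - 1) /\
     (card_Delta F = 4 * (m - 1) <->
      exists G : {mpoly K[n.+2]},
        [/\ G \is 4.-homog,
            in_vars (fun j => [|| j == 2 * m - 2, j == 2 * m - 1
                                | j == n%:Z + 1]) G,
            has_multiple_component G &
            proj_equiv (hypersurface F) (hypersurface
              (\sum_(i < n.+2 | i%:Z <= m - 2)
                  xvar K n.+1 (m - 1 + i%:Z) * 'X_i ^+ 3
               + \sum_(i < n.+2 | m - 1 <= i%:Z <= 2 * m - 3) 'X_i ^+ 4
               + G))]))
  /\
  (* I-4 *)
  (d = 4%N -> 2 <= s -> (2 %| n%:Z + s)%Z ->
     card_Delta F <= 4 * (m - s - 1) + (s + 2) /\
     (card_Delta F = 4 * (m - s - 1) + (s + 2) <->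
      (s = 2 /\
       exists G1 : {mpoly K[n.+2]},
         [/\ G1 \is 4.-homog,
             in_vars (fun j => 2 * m - 2 * s <= j) G1,
             has_multiple_component G1 &
             proj_equiv (hypersurface F) (hypersurface
               (\sum_(i < n.+2 | i%:Z <= m - s - 1)
                   xvar K n.+1 (m - s + i%:Z) * 'X_i ^+ 3
                + \sum_(i < n.+2 | m - s <= i%:Z <= 2 * m - 2 * s - 1) 'X_i ^+ 4
                + G1))])
      \/
      (exists (A : 'I_n.+2 -> {mpoly K[n.+2]}) (G2 : {mpoly K[n.+2]}),
         [/\ forall i : 'I_n.+2, m - s <= i%:Z <= m ->
               A i \is 1.-homog /\
               in_vars (fun j => (j == 2 * m - s) || (j == n%:Z + 1)) (A i),
             G2 \is 4.-homog,
             in_vars (fun j => (j == 2 * m - s) || (j == n%:Z + 1)) G2 &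
             proj_equiv (hypersurface F) (hypersurface
               (\sum_(i < n.+2 | i%:Z <= m - s - 2)
                   xvar K n.+1 (m + 1 + i%:Z) * 'X_i ^+ 3
                + xvar K n.+1 (2 * m - s) * xvar K n.+1 (m - s - 1) ^+ 3
                + \sum_(i < n.+2 | m - s <= i%:Z <= m) A i * 'X_i ^+ 3
                + \sum_(i < n.+2 | m + 1 <= i%:Z <= 2 * m - s - 1) 'X_i ^+ 4
                + G2))])))
  /\
  (* II *)
  ((5 <= d)%N ->
     card_Delta F <= m + 1 /\
     (card_Delta F = m + 1 <->
      exists (A : 'I_n.+2 -> {mpoly K[n.+2]}) (G : {mpoly K[n.+2]}),
        [/\ forall i : 'I_n.+2, m - s <= i%:Z <= m ->
              A i \is 1.-homog /\ in_vars (fun j => m + 1 <= j) (A i),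
            G \is d.-homog,
            in_vars (fun j => m + 1 <= j) G &
            proj_equiv (hypersurface F) (hypersurface
              (\sum_(i < n.+2 | i%:Z <= m - s - 1)
                  xvar K n.+1 (m + 1 + i%:Z) * 'X_i ^+ (d - 1)
               + \sum_(i < n.+2 | m - s <= i%:Z <= m) A i * 'X_i ^+ (d - 1)
               + G))])).
Proof.
have sm : d = 4%N -> F \is 4.-homog by move=> <-.
split=> [d4 s1|]; first exact: (quartic_smooth charK (sm d4) irrF hs hsn finD hm).
split=> [d4 s0 par|]; first exact: (quartic_odd charK (sm d4) irrF hs hsn finD hm).
split=> [d4 s0 par|]; first exact: (quartic_isolated charK (sm d4) irrF hs hsn finD hm).
split=> [d4 s1 par|]; first exact: (quartic_curve charK (sm d4) irrF hs hsn finD hm).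
split=> [d4 s2 par|d5]; first exact: (quartic_even charK (sm d4) irrF hs hsn finD hm).
exact: (high_degree charK d5 homF irrF hs hsn finD hm).
Qed.
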